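(* Let $b,\sigma:\mathbb{R}\to\mathbb{R}$ be Lipschitz continuous, let $X_0$ be a square integrable real random variable, and let $h:\mathbb{R}\to\mathbb{R}$ be an increasing function for which there are constants $0<m\le M$ with $m|x-y|\le |h(x)-h(y)|\le M|x-y|$ for all $x,y\in\mathbb{R}$. Assume $\mathbb{E}[h(X_0)]\ge 0$. Let $T>0$, and let $(X^i)_{1\le i\le N}$ be the interacting system of $N$ particles and $(\bar X^i)_{1\le i\le N}$ the coupled independent copies of the solution $X$ of the mean reflected SDE, all as defined in the context. (i) If there exists $p>4$ such that $\mathbb{E}[|X_0|^p]<\infty$, then there exists a constant $C$ depending on $b$ and $\sigma$ such that, for each $j\in\{1,\dots,N\}$, $$\mathbb{E}\Big[\sup_{s\le T}|X^j_s-\bar X^j_s|^2\Big]\le C\exp\Big(C\Big(1+\frac{M^2}{m^2}\Big)(1+T^2)\Big)\frac{M^2}{m^2}\,N^{-1/2}.$$ (ii) If $h$ is twice continuously differentiable with bounded derivatives, then there exists a constant $C$ depending on $b$ and $\sigma$ such that, for each $j\in\{1,\dots,N\}$, $$\mathbb{E}\Big[\sup_{s\le T}|X^j_s-\bar X^j_s|^2\Big]\le C\exp\Big(C\Big(1+\frac{M^2}{m^2}\Big)(1+T^2)\Big)\frac{1+T^2}{m^2}\Big(1+\mathbb{E}\Big[\sup_{s\le T}|X_s|^2\Big]\Big)\,N^{-1}.$$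
   Context: $(B_t)_{t\ge0}$ is a standard Brownian motion on a complete probability space. The mean reflected SDE is the system $$X_t=X_0+\int_0^t b(X_s)\,ds+\int_0^t\sigma(X_s)\,dB_s+K_t,\quad \mathbb{E}[h(X_t)]\ge0,\quad \int_0^t\mathbb{E}[h(X_s)]\,dK_s=0,\qquad t\ge0.$$ A flat deterministic solution is a pair of continuous processes $(X,K)$ satisfying this system with $K$ a non-decreasing deterministic function and $K_0=0$. Under the hypotheses on $b,\sigma,h,X_0$ stated before (i) and (ii), there is a unique flat deterministic solution $(X,K)$. For a probability measure $\nu$ on $\mathbb{R}$, $G_0(\nu)=\inf\{x\ge0:\int h(x+z)\,\nu(dz)\ge0\}$. Let $\mu_t$ be the law of $U_t=X_0+\int_0^t b(X_s)\,ds+\int_0^t\sigma(X_s)\,dB_s$; one has $K_t=\sup_{s\le t}G_0(\mu_s)$. Let $X_0^i$, $1\le i\le N$, be independent copies of $X_0$ and $B^i$, $1\le i\le N$, independent Brownian motions. The interacting particle system is $$X^i_t=X^i_0+\int_0^t b(X^i_s)\,ds+\int_0^t\sigma(X^i_s)\,dB^i_s+\sup_{s\le t}G_0(\mu^N_s),\quad 1\le i\le N,$$ where $\mu^N_s=\frac1N\sum_{i=1}^N\delta_{U^i_s}$ and $U^i_s=X^i_0+\int_0^s b(X^i_r)\,dr+\int_0^s\sigma(X^i_r)\,dB^i_r$. (In these equations $X_0^i$ on the right-hand side is the given initial random variable.) The independent copies of $X$, coupled with the particles by using the same Brownian motions and the same initial variables, are $$\bar X^i_t=X^i_0+\int_0^t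 b(\bar X^i_s)\,ds+\int_0^t\sigma(\bar X^i_s)\,dB^i_s+\sup_{s\le t}G_0(\mu_s),\quad 1\le i\le N.$$
   Formalization: The constant C may depend, besides b and σ, in (i) on p and on a bound for E|X_0|^p, and in (ii) on a bound for |h'| and |h''|; with C depending on b and σ alone both estimates fail (b=σ=0, h=id with large Var X_0, or h=λ·id with λ large). *)

(* Defs.v *)
From HB Require Import structures.
From mathcomp Require Import all_boot all_order all_algebra.
From mathcomp Require Import all_classical all_reals all_analysis.

Set Implicit Arguments.
Unset Strict Implicit.
Unset Printing Implicit Defensive.

Import Order.TTheory GRing.Theory Num.Theory.
Import numFieldNormedType.Exports.

Local Open Scope classical_set_scope.
Local Open Scope ring_scope.

(* Processes are functions [X : R -> Om -> R], [X t w] being the value at time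
   [t]; only times [0 <= t] are meaningful. *)

Section Processes.
Context {R : realType} {d : measure_display} {Om : measurableType d}.
Implicit Types (P : probability Om R) (F : R -> set (set Om)).
Implicit Types (B X H I : R -> Om -> R).

Definition complete_filtration P F : Prop :=
  [/\ measure_is_complete P,
      forall t, 0 <= t -> sigma_algebra [set: Om] (F t),
      forall t, 0 <= t -> F t `<=` measurable,
      forall s t, 0 <= s -> s <= t -> F s `<=` F t
    & forall t A, 0 <= t -> P.-negligible A -> F t A].

Definition measurable_wrt (G : set (set Om)) (f : Om -> R) : Prop :=
  forall D : set R, measurable D -> G (f @^-1` D).

Definition adapted F X : Prop :=
  forall t, 0 <= t -> measurable_wrt (F t) (X t).

Definition continuous_paths X : Prop :=
  forall w, {within `[0, +oo[, continuous (fun t => X t w)}.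

(* The product formula says at once that the increments over [s, t] of the
   [n] coordinates are N(0, t - s), mutually independent, and jointly
   independent of [F s]: [B] is a family of [n] independent Brownian motions
   with respect to the same filtration.  The second argument of [normal_prob]
   is the standard deviation. *)
Definition brownian_family P F (n : nat) (B : 'I_n -> R -> Om -> R) : Prop :=
  [/\ forall i, adapted F (B i),
      forall i, continuous_paths (B i),
      forall i, \forall w \ae P, B i 0 w = 0
    & forall (s t : R) (A : set Om) (D : 'I_n -> set R),
        0 <= s -> s < t -> F s A -> (forall i, measurable (D i)) ->
        P (A `&` [set w | forall i, D i (B i t w - B i s w)]) =
        (P A * \prod_(i < n) normal_prob 0 (Num.sqrt (t - s)) (D i))%E].

Definition brownian_motion P F B : Prop :=
  brownian_family P F (fun _ : 'I_1 => B).

(* The step process sum_(k < size) coef k * 1_(]time k, time k.+1]). *)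
Record step_process := StepProcess {
  step_size : nat ;
  step_time : nat -> R ;
  step_coef : nat -> Om -> R }.

Definition simple_process F (phi : step_process) : Prop :=
  [/\ 0 <= step_time phi 0,
      forall i j, (i <= j)%N -> step_time phi i <= step_time phi j,
      forall k, measurable_wrt (F (step_time phi k)) (step_coef phi k)
    & exists c, forall k w, `|step_coef phi k w| <= c].

Definition step_eval (phi : step_process) (t : R) (w : Om) : R :=
  \sum_(k < step_size phi)
    step_coef phi k w * \1_(`]step_time phi k, step_time phi k.+1]) t.

Definition step_integral B (phi : step_process) (t : R) (w : Om) : R :=
  \sum_(k < step_size phi) step_coef phi k w *
    (B (Num.min (step_time phi k.+1) t) w - B (Num.min (step_time phi k) t) w).

Definition cvg0_in_probability P (Z : nat -> Om -> \bar R) : Prop :=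
  forall e : R, 0 < e ->
    (fun n => P [set w | (e%:E <= Z n w)%E]) @ \oo --> (0 : \bar R).

(* [I] is (a continuous version of) the process [t |-> int_0^t H dB]: the
   usual extension of the integral from simple processes to integrands whose
   paths are locally square integrable. *)
Definition ito_integral P F B H I : Prop :=
  [/\ adapted F I, continuous_paths I
    & exists phi : nat -> step_process,
        (forall n, simple_process F (phi n)) /\
        forall t, 0 <= t ->
          cvg0_in_probability P (fun n w =>
            (\int[lebesgue_measure]_(s in `[0%R, t])
              ((step_eval (phi n) s w - H s w) ^+ 2)%:E)%E) /\
          cvg0_in_probability P (fun n w =>
            ereal_sup [set (`|step_integral B (phi n) s w - I s w|)%:E
                      | s in `[0, t]])].

Definition esup_sqr (X : R -> Om -> R) (t : R) (w : Om) : \bar R :=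
  ereal_sup [set (`|X s w| ^+ 2)%:E | s in `[0, t]].

(* The process [U]; in all uses [I] is the stochastic integral of
   [sigma (X)]. *)
Definition unreflected (b : R -> R) (X0 : Om -> R) X I (t : R) (w : Om) : R :=
  X0 w + \int[lebesgue_measure]_(s in `[0, t]) b (X s w) + I t w.

End Processes.

Arguments step_process R {d} Om.

Section MeanReflection.
Context {R : realType}.
Implicit Types (b sigma h : R -> R).

Definition G0 h (nu : set R -> \bar R) : R :=
  inf [set x | 0 <= x /\ (0 <= \int[nu]_z (h (x + z)%R)%:E)%E].

Definition empirical (n : nat) (u : 'I_n -> R) (A : set R) : \bar R :=
  ((n%:R^-1)%:E * \sum_(i < n) \d_(u i) A)%E.

Definition law d (Om : measurableType d) (P : probability Om R)
  (Y : Om -> R) : set R -> \bar R := pushforward P Y.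

Definition increasing_bilipschitz h (m M : R) : Prop :=
  [/\ 0 < m, m <= M, {homo h : x y / x <= y}
    & forall x y, m * `|x - y| <= `|h x - h y| <= M * `|x - y| ].

Definition C2_with_derivatives_bounded_by (A : R) h : Prop :=
  [/\ forall x, derivable h x 1,
      forall x, derivable (derive1 h) x 1,
      continuous (derive1 (derive1 h))
    & forall x, `|derive1 h x| <= A /\ `|derive1 (derive1 h) x| <= A].

Definition square_integrable d (Om : measurableType d) (P : probability Om R)
  (Y : Om -> R) : Prop := ('E_P[fun w => (Y w ^+ 2)%R] < +oo)%E.

Definition driving_data d (Om : measurableType d) (P : probability Om R)
    (F : R -> set (set Om)) (B : R -> Om -> R) (X0 : Om -> R) : Prop :=
  [/\ complete_filtration P F, brownian_motion P F B,
      measurable_wrt (F 0) X0 & square_integrable P X0].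

(* [K] lives on the whole line (so as to define a Stieltjes measure); it is
   extended by 0 to negative times. *)
Definition flat_solution d (Om : measurableType d) (P : probability Om R)
    (F : R -> set (set Om)) b sigma h (B : R -> Om -> R) (X0 : Om -> R)
    (X I : R -> Om -> R) (K : cumulative R R) : Prop :=
  [/\ adapted F X /\ continuous_paths X,
      continuous K /\ (forall t, t <= 0 -> K t = 0),
      ito_integral P F B (fun t w => sigma (X t w)) I,
      \forall w \ae P, forall t, 0 <= t -> X t w = unreflected b X0 X I t w + K t
    & (forall t, 0 <= t -> (0 <= 'E_P[h \o X t])%E) /\
      (forall t, 0 <= t ->
        (\int[lebesgue_stieltjes_measure K]_(s in `[0%R, t]) 'E_P[h \o X s] = 0)%E)].

(* The product formula expresses both that the [X0s i] are mutually
   independent and that each has the law of [X0]; as they are [F' 0]-measurable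
   they are also independent of the Brownian family [Bs]. *)
Definition particle_data d (Om : measurableType d) (P : probability Om R)
    (X0 : Om -> R) d' (Om' : measurableType d') (P' : probability Om' R)
    (F' : R -> set (set Om')) (n : nat) (Bs : 'I_n -> R -> Om' -> R)
    (X0s : 'I_n -> Om' -> R) : Prop :=
  [/\ complete_filtration P' F', brownian_family P' F' Bs,
      forall i, measurable_wrt (F' 0) (X0s i)
    & forall D : 'I_n -> set R, (forall i, measurable (D i)) ->
        P' [set w | forall i, D i (X0s i w)] =
        (\prod_(i < n) law P X0 (D i))%E].

Definition particle_system d (Om : measurableType d) (P : probability Om R)
    (F : R -> set (set Om)) b sigma h (n : nat) (Bs : 'I_n -> R -> Om -> R)
    (X0s : 'I_n -> Om -> R) (Xs Is : 'I_n -> R -> Om -> R) : Prop :=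
  let U i := unreflected b (X0s i) (Xs i) (Is i) in
  forall i,
  [/\ adapted F (Xs i), continuous_paths (Xs i),
      ito_integral P F (Bs i) (fun t w => sigma (Xs i t w)) (Is i)
    & \forall w \ae P, forall t, 0 <= t ->
        Xs i t w = U i t w +
          sup [set G0 h (empirical (fun k => U k s w)) | s in `[0, t]]].

Definition coupled_copies d (Om : measurableType d) (P : probability Om R)
    (F : R -> set (set Om)) b sigma h (mu : R -> set R -> \bar R)
    (n : nat) (Bs : 'I_n -> R -> Om -> R)
    (X0s : 'I_n -> Om -> R) (Ys Js : 'I_n -> R -> Om -> R) : Prop :=
  forall i,
  [/\ adapted F (Ys i), continuous_paths (Ys i),
      ito_integral P F (Bs i) (fun t w => sigma (Ys i t w)) (Js i)
    & \forall w \ae P, forall t, 0 <= t ->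
        Ys i t w = unreflected b (X0s i) (Ys i) (Js i) t w +
          sup [set G0 h (mu s) | s in `[0, t]]].

End MeanReflection.

(* Main.v *)
(** Both estimates come from one bound, which only uses second moments of [X0].
Let [R] be the supremum over [s <= T] of the distance between the empirical
mean of the [h (Ys i s)] and [E h (X s)].  Since [h] is bi-Lipschitz, the two
reflection terms differ at time [t] by at most
[(M sup_s avg |U^i_s - Ubar^i_s| + R) / m]: at a time where [G0 (mu s)] is close
to its running supremum [K t], the mean [E h (K s + U s)] is close to 0.
Gronwall's inequality, localised, then bounds the squared distance of [Xs j]
and [Ys j] by [E R^2 / m^2] up to a factor [exp (C (1 + M^2/m^2) (1 + T^2))].

That [E R^2 = O(1/N)] is proved by dyadic chaining.  At each dyadic level the
increments of the empirical mean are sums of independent centred variables,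
measured in the norm of [l^4], which has type 2.  The fourth moments of the
increments of [Ys i] are taken with the weight [1 / (Q + X0^2)], hence are
finite although [X0] only has two moments.  Independence of the copies is
transferred from their Euler schemes, and so is the equality in law with [X].
No Ito formula is needed: moments of stochastic integrals follow from a
pathwise form of Doob's inequality for discrete integrals. *)

Require Import Defs.
From HB Require Import structures.
From mathcomp Require Import all_boot all_order all_algebra.
From mathcomp Require Import all_classical all_reals all_analysis.
From mathcomp Require Import measurable_realfun.
From mathcomp Require Import ring lra.
Set Implicit Arguments.
Unset Strict Implicit.
Unset Printing Implicit Defensive.
Import Order.TTheory GRing.Theory Num.Theory.
Import numFieldNormedType.Exports.
Local Open Scope classical_set_scope.
Local Open Scope ring_scope.

Local Notation meas := (measurable_fun setT).
Local Notation lip L f := (forall x y, `|f x - f y| <= L * `|x - y|).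

(** The norm of [l^4] is dictated by the chaining. At level [l] there are [2^l] increments, with
    squares of order [2^-l]: in [l^2] the levels would not decay, whereas the square of the [l^4]
    norm is of order [2^(l/2) 2^-l], which is summable. The weight [1 / (Q + X0^2)] keeps every
    bound linear in [Q], because a square of a quantity of order [Q] always comes divided by [Q];
    this linearity lets [Q] become the factor [1 + E sup |X|^2] of (ii). In (i) the rate [1/N] is
    simply weakened to [N^(-1/2)]. The Lipschitz constant of [h] enters twice: through the ratio
    [M/m] when the reflections are compared, and through a separate [M'] in the fluctuations of the
    empirical mean, so that (ii) can use there the bound on [h']. Stopping times are replaced by
    decreasing adapted processes with values 0 and 1, which multiply integrands and suprema and
    require no optional stopping. Gronwall arguments act on bounds of the form [N expR (lam t)],
    with [lam] so large that one step halves [N]. *)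

Lemma normr_sqr {R : realDomainType} (x : R) : `|x| ^+ 2 = x ^+ 2.
Proof. by rewrite real_normK ?num_real. Qed.

Lemma eq_leW {disp} {T : porderType disp} (x y : T) : x = y -> (x <= y)%O.
Proof. by move->. Qed.

(** * Moments and independence *)

(** Meant for nonnegative integrands, for which it always makes sense in the extended reals;
    inequalities between moments can then be stated before finiteness is known. *)
Definition Ex {d} {T : measurableType d} {R : realType}
  (P : {measure set T -> \bar R}) (f : T -> R) : \bar R := (\int[P]_w (f w)%:E)%E.
Local Notation "\E[ P ]_ w e" := (Ex P (fun w => e%R))
  (at level 36, w name, e at level 36).

Lemma measurable_fun_normr {d} {T : measurableType d} {R : realType} (D : set T)
  (f : T -> R) : measurable_fun D f -> measurable_fun D (fun x => `|f x|).
Proof. by move=> mf; apply: measurableT_comp. Qed.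

Ltac mea := repeat (match goal with
  | H : measurable_fun _ ?f |- measurable_fun _ ?f => exact: H
  | H : measurable_fun _ ?f |- measurable_fun _ (fun x => ?f x) => exact: H
  | H : forall x, measurable_fun _ (?f x) |- measurable_fun _ (?f _) => exact: H
  | H : forall x, measurable_fun _ (?f x) |- measurable_fun _ (fun y => ?f _ y) => exact: H
  | |- measurable_fun _ (cst _) => exact: measurable_cst
  | |- measurable_fun _ (fun x => ?c) => exact: measurable_cst
  | |- measurable_fun _ (fun x => x) => exact: measurable_id
  | |- measurable_fun _ (fun x => - _) => apply: measurable_funN
  | |- measurable_fun _ (fun x => _ - _) => apply: measurable_funB
  | |- measurable_fun _ (fun x => _ + _) => apply: measurable_funD
  | |- measurable_fun _ (fun x => _ * _) => apply: measurable_funM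
  | |- measurable_fun _ (fun x => _ ^+ _) => apply: measurable_funX
  | |- measurable_fun _ (fun x => `|_|) => apply: measurable_fun_normr
  | |- measurable_fun _ (fun x => Num.max _ _) => apply: measurable_maxr
  | |- measurable_fun _ (fun x => \sum_(_ < _) _) => apply: measurable_sum => ?
  | H : meas ?f |- measurable_fun _ (fun x => ?f _) => refine (measurableT_comp H _)
  | H : meas ?f |- measurable_fun _ (?f \o _) => refine (measurableT_comp H _)
  end).

Ltac nneg := repeat (match goal with
  | |- forall _, _ => move=> ?
  | H : forall w, is_true (0 <= ?f w) |- is_true (0 <= ?f _) => exact: H
  | H : is_true (0 <= ?x) |- is_true (0 <= ?x) => exact: H
  | H : forall i, is_true (0 <= _ - _) |- is_true (0 <= _ - _) => exact: H
  | |- is_true (0 <= _%:R) => exact: ler0n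
  | |- is_true (0 <= ?x * ?x) => exact: (sqr_ge0 x)
  | |- is_true (0 <= _ * _) => apply: mulr_ge0
  | |- is_true (0 <= _ + _) => apply: addr_ge0
  | |- is_true (0 <= _ ^+ 2) => exact: sqr_ge0
  | |- is_true (0 <= _ ^+ 4) => by rewrite exprn_even_ge0
  | |- is_true (0 <= _ ^+ _) => apply: exprn_ge0
  | |- is_true (0 <= `|_|) => exact: normr_ge0
  | |- is_true (0 <= _^-1) => rewrite invr_ge0
  | |- is_true (0 <= expR _) => exact: expR_ge0
  | |- is_true (0 <= Num.sqrt _) => exact: sqrtr_ge0
  | |- is_true (0 <= \sum_(_ < _) _) => apply: sumr_ge0 => ? _
  | |- is_true (0 <= _) => by [|lra]
  end).

Ltac side := first [by nneg|by mea].

Section expectation.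
Context {d} {T : measurableType d} {R : realType} (P : {measure set T -> \bar R}).
Implicit Types f g Z : T -> R.

Lemma Ex_ge0 f : (forall w, 0 <= f w) -> (0 <= Ex P f)%E.
Proof. by move=> f0; apply: integral_ge0 => w _; rewrite lee_fin. Qed.

Lemma Ex_le f g : (forall w, 0 <= f w) -> meas f ->
  meas g -> (forall w, f w <= g w) -> (Ex P f <= Ex P g)%E.
Proof.
move=> f0 mf mg fg; apply: ge0_le_integral => //.
- by move=> w _; rewrite lee_fin.
- exact/measurable_EFinP.
- exact/measurable_EFinP.
- by move=> w _; rewrite lee_fin.
Qed.

Lemma ExD f g : (forall w, 0 <= f w) -> (forall w, 0 <= g w) ->
  meas f -> meas g ->
  \E[P]_w (f w + g w) = (Ex P f + Ex P g)%E.
Proof.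
move=> f0 g0 mf mg; rewrite /Ex -ge0_integralD//.
- by move=> w _; rewrite lee_fin.
- exact/measurable_EFinP.
- by move=> w _; rewrite lee_fin.
- exact/measurable_EFinP.
Qed.

Lemma ExZ (c : R) f : 0 <= c -> (forall w, 0 <= f w) ->
  meas f -> \E[P]_w (c * f w) = (c%:E * Ex P f)%E.
Proof.
move=> c0 f0 mf; rewrite /Ex -ge0_integralZl//.
- exact/measurable_EFinP.
- by move=> w _; rewrite lee_fin.
Qed.

Lemma Ex_sum (n : nat) (f : nat -> T -> R) : (forall i w, 0 <= f i w) ->
  (forall i, meas (f i)) ->
  \E[P]_w (\sum_(i < n) f i w) = (\sum_(i < n) Ex P (f i))%E.
Proof.
move=> f0 mf; elim: n => [|n ih].
  rewrite big_ord0 /Ex; under eq_integral do rewrite big_ord0.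
  by rewrite integral0.
rewrite [RHS]big_ord_recr/= -ih -ExD//.
- by apply: eq_integral => w _; rewrite big_ord_recr.
- by move=> w; apply: sumr_ge0.
- exact: measurable_sum.
Qed.

(** Turns a pathwise inequality into one between moments: a centred term [Z] costs nothing. If [g]
    has infinite mean there is nothing to prove; otherwise [g + Z] is integrable and linearity
    applies. *)
Lemma Ex_le_centered f g Z : (forall w, 0 <= f w) -> (forall w, 0 <= g w) ->
  meas f -> meas g ->
  P.-integrable setT (EFin \o Z) -> (\int[P]_w (Z w)%:E = 0)%E ->
  (forall w, f w <= g w + Z w) -> (Ex P f <= Ex P g)%E.
Proof.
move=> f0 g0 mf mg iZ Z0 fgZ.
have [->|gfin] := eqVneq (Ex P g) +oo%E; first exact: leey.
have ig : P.-integrable setT (EFin \o g).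
  apply/integrableP; split; first exact/measurable_EFinP.
  rewrite (eq_integral (EFin \o g)); first by rewrite ltey.
  by move=> w _ /=; rewrite ger0_norm.
have igZ : P.-integrable setT (EFin \o (fun w => g w + Z w)).
  rewrite (_ : _ \o _ = (EFin \o g) \+ (EFin \o Z))%E //.
  exact: integrableD.
rewrite -[leRHS]adde0 -Z0 -[X in (_ <= X)%E](integralD _ ig iZ)//.
apply: le_integral => //=.
- apply: le_integrable igZ => //; first exact/measurable_EFinP.
  by move=> w _ /=; rewrite lee_fin ger0_norm// (le_trans (fgZ w))// ler_norm.
- by move=> w _; rewrite -EFinD lee_fin.
Qed.

Lemma Ex_lty_integrable Z : meas Z ->
  (\E[P]_w (`|Z w|%R) < +oo)%E -> P.-integrable setT (EFin \o Z).
Proof. by move=> mZ hZ; apply/integrableP; split => //; exact/measurable_EFinP. Qed.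

End expectation.

(** * Measures with a density and moments of the normal law *)

Section density.
Context {d} {T : measurableType d} {R : realType}.
Variables (mu nu : {measure set T -> \bar R}) (g : T -> R).
Hypotheses (g0 : forall x, 0 <= g x) (mg : meas g).
Hypothesis nug : forall A, measurable A -> nu A = (\int[mu]_(x in A) (g x)%:E)%E.
Local Open Scope ereal_scope.
Import HBNNSimple.

(** On indicators this is the hypothesis [nug]; simple functions follow by linearity, and monotone
    convergence on both sides does the rest. *)
Lemma ge0_integral_density (f : T -> \bar R) : (forall x, 0 <= f x) ->
  meas f -> \int[nu]_x f x = \int[mu]_x (f x * (g x)%:E).
Proof.
move=> f0 mf.
have mgE : meas (EFin \o g) by exact/measurable_EFinP.
pose h := nnsfun_approx measurableT mf.
have -> : \int[nu]_x f x = lim (\int[nu]_x (EFin \o h n) x @[n --> \oo]).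
  have fE x : f x = lim ((EFin \o h n) x @[n --> \oo]).
    by apply/esym/cvg_lim => //; exact: cvg_nnsfun_approx.
  under eq_integral => x _ do rewrite fE.
  apply: monotone_convergence => //.
  - by move=> n; apply/measurable_EFinP.
  - by move=> n x _ //=; rewrite lee_fin.
  - by move=> x _ a b ab; rewrite lee_fin; exact/lefP/nd_nnsfun_approx.
have -> : \int[mu]_x (f x * (g x)%:E) =
    lim (\int[mu]_x ((EFin \o h n) \* (EFin \o g)) x @[n --> \oo]).
  have fg x : f x * (g x)%:E = lim (((EFin \o h n) \* (EFin \o g)) x @[n --> \oo]).
    apply/esym/cvg_lim => //; apply: cvgeZr => //; exact: cvg_nnsfun_approx.
  under eq_integral => x _ do rewrite fg.
  apply: monotone_convergence => [//| | |].
  - by move=> n; apply/emeasurable_funM => //; exact/measurable_EFinP.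
  - by move=> n x _ /=; rewrite mule_ge0 ?lee_fin.
  - by move=> x _ a b ab/=; rewrite lee_wpmul2r ?lee_fin//; exact/lefP/nd_nnsfun_approx.
suff suf n : \int[mu]_x ((EFin \o h n) x * (g x)%:E) = \int[nu]_x (EFin \o h n) x.
  by under [in RHS]eq_fun do rewrite suf.
transitivity (\int[nu]_x
   (\sum_(y \in range (h n)) (y * \1_(h n @^-1` [set y]) x)%:E)); last first.
  by apply: eq_integral => t tE; rewrite /= fimfunE -fsumEFin.
have indich m r : meas (fun x => (r * \1_(h m @^-1` [set r]) x)%:E).
  by apply/measurable_EFinP; exact: measurable_funM.
rewrite ge0_integral_fsum//; last by move=> m y Ey; exact: nnfun_muleindic_ge0.
transitivity (\int[mu]_x (\sum_(y \in range (h n))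
    (y * \1_(h n @^-1` [set y]) x)%:E * (g x)%:E)).
  under [RHS]eq_integral => x xE.
    rewrite -ge0_mule_fsuml => [|y]; last exact: nnfun_muleindic_ge0.
    rewrite fsumEFin // -(fimfunE _ x); over.
  by [].
rewrite ge0_integral_fsum//; last 2 first.
  - by move=> y; apply: emeasurable_funM.
  - by move=> m y Ey; apply: mule_ge0; [exact: nnfun_muleindic_ge0|rewrite lee_fin].
apply: eq_fsbigr => r rhn.
under [RHS]eq_integral do rewrite EFinM.
rewrite integralZl_indic_nnsfun => //.
under eq_integral do rewrite EFinM -muleA.
rewrite ge0_integralZl//.
- under eq_integral do rewrite muleC.
  rewrite (eq_integral ((EFin \o g) \_ (h n @^-1` [set r]))); last first.
    by move=> x xE; rewrite epatch_indic.
  by rewrite -integral_mkcond -nug// integral_indic// setIT.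
- by apply: emeasurable_funM => //; exact/measurable_EFinP.
- by move=> t Et; rewrite mule_ge0 ?lee_fin.
- by move: rhn; rewrite inE => -[t _ <-]; rewrite lee_fin.
Qed.

End density.

Section normal_moments.
Context {R : realType}.
Implicit Types s x : R.

Lemma mul_expRN_le1 x : x * expR (- x) <= 1.
Proof.
rewrite expRN ler_pdivrMr ?expR_gt0// mul1r.
by apply: le_trans (expR_ge1Dx _); rewrite lerDr.
Qed.

(** Half of the Gaussian exponent is set aside, the other half being that of a normal law of
    standard deviation [sqrt 2 s]. The part set aside absorbs polynomials, so moments are bounded
    without evaluating a Gaussian integral. The factor 2 bounds [sqrt 2]. *)
Lemma normal_pdf_sqrt2 s x : 0 < s ->
  normal_pdf 0 s x <=
  2 * expR (- (x ^+ 2 / (4 * s ^+ 2))) * normal_pdf 0 (Num.sqrt 2 * s) x.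
Proof.
move=> s0.
have q0 : (0 : R) < Num.sqrt 2 by rewrite sqrtr_gt0.
have qs0 : 0 < Num.sqrt 2 * s by rewrite mulr_gt0.
rewrite !normal_pdfE ?gt_eqF// /normal_peak /normal_fun !subr0.
have -> : (Num.sqrt 2 * s) ^+ 2 = 2 * s ^+ 2 by rewrite exprMn sqr_sqrtr.
have -> : Num.sqrt (2 * s ^+ 2 * pi *+ 2) = Num.sqrt 2 * Num.sqrt (s ^+ 2 * pi *+ 2).
  by rewrite -sqrtrM//; congr Num.sqrt; set c := s ^+ 2; set q := pi; rewrite -(mulr_natr (2 * c * q)) -(mulr_natr (c * q)); ring.
set A := Num.sqrt (_ *+ 2).
have A0 : 0 < A by rewrite sqrtr_gt0 pmulrn_lgt0// mulr_gt0 ?pi_gt0// exprn_gt0.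
have -> : - x ^+ 2 / (s ^+ 2 *+ 2) = - (x ^+ 2 / (4 * s ^+ 2)) + - x ^+ 2 / (2 * s ^+ 2 *+ 2).
  set c := s ^+ 2; have c0 : c != 0 by rewrite gt_eqF// exprn_gt0.
  by rewrite -(mulr_natr (2 * c)) -(mulr_natr c); field.
rewrite expRD (invfM (Num.sqrt 2) A).
set E1 := expR _; set E2 := expR _.
have E10 : 0 < E1 by exact: expR_gt0.
have E20 : 0 < E2 by exact: expR_gt0.
rewrite [leRHS](_ : _ = (2 / Num.sqrt 2) * (A^-1 * (E1 * E2))); last by move: (_^-1) (A^-1) => u v; ring.
apply: ler_peMl; first by rewrite !mulr_ge0 ?invr_ge0// ltW.
rewrite ler_pdivlMr// mul1r -ler_sqr ?nnegrE ?ltW// sqr_sqrtr//; lra.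
Qed.

Lemma sqr_normal_pdf_le s x : 0 < s ->
  x ^+ 2 * normal_pdf 0 s x <= 8 * s ^+ 2 * normal_pdf 0 (Num.sqrt 2 * s) x.
Proof.
move=> s0; apply: (le_trans (ler_wpM2l (sqr_ge0 x) (normal_pdf_sqrt2 x s0))).
set y := x ^+ 2 / (4 * s ^+ 2); set p := normal_pdf _ _ _.
have p0 : 0 <= p by exact: normal_pdf_ge0.
have -> : x ^+ 2 = 4 * s ^+ 2 * y by rewrite /y; field; rewrite gt_eqF.
rewrite [leLHS](_ : _ = (y * expR (- y)) * (8 * s ^+ 2 * p)); last by ring.
apply: ler_piMl (mul_expRN_le1 y).
by apply: mulr_ge0 => //; apply: mulr_ge0 => //; exact: sqr_ge0.
Qed.

Lemma pow4_normal_pdf_le s x : 0 < s ->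
  x ^+ 4 * normal_pdf 0 s x <= 128 * s ^+ 4 * normal_pdf 0 (Num.sqrt 2 * s) x.
Proof.
move=> s0.
have x40 : 0 <= x ^+ 4 by rewrite exprn_even_ge0.
apply: (le_trans (ler_wpM2l x40 (normal_pdf_sqrt2 x s0))).
set y := x ^+ 2 / (4 * s ^+ 2); set p := normal_pdf _ _ _.
have p0 : 0 <= p by exact: normal_pdf_ge0.
have y0 : 0 <= y by apply: divr_ge0; [exact: sqr_ge0|apply: mulr_ge0 => //; exact: sqr_ge0].
have -> : x ^+ 4 = 16 * s ^+ 4 * y ^+ 2 by rewrite /y; field; rewrite gt_eqF.
have -> : expR (- y) = expR (- (y / 2)) ^+ 2.
  by rewrite expr2 -expRD; congr expR; field.
(* Since [y^2 e^-y = 4 ((y/2) e^(-y/2))^2], the constant is [16 . 2 . 4 = 128]. *)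
rewrite [leLHS](_ : _ = ((y / 2) * expR (- (y / 2))) ^+ 2 * (128 * s ^+ 4 * p)); last by field.
have s40 : 0 <= s ^+ 4 by rewrite exprn_even_ge0.
apply: ler_piMl; first by apply: mulr_ge0 => //; apply: mulr_ge0.
apply: exprn_ile1; last exact: mul_expRN_le1.
by apply: mulr_ge0; [exact: divr_ge0|exact: expR_ge0].
Qed.

Lemma ge0_integral_normal s (f : R -> R) : (forall x, 0 <= f x) ->
  meas f ->
  Ex (normal_prob 0 s) f = (\int[lebesgue_measure]_x (f x * normal_pdf 0 s x)%:E)%E.
Proof.
move=> f0 mf; rewrite /Ex.
under [RHS]eq_integral do rewrite EFinM.
apply: ge0_integral_density => //.
- by move=> x; exact: normal_pdf_ge0.
- exact: measurable_normal_pdf.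
- exact/measurable_EFinP.
Qed.

Lemma normal_moment_le (f : R -> R) (c s : R) : (forall x, 0 <= f x) ->
  meas f -> 0 <= c ->
  (forall x, f x * normal_pdf 0 s x <= c * normal_pdf 0 (Num.sqrt 2 * s) x) ->
  (Ex (normal_prob 0 s) f <= c%:E)%E.
Proof.
move=> f0 mf c0 fc; rewrite ge0_integral_normal//.
rewrite -[leRHS]mule1 -(integral_normal_pdf 0 (Num.sqrt 2 * s)).
rewrite -ge0_integralZl//; last 2 first.
- by apply/measurable_EFinP; exact: measurable_normal_pdf.
- by move=> x _; rewrite lee_fin normal_pdf_ge0.
apply: ge0_le_integral => //.
- by move=> x _; rewrite lee_fin mulr_ge0 ?normal_pdf_ge0.
- by apply/measurable_EFinP/measurable_funM => //; exact: measurable_normal_pdf.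
- apply/measurable_EFinP; apply: measurable_funM => //; exact: measurable_normal_pdf.
- by move=> x _; rewrite lee_fin.
Qed.

Lemma normal_moment2 s : 0 < s ->
  (Ex (normal_prob 0 s) (fun x => x ^+ 2)%R <= (8 * s ^+ 2)%:E)%E.
Proof.
move=> s0; apply: normal_moment_le.
- by move=> x; exact: sqr_ge0.
- exact: measurable_funX.
- by apply: mulr_ge0 => //; exact: sqr_ge0.
- by move=> x; exact: sqr_normal_pdf_le.
Qed.

Lemma normal_moment4 s : 0 < s ->
  (Ex (normal_prob 0 s) (fun x => x ^+ 4)%R <= (128 * s ^+ 4)%:E)%E.
Proof.
move=> s0; apply: normal_moment_le.
- by move=> x; rewrite exprn_even_ge0.
- exact: measurable_funX.
- by rewrite mulr_ge0 // exprn_even_ge0.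
- by move=> x; exact: pow4_normal_pdf_le.
Qed.

(** By this symmetry the positive and negative parts of a Brownian increment have the same mean,
    which is the form in which [indep_centered] takes the condition of being centred. *)
Lemma normal_prob_opp s (A : set R) : s != 0 -> measurable A ->
  normal_prob 0 s (-%R @^-1` A) = normal_prob 0 s A.
Proof.
move=> s0 mA; rewrite /normal_prob.
transitivity (\int[pushforward lebesgue_measure (-%R : _ -> measurableTypeR R)]_(x in A)
   (normal_pdf 0 s (- x))%:E)%E.
  rewrite ge0_integral_pushforward//.
  - by apply: eq_integral => x _ /=; rewrite opprK.
  - apply/measurable_EFinP/measurable_funTS/measurableT_comp => //.
    exact: measurable_normal_pdf.
  - by move=> x _; rewrite lee_fin normal_pdf_ge0.
transitivity (\int[lebesgue_measure]_(x in A) (normal_pdf 0 s (- x))%:E)%E.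
  by apply: eq_measure_integral => //= B mB BA; exact: lebesgue_measureN.
by apply: eq_integral => x _; rewrite normal_pdfE// /normal_fun !subr0 sqrrN.
Qed.

Lemma Ex_normal_opp s (f : R -> R) : s != 0 -> (forall x, 0 <= f x) ->
  meas f ->
  Ex (normal_prob 0 s) (fun x => f (- x)) = Ex (normal_prob 0 s) f.
Proof.
move=> s0 f0 mf; rewrite /Ex.
transitivity (\int[pushforward (normal_prob 0 s) (-%R : _ -> measurableTypeR R)]_x
   (f x)%:E)%E.
  rewrite ge0_integral_pushforward//; first exact/measurable_EFinP.
  by move=> x _; rewrite lee_fin.
by apply: eq_measure_integral => //= B mB BA; exact: normal_prob_opp.
Qed.

End normal_moments.

(* [V] has law [nu] and is independent of [Z]. *)
Definition indep_of_law {d} {T : measurableType d} {R : realType}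
  (P : set T -> \bar R) (Z V : T -> R) (nu : set R -> \bar R) :=
  forall A B : set R, measurable A -> measurable B ->
    P (Z @^-1` A `&` V @^-1` B) = (P (Z @^-1` A) * nu B)%E.

(** * Products of independent variables *)

Section independence.
Context {d} {T : measurableType d} {R : realType} (P : probability T R).
Variables (nu : probability (measurableTypeR R) R) (Z V : T -> R).
Hypotheses (mZ : meas Z) (mV : meas V).
Hypothesis ZV : indep_of_law P Z V nu.

(** The joint law of [Z] and [V] agrees with a product measure on rectangles, hence equals it, and
    Tonelli's theorem applies. *)
Lemma indep_ge0_integral (f : R * measurableTypeR R -> \bar R) : (forall x, (0 <= f x)%E) ->
  meas f ->
  (\int[P]_w f (Z w, V w) = \int[P]_w \int[nu]_v f (Z w, v))%E.
Proof.
move=> f0 mf.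
pose Zm : {RV P >-> R} := mfun_Sub (mem_set mZ).
have mV' : measurable_fun (U := measurableTypeR R) setT V by exact: mV.
have mZV := measurable_fun_pair mZ mV'.
transitivity (\int[pushforward P (fun w => (Z w, (V w : measurableTypeR R)))]_x f x)%E.
  by rewrite ge0_integral_pushforward.
transitivity (\int[distribution P Zm \x nu]_x f x)%E.
  apply: eq_measure_integral => //= B mB _; apply/esym.
  pose ZVm : {mfun T >-> (R * measurableTypeR R)%type} := mfun_Sub (mem_set mZV).
  apply: (@product_measure_unique _ _ _ _ _ (distribution P Zm) nu (distribution P ZVm)) => //.
rewrite (fubini_tonelli1 _ mf f0).
rewrite (@ge0_integral_distribution _ _ _ _ _ P Zm)//.
  exact: measurable_fun_fubini_tonelli_F.
by move=> y; apply: integral_ge0.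
Qed.

Lemma indep_Ex_mul (g k : R -> R) : (forall x, 0 <= g x) -> (forall x, 0 <= k x) ->
  meas g -> meas k ->
  \E[P]_w (g (Z w) * k (V w)) = (Ex P (g \o Z) * Ex nu k)%E.
Proof.
move=> g0 k0 mg mk.
rewrite /Ex (indep_ge0_integral (f := fun x => (g x.1 * k x.2)%:E))/=; last 2 first.
- by move=> x; rewrite lee_fin mulr_ge0.
- apply/measurable_EFinP/measurable_funM; exact: measurableT_comp.
rewrite -/(Ex nu k) -ge0_integralZr//.
- apply: eq_integral => w _; by rewrite -ExZ.
- by apply/measurable_EFinP/measurableT_comp.
- by move=> w _; rewrite lee_fin.
- by apply: integral_ge0 => v _; rewrite lee_fin.
Qed.

(** Splitting both factors into positive and negative parts writes [Z V] as a difference of two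
    nonnegative functions; the product formula gives both the same finite mean. *)
Lemma indep_centered : (\E[P]_w (`|Z w|%R) < +oo)%E ->
  (Ex nu (fun v => `|v|%R) < +oo)%E ->
  Ex nu (fun v => Num.max v 0) = Ex nu (fun v => Num.max (- v) 0) ->
  P.-integrable setT (EFin \o (fun w => Z w * V w)) /\
  (\int[P]_w (Z w * V w)%:E = 0)%E.
Proof.
move=> Zoo noo nu0.
pose pos (x : R) := Num.max x 0; pose neg (x : R) := Num.max (- x) 0.
have p0 x : 0 <= pos x by rewrite /pos le_max lexx orbT.
have n0 x : 0 <= neg x by rewrite /neg le_max lexx orbT.
have mpos : meas pos by exact: measurable_maxr.
have mneg : meas neg by apply: measurable_maxr => //; exact: measurable_funN.
have pnE x : x = pos x - neg x by rewrite /pos /neg !maxElt; do !case: ifP => ?; lra.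
have pnA x : `|x| = pos x + neg x.
  by rewrite /pos /neg !maxElt; case: ger0P => ?; do !case: ifP => ?; lra.
pose a w := pos (Z w) * pos (V w) + neg (Z w) * neg (V w).
pose b w := pos (Z w) * neg (V w) + neg (Z w) * pos (V w).
have a0 w : 0 <= a w by rewrite /a addr_ge0 ?mulr_ge0.
have b0 w : 0 <= b w by rewrite /b addr_ge0 ?mulr_ge0.
have ma : meas a.
  by apply: measurable_funD; apply: measurable_funM; exact: measurableT_comp.
have mb : meas b.
  by apply: measurable_funD; apply: measurable_funM; exact: measurableT_comp.
have ZVab w : Z w * V w = a w - b w.
  by rewrite [in LHS](pnE (Z w)) [in LHS](pnE (V w)) /a /b; ring.
have Zpos : (Ex P (pos \o Z) < +oo)%E.
  apply: le_lt_trans Zoo; apply: Ex_le => //.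
  - by move=> w /=.
  - by mea.
  - by mea.
  - by move=> w /=; rewrite pnA lerDl.
have Zneg : (Ex P (neg \o Z) < +oo)%E.
  apply: le_lt_trans Zoo; apply: Ex_le => //.
  - by move=> w /=.
  - by mea.
  - by mea.
  - by move=> w /=; rewrite pnA lerDr.
have posle (x : R) : pos x <= `|x| by rewrite pnA lerDl.
have npos : (Ex nu pos < +oo)%E.
  apply: le_lt_trans noo; apply: Ex_le => //.
  have mabs : meas (fun v : R => `|v|) by mea.
  exact: mabs.
have Exa : Ex P a = (Ex P (pos \o Z) * Ex nu pos + Ex P (neg \o Z) * Ex nu pos)%E.
  rewrite ExD//; last 4 first.
  - by move=> w; rewrite mulr_ge0.
  - by move=> w; rewrite mulr_ge0.
  - by apply: measurable_funM; exact: measurableT_comp.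
  - by apply: measurable_funM; exact: measurableT_comp.
  by rewrite !indep_Ex_mul// -nu0.
have Exb : Ex P b = (Ex P (pos \o Z) * Ex nu pos + Ex P (neg \o Z) * Ex nu pos)%E.
  rewrite ExD//; last 4 first.
  - by move=> w; rewrite mulr_ge0.
  - by move=> w; rewrite mulr_ge0.
  - by apply: measurable_funM; exact: measurableT_comp.
  - by apply: measurable_funM; exact: measurableT_comp.
  by rewrite !indep_Ex_mul// -nu0.
have fin : (Ex P (pos \o Z) * Ex nu pos + Ex P (neg \o Z) * Ex nu pos < +oo)%E.
  have ep : (0 <= Ex P (pos \o Z))%E by apply: Ex_ge0 => w /=.
  have en : (0 <= Ex P (neg \o Z))%E by apply: Ex_ge0 => w /=.
  by apply: lte_add_pinfty; apply: lte_mul_pinfty => //; rewrite ge0_fin_numE.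
have ia : P.-integrable setT (EFin \o a).
  apply: Ex_lty_integrable => //; rewrite (_ : (fun w => _) = a) ?Exa//.
  by apply/funext => w; rewrite ger0_norm.
have ib : P.-integrable setT (EFin \o b).
  apply: Ex_lty_integrable => //; rewrite (_ : (fun w => _) = b) ?Exb//.
  by apply/funext => w; rewrite ger0_norm.
have -> : EFin \o (fun w => Z w * V w) = ((EFin \o a) \- (EFin \o b))%E.
  by apply/funext => w /=; rewrite ZVab EFinB.
split; first exact: integrableB.
under eq_integral do rewrite ZVab EFinB.
rewrite integralB//= -/(Ex P a) -/(Ex P b) Exa Exb subee//.
by rewrite ge0_fin_numE// adde_ge0//; apply: mule_ge0; apply: Ex_ge0 => w /=.
Qed.

End independence.

(** * Sub-sigma-algebras and Brownian increments *)

Section measurability_wrt.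
Context {R : realType} {d} {Om : measurableType d}.
Implicit Types (G : set (set Om)) (f : Om -> R).

(** Viewing [G] as the sigma-algebra of a measurable type of its own makes all closure properties of
    measurable functions available for adaptedness. *)
Lemma measurable_wrtP G f : sigma_algebra [set: Om] G ->
  measurable_wrt G f <->
  measurable_fun (T := g_sigma_algebraType G) (U := R) setT f.
Proof.
move=> sG; split => [fG _ Y mY|mf D mD].
  by rewrite setTI; apply: sub_sigma_algebra; exact: fG.
have : (<<s G >>) (setT `&` f @^-1` D) by exact: mf.
by rewrite setTI sigma_algebra_id.
Qed.

Lemma measurable_wrt_measurable G f : G `<=` measurable ->
  measurable_wrt G f -> meas f.
Proof. by move=> Gm fG _ Y mY; rewrite setTI; apply: Gm; exact: fG. Qed.

Lemma measurable_wrtS G G' f : G `<=` G' -> measurable_wrt G f -> measurable_wrt G' f.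
Proof. by move=> GG fG D mD; apply: GG; exact: fG. Qed.

End measurability_wrt.

Section brownian.
Context {R : realType} {d} {Om : measurableType d} (P : probability Om R).
Variables (F : R -> set (set Om)) (B : R -> Om -> R).
Hypotheses (cF : complete_filtration P F) (BM : brownian_motion P F B).

Lemma filtration_sigma t : 0 <= t -> sigma_algebra setT (F t).
Proof. by case: cF => _ + _ _ _; exact. Qed.

Lemma filtration_sub s t : 0 <= s -> s <= t -> F s `<=` F t.
Proof. by case: cF => _ _ _ + _; exact. Qed.

Lemma filtration_measurable t f : 0 <= t -> measurable_wrt (F t) f ->
  meas (f : Om -> R).
Proof. by move=> t0; apply: measurable_wrt_measurable; case: cF => _ _ + _ _; exact. Qed.

Lemma brownian_adapted t : 0 <= t -> measurable_wrt (F t) (B t).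
Proof. by move=> t0; case: BM => /(_ ord0) + _ _ _; exact. Qed.

Lemma brownian_measurable t : 0 <= t -> meas (B t).
Proof. by move=> t0; apply: (filtration_measurable t0); exact: brownian_adapted. Qed.

Lemma brownian_incr_measurable s t : 0 <= s -> s <= t ->
  meas (fun w => B t w - B s w).
Proof.
by move=> s0 st; apply: measurable_funB; apply: brownian_measurable => //; exact: le_trans st.
Qed.

Lemma brownian_indep s t Z : 0 <= s -> s < t -> measurable_wrt (F s) Z ->
  indep_of_law P Z (fun w => B t w - B s w) (normal_prob 0 (Num.sqrt (t - s))).
Proof.
move=> s0 st ZF A D mA mD; case: BM => _ _ _ /(_ s t (Z @^-1` A) (fun=> D) s0 st (ZF _ mA)).
rewrite big_ord1 => <- //; congr (P (_ `&` _)).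
by apply/seteqP; split => [w /= Dw _ //|w /= /(_ ord0)].
Qed.

Variables (s t : R) (Z : Om -> R).
Hypotheses (s0 : 0 <= s) (st : s <= t) (ZF : measurable_wrt (F s) Z).
Let mZ : meas Z := filtration_measurable s0 ZF.
Let mB := brownian_incr_measurable s0 st.

Lemma brownian_incr_mean0 : (\E[P]_w (`|Z w|%R) < +oo)%E ->
  P.-integrable setT (EFin \o (fun w => Z w * (B t w - B s w))) /\
  (\int[P]_w (Z w * (B t w - B s w))%:E = 0)%E.
Proof.
(* The product formula for Brownian increments covers [s < t] only; for [s = t] the increment
   vanishes. *)
move=> Zoo; move: st; rewrite le_eqVlt => /predU1P[<-|st'].
  have zE : (fun w => Z w * (B s w - B s w)) = cst 0.
    by apply/funext => w; rewrite subrr mulr0.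
  split; first by rewrite zE; exact: integrable0.
  by apply: integral0_eq => w _; rewrite subrr mulr0.
have sq0 : 0 < Num.sqrt (t - s) by rewrite sqrtr_gt0 subr_gt0.
have m0 : meas (fun x : R => Num.max x 0) by mea.
have ind := brownian_indep s0 st' ZF.
apply: (indep_centered (nu := normal_prob 0 (Num.sqrt (t - s)) : probability (measurableTypeR R) R) mZ mB ind Zoo).
- apply: (@le_lt_trans _ _ (Ex (normal_prob 0 (Num.sqrt (t - s))) (fun x => 1 + x ^+ 2)%R)).
    apply: Ex_le => //; [by mea|by mea|move=> x].
    have h : `|x| ^+ 2 = x ^+ 2 by rewrite normr_sqr.
    by have := sqr_ge0 (`|x| - 2^-1); move: h; move: (`|x|) (x ^+ 2) => a b; nra.
  have mX : meas (fun v : R => v ^+ 2) by mea.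
  rewrite ExD; [|by []|by move=> x; exact: sqr_ge0|exact: measurable_cst|exact: mX].
  apply: lte_add_pinfty; last exact: le_lt_trans (normal_moment2 sq0) (ltry _).
  rewrite /Ex integral_cst// mul1e.
  have /= -> := @probability_setT _ _ _ (normal_prob 0 (Num.sqrt (t - s)) : probability (measurableTypeR R) R).
  exact: ltry.
- rewrite -(Ex_normal_opp (f := fun x => Num.max x 0))//; first by rewrite gt_eqF.
  by move=> x; rewrite le_max lexx orbT.
Qed.

Let pos (x : R) := Num.max x 0.
Let pos0 x : 0 <= pos x. Proof. by rewrite /pos le_max lexx orbT. Qed.
Let mpos : meas pos. Proof. by rewrite /pos; mea. Qed.

Let incr_moment (k : nat) (c : R) : (0 < k)%N -> (forall x : R, 0 <= x ^+ k) ->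
  (s < t -> (Ex (normal_prob 0 (Num.sqrt (t - s))) (fun x => x ^+ k)%R <= c%:E)%E) ->
  0 <= c -> (forall w, 0 <= Z w) ->
  (\E[P]_w (Z w * (B t w - B s w) ^+ k) <= c%:E * Ex P Z)%E.
Proof.
move=> k0 xk0 hc c0 Z0; have := st; rewrite le_eqVlt => /predU1P[<-|st'].
  rewrite /Ex integral0_eq; last by move=> w _; rewrite subrr expr0n gtn_eqF// mulr0.
  by rewrite mule_ge0// Ex_ge0.
(* [indep_Ex_mul] wants factors that are nonnegative on the whole line; passing through the positive
   part leaves [Z] unchanged. *)
have posZ : pos \o Z = Z by apply/funext => w /=; rewrite /pos max_l.
have := @indep_Ex_mul _ _ _ P (normal_prob 0 (Num.sqrt (t - s)) : probability (measurableTypeR R) R)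
  Z (fun w => B t w - B s w) mZ mB (brownian_indep s0 st' ZF) pos (fun x => x ^+ k).
rewrite posZ => /(_ pos0 xk0 mpos) E.
rewrite [X in Ex P X](_ : _ = fun w => pos (Z w) * (B t w - B s w) ^+ k); last first.
  by apply/funext => w; rewrite -[in LHS]posZ.
rewrite E; last by mea.
by rewrite muleC lee_wpmul2r ?Ex_ge0// hc.
Qed.

Lemma brownian_incr_moment2 : (forall w, 0 <= Z w) ->
  (\E[P]_w (Z w * (B t w - B s w) ^+ 2) <= (8 * (t - s))%:E * Ex P Z)%E.
Proof.
apply: incr_moment => //.
- by move=> x; exact: sqr_ge0.
- move=> st'; rewrite -[X in (8 * X)%:E](@sqr_sqrtr _ (t - s)) ?subr_ge0//.
  by apply: normal_moment2; rewrite sqrtr_gt0 subr_gt0.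
- by rewrite mulr_ge0 ?subr_ge0.
Qed.

Lemma brownian_incr_moment4 : (forall w, 0 <= Z w) ->
  (\E[P]_w (Z w * (B t w - B s w) ^+ 4) <= (128 * (t - s) ^+ 2)%:E * Ex P Z)%E.
Proof.
apply: incr_moment => //.
- by move=> x; rewrite exprn_even_ge0.
- move=> st'; have -> : (t - s) ^+ 2 = Num.sqrt (t - s) ^+ 4.
    by rewrite (exprM _ 2 2) sqr_sqrtr// subr_ge0.
  by apply: normal_moment4; rewrite sqrtr_gt0 subr_gt0.
- by rewrite mulr_ge0 ?sqr_ge0.
Qed.

End brownian.

(** * Discrete stochastic integrals *)

Section pathwise.
Context {R : realType}.
Implicit Types m x g : R.

(* One step of the pathwise proof of Doob's L^2 inequality
   (Acciaio, Beiglboeck, Penkner, Schachermayer, Temme 2013). *)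
Lemma doob_step m x x' g : 0 <= m -> x + g <= x' ->
  2 * Num.max m x' ^+ 2 - 4 * Num.max m x' * x' <= 2 * m ^+ 2 - 4 * m * x - 4 * m * g.
Proof.
move=> m0 xg; have [mx|mx] := leP m x'; last by nra.
have := sqr_ge0 (m - x'); nra.
Qed.

Lemma max_sqr (a b : R) : 0 <= a -> 0 <= b ->
  Num.max (a ^+ 2) (b ^+ 2) = Num.max a b ^+ 2.
Proof.
move=> a0 b0; case: (leP a b) => h; [apply: max_r|apply: max_l];
  by rewrite ler_sqr ?nnegrE// ltW.
Qed.

(** The sign is a subgradient of the absolute value. This supplies the hypothesis of [doob_step] for
    the absolute value of a discrete integral, with a linear term that is centred. *)
Lemma ler_normD_sg (a b : R) : `|a| + Num.sg a * b <= `|a + b|.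
Proof.
have [->|a0|a0] := sgrP a; first by rewrite mul0r !add0r.
- by rewrite mul1r ler_norm.
- by rewrite mulN1r -opprD ler_normr lexx orbT.
Qed.

(** The cross term [4 a b^3] is absorbed by [2 a^2 b^2 + 2 b^4], so that the only odd power of [b]
    left is the linear one, which is centred in the uses. *)
Lemma pow4D_le (a b : R) :
  (a + b) ^+ 4 <= a ^+ 4 + 4 * a ^+ 3 * b + 8 * a ^+ 2 * b ^+ 2 + 3 * b ^+ 4.
Proof. by have := sqr_ge0 (b * (a - b)); nra. Qed.

End pathwise.

(** Half of [Ex P f] is moved to the left side, which is legitimate because [Ex P f] is known
    beforehand to be finite. *)
Lemma Ex_absorb {d} {T : measurableType d} {R : realType} (P : {measure set T -> \bar R})
  (f g : T -> R) : (forall w, 0 <= f w) -> (forall w, 0 <= g w) ->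
  meas f -> meas g -> (Ex P f < +oo)%E ->
  (Ex P f <= \E[P]_w (2^-1 * f w + g w))%E -> (Ex P f <= 2%:E * Ex P g)%E.
Proof.
move=> f0 g0 mf mg foo; rewrite ExD//; [|by move=> w; rewrite mulr_ge0|by mea].
rewrite ExZ//.
have /fineK fE : (Ex P f \is a fin_num)%E by rewrite ge0_fin_numE// Ex_ge0.
have [->|goo] := eqVneq (Ex P g) +oo%E; first by rewrite gt0_muley ?leey// lte_fin.
have /fineK gE : (Ex P g \is a fin_num)%E by rewrite ge0_fin_numE ?Ex_ge0// ltey.
by rewrite -fE -gE -!EFinM -EFinD !lee_fin; lra.
Qed.

Section discrete.
Context {R : realType} {d} {Om : measurableType d} (P : probability Om R).
Variables (F : R -> set (set Om)) (B : R -> Om -> R).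
Hypotheses (cF : complete_filtration P F) (BM : brownian_motion P F B).
Variables (s : nat -> R) (psi : nat -> Om -> R) (c : R).
Hypotheses (s0 : 0 <= s 0) (smono : forall i, s i <= s i.+1).
Hypothesis (Fpsi : forall i, measurable_wrt (F (s i)) (psi i)).
Hypothesis (psic : forall i w, `|psi i w| <= c).

Definition discrete_integral n w := \sum_(i < n) psi i w * (B (s i.+1) w - B (s i) w).
Definition discrete_bracket n w := \sum_(i < n) psi i w ^+ 2 * (s i.+1 - s i).
Fixpoint running_max n w :=
  if n is k.+1 then Num.max (running_max k w) `|discrete_integral n w| else 0.

Local Notation S := discrete_integral.
Local Notation V := discrete_bracket.
Local Notation M := running_max.
Let dB i w := B (s i.+1) w - B (s i) w.

Let s_ge0 i : 0 <= s i.
Proof. by elim: i => // i ih; exact: le_trans ih (smono i). Qed.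

Let c0 : 0 <= c.
Proof.
(* A probability space has a point, and at that point [c] dominates an absolute value. *)
have [w _] : [set: Om] !=set0.
  apply/set0P/eqP => O; have := @probability_setT _ _ _ P.
  by rewrite O measure0 => /eqP; rewrite eqe eq_sym oner_eq0.
exact: le_trans (psic 0 w).
Qed.

Let SS n w : S n.+1 w = S n w + psi n w * dB n w.
Proof. by rewrite /S big_ord_recr. Qed.

Let S0 w : S 0 w = 0. Proof. by rewrite /S big_ord0. Qed.

Let VS n w : V n.+1 w = V n w + psi n w ^+ 2 * (s n.+1 - s n).
Proof. by rewrite /V big_ord_recr. Qed.

Let M0 n w : 0 <= M n w.
Proof. by elim: n => //= n ih; rewrite le_max ih. Qed.

Lemma discrete_integral_le_max j n w : (j <= n)%N -> `|S j w| <= M n w.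
Proof.
elim: n => [|n ih]; first by rewrite leqn0 => /eqP->; rewrite S0 normr0.
by rewrite leq_eqVlt => /predU1P[->/=|/ih jn]; rewrite /= le_max ?lexx ?orbT// jn.
Qed.

Let FSM n : measurable_wrt (F (s n)) (S n) /\ measurable_wrt (F (s n)) (M n).
Proof.
elim: n => [|n [hS hM]].
  split; last by apply/measurable_wrtP; [exact: (filtration_sigma cF (s_ge0 0))|exact: measurable_cst].
  apply/measurable_wrtP; first exact: (filtration_sigma cF (s_ge0 0)).
  by rewrite (_ : S 0 = cst 0)//; apply/funext => w; rewrite S0.
have up f : measurable_wrt (F (s n)) f ->
    measurable_fun (T := g_sigma_algebraType (F (s n.+1))) setT (f : Om -> R).
  move=> h; apply/(measurable_wrtP _ (filtration_sigma cF (s_ge0 n.+1))).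
  exact: measurable_wrtS (filtration_sub cF (s_ge0 n) (smono n)) h.
have mS : measurable_fun (T := g_sigma_algebraType (F (s n.+1))) setT (S n.+1 : Om -> R).
  rewrite (_ : S n.+1 = fun w => S n w + psi n w * (B (s n.+1) w - B (s n) w)); last first.
    by apply/funext => w; rewrite SS.
  have h1 := up _ hS; have h2 := up _ (Fpsi n).
  have h3 := up _ (brownian_adapted BM (s_ge0 n)).
  have h4 : measurable_fun (T := g_sigma_algebraType (F (s n.+1))) setT (B (s n.+1) : Om -> R).
    apply/(measurable_wrtP _ (filtration_sigma cF (s_ge0 n.+1))).
    exact: (brownian_adapted BM (s_ge0 n.+1)).
  apply: measurable_funD => //; apply: measurable_funM => //; exact: measurable_funB.
split; apply/(measurable_wrtP _ (filtration_sigma cF (s_ge0 n.+1))) => //=.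
apply: measurable_maxr; first exact: up.
exact: measurable_fun_normr.
Qed.

Let mpsi i : meas (psi i).
Proof. exact: (filtration_measurable cF (s_ge0 i) (Fpsi i)). Qed.
Let mdB i : meas (dB i).
Proof. exact: (brownian_incr_measurable cF BM). Qed.
Let mS n : meas (S n).
Proof. by apply: (filtration_measurable cF (s_ge0 n)); case: (FSM n). Qed.
Lemma measurable_running_max n : meas (M n).
Proof. by apply: (filtration_measurable cF (s_ge0 n)); case: (FSM n). Qed.
Let mM := measurable_running_max.
Lemma measurable_discrete_bracket n : meas (V n).
Proof. by rewrite /V; mea. Qed.

Let Ex1 : Ex P (fun=> 1) = 1%E.
Proof. by rewrite /Ex integral_cst// mul1e; exact: probability_setT. Qed.

Let ExdB4 n : (\E[P]_w (dB n w ^+ 4) < +oo)%E.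
Proof.
have F1 : measurable_wrt (F (s n)) (fun=> 1 : R).
  by apply/measurable_wrtP; [exact: (filtration_sigma cF (s_ge0 n))|exact: measurable_cst].
have := brownian_incr_moment4 cF BM (s_ge0 n) (smono n) F1 (fun=> ler01).
rewrite Ex1 mule1; under [X in (Ex P X <= _)%E]eq_fun do rewrite mul1r.
by move=> /le_lt_trans; apply; exact: ltry.
Qed.

Let pow4_ge0 (x : R) : 0 <= x ^+ 4. Proof. by rewrite exprn_even_ge0. Qed.

Let ExS4 n : (\E[P]_w (S n w ^+ 4) < +oo)%E.
Proof.
elim: n => [|n ih].
  by rewrite /Ex integral0_eq ?ltry// => w _; rewrite S0 expr0n.
apply: (@le_lt_trans _ _ (\E[P]_w (8 * S n w ^+ 4 + 8 * c ^+ 4 * dB n w ^+ 4))).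
  apply: Ex_le => //; [by mea|by mea|move=> w].
  rewrite SS; have h : (psi n w * dB n w) ^+ 4 <= c ^+ 4 * dB n w ^+ 4.
    rewrite exprMn ler_wpM2r// -[leLHS]ger0_norm// normrX lerXn2r// ?nnegrE//.
  move: (psi n w * dB n w) h => x h.
  have : (S n w + x) ^+ 4 <= 8 * S n w ^+ 4 + 8 * x ^+ 4.
    move: (S n w) => y; have := sqr_ge0 (y ^+ 2 - x ^+ 2); have := sqr_ge0 (y * (y - x)).
    have := sqr_ge0 (x * (y - x)); have := sqr_ge0 (y - x); nra.
  by move=> /le_trans; apply; lra.
rewrite ExD; try side.
rewrite !ExZ; try side.
apply: lte_add_pinfty; apply: lte_mul_pinfty => //.
by rewrite lee_fin; nneg.
Qed.

Lemma Ex_running_max_pow4 n : (\E[P]_w (M n w ^+ 4) < +oo)%E.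
Proof.
elim: n => [|n ih].
  by rewrite /Ex integral0_eq ?ltry// => w _ /=; rewrite expr0n.
apply: (@le_lt_trans _ _ (\E[P]_w (M n w ^+ 4 + S n.+1 w ^+ 4))).
  apply: Ex_le => //; [by mea|by mea|move=> w /=].
  have [_|_] := leP (M n w) `|S n.+1 w|; last by rewrite lerDl.
  by rewrite -normrX ger0_norm// lerDr.
by rewrite ExD; [exact: lte_add_pinfty|by nneg|by nneg|by mea|by mea].
Qed.

(** Fourth moments of the running maximum are finite, so any integrand of at most quartic growth in
    it is integrable, and its product with the next increment is centred. *)
Let integrable_dB n (Z : Om -> R) (k : R) : measurable_wrt (F (s n)) Z ->
  (forall w, `|Z w| <= k * (1 + M n w ^+ 4)) -> 0 <= k ->
  P.-integrable setT (EFin \o (fun w => Z w * dB n w)) /\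
  (\int[P]_w (Z w * dB n w)%:E = 0)%E.
Proof.
move=> FZ Zk k0; apply: (brownian_incr_mean0 cF BM) => //.
have mZ := filtration_measurable cF (s_ge0 n) FZ.
apply: (@le_lt_trans _ _ (\E[P]_w (k * (1 + M n w ^+ 4)))).
  by apply: Ex_le => //; mea.
rewrite ExZ; [|by []|by nneg|by mea].
apply: lte_mul_pinfty => //; rewrite ExD; try side.
by apply: lte_add_pinfty; [rewrite Ex1 ltry|exact: Ex_running_max_pow4].
Qed.

Let wrtM n (f g : Om -> R) : measurable_wrt (F (s n)) f -> measurable_wrt (F (s n)) g ->
  measurable_wrt (F (s n)) (fun w => f w * g w).
Proof.
move=> /(measurable_wrtP _ (filtration_sigma cF (s_ge0 n))) mf.
move=> /(measurable_wrtP _ (filtration_sigma cF (s_ge0 n))) mg.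
by apply/(measurable_wrtP _ (filtration_sigma cF (s_ge0 n))); exact: measurable_funM.
Qed.

Let Ex_sqr_dB n (Z : Om -> R) : measurable_wrt (F (s n)) Z -> (forall w, 0 <= Z w) ->
  (\E[P]_w (Z w * dB n w ^+ 2) <= (8 * (s n.+1 - s n))%:E * Ex P Z)%E.
Proof. by move=> FZ Z0; exact: (brownian_incr_moment2 cF BM (s_ge0 n) (smono n)). Qed.

Let psiM n w (x k : R) : `|x| <= k -> `|psi n w * x| <= c * k.
Proof. by move=> xk; rewrite normrM ler_pM. Qed.

Let M_pow n w j : (j <= 4)%N -> M n w ^+ j <= 1 + M n w ^+ 4.
Proof.
move=> j4; have [M1|/ltW M1] := leP (M n w) 1.
  by apply: (@le_trans _ _ 1); [exact: exprn_ile1|rewrite lerDl].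
by apply: (@le_trans _ _ (M n w ^+ 4)); [exact: ler_weXn2l|rewrite lerDr].
Qed.

Let measurable_sg : meas (@Num.sg R).
Proof.
have -> : (@Num.sg R) = fun x => (\1_(`]0, +oo[) x : R) - \1_(`]-oo, 0[) x.
  apply/funext => x; rewrite !indicE !mem_setE !in_itv/= andbT.
  by case: (ltrgt0P x) => [x0|x0|->] /=; rewrite ?(gtr0_sg x0) ?(ltr0_sg x0) ?sgr0 ?subr0 ?sub0r ?subrr//.
by apply: measurable_funB; exact: measurable_indic.
Qed.

(** The functional [L] exceeds the squared maximum by [(M - 2 |S|)^2]. By [doob_step], one time step
    increases it by at most a centred term plus [4 psi^2 dB^2]; with the constant 8 for second
    moments of increments this gives 32. *)
Lemma discrete_doob2 n :
  (\E[P]_w (M n w ^+ 2) <= 32%:E * Ex P (V n))%E.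
Proof.
pose L n w := 2 * M n w ^+ 2 - 4 * M n w * `|S n w| + 4 * S n w ^+ 2.
have mL k : meas (L k).
  by rewrite /L; mea.
have L0 k w : M k w ^+ 2 <= L k w.
  rewrite /L -[S k w ^+ 2]normr_sqr//.
  by have := sqr_ge0 (M k w - 2 * `|S k w|); nra.
have L_ge0 k w : 0 <= L k w by apply: le_trans (L0 k w); nneg.
have mV := measurable_discrete_bracket.
apply: (@le_trans _ _ (Ex P (L n))).
  by apply: Ex_le => //; [nneg|mea].
elim: n => [|n ih].
  rewrite [leLHS]/Ex integral0_eq; last first.
    by move=> w _; rewrite /L S0 /= normr0 !expr0n /=; congr EFin; ring.
  by rewrite mule_ge0// Ex_ge0// => w; rewrite /V big_ord0.
pose Z w := psi n w * (8 * S n w - 4 * (M n w * Num.sg (S n w))).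
have [hS hM] := FSM n.
have FZ : measurable_wrt (F (s n)) Z.
  have sg := filtration_sigma cF (s_ge0 n).
  apply: wrtM => //; apply/(measurable_wrtP _ sg).
  move: hS hM => /(measurable_wrtP _ sg) hS /(measurable_wrtP _ sg) hM.
  apply: measurable_funB; first by mea.
  apply: measurable_funM => //; apply: measurable_funM => //.
  exact: (measurableT_comp measurable_sg hS).
have SM w : `|S n w| <= M n w by exact: discrete_integral_le_max.
have ZM w : `|Z w| <= c * 12 * (1 + M n w ^+ 4).
  rewrite -mulrA; apply: psiM; apply: (@le_trans _ _ (12 * M n w)); last first.
    by rewrite ler_wpM2l// -[leLHS]expr1 M_pow.
  rewrite (le_trans (ler_normB _ _))// !normrM [`|M n w|]ger0_norm//.
  have : `|Num.sg (S n w)| <= 1 by rewrite normr_sg; case: eqP.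
  have := SM w; have := M0 n w; rewrite !normr_nat; move: (M n w) (`|S n w|) (`|Num.sg (S n w)|) => a b e.
  by nra.
have [|iZ Z0] := integrable_dB FZ ZM; first by nneg.
apply: (@le_trans _ _ (\E[P]_w (L n w + 4 * (psi n w ^+ 2 * dB n w ^+ 2)))).
  apply: (Ex_le_centered _ _ _ _ iZ) => //; [by nneg|by mea|move=> w].
  have := @doob_step R (M n w) `|S n w| `|S n.+1 w| (Num.sg (S n w) * (psi n w * dB n w)) (M0 n w).
  rewrite SS => /(_ (ler_normD_sg _ _)) h.
  rewrite /L /= SS /Z; move: h; set x := Num.max _ _; set y := `|S n w + _|.
  by move: (Num.sg _) => sg; nra.
rewrite ExD; try side.
rewrite ExZ; try side.
have dn0 : 0 <= s n.+1 - s n by rewrite subr_ge0.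
rewrite (_ : V n.+1 = fun w => V n w + psi n w ^+ 2 * (s n.+1 - s n)); last first.
  by apply/funext => w; rewrite VS.
have V0 w : 0 <= V n w by apply: sumr_ge0 => k _; rewrite mulr_ge0 ?sqr_ge0// subr_ge0.
rewrite (ExD P (f := V n)); try side.
rewrite [leRHS]ge0_muleDr; [|by apply: Ex_ge0; nneg|by apply: Ex_ge0; nneg].
apply: leeD => //.
have -> : (fun w => psi n w ^+ 2 * (s n.+1 - s n)) = (fun w => (s n.+1 - s n) * psi n w ^+ 2).
  by apply/funext => w; rewrite mulrC.
rewrite ExZ; try side.
have FZ2 : measurable_wrt (F (s n)) (fun w => psi n w * psi n w) by exact: wrtM.
have := Ex_sqr_dB FZ2 (fun w => sqr_ge0 (psi n w)).
have -> : (fun w => psi n w * psi n w) = (fun w => psi n w ^+ 2) by [].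
move=> h; rewrite (_ : 32 = 4 * 8); last by ring.
by rewrite EFinM -muleA lee_pmul2l// muleA -EFinM.
Qed.

(** Same functional, built on [M^2] and [S^2]. One step now adds [32 S^2 psi^2 dB^2 + 12 psi^4 dB^4]
    beyond centred terms, whence the factors [32 * 8] and [12 * 128]. Bounding [S^2] by [M^2] and
    using [256 x y <= x^2 / 2 + 128 . 256 y^2], half of the fourth moment is absorbed. The term
    carrying the mesh [h] disappears when the grid is refined. *)
Lemma discrete_doob4 n (h : R) : (forall i, s i.+1 - s i <= h) ->
  (\E[P]_w (M n w ^+ 4) <=
   2%:E * \E[P]_w (128 * (32 * 8) * V n w ^+ 2 + (12 * 128) * c ^+ 2 * h * V n w))%E.
Proof.
move=> dh.
have h0 : 0 <= h by apply: le_trans (dh 0); rewrite subr_ge0.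
have ds i : 0 <= s i.+1 - s i by rewrite subr_ge0.
have mV := measurable_discrete_bracket.
have V0 k w : 0 <= V k w by apply: sumr_ge0 => j _; rewrite mulr_ge0 ?sqr_ge0.
pose L k w := 2 * (M k w ^+ 2) ^+ 2 - 4 * M k w ^+ 2 * S k w ^+ 2 + 4 * (S k w ^+ 2) ^+ 2.
have mL k : meas (L k) by rewrite /L; mea.
have L0 k w : M k w ^+ 4 <= L k w.
  by rewrite /L (exprM _ 2 2); have := sqr_ge0 (M k w ^+ 2 - 2 * S k w ^+ 2); nra.
have L_ge0 k w : 0 <= L k w by apply: le_trans (L0 k w); nneg.
pose U k w := \sum_(i < k)
  ((32 * 8) * (S i w ^+ 2 * psi i w ^+ 2) * (s i.+1 - s i) + (12 * 128) * psi i w ^+ 4 * (s i.+1 - s i) ^+ 2).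
have U0 k w : 0 <= U k w by apply: sumr_ge0 => j _; have := ds j; nneg.
have mU k : meas (U k) by rewrite /U; mea.
have US k w : U k.+1 w = U k w + ((32 * 8) * (s k.+1 - s k) * (S k w ^+ 2 * psi k w ^+ 2) +
    (12 * 128) * (s k.+1 - s k) ^+ 2 * psi k w ^+ 4).
  by rewrite /U big_ord_recr/=; ring.
have LU k : (Ex P (L k) <= Ex P (U k))%E.
  elim: k => [|k ih].
    rewrite [leLHS]/Ex integral0_eq ?Ex_ge0//.
    by move=> w _; rewrite /L S0 /= !expr0n /=; congr EFin; ring.
  pose Z w := psi k w * (16 * (S k w * (S k w * S k w)) - 8 * (M k w * (M k w * S k w))).
  have [hS hM] := FSM k.
  have FZ : measurable_wrt (F (s k)) Z.
    have sg := filtration_sigma cF (s_ge0 k).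
    apply: wrtM => //; apply/(measurable_wrtP _ sg).
    by move: hS hM => /(measurable_wrtP _ sg) hS /(measurable_wrtP _ sg) hM; mea.
  have SM w : `|S k w| <= M k w by exact: discrete_integral_le_max.
  have ZM w : `|Z w| <= c * 24 * (1 + M k w ^+ 4).
    rewrite -mulrA; apply: psiM; apply: (@le_trans _ _ (24 * M k w ^+ 3)); last first.
      by rewrite ler_wpM2l// M_pow.
    rewrite (le_trans (ler_normB _ _))// !normrM [`|M k w|]ger0_norm// !normr_nat.
    have := SM w; have := M0 k w; have := normr_ge0 (S k w).
    move: (M k w) (`|S k w|) => a b b0 a0 ba.
    have b3 : b * (b * b) <= a * (a * a) by rewrite !ler_pM// ?mulr_ge0.
    have ab : a * (a * b) <= a * (a * a) by rewrite !ler_wpM2l.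
    by rewrite !exprS expr0; nra.
  have [|iZ Z0] := integrable_dB FZ ZM; first by nneg.
  pose W w := 32 * ((S k w * psi k w) * (S k w * psi k w) * dB k w ^+ 2) +
    12 * ((psi k w * psi k w) * (psi k w * psi k w) * dB k w ^+ 4).
  have W0 w : 0 <= W w.
    rewrite /W -!expr2; nneg.
  have mW : meas W by rewrite /W; mea.
  apply: (@le_trans _ _ (\E[P]_w (L k w + W w))).
    apply: (Ex_le_centered _ _ _ _ iZ) => //; [by nneg|by mea|move=> w].
    have xg : S k w ^+ 2 + 2 * S k w * (psi k w * dB k w) <= S k.+1 w ^+ 2.
      by rewrite SS; have := sqr_ge0 (psi k w * dB k w); nra.
    have := doob_step (sqr_ge0 (M k w)) xg.
    have -> : Num.max (M k w ^+ 2) (S k.+1 w ^+ 2) = M k.+1 w ^+ 2.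
      rewrite /= -[S k.+1 w ^+ 2]normr_sqr//.
      exact: max_sqr.
    have := pow4D_le (S k w) (psi k w * dB k w); rewrite -SS.
    rewrite /L /W /Z.
    move: (M k.+1 w) (S k.+1 w) (S k w) (M k w) (psi k w) (dB k w) => m x y m' p b.
    by nra.
  rewrite (_ : U k.+1 = fun w => U k w + ((32 * 8) * (s k.+1 - s k) * (S k w ^+ 2 * psi k w ^+ 2) +
    (12 * 128) * (s k.+1 - s k) ^+ 2 * psi k w ^+ 4)); last by apply/funext => w; rewrite US.
  have dk := ds k.
  rewrite (ExD P (f := L k)); try side.
  rewrite (ExD P (f := U k)); try side.
  apply: leeD => //.
  rewrite /W ExD; try side.
  rewrite ExZ; try side.
  rewrite ExZ; try side.
  rewrite ExD; try side.
  rewrite ExZ; try side.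
  rewrite ExZ; try side.
  have FSpsi : measurable_wrt (F (s k)) (fun w => S k w * psi k w) by exact: wrtM.
  have Fpsi2 : measurable_wrt (F (s k)) (fun w => psi k w * psi k w) by exact: wrtM.
  have F4 := wrtM Fpsi2 Fpsi2.
  have e2 := Ex_sqr_dB (wrtM FSpsi FSpsi) (fun w => sqr_ge0 (S k w * psi k w)).
  have e4 := brownian_incr_moment4 cF BM (s_ge0 k) (smono k) F4 (fun w => sqr_ge0 (psi k w * psi k w)).
  apply: leeD.
    rewrite (_ : (fun w => S k w ^+ 2 * psi k w ^+ 2) =
      (fun w => S k w * psi k w * (S k w * psi k w))); last by apply/funext => w; ring.

    by rewrite -!mulrA EFinM -[X in (_ <= X)%E]muleA lee_pmul2l.
  rewrite (_ : (fun w => psi k w ^+ 4) =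
    (fun w => psi k w * psi k w * (psi k w * psi k w))); last by apply/funext => w; ring.

  by rewrite -!mulrA EFinM -[X in (_ <= X)%E]muleA lee_pmul2l.
have mg : meas (fun w => 128 * (32 * 8) * V n w ^+ 2 + (12 * 128) * c ^+ 2 * h * V n w) by mea.
have g0 w : 0 <= 128 * (32 * 8) * V n w ^+ 2 + (12 * 128) * c ^+ 2 * h * V n w by nneg.
apply: Ex_absorb => //; [by mea|exact: Ex_running_max_pow4|].
apply: (@le_trans _ _ (Ex P (L n))); first by apply: Ex_le => //; mea.
apply: (le_trans (LU n)); apply: Ex_le => //; [by mea|move=> w].
apply: (@le_trans _ _ (((32 * 8) * M n w ^+ 2 + (12 * 128) * c ^+ 2 * h) * V n w)); last first.
  have := sqr_ge0 (M n w ^+ 2 - (32 * 8) * V n w); rewrite (exprM _ 2 2).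
  by move: (M n w ^+ 2) (V n w) => x y; nra.
rewrite /V mulr_sumr; apply: ler_sum => i _.
have SM : S i w ^+ 2 <= M n w ^+ 2.
  rewrite -[S i w ^+ 2]normr_sqr// ler_sqr ?nnegrE//.
  by apply: discrete_integral_le_max; exact: ltnW.
have psi2 : psi i w ^+ 2 <= c ^+ 2.
  by rewrite -[psi i w ^+ 2]normr_sqr// ler_sqr ?nnegrE.
have dsi := ds i; have dhi := dh i; have p0 := sqr_ge0 (psi i w).
move: (s i.+1 - s i) dsi dhi => a a0 ah.
rewrite (exprM _ 2 2) [leRHS]mulrDl; move: (psi i w ^+ 2) (S i w ^+ 2) (M n w ^+ 2) (c ^+ 2) SM psi2 p0 => p x m k xm pk p0.
apply: lerD.
  rewrite [leLHS](_ : _ = 32 * 8 * (p * a) * x); last by ring.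
  rewrite [leRHS](_ : _ = 32 * 8 * (p * a) * m); last by ring.
  by apply: ler_wpM2l => //; nneg.
rewrite [leLHS](_ : _ = 12 * 128 * (p * a) * (p * a)); last by ring.
rewrite [leRHS](_ : _ = 12 * 128 * (p * a) * (k * h)); last by ring.
by apply: ler_wpM2l; [nneg|exact: ler_pM].
Qed.

End discrete.

(** * Processes and time integrals *)

Lemma cvg_within_seq {R : realType} (A : set R) (f : R -> R) (x : R) (u : nat -> R) :
  {within A, continuous f} -> A x -> (forall k, A (u k)) -> u @ \oo --> x ->
  f (u k) @[k --> \oo] --> f x.
Proof.
move=> cf Ax Auk ux.
move/subspace_continuousP : cf => /(_ x Ax) cfx.
have h : u @ \oo --> within A (nbhs x).
  move=> B AB; have /= := ux _ AB; rewrite !near_simpl => uB.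
  by near=> k; apply: (near uB k) => //; exact: Auk.
by apply: cvg_comp cfx.
Unshelve. all: by end_near. Qed.

Section dyadic.
Context {R : realType}.
Implicit Types (s t : R).

Definition dyadic_floor k s : R := (Num.truncn (2 ^+ k * s))%:R / 2 ^+ k.

Lemma dyadic_floor_itv k s : 0 <= s -> 0 <= dyadic_floor k s <= s.
Proof.
move=> s0; have p : (0 : R) < 2 ^+ k by rewrite exprn_gt0.
rewrite /dyadic_floor divr_ge0//= ?(ltW p)//.
by rewrite ler_pdivrMr// mulrC truncn_le// mulr_ge0// ltW.
Qed.

Lemma dyadic_floor_gt k s : 0 <= s -> s - (2 ^+ k)^-1 < dyadic_floor k s.
Proof.
move=> s0; have p : (0 : R) < 2 ^+ k by rewrite exprn_gt0.
rewrite /dyadic_floor ltr_pdivlMr// mulrBl mulVf ?gt_eqF//.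
rewrite ltrBlDr mulrC natr1; exact: truncnS_gt.
Qed.

Lemma cvg_inv_pow2 : ((2 ^+ k)^-1 : R) @[k --> \oo] --> (0 : R).
Proof.
under eq_fun do rewrite -exprVn.
by apply: cvg_expr; rewrite ger0_norm ?invr_ge0// invf_lt1// ltr1n.
Qed.

Lemma cvg_dyadic_floor s : 0 <= s -> dyadic_floor k s @[k --> \oo] --> s.
Proof.
move=> s0; apply: (@squeeze_cvgr _ _ _ _ (fun k => s - (2 ^+ k)^-1) (fun=> s)).
- by apply: nearW => k; rewrite ltW ?dyadic_floor_gt//; case/andP: (dyadic_floor_itv k s0).
- by rewrite -[X in _ --> X]subr0; apply: cvgB; [exact: cvg_cst|exact: cvg_inv_pow2].
- exact: cvg_cst.
Qed.

(** Enumerates the dyadic points of the unit interval through codes of pairs. The minimum with 1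
    takes care of pairs beyond the interval, the default pair of integers that code nothing. *)
Definition dyadic (n : nat) : R :=
  let: (k, i) := odflt (0, 0)%N (unpickle n) in Num.min 1 (i%:R / 2 ^+ k).

Lemma dyadic_itv n : 0 <= dyadic n <= 1.
Proof.
rewrite /dyadic; case: (odflt _ _) => k i.
by rewrite le_min ler01 divr_ge0 ?ler0n ?exprn_ge0//= ge_min lexx.
Qed.

Lemma dyadicE k i : (i <= 2 ^ k)%N -> dyadic (pickle (k, i)) = i%:R / 2 ^+ k.
Proof.
move=> ik; rewrite /dyadic pickleK/=; apply: min_r.
by rewrite ler_pdivrMr ?exprn_gt0// mul1r -natrX ler_nat.
Qed.

Lemma dyadic_floorE k s : 0 <= s -> s <= 1 -> exists n, dyadic_floor k s = dyadic n.
Proof.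
move=> s0 s1; exists (pickle (k, Num.truncn (2 ^+ k * s))).
rewrite dyadicE// -(@ler_nat R) natrX (@le_trans _ _ (2 ^+ k * s))//.
  by rewrite truncn_le// mulr_ge0// exprn_ge0.
by rewrite ler_piMr// exprn_ge0.
Qed.

End dyadic.

Section processes.
Context {R : realType} {d} {T : measurableType d}.
Implicit Types (f g : R -> T -> R) (w : T).

(** Left continuity is all that joint measurability, left Riemann sums and suprema over dyadic times
    require, and unlike continuity it holds for indicators of []u, v]] and for cut-offs. *)
Definition leftcont f := forall w (s : R) (u : nat -> R), 0 <= s ->
  (forall k, 0 <= u k <= s) -> u @ \oo --> s -> f (u k) w @[k --> \oo] --> f s w.

Definition locbdd f := forall w (t : R),
  exists c : R, forall s, 0 <= s <= t -> `|f s w| <= c.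

(* Contains the continuous processes as well as the step processes and the
   cut-offs used for localisation. *)
Definition proc f := [/\ forall s, 0 <= s -> meas (f s),
  leftcont f & locbdd f].

Lemma procD f g : proc f -> proc g -> proc (fun s w => f s w + g s w).
Proof.
move=> [mf lf bf] [mg lg bg]; split.
- by move=> s s0; apply: measurable_funD; [exact: mf|exact: mg].
- by move=> w s u s0 us cu; apply: cvgD; [exact: lf|exact: lg].
- move=> w t; have [c fc] := bf w t; have [e ge] := bg w t; exists (c + e) => s st.
  by apply: le_trans (ler_normD _ _) (lerD _ _); [exact: fc|exact: ge].
Qed.

Lemma procM f g : proc f -> proc g -> proc (fun s w => f s w * g s w).
Proof.
move=> [mf lf bf] [mg lg bg]; split.
- by move=> s s0; apply: measurable_funM; [exact: mf|exact: mg].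
- by move=> w s u s0 us cu; apply: cvgM; [exact: lf|exact: lg].
- move=> w t; have [c fc] := bf w t; have [e ge] := bg w t; exists (c * e) => s st.
  by rewrite normrM ler_pM//; [exact: fc|exact: ge].
Qed.

Lemma proc_time (g : R -> R) : continuous g ->
  (forall t, exists c : R, forall s, 0 <= s <= t -> `|g s| <= c) -> proc (fun s _ => g s).
Proof.
move=> cg bg; split; first by move=> s _; exact: measurable_cst.
  by move=> w s u _ _ us; exact: (cvg_comp _ _ us (cg s)).
by move=> _ t; exact: bg.
Qed.

Lemma proc_const (Z : T -> R) : meas Z -> proc (fun _ w => Z w).
Proof.
move=> mZ; split => //; first by move=> w s u _ _ _; exact: cvg_cst.
by move=> w t; exists `|Z w|.
Qed.

Lemma procN f : proc f -> proc (fun s w => - f s w).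
Proof.
move=> [mf lf bf]; split.
- by move=> s s0; apply: measurable_funN; exact: mf.
- by move=> w s u s0 us cu; apply: cvgN; exact: lf.
- by move=> w t; have [c fc] := bf w t; exists c => s st; rewrite normrN fc.
Qed.

Lemma procB f g : proc f -> proc g -> proc (fun s w => f s w - g s w).
Proof. by move=> pf pg; exact: procD pf (procN pg). Qed.

Lemma procX f n : proc f -> proc (fun s w => f s w ^+ n).
Proof.
move=> pf; elim: n => [|n ih].
  rewrite (_ : (fun s w => _) = fun _ _ => 1); first exact: (@proc_const (fun=> 1)).
  by apply/funext => s; apply/funext => w; rewrite expr0.
rewrite (_ : (fun s w => _) = fun s w => f s w * f s w ^+ n); first exact: procM.
by apply/funext => s; apply/funext => w; rewrite exprS.
Qed.

Lemma proc_abs f : proc f -> proc (fun s w => `|f s w|).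
Proof.
move=> [mf lf bf]; split.
- by move=> s s0; apply: measurable_fun_normr; exact: mf.
- by move=> w s u s0 us cu; apply: cvg_norm; exact: lf.
- by move=> w t; have [c fc] := bf w t; exists c => s st; rewrite normr_id fc.
Qed.

Lemma proc_lip (g : R -> R) (L : R) f : 0 <= L ->
  lip L g -> proc f -> proc (fun s w => g (f s w)).
Proof.
move=> L0 gL [mf lf bf].
split.
- move=> s s0; apply: measurableT_comp; last exact: mf.
  apply: continuous_measurable_fun => x; apply/cvgrPdist_le => e e0.
  have eL : 0 < e / (L + 1) by rewrite divr_gt0// ltr_wpDl.
  near=> y; apply: le_trans (gL x y) _.
  apply: (@le_trans _ _ (L * (e / (L + 1)))).
    by apply: ler_wpM2l => //; near: y; exact: cvgr_dist_le.
  by rewrite mulrCA ler_piMr ?(ltW e0)// ler_pdivrMr ?ltr_wpDl// mul1r lerDl.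
- move=> w s u s0 us cu; have := lf w s u s0 us cu.
  move=> h; apply/cvgrPdist_le => e e0.
  have eL : 0 < e / (L + 1) by rewrite divr_gt0// ltr_wpDl.
  near=> k; apply: le_trans (gL _ _) _.
  apply: (@le_trans _ _ (L * (e / (L + 1)))).
    by apply: ler_wpM2l => //; near: k; exact: cvgr_dist_le.
  by rewrite mulrCA ler_piMr ?(ltW e0)// ler_pdivrMr ?ltr_wpDl// mul1r lerDl.
- move=> w t; have [c fc] := bf w t; exists (L * c + `|g 0|) => s st.
  rewrite -[g _](subrK (g 0)) (le_trans (ler_normD _ _))// lerD2r.
  apply: le_trans (gL _ _) _; rewrite subr0 ler_wpM2l//; exact: fc.
Unshelve. all: by end_near. Qed.

Lemma proc_continuous (X : R -> T -> R) : (forall s, 0 <= s -> meas (X s)) ->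
  continuous_paths X -> proc X.
Proof.
move=> mX cX; split => //.
  move=> w s u s0 us cu; apply: (cvg_within_seq (cX w)) => //=.
    by rewrite in_itv/= s0.
  by move=> k; rewrite in_itv/= andbT; case/andP: (us k).
move=> w t.
have cpt : compact ((fun s => X s w) @` `[0, t]).
  apply: continuous_compact; last exact: segment_compact.
  apply: continuous_subspaceW (cX w) => x /=; rewrite !in_itv/= => /andP[-> _] //.
have /= [M [_ hM]] := compact_bounded cpt.
exists (M + 1) => s st.
by apply: (hM (M + 1)); [rewrite ltrDl|exists s => //; rewrite /= in_itv/=].
Qed.

(** Nothing is assumed of processes at negative times; freezing them at their value at 0 gives
    functions on the whole line, to which Fubini's theorem applies. *)
Definition pos_time (s : R) := Num.max 0 s.

(** A left-continuous process is the limit of the processes frozen at the dyadic time to the left,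
    and those are measurable piece by piece over countably many time cells. *)
Lemma proc_joint f : proc f ->
  meas (fun p : measurableTypeR R * T => f (pos_time p.1) p.2).
Proof.
move=> [mf lf _].
pose a k (p : measurableTypeR R * T) := f (dyadic_floor k (pos_time p.1)) p.2.
have pt0 s : 0 <= pos_time s by rewrite /pos_time le_max lexx.
have mpt : meas (pos_time : measurableTypeR R -> R).
  have h : measurable_fun (setT : set R) (fun s : R => Num.max 0 s) by mea.
  exact: h.
apply: (@measurable_fun_cvg _ _ _ _ a) => [k|p _]; last first.
  apply: lf => //; last exact: cvg_dyadic_floor.
  by move=> k; exact: dyadic_floor_itv.
move=> _ Y mY; rewrite setTI.
rewrite (_ : _ @^-1` _ = \bigcup_j ((fun s : measurableTypeR R => 2 ^+ k * pos_time s) @^-1` `[j%:R, j.+1%:R[ `*`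
   (f (j%:R / 2 ^+ k) @^-1` Y))).
  apply: bigcupT_measurable => j; apply: measurableX.
    rewrite -[X in measurable X]setTI.
    have h : meas (fun s : measurableTypeR R => 2 ^+ k * pos_time s).
      by apply: measurable_funM.
    exact: h.
  by rewrite -[X in measurable X]setTI; apply: mf => //; rewrite divr_ge0// exprn_ge0.
apply/seteqP; split => [[s w] /= fY|[s w] /= [j _ [/= sj fY]]].
  exists (Num.truncn (2 ^+ k * pos_time s)) => //; split => //=.
  by rewrite in_itv/=; apply: truncn_itv; rewrite mulr_ge0// exprn_ge0.
rewrite /a /dyadic_floor/= (_ : Num.truncn _ = j)//.
by apply: truncn_def; move: sj; rewrite in_itv.
Qed.

Lemma proc_measurable_time f w : proc f ->
  meas (fun s : measurableTypeR R => f (pos_time s) w).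
Proof.
move=> /proc_joint mf.
exact: (measurableT_comp mf (pair2_measurable w)).
Qed.

Lemma proc_measurable_itv f w a t : 0 <= a -> proc f ->
  measurable_fun (`[a, t] : set (measurableTypeR R)) (fun s => f s w).
Proof.
move=> a0 /(proc_measurable_time w) mf.
apply: (@eq_measurable_fun _ _ (measurableTypeR R) R _ (fun s => f (pos_time s) w)).
  move=> s; rewrite inE/= in_itv/= => /andP[as_ _].
  by rewrite /pos_time max_r// (le_trans a0).
exact: measurable_funTS.
Qed.

Local Notation leb := (@lebesgue_measure R).

Lemma proc_integrable f w a t : 0 <= a -> proc f ->
  leb.-integrable `[a, t] (EFin \o (fun s => f s w)).
Proof.
move=> a0 pf; case: (pf) => _ _ /(_ w t)[c fc].
apply: measurable_bounded_integrable => //.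
- have [at_|ta] := leP a t; last first.
    by rewrite set_itv_ge ?measure0// bnd_simp -ltNge.
  by rewrite /= lebesgue_measure_itv/=; case: ifP => _; rewrite -?EFinD ltry.
- exact: proc_measurable_itv.
- exists c; split; first by rewrite num_real.
  move=> M cM s /=; rewrite in_itv/= => /andP[as_ st].
  by rewrite (le_trans (fc s _))// ?(ltW cM)// st (le_trans a0).
Qed.

Definition tint f (a t : R) (w : T) : R := \int[leb]_(s in `[a, t]) f s w.

Lemma tint_ge0 f a t w : (forall s, a <= s <= t -> 0 <= f s w) -> 0 <= tint f a t w.
Proof. by move=> f0; apply: Rintegral_ge0 => s /=; rewrite in_itv; exact: f0. Qed.

Lemma tint_le f g a t w : 0 <= a -> proc f -> proc g ->
  (forall s, a <= s <= t -> f s w <= g s w) -> tint f a t w <= tint g a t w.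
Proof.
move=> a0 pf pg fg.
apply: (le_Rintegral _ (proc_integrable w t a0 pf) (proc_integrable w t a0 pg)) => //.
Qed.

Lemma tint_eq f g a t w : (forall s, a <= s <= t -> f s w = g s w) ->
  tint f a t w = tint g a t w.
Proof. by move=> fg; apply: eq_Rintegral => s; rewrite inE/= in_itv; exact: fg. Qed.

Lemma tintD f g a t w : 0 <= a -> proc f -> proc g ->
  tint (fun s w => f s w + g s w) a t w = tint f a t w + tint g a t w.
Proof. by move=> a0 pf pg; rewrite /tint RintegralD//; exact: proc_integrable. Qed.

Lemma tintB f g a t w : 0 <= a -> proc f -> proc g ->
  tint (fun s w => f s w - g s w) a t w = tint f a t w - tint g a t w.
Proof. by move=> a0 pf pg; rewrite /tint RintegralB//; exact: proc_integrable. Qed.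

Lemma tintZ (c : R) f a t w : 0 <= a -> proc f ->
  tint (fun s w => c * f s w) a t w = c * tint f a t w.
Proof. by move=> a0 pf; rewrite /tint RintegralZl//; exact: proc_integrable. Qed.

Lemma tint_cst (c : R) a t w : a <= t -> tint (fun _ _ => c) a t w = c * (t - a).
Proof.
move=> at_; rewrite /tint Rintegral_cst//= lebesgue_measure_itv/= lte_fin.
by move: at_; rewrite le_eqVlt => /predU1P[->|->//]; rewrite ltxx subrr.
Qed.

Lemma norm_tint f a t w : 0 <= a -> proc f ->
  `|tint f a t w| <= tint (fun s w => `|f s w|) a t w.
Proof. by move=> a0 pf; apply: le_normr_Rintegral => //; exact: proc_integrable. Qed.

Lemma tint_cat f a s t w : 0 <= a -> a <= s -> s <= t -> proc f ->
  tint f a t w = tint f a s w + tint f s t w.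
Proof.
move=> a0 as_ st pf; rewrite /tint.
have := @Rintegral_itvB R (fun s => f s w) (BLeft a) (BRight t) s (proc_integrable w t a0 pf).
rewrite !bnd_simp => /(_ as_ st) => /eqP.
rewrite subr_eq => /eqP ->; rewrite addrC; congr (_ + _).
apply: Rintegral_itv_obnd_cbnd.
apply: integrableS (proc_integrable w t (le_trans a0 as_) pf) => //.
by move=> x /=; rewrite !in_itv/= => /andP[/ltW -> ->].
Qed.

Lemma tint_ge0E f a t w : 0 <= a -> proc f ->
  (tint f a t w)%:E = (\int[leb]_(s in `[a, t]) (f s w)%:E)%E.
Proof.
move=> a0 pf; rewrite /tint /Rintegral fineK//.
exact: integrable_fin_num (proc_integrable w t a0 pf).
Qed.

Lemma measurable_tint f a t : 0 <= a -> proc f -> meas (tint f a t).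
Proof.
move=> a0; wlog f0 : f / forall s w, 0 <= f s w => [hw pf|pf].
  (* A signed process is the difference of these two nonnegative ones. *)
  pose p s w := (`|f s w| + f s w); pose n s w := `|f s w|.
  have pp : proc p by exact: procD (proc_abs pf) pf.
  have pn : proc n by exact: proc_abs.
  rewrite (_ : tint f a t = fun w => tint p a t w - tint n a t w); last first.
    apply/funext => w; rewrite -tintB//; apply: tint_eq => s _.
    by rewrite /p /n addrAC subrr add0r.
  apply: measurable_funB; apply: hw => // s w; last exact: normr_ge0.
  by have := ler_norm (- f s w); rewrite normrN /p; lra.
apply/measurable_EFinP.
pose F (p : measurableTypeR R * T) :=
  ((f (pos_time p.1) p.2 * \1_(`[a, t]) (p.1 : R)) : R)%:E.
rewrite (_ : EFin \o tint f a t = fun w => \int[leb]_s F (s, w))%E; last first.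
  apply/funext => w /=; rewrite tint_ge0E// integral_mkcond.
  apply: eq_integral => s _; rewrite /F/= /patch indicE mem_setE.
  case: ifPn => [|]; rewrite ?mulr0//= in_itv/= => /andP[as_ _].
  by rewrite mulr1 /pos_time max_r// (le_trans a0).
apply: (@measurable_fun_fubini_tonelli_G _ _ _ _ _ leb F) => [|p]; last first.
  by rewrite lee_fin mulr_ge0// indicE ler0n.
apply/measurable_EFinP/measurable_funM; first exact: proc_joint.
apply: measurableT_comp => //; exact: measurable_indic.
Qed.

Lemma Ex_tint (P : probability T R) f a t : 0 <= a -> proc f -> (forall s w, 0 <= f s w) ->
  Ex P (tint f a t) = (\int[leb]_(s in `[a, t]) Ex P (f s))%E.
Proof.
move=> a0 pf f0.
pose F (p : measurableTypeR R * T) :=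
  ((f (pos_time p.1) p.2 * \1_(`[a, t]) (p.1 : R)) : R)%:E.
rewrite /Ex; transitivity (\int[P]_w \int[leb]_s F (s, w))%E.
  apply: eq_integral => w _; rewrite tint_ge0E// integral_mkcond.
  apply: eq_integral => s _; rewrite /F/= /patch indicE mem_setE.
  case: ifPn => [|]; rewrite ?mulr0//= in_itv/= => /andP[as_ _].
  by rewrite mulr1 /pos_time max_r// (le_trans a0).
rewrite -(@fubini_tonelli _ _ _ _ _ leb P F); last 2 first.
- apply/measurable_EFinP/measurable_funM; first exact: proc_joint.
  apply: measurableT_comp => //; exact: measurable_indic.
- by move=> p; rewrite lee_fin mulr_ge0// indicE ler0n.
rewrite [RHS]integral_mkcond; apply: eq_integral => s _.
rewrite /patch; case: ifPn => [|sat].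
  rewrite mem_setE in_itv/= => /andP[as_ st].
  apply: eq_integral => w _; rewrite /F/= indicE mem_setE in_itv/= as_ st mulr1.
  by rewrite /pos_time max_r// (le_trans a0).
by apply: integral0_eq => w _; rewrite /F/= indicE (negbTE sat) mulr0.
Qed.

End processes.

(** * Weighted Cauchy-Schwarz inequalities for time integrals *)

Section exponential_weight.
Context {R : realType} {d} {T : measurableType d}.
Implicit Types (f g : R -> T -> R).

Lemma proc_expR (c : R) : proc (fun s (_ : T) => expR (c * s)).
Proof.
apply: proc_time => [|t].
  move=> s; apply: (@continuous_comp _ _ _ (fun s => c * s) expR); last exact: continuous_expR.
  by apply: mulrl_continuous.
exists (expR (`|c| * `|t|)) => s /andP[s0 st].
rewrite ger0_norm ?expR_ge0// ler_expR (le_trans (ler_norm _))// normrM ler_wpM2l//.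
by rewrite ger0_norm// (le_trans st)// ler_norm.
Qed.

Lemma tint_expR (c t : R) (w : T) : 0 < c -> 0 <= t ->
  tint (fun s _ => expR (c * s)) 0 t w = (expR (c * t) - 1) / c.
Proof.
move=> c0; rewrite le_eqVlt => /predU1P[<-|t0].
  by rewrite /tint set_itv1 Rintegral_set1 mulr0 expR0 subrr mul0r.
have dF (x : R) : is_derive x (1:R) (expR \o ( *%R c)) (expR (c * x) * c).
  apply: is_derive1_comp.
  have := is_deriveZ (f := id) c (is_derive_id x (1 : R)).
  by rewrite /GRing.scale/= mulr1.
have dF1 (x : R) : derivable (expR \o ( *%R c)) x 1 by case: (dF x).
have cF : continuous (expR \o ( *%R c)).
  by move=> x; apply: differentiable_continuous; apply/derivable1_diffP.
have cf : {within `[0, t], continuous (fun s => expR (c * s) * c)}.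
  apply: continuous_subspaceT => x; apply: cvgM; last exact: cvg_cst.
  exact: cF.
have := continuous_FTC2 t0 cf (F := expR \o ( *%R c)).
rewrite /= mulr0 expR0 => h.
have pe : proc (fun s (_ : T) => expR (c * s)) := proc_expR c.
have E : tint (fun s (_ : T) => c * expR (c * s)) 0 t w = expR (c * t) - 1.
  rewrite /tint; under eq_Rintegral do rewrite mulrC.
  rewrite /Rintegral h//.
  - split => [x _| |]; first exact: dF1.
    + by apply: cvg_at_right_filter; exact: cF.
    + by apply: cvg_at_left_filter; exact: cF.
  - by move=> x _; rewrite derive1E; case: (dF x).
by rewrite -E tintZ// mulrAC mulfV ?mul1r// gt_eqF.
Qed.

Lemma tint_expR_le (c t : R) (w : T) : 0 < c -> 0 <= t ->
  tint (fun s _ => expR (c * s)) 0 t w <= expR (c * t) / c.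
Proof.
by move=> c0 t0; rewrite tint_expR// ler_pM2r ?invr_gt0// gerBl.
Qed.

(* Cauchy-Schwarz with weight [g], from the positivity of
   [int (f - x g)^2 / g] at [x = int f / int g]. *)
Lemma sqr_tint_le f g (a t : R) w : 0 <= a -> proc f -> proc g ->
  proc (fun s w => (g s w)^-1) -> (forall s w, 0 < g s w) -> 0 < tint g a t w ->
  tint f a t w ^+ 2 <= tint g a t w * tint (fun s w => f s w ^+ 2 * (g s w)^-1) a t w.
Proof.
move=> a0 pf pg pi g0 A0.
have ph : proc (fun s w => f s w ^+ 2 * (g s w)^-1) by exact: procM (procX _ pf) pi.
set A := tint g a t w; set C := tint f a t w; set D := tint _ a t w.
pose x := C / A.
have : 0 <= tint (fun s w => f s w ^+ 2 * (g s w)^-1 + (- (2 * x) * f s w + x ^+ 2 * g s w)) a t w.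
  apply: tint_ge0 => s _; have gn0 := g0 s w.
  rewrite [leRHS](_ : _ = (f s w - x * g s w) ^+ 2 / g s w); last by field; rewrite gt_eqF.
  by rewrite divr_ge0 ?sqr_ge0// ltW.
have p1 : proc (fun s w => - (2 * x) * f s w) by apply: procM => //; apply: proc_const.
have p2 : proc (fun s w => x ^+ 2 * g s w) by apply: procM => //; apply: proc_const.
rewrite tintD//; last exact: procD.
rewrite tintD// !tintZ// -/A -/C -/D => h.
have : 0 <= A * (D - C ^+ 2 / A).
  apply: mulr_ge0; first exact: ltW.
  apply: le_trans h _; apply: eq_leW; rewrite /x; field.
  by rewrite gt_eqF.
by rewrite mulrBr mulrCA mulfV ?gt_eqF// mulr1 subr_ge0.
Qed.

Lemma tint_point f a w : tint f a a w = 0.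
Proof. by rewrite /tint set_itv1 Rintegral_set1. Qed.

Lemma tint_expR_gt0 (c t : R) (w : T) : 0 < c -> 0 < t ->
  0 < tint (fun s _ => expR (c * s)) 0 t w.
Proof.
by move=> c0 t0; rewrite tint_expR// ?ltW// divr_gt0// subr_gt0 -expR0 ltr_expR mulr_gt0.
Qed.

(** With the weight [expR (c * s)], Cauchy-Schwarz costs [1 / c] instead of the length of the
    interval: a large rate makes the drift term small in the Gronwall arguments. *)
Lemma sqr_tint_expR f (c t : R) w : 0 < c -> 0 <= t -> proc f ->
  tint f 0 t w ^+ 2 <= expR (c * t) / c * tint (fun s w => f s w ^+ 2 * expR (- c * s)) 0 t w.
Proof.
move=> c0; rewrite le_eqVlt => /predU1P[<- _|t0 pf].
  by rewrite !tint_point expr0n mulr0.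
have pe : proc (fun s (_ : T) => expR (c * s)) := proc_expR c.
have pe' : proc (fun s (_ : T) => expR (- c * s)) := proc_expR (- c).
have eE : (fun s (_ : T) => (expR (c * s))^-1) = (fun s _ => expR (- c * s)).
  by apply/funext => s; apply/funext => _; rewrite mulNr expRN.
have := @sqr_tint_le f (fun s _ => expR (c * s)) 0 t w (lexx 0) pf pe.
rewrite eE => /(_ pe' (fun s _ => expR_gt0 _) (tint_expR_gt0 w c0 t0)) /le_trans; apply.
have -> : tint (fun s w => f s w ^+ 2 * (expR (c * s))^-1) 0 t w =
    tint (fun s w => f s w ^+ 2 * expR (- c * s)) 0 t w.
  by apply: tint_eq => s _; rewrite mulNr expRN.
apply: ler_wpM2r; last by apply: tint_expR_le => //; exact: ltW.
by apply: tint_ge0 => s _ /=; nneg.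
Qed.

Lemma sqr_tint f (a t : R) w : 0 <= a -> a <= t -> proc f ->
  tint f a t w ^+ 2 <= (t - a) * tint (fun s w => f s w ^+ 2) a t w.
Proof.
move=> a0; rewrite le_eqVlt => /predU1P[<- _|at_ pf].
  by rewrite !tint_point expr0n mulr0.
have p1 : proc (fun (_ : R) (_ : T) => 1 : R) by exact: proc_const.
have p1' : proc (fun (_ : R) (_ : T) => (1 : R)^-1) by exact: proc_const.
have := @sqr_tint_le f (fun _ _ => 1) a t w a0 pf p1 p1' (fun s _ => ltr01).
rewrite (tint_cst 1 w (ltW at_)) mul1r subr_gt0 => /(_ at_)/le_trans; apply.
by rewrite (@tint_eq _ _ _ _ (fun s w => f s w ^+ 2))// => s _; rewrite invr1 mulr1.
Qed.

Lemma Ex_tint_le (P : probability T R) f g (a t : R) w : 0 <= a -> proc f -> (forall s w, 0 <= f s w) ->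
  proc g -> (forall s, a <= s <= t -> (Ex P (f s) <= (g s w)%:E)%E) ->
  (Ex P (tint f a t) <= (tint g a t w)%:E)%E.
Proof.
move=> a0 pf f0 pg fg; rewrite Ex_tint// tint_ge0E//.
apply: ge0_le_integral => //.
- by move=> s _; exact: Ex_ge0.
- apply: (@eq_measurable_fun _ _ (measurableTypeR R) (\bar R) _ (fun s => \int[P]_w (f (pos_time s) w)%:E)%E).
    move=> s; rewrite inE/= in_itv/= => /andP[as_ _].
    by rewrite /pos_time max_r// (le_trans a0).
  apply: measurable_funTS.
  apply: (@measurable_fun_fubini_tonelli_F _ _ _ _ _ P (fun p => (f (pos_time p.1) p.2)%:E)).
    by apply/measurable_EFinP; exact: proc_joint.
  by move=> p; rewrite lee_fin.
- by apply/measurable_EFinP; exact: proc_measurable_itv.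
Qed.

Lemma Ex_tint_cst (P : probability T R) f (a t c : R) : 0 <= a -> a <= t -> proc f ->
  (forall s w, 0 <= f s w) -> (forall s, a <= s <= t -> (Ex P (f s) <= c%:E)%E) ->
  (Ex P (tint f a t) <= (c * (t - a))%:E)%E.
Proof.
move=> a0 at_ pf f0 fc.
rewrite -(@tint_cst _ _ T c a t point at_); apply: Ex_tint_le => //.
exact: (@proc_const _ _ _ (fun=> c)).
Qed.

Lemma Ex_tint_expR (P : probability T R) f (t k c : R) : 0 <= t -> 0 < c -> 0 <= k -> proc f ->
  (forall s w, 0 <= f s w) -> (forall s, 0 <= s <= t -> (Ex P (f s) <= (k * expR (c * s))%:E)%E) ->
  (Ex P (tint f 0 t) <= (k * (expR (c * t) / c))%:E)%E.
Proof.
move=> t0 c0 k0 pf f0 fc.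
have pe : proc (fun s (_ : T) => expR (c * s)) := proc_expR c.
have pk : proc (fun s (_ : T) => k * expR (c * s)).
  by apply: procM => //; exact: (@proc_const _ _ _ (fun=> k)).
have h := @Ex_tint_le P f _ 0 t point (lexx 0) pf f0 pk fc.
apply: (le_trans h).
rewrite lee_fin tintZ// ler_wpM2l//; exact: tint_expR_le.
Qed.

End exponential_weight.

(** * Left Riemann sums *)

Section riemann.
Context {R : realType} {d} {T : measurableType d}.
Implicit Types (f g : R -> T -> R).

Lemma indic_ocE (u v s : R) : \1_(`]u, v]) s = ((u < s) && (s <= v))%:R :> R.
Proof. by rewrite indicE mem_setE in_itv. Qed.

Lemma proc_indic_oc (u v : R) : proc (fun s (_ : T) => \1_(`]u, v]) s : R).
Proof.
split=> [s _|w s x s0 xs cx|w t]; first exact: measurable_cst.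
- rewrite indic_ocE; have [us|su] := ltP u s; last first.
    apply: cvg_near_cst; apply: nearW => k; rewrite indic_ocE.
    by rewrite ltNge (le_trans _ su)//; case/andP: (xs k).
  have [sv|vs] := leP s v.
    apply: cvg_near_cst; near=> k; rewrite indic_ocE.
    have -> : x k <= v by apply: le_trans sv; case/andP: (xs k).
    by have -> : u < x k by near: k; exact: cvgr_gt cx _ us.
  apply: cvg_near_cst; near=> k; rewrite indic_ocE.
  suff : v < x k by rewrite ltNge => /negbTE ->; rewrite andbF.
  by near: k; exact: cvgr_gt cx _ vs.
- by exists 1 => s _; rewrite indic_ocE; case: (_ && _); rewrite ?normr1 ?normr0.
Unshelve. all: by end_near. Qed.

Lemma tint_indic_oc (a t u v : R) w : a <= u -> u <= v -> v <= t ->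
  tint (fun s (_ : T) => \1_(`]u, v]) s : R) a t w = v - u.
Proof.
move=> au uv vt; rewrite /tint /Rintegral integral_indic//=.
rewrite setIidl; last first.
  move=> s /=; rewrite !in_itv/= => /andP[us sv].
  by rewrite (le_trans au (ltW us)) (le_trans sv).
rewrite lebesgue_measure_itv/= lte_fin; move: uv; rewrite le_eqVlt => /predU1P[->|->//].
by rewrite ltxx subrr.
Qed.

Lemma proc_sum (n : nat) (f : nat -> R -> T -> R) : (forall i, proc (f i)) ->
  proc (fun s w => \sum_(i < n) f i s w).
Proof.
move=> pf; elim: n => [|n ih].
  rewrite (_ : (fun s w => _) = fun _ _ => 0); first exact: (@proc_const _ _ _ (fun=> 0)).
  by apply/funext => s; apply/funext => w; rewrite big_ord0.
rewrite (_ : (fun s w => _) = fun s w => \sum_(i < n) f i s w + f n s w); first exact: procD.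
by apply/funext => s; apply/funext => w; rewrite big_ord_recr.
Qed.

Lemma tint_sum (n : nat) (f : nat -> R -> T -> R) a t w : 0 <= a -> (forall i, proc (f i)) ->
  tint (fun s w => \sum_(i < n) f i s w) a t w = \sum_(i < n) tint (f i) a t w.
Proof.
move=> a0 pf; elim: n => [|n ih].
  rewrite big_ord0 (@tint_eq _ _ _ _ (fun _ _ => 0)); last by move=> s _; rewrite big_ord0.
  by rewrite /tint /Rintegral integral0.
rewrite big_ord_recr/= -ih -tintD//; last exact: proc_sum.
by apply: tint_eq => s _; rewrite big_ord_recr.
Qed.

Definition grid (a t : R) k (i : nat) : R := a + i%:R * ((t - a) / 2 ^+ k).

Lemma grid_le (a t : R) k i j : a <= t -> (i <= j)%N -> grid a t k i <= grid a t k j.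
Proof.
move=> at_ ij; rewrite /grid lerD2l ler_wpM2r ?ler_nat//.
by rewrite divr_ge0 ?subr_ge0// exprn_ge0.
Qed.

Lemma grid0 (a t : R) k : grid a t k 0 = a. Proof. by rewrite /grid mul0r addr0. Qed.

Lemma grid_end (a t : R) k : grid a t k (2 ^ k) = t.
Proof.
by rewrite /grid natrX mulrCA mulfV ?expf_neq0// mulr1 addrC subrK.
Qed.

Lemma gridS (a t : R) k i : grid a t k i.+1 - grid a t k i = (t - a) / 2 ^+ k.
Proof. by rewrite /grid -natr1; ring. Qed.

Lemma gridE (a t : R) k i : grid a t k i = a + (t - a) * (i%:R / 2 ^+ k).
Proof. by rewrite /grid; ring. Qed.

(** The sums are integrals of step functions [F k] that take the value of [f] at the left end of
    each cell. They converge pointwise by left continuity, and local boundedness of the path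
    provides domination. *)
Lemma riemann_left f (a t : R) w : 0 <= a -> a <= t -> proc f ->
  \sum_(i < 2 ^ k) f (grid a t k i) w * ((t - a) / 2 ^+ k) @[k --> \oo] --> tint f a t w.
Proof.
move=> a0 at_ pf; case: (pf) => _ lf bf.
pose F k s (_ : T) := \sum_(i < 2 ^ k) f (grid a t k i) w * \1_(`]grid a t k i, grid a t k i.+1]) s.
have pF1 k i : proc (fun s (_ : T) => f (grid a t k i) w * (\1_(`]grid a t k i, grid a t k i.+1]) s : R)).
  by apply: procM; [exact: (@proc_const _ _ _ (fun=> f _ w))|exact: proc_indic_oc].
have pF k : proc (F k).
  exact: (@proc_sum _ (fun i s _ => f (grid a t k i) w * (\1_(`]grid a t k i, grid a t k i.+1]) s : R)) (pF1 k)).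
have FE k : tint (F k) a t w = \sum_(i < 2 ^ k) f (grid a t k i) w * ((t - a) / 2 ^+ k).
  rewrite (@tint_sum _ (fun i s (_ : T) => f (grid a t k i) w * (\1_(`]grid a t k i, grid a t k i.+1]) s : R)))//.
  apply: eq_bigr => i _; rewrite tintZ//; last exact: proc_indic_oc.
  rewrite tint_indic_oc ?gridS//.
  - by rewrite -{1}(grid0 a t k); exact: grid_le.
  - exact: grid_le.
  - by rewrite -{2}(grid_end a t k); exact: grid_le.
have loc k s : a < s <= t -> exists2 i : 'I_(2 ^ k), grid a t k i < s <= grid a t k i.+1 & F k s w = f (grid a t k i) w.
  move=> /andP[as_ st].
  have ex : exists i, s <= grid a t k i.+1.
    exists (2 ^ k).-1; rewrite prednK ?expn_gt0// grid_end//.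
  case: (ex_minnP ex) => i si imin.
  have ik : (i < 2 ^ k)%N.
    by have := imin (2 ^ k).-1; rewrite prednK ?expn_gt0// grid_end => /(_ st); rewrite -ltnS prednK ?expn_gt0.
  have is_ : grid a t k i < s.
    case: i si imin ik => [|i] si imin ik; first by rewrite grid0.
    by rewrite ltNge; apply/negP => /imin; rewrite ltnn.
  exists (Ordinal ik) => /=; first by rewrite is_.
  rewrite /F (bigD1 (Ordinal ik))//= indic_ocE is_ si mulr1 big1 ?addr0// => j ji.
  rewrite indic_ocE; case: (ltngtP j i) ji => [ji|ij|ji].
  - move=> _; have h : grid a t k j.+1 < s by apply: le_lt_trans is_; exact: grid_le.
    by rewrite [s <= _]leNgt h andbF mulr0.
  - move=> _; have h : s <= grid a t k j by apply: (le_trans si); exact: grid_le.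
    by rewrite ltNge h mulr0.
  - by move=> /eqP; case; apply/val_inj.
have st_conv s : a < s <= t -> F k s w @[k --> \oo] --> f s w.
  move=> ast; have s0 : 0 <= s by case/andP: ast => /ltW/(le_trans a0).
  pose u k := grid a t k (sval (cid2 (loc k s ast))).
  have uP k : u k < s <= u k + (t - a) / 2 ^+ k /\ F k s w = f (u k) w.
    rewrite /u; case: (cid2 _) => i /= h1 h2; split => //.
    by rewrite -(gridS a t k i) addrC subrK.
  rewrite (_ : (fun k => F k s w) = fun k => f (u k) w); last first.
    by apply/funext => k; case: (uP k).
  apply: lf => //.
    move=> k; have [/andP[us _] _] := uP k; rewrite (ltW us) andbT.
    by rewrite /u /grid addr_ge0// mulr_ge0// divr_ge0 ?subr_ge0// exprn_ge0.
  apply: (@squeeze_cvgr _ _ _ _ (fun k => s - (t - a) * (2 ^+ k)^-1) (fun=> s)).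
  - apply: nearW => k; have [/andP[us su] _] := uP k.
    by rewrite (ltW us) andbT lerBlDr.
  - rewrite -[X in _ --> X]subr0 -(mulr0 (t - a)).
    by apply: cvgB; [exact: cvg_cst|apply: cvgM; [exact: cvg_cst|exact: cvg_inv_pow2]].
  - exact: cvg_cst.
under eq_fun do rewrite -FE.
have [c fc] := bf w t.
(* The step functions vanish at [a], so pointwise convergence holds only on the half-open interval,
   which has the same integral. *)
have sub : (`]a, t] : set R) `<=` `[a, t].
  by move=> s /=; rewrite !in_itv/= => /andP[/ltW -> ->].
have mo g : proc g -> measurable_fun (`]a, t] : set (measurableTypeR R)) (fun s => g s w).
  by move=> pg; apply: (@measurable_funS _ _ (measurableTypeR R) R `[a, t]) => //; exact: proc_measurable_itv.
have tintE g : proc g -> (tint g a t w)%:E = (\int[lebesgue_measure]_(s in `]a, t]) (g s w)%:E)%E.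
  move=> pg; rewrite tint_ge0E// integral_itv_obnd_cbnd//.
  by apply/measurable_EFinP; exact: mo.
suff : (tint (F k) a t w)%:E @[k --> \oo] --> (tint f a t w)%:E by move/fine_cvgP => -[].
rewrite tintE//; under eq_fun do rewrite tintE//.
have := @dominated_convergence _ _ R lebesgue_measure `]a, t] _ (fun k s => (F k s w)%:E) (fun s => (f s w)%:E) (cst c%:E).
case=> //.
- by move=> k; apply/measurable_EFinP; exact: mo.
- by apply/measurable_EFinP; exact: mo.
- apply: aeW => s; rewrite /= in_itv/= => ast.
  by apply: cvg_EFin; [exact: nearW|exact: st_conv].
- apply/integrableP; split => //.
  rewrite integral_cst//= lebesgue_measure_itv/=; case: ifP => _; last by rewrite mule0.
  by rewrite -EFinD -EFinM ltry.
- apply: aeW => s k; rewrite /= in_itv/= => ast.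
  have [i /andP[i1 i2] ->] := loc k s ast; rewrite lee_fin fc//.
  rewrite -{1}(_ : 0 + 0 = 0) ?addr0// /grid addr_ge0 ?mulr_ge0 ?divr_ge0 ?subr_ge0 ?exprn_ge0//=.
  by case/andP: ast => _; apply: le_trans; exact: ltW.
Qed.

End riemann.

(** * Suprema over time intervals *)

Section suprema.
Context {R : realType} {d} {T : measurableType d}.
Implicit Types (f g : R -> T -> R).

Definition esup f (a t : R) (w : T) : \bar R := ereal_sup [set (f s w)%:E | s in `[a, t]].

(** Every time of the interval is a limit from the left of dyadic ones, so the supremum is over a
    countable set; this is what makes it measurable. *)
Lemma esup_dyadic f a t w : 0 <= a -> a <= t -> leftcont f ->
  esup f a t w = ereal_sup (range (fun n => (f (a + (t - a) * dyadic n) w)%:E)).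
Proof.
move=> a0 at_ lf; apply/eqP; rewrite eq_le; apply/andP; split; last first.
  apply: ereal_sup_le => _ [n _ <-]; exists (a + (t - a) * dyadic n) => //.
  rewrite /= in_itv/=; have /andP[q0 q1] := @dyadic_itv R n.
  have ta0 : 0 <= t - a by rewrite subr_ge0.
  by rewrite lerDl mulr_ge0//= -lerBrDl ler_piMr.
apply: ge_ereal_sup => _ [s /= + <-]; rewrite in_itv/= => /andP[as_ st].
have [ta|ta] := eqVneq t a.
  have -> : s = a by apply/eqP; rewrite eq_le as_ -ta st.
  apply: ereal_sup_ubound; exists 0%N => //.
  by rewrite ta subrr mul0r addr0.
have ta0 : 0 < t - a by rewrite subr_gt0 lt_neqAle eq_sym ta.
pose x := (s - a) / (t - a).
have x0 : 0 <= x by apply: divr_ge0; [rewrite subr_ge0|exact: ltW].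
have x1 : x <= 1 by rewrite ler_pdivrMr// mul1r lerD2r.
have sE : s = a + (t - a) * x by rewrite /x mulrCA mulfV ?gt_eqF// mulr1 addrC subrK.
pose u k := a + (t - a) * dyadic_floor k x.
have us k : 0 <= u k <= s.
  have /andP[q0 q1] := dyadic_floor_itv k x0.
  rewrite sE /u lerD2l ler_pM2l// q1 andbT.
  by apply: addr_ge0 => //; apply: mulr_ge0 => //; exact: ltW.
have cu : u @ \oo --> a + (t - a) * x.
  apply: cvgD; first exact: cvg_cst.
  by apply: cvgM; [exact: cvg_cst|exact: cvg_dyadic_floor].
rewrite -sE in cu.
have s0 : 0 <= s by exact: le_trans as_.
have h : (f (u k) w)%:E @[k --> \oo] --> (f s w)%:E.
  by apply: cvg_EFin; [exact: nearW|exact: lf].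
rewrite -(cvg_lim _ h)//; apply: lime_le; first by apply/cvg_ex; eexists; exact: h.
apply: nearW => k; apply: ereal_sup_ubound.
by have [n nE] := dyadic_floorE k x0 x1; exists n => //; rewrite /u nE.
Qed.

Lemma measurable_esup f a t : 0 <= a -> a <= t -> proc f ->
  meas (esup f a t).
Proof.
move=> a0 at_ [mf lf _].
rewrite (_ : esup f a t = fun w => esups (fun n => (f (a + (t - a) * dyadic n) w)%:E) 0); last first.
  apply/funext => w; rewrite esup_dyadic// /esups/=; congr ereal_sup.
  by rewrite /sdrop; congr (_ @` _); apply/seteqP; split.
apply: measurable_fun_esups => n; apply/measurable_EFinP; apply: mf.
have /andP[q0 q1] := @dyadic_itv R n.
by rewrite addr_ge0// mulr_ge0// subr_ge0.
Qed.

Lemma esup_ubound f a t w s : a <= s <= t -> ((f s w)%:E <= esup f a t w)%E.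
Proof. by move=> st; apply: ereal_sup_ubound; exists s => //; rewrite /= in_itv. Qed.

Lemma esup_ge0 f a t w : a <= t -> (forall s, 0 <= f s w) -> (0 <= esup f a t w)%E.
Proof.
move=> at_ f0; apply: le_trans (esup_ubound f w (s := a) _); last by rewrite lexx.
by rewrite lee_fin.
Qed.

Lemma esup_le f a t w (c : \bar R) : (forall s, a <= s <= t -> ((f s w)%:E <= c)%E) ->
  (esup f a t w <= c)%E.
Proof. by move=> h; apply: ge_ereal_sup => _ [s /= + <-]; rewrite in_itv; exact: h. Qed.

End suprema.

(** * Maximal inequalities for Ito integrals *)

Lemma cvgX {R : realType} (u : nat -> R) (l : R) n : u k @[k --> \oo] --> l ->
  u k ^+ n @[k --> \oo] --> l ^+ n.
Proof.
move=> ul; elim: n => [|n ih].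
  by under eq_fun do rewrite expr0; rewrite expr0; exact: cvg_cst.
by under eq_fun do rewrite exprS; rewrite exprS; exact: cvgM.
Qed.

Lemma Ex_cst {d} {T : measurableType d} {R : realType} (P : probability T R) (K : R) :
  Ex P (fun=> K) = K%:E.
Proof.
by rewrite /Ex integral_cst// -[RHS]mule1; congr (_ * _)%E; exact: probability_setT.
Qed.

Section fatou.
Context {R : realType}.

(** Testing with reals [y < x] treats finite and infinite [x] alike, and suits a supremum: such a
    [y] is already exceeded at a single time. *)
Lemma le_limn_einf (x : \bar R) (v : nat -> \bar R) :
  (forall y : R, (y%:E < x)%E -> \forall k \near \oo, (y%:E <= v k)%E) ->
  (x <= limn_einf v)%E.
Proof.
move=> h.
have H y : (y%:E < x)%E -> (y%:E <= limn_einf v)%E.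
  move=> /h [N _ hN]; rewrite limn_einf_lim; apply: lime_ge; first exact: is_cvg_einfs.
  exists N => // n /= Nn; apply: le_ereal_inf_tmp => _ [k /= nk <-].
  by apply: hN => /=; exact: leq_trans Nn nk.
case: x h H => [r| |] h H; last exact: leNye.
  apply/lee_subgt0Pr => e e0; rewrite -EFinB; apply: H.
  by rewrite lte_fin ltrBlDr ltrDl.
suff -> : limn_einf v = +oo%E by [].
by apply/eqyP => A A0; apply: H; rewrite ltry.
Qed.

(** The form of Fatou's lemma behind most passages to the limit below: only a pathwise lower limit
    has to be controlled, and no dominating function is involved. *)
Lemma int_fatou {d} {T : measurableType d} (P : {measure set T -> \bar R}) (f : T -> \bar R)
  (g : nat -> T -> \bar R) (u : nat -> \bar R) (l : \bar R) :
  meas f -> (forall w, (0 <= f w)%E) ->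
  (forall k, meas (g k)) -> (forall k w, (0 <= g k w)%E) ->
  {ae P, forall w, (f w <= limn_einf (g^~ w))%E} ->
  (forall k, (\int[P]_w g k w <= u k)%E) -> u @ \oo --> l ->
  (\int[P]_w f w <= l)%E.
Proof.
move=> mf f0 mg g0 fg gu ul.
have ml : meas (fun w => limn_einf (g^~ w)).
  rewrite (_ : (fun w => _) = fun w => (- limn_esup (fun k => - g k w))%E)//.
  by apply: measurableT_comp => //; apply: measurable_fun_limn_esup => k; exact: measurableT_comp.
have l0 w : (0 <= limn_einf (g^~ w))%E.
  rewrite limn_einf_lim; apply: lime_ge.
    exact: is_cvg_einfs.
  apply: nearW => n; apply: le_ereal_inf_tmp => _ [k _ <-]; exact: g0.
apply: (@le_trans _ _ (\int[P]_w limn_einf (g^~ w))%E).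
  apply: ae_ge0_le_integral => //.
  by apply: filterS fg => w h _.
apply: (le_trans (fatou P measurableT mg (fun k w _ => g0 k w))).
have [E1 _] := cvg_limn_einf_sup ul; rewrite -E1.
rewrite !limn_einf_lim; apply: lee_lim; [exact: is_cvg_einfs..|].
apply: nearW => n; apply: le_ereal_inf_tmp => _ [k nk <-].
by apply: le_trans (gu k); apply: ereal_inf_lbound; exists k.
Qed.

End fatou.

(** * Step integrals as limits along dyadic grids *)

Section prefix_sums.
Context {R : realType}.
Variables (s : nat -> R) (beta : R -> R) (v : R).
Hypothesis smono : forall i j, (i <= j)%N -> s i <= s j.

(** The indices with [s i <= v] form an initial segment, so the sum telescopes up to the first time
    beyond [v], or up to the last time if there is none. *)
Lemma prefix_sum n : exists m, [/\ (m <= n)%N,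
  \sum_(i < n) (s i <= v)%R%:R * (beta (s i.+1) - beta (s i)) = beta (s m) - beta (s 0%N),
  forall i, (i < m)%N -> s i <= v & (m < n)%N -> v < s m].
Proof.
elim: n => [|n [m [mn E im mv]]]; first by exists 0%N; rewrite big_ord0 subrr.
rewrite big_ord_recr/= E; have [sv|vs] := leP (s n) v.
  have mE : m = n.
    apply/eqP; rewrite eqn_leq mn leqNgt; apply/negP => nm.
    by have := mv nm; rewrite ltNge (le_trans (smono mn) sv).
  exists n.+1; split => //; first by rewrite mE mul1r addrC addrA subrK.
  - by move=> i; rewrite ltnS => ni; exact: le_trans (smono ni) sv.
  - by rewrite ltnn.
exists m; split => //; first exact: leqW.
  by rewrite mul0r addr0.
by rewrite ltnS leq_eqVlt => /predU1P[->|].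
Qed.

End prefix_sums.

(** A dyadic point is a node of all sufficiently fine grids; at coarser levels the node 0 serves as
    a placeholder. Codes beyond the interval give its right end, the last node of every grid. *)
Lemma dyadic_grid {R : realType} (a t : R) (n : nat) : exists m : nat -> nat,
  (forall k, (m k <= 2 ^ k)%N) /\
  \forall k \near \oo, grid a t k (m k) = a + (t - a) * dyadic n.
Proof.
rewrite /dyadic; case: (odflt _ _) => k0 i.
have [ik|ki] := leqP i (2 ^ k0); last first.
  exists (fun k => 2 ^ k)%N; split => //; apply: nearW => k.
  rewrite grid_end min_l ?mulr1 1?addrC ?subrK//.
  by rewrite ler_pdivlMr ?exprn_gt0// mul1r -natrX ler_nat ltnW.
exists (fun k => if (k0 <= k)%N then i * 2 ^ (k - k0) else 0)%N; split.
  move=> k; case: ifP => // kk.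
  by rewrite -{2}(subnKC kk) expnD leq_mul2r ik orbT.
exists k0 => // k /= kk; rewrite kk gridE min_r; last first.
  by rewrite ler_pdivrMr ?exprn_gt0// mul1r -natrX ler_nat.
congr (_ + _ * _); rewrite natrM natrX -{2}(subnKC kk) exprD invfM mulrACA.
by rewrite mulfV ?mulr1// expf_neq0.
Qed.

Section step_riemann.
Context {R : realType}.
Variables (beta : R -> R) (a t : R).
Hypotheses (cb : {within `[0, +oo[, continuous beta}) (a0 : 0 <= a) (at_ : a <= t).

(** The telescoped sum ends at a node within one mesh of [min v x], and [beta] is continuous. If [v]
    lies before the interval, both sides vanish. *)
Lemma cvg_prefix_sum (v x : R) (n : nat -> nat) : a <= x ->
  (\forall k \near \oo, grid a t k (n k) = x) ->
  \sum_(i < n k) (grid a t k i <= v)%R%:R * (beta (grid a t k i.+1) - beta (grid a t k i))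
    @[k --> \oo] --> beta (Num.min v x) - beta (Num.min v a).
Proof.
move=> ax nx.
have gm k i j : (i <= j)%N -> grid a t k i <= grid a t k j by exact: grid_le.
pose m k := sval (cid (prefix_sum beta v (gm k) (n k))).
have mP k : [/\ (m k <= n k)%N, \sum_(i < n k) (grid a t k i <= v)%R%:R * (beta (grid a t k i.+1) - beta (grid a t k i)) = beta (grid a t k (m k)) - beta (grid a t k 0%N),
  forall i, (i < m k)%N -> grid a t k i <= v & (m k < n k)%N -> v < grid a t k (m k)].
  by rewrite /m; case: (cid _).
rewrite (_ : (fun k => _) = fun k => beta (grid a t k (m k)) - beta a); last first.
  by apply/funext => k; have [_ -> _ _] := mP k; rewrite grid0.
have [av|va] := leP a v; last first.
  rewrite (min_l (ltW (lt_le_trans va ax))) subrr.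
  apply: cvg_near_cst; apply: nearW => k; have [_ _ mv _] := mP k.
  case: (m k) mv => [|j] mv; first by rewrite grid0 subrr.
  by have := mv 0%N isT; rewrite grid0 leNgt va.
apply: cvgB; last exact: cvg_cst.
have [vx|xv] := ltP v x; last first.
  apply: cvg_near_cst; near=> k.
  have nk : grid a t k (n k) = x by near: k.
  have [mn _ _ mv] := mP k; move: mn; rewrite leq_eqVlt => /predU1P[->|/mv]; first by rewrite nk.
  move=> h; have := le_lt_trans xv h; rewrite -nk ltNge gm//.
  by case: (mP k).
apply: (cvg_within_seq cb) => /=.
- by rewrite in_itv/= andbT (le_trans a0 av).
- move=> k; rewrite /= in_itv/= andbT (le_trans a0)// -{1}(grid0 a t k); exact: grid_le.
apply: (@squeeze_cvgr _ _ _ _ (fun=> v) (fun k => v + (t - a) * (2 ^+ k)^-1)).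
- near=> k; have nk : grid a t k (n k) = x by near: k.
  have [mn _ im mv] := mP k.
  have vm : v < grid a t k (m k).
    by move: mn; rewrite leq_eqVlt => /predU1P[->|/mv//]; rewrite nk.
  rewrite (ltW vm)/=; case: (m k) im vm => [|j] im vm.
    by move: vm; rewrite grid0 ltNge av.
  by rewrite -[grid _ _ _ _](subrK (grid a t k j)) gridS addrC lerD2r im.
- exact: cvg_cst.
- rewrite -[X in _ --> X]addr0 -(mulr0 (t - a)).
  by apply: cvgD; [exact: cvg_cst|apply: cvgM; [exact: cvg_cst|exact: cvg_inv_pow2]].
Unshelve. all: by end_near. Qed.

End step_riemann.

Section step_maximal.
Context {R : realType} {d} {Om : measurableType d} (P : probability Om R).
Variables (F : R -> set (set Om)) (B : R -> Om -> R).
Hypotheses (cF : complete_filtration P F) (BM : brownian_motion P F B).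

Lemma brownian_continuous : continuous_paths B.
Proof. by case: BM => _ /(_ ord0). Qed.

Lemma proc_stopped_time (f : R -> Om -> R) (u : R) : (forall s, 0 <= s -> meas (f s)) ->
  continuous_paths f -> 0 <= u -> proc (fun s w => f (Num.min u s) w).
Proof.
move=> mf cf u0; have [_ _ bf] := proc_continuous mf cf.
have mu0 s : 0 <= s -> 0 <= Num.min u s by move=> s0; rewrite le_min u0.
split.
- by move=> s s0; exact: mf (mu0 s s0).
- move=> w s x s0 xs cx; apply: (cvg_within_seq (cf w)) => /=.
  + by rewrite in_itv/= mu0.
  + by move=> k; rewrite in_itv/= mu0//; case/andP: (xs k).
  + by apply: (@continuous_cvg _ _ _ _ _ _ (fun x => Num.min u x)) => //; apply: continuous_min => //; exact: cvg_cst.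
- move=> w t; have [c hc] := bf w t; exists c => s /andP[s0 st].
  by apply: hc; rewrite mu0//= ge_min st orbT.
Qed.

Lemma proc_step_integral phi : simple_process F phi -> proc (step_integral B phi).
Proof.
move=> [t0 tm mc _].
have tk0 k : 0 <= step_time phi k by apply: le_trans t0 (tm 0%N k _).
rewrite (_ : step_integral B phi = fun s w => \sum_(k < step_size phi)
    (step_coef phi k w * (B (Num.min (step_time phi k.+1) s) w - B (Num.min (step_time phi k) s) w)))//.
apply: (@proc_sum _ _ _ _ (fun k s w => step_coef phi k w * (B (Num.min (step_time phi k.+1) s) w - B (Num.min (step_time phi k) s) w))) => k.
apply: procM; first by apply: proc_const; apply: (filtration_measurable cF (tk0 k)).
by apply: procB; apply: proc_stopped_time => //;
  [move=> s; exact: (brownian_measurable cF BM)|exact: brownian_continuous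
  |move=> s; exact: (brownian_measurable cF BM)|exact: brownian_continuous].
Qed.

Lemma proc_step_eval phi : simple_process F phi -> proc (step_eval phi).
Proof.
move=> [t0 tm mc _].
have tk0 k : 0 <= step_time phi k by apply: le_trans t0 (tm 0%N k _).
rewrite (_ : step_eval phi = fun s w => \sum_(k < step_size phi)
    (step_coef phi k w * \1_(`]step_time phi k, step_time phi k.+1]) s))//.
apply: (@proc_sum _ _ _ _ (fun k s w => step_coef phi k w * \1_(`]step_time phi k, step_time phi k.+1]) s)) => k.
apply: procM; last exact: proc_indic_oc.
by apply: proc_const; apply: (filtration_measurable cF (tk0 k)).
Qed.

Lemma wrt_fun (f : Om -> R) s : 0 <= s -> measurable_wrt (F s) f ->
  measurable_fun (T := g_sigma_algebraType (F s)) setT f.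
Proof. by move=> s0 /(measurable_wrtP _ (filtration_sigma cF s0)). Qed.

Lemma fun_wrt (f : Om -> R) s : 0 <= s ->
  measurable_fun (T := g_sigma_algebraType (F s)) setT f -> measurable_wrt (F s) f.
Proof. by move=> s0 h; apply/(measurable_wrtP _ (filtration_sigma cF s0)). Qed.

Lemma wrt_mono (f : Om -> R) s s' : 0 <= s -> s <= s' -> measurable_wrt (F s) f ->
  measurable_wrt (F s') f.
Proof. by move=> s0 ss'; apply: measurable_wrtS; exact: (filtration_sub cF s0 ss'). Qed.

Lemma step_eval_wrt phi s : simple_process F phi -> 0 <= s -> measurable_wrt (F s) (step_eval phi s).
Proof.
move=> [t0 tm mc _] s0; apply: fun_wrt => //.
have tk0 k : 0 <= step_time phi k by apply: le_trans t0 (tm 0%N k _).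
rewrite /step_eval; apply: measurable_sum => k.
rewrite indic_ocE; case: ltP => [ks|_] /=; last by under eq_fun do rewrite mulr0; exact: measurable_cst.
apply: measurable_funM; last exact: measurable_cst.
by apply: wrt_fun => //; apply: wrt_mono (mc k) => //; exact: ltW.
Qed.

Lemma step_eval_bounded phi : simple_process F phi ->
  exists2 c : R, 0 <= c & forall s w, `|step_eval phi s w| <= c.
Proof.
move=> [_ _ _ [c hc]]; exists (\sum_(k < step_size phi) `|c|).
  by apply: sumr_ge0 => k _.
move=> s w; apply: le_trans (ler_norm_sum _ _ _) _; apply: ler_sum => k _.
rewrite normrM -[leRHS]mulr1 ler_pM//.
  by apply: le_trans (hc k w) _; exact: ler_norm.
by rewrite indic_ocE; case: (_ && _); rewrite ?normr1 ?normr0.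
Qed.

Section one_grid.
Variables (phi phi' : step_process R Om) (a : R -> Om -> R) (zeta : Om -> R) (s0 t : R).
Hypotheses (hphi : simple_process F phi) (hphi' : simple_process F phi').
Hypotheses (a01 : forall s w, a s w = 0 \/ a s w = 1).
Hypotheses (amono : forall s s' w, 0 <= s -> s <= s' -> a s' w <= a s w).
Hypotheses (pa : proc a) (Fa : forall s, 0 <= s -> measurable_wrt (F s) (a s)).
Hypotheses (Fz : measurable_wrt (F 0) zeta) (z1 : forall w, `|zeta w| <= 1).
Hypotheses (s00 : 0 <= s0) (s0t : s0 <= t).

(** The cut-off [a] multiplies the integrand here, while [step_increment] is not stopped. The two
    match at every time where [a] is 1, since [a] decreases and hence was 1 at all earlier times.
    The factor [zeta] is known at time 0. *)
Definition stopped_step s w := a s w * (zeta w * (step_eval phi s w - step_eval phi' s w)).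
Definition step_increment s w := zeta w *
  ((step_integral B phi s w - step_integral B phi s0 w) -
   (step_integral B phi' s w - step_integral B phi' s0 w)).

Local Notation psi := stopped_step.
Local Notation G := (grid s0 t).

Let G_ge0 k i : 0 <= G k i.
Proof. by apply: (le_trans s00); rewrite -{1}(grid0 s0 t k); exact: grid_le. Qed.

Let Gmono k i : G k i <= G k i.+1.
Proof. exact: grid_le. Qed.

Let mz : meas zeta := filtration_measurable cF (lexx 0) Fz.

Lemma proc_stopped_step : proc psi.
Proof.
apply: procM => //; apply: procM; first exact: proc_const.
by apply: procB; exact: proc_step_eval.
Qed.

Let Fpsi k i : measurable_wrt (F (G k i)) (psi (G k i)).
Proof.
apply: fun_wrt => //; apply: measurable_funM; first by apply: wrt_fun => //; exact: Fa.
apply: measurable_funM; first by apply: wrt_fun => //; exact: wrt_mono (lexx 0) (G_ge0 k i) Fz.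
by apply: measurable_funB; apply: wrt_fun => //; exact: step_eval_wrt.
Qed.

Let psi_bound : exists2 c : R, 0 <= c & forall s w, `|psi s w| <= c.
Proof.
have [c c0 hc] := step_eval_bounded hphi; have [c' c'0 hc'] := step_eval_bounded hphi'.
exists (c + c'); first exact: addr_ge0.
move=> s w; rewrite /psi normrM normrM -[leRHS]mul1r ler_pM//.
  by case: (a01 s w) => ->; rewrite ?normr0 ?normr1.
rewrite -[leRHS]mul1r ler_pM//.
by apply: le_trans (ler_normB _ _) (lerD _ _).
Qed.

Let S k n w := discrete_integral B (G k) (fun i => psi (G k i)) n w.
Let M k n w := running_max B (G k) (fun i => psi (G k i)) n w.
Let V k n w := discrete_bracket (G k) (fun i => psi (G k i)) n w.

(** The indicator of []u j, u j.+1]] is a difference of indicators of half-lines, and for a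
    half-line the sum along the grid is handled by [cvg_prefix_sum]. *)
Let step_sum_cvg (ph : step_process R Om) (x : R) (n : nat -> nat) w : simple_process F ph -> s0 <= x ->
  (\forall k \near \oo, G k (n k) = x) ->
  \sum_(i < n k) step_eval ph (G k i) w * (B (G k i.+1) w - B (G k i) w)
   @[k --> \oo] --> step_integral B ph x w - step_integral B ph s0 w.
Proof.
move=> [t0 tm _ _] s0x nx.
pose c j w := step_coef ph j w; pose u j := step_time ph j.
pose A j k := \sum_(i < n k) (G k i <= u j)%R%:R * (B (G k i.+1) w - B (G k i) w).
rewrite (_ : (fun k => _) = fun k => \sum_(j < step_size ph) c j w * (A j.+1 k - A j k)); last first.
  apply/funext => k; rewrite /step_eval.
  under eq_bigr do rewrite mulr_suml.
  rewrite exchange_big/=; apply: eq_bigr => j _.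
  rewrite /A -sumrB mulr_sumr; apply: eq_bigr => i _.
  rewrite -mulrA; congr (_ * _); rewrite -mulrBl; congr (_ * _).
  rewrite indic_ocE; have [h|h] := leP (G k i) (u j); rewrite /= ?mulr0 ?subr0.
    by rewrite (le_trans h (tm _ _ (leqnSn j))) subrr.
  by case: (_ <= _); rewrite ?mulr1.
rewrite (_ : step_integral B ph x w - step_integral B ph s0 w =
  \sum_(j < step_size ph) c j w * ((B (Num.min (u j.+1) x) w - B (Num.min (u j.+1) s0) w) -
     (B (Num.min (u j) x) w - B (Num.min (u j) s0) w))); last first.
  rewrite /step_integral -sumrB; apply: eq_bigr => j _; rewrite /c /u; ring.
have cA j : A j k @[k --> \oo] --> B (Num.min (u j) x) w - B (Num.min (u j) s0) w.
  have h := @cvg_prefix_sum _ (fun s => B s w) s0 t (@brownian_continuous w) s00 s0t (u j) x n s0x nx.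
  by apply: cvg_trans h; apply: near_eq_cvg; exact: nearW.
elim: (step_size ph) => [|N ih].
  by under eq_fun do rewrite big_ord0; rewrite big_ord0; exact: cvg_cst.
under eq_fun do rewrite big_ord_recr; rewrite big_ord_recr/=.
by apply: cvgD => //; apply: cvgM; [exact: cvg_cst|exact: cvgB].
Qed.

Let S_cvg (x : R) (n : nat -> nat) w : s0 <= x -> a x w = 1 ->
  (\forall k \near \oo, G k (n k) = x) -> S k (n k) w @[k --> \oo] --> step_increment x w.
Proof.
move=> s0x ax nx.
have h1 := @step_sum_cvg phi x n w hphi s0x nx; have h2 := @step_sum_cvg phi' x n w hphi' s0x nx.
have h : zeta w * (\sum_(i < n k) step_eval phi (G k i) w * (B (G k i.+1) w - B (G k i) w) -
   \sum_(i < n k) step_eval phi' (G k i) w * (B (G k i.+1) w - B (G k i) w)) @[k --> \oo] --> step_increment x w.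
  by apply: cvgM; [exact: cvg_cst|exact: cvgB].
apply: cvg_trans h; apply: near_eq_cvg; near=> k.
have nk : G k (n k) = x by near: k.
rewrite -sumrB mulr_sumr /S /discrete_integral; apply: eq_bigr => i _.
have -> : psi (G k i) w = zeta w * (step_eval phi (G k i) w - step_eval phi' (G k i) w).
  rewrite /psi; suff -> : a (G k i) w = 1 by rewrite mul1r.
  have : 1 <= a (G k i) w.
    rewrite -ax; apply: amono => //; rewrite -nk; apply: grid_le => //; exact: ltnW.
  by case: (a01 (G k i) w) => ->//; rewrite ler10.
by ring.
Unshelve. all: by end_near. Qed.

Lemma proc_step_increment : proc step_increment.
Proof.
have mc ph : simple_process F ph -> proc (fun (_ : R) w => step_integral B ph s0 w).
  by move=> /proc_step_integral [+ _ _] => /(_ s0 s00); exact: proc_const.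
apply: procM; first exact: proc_const.
by apply: procB; apply: procB; [exact: proc_step_integral|exact: mc|exact: proc_step_integral|exact: mc].
Qed.

Let M0 k n w : 0 <= M k n w.
Proof. by rewrite /M; elim: n => //= n ih; rewrite le_max ih. Qed.

(** At a dyadic time where [a] is 1, the discrete integrals up to that node converge to the
    increment and are dominated by the running maxima; where [a] is 0 there is nothing to bound. *)
Let step_sup_le (q : nat) w :
  (esup (fun s w => a s w * step_increment s w ^+ (2 * q))%R s0 t w <=
   limn_einf (fun k => (M k (2 ^ k) w ^+ (2 * q))%:E))%E.
Proof.
have pf : proc (fun s w => a s w * step_increment s w ^+ (2 * q)).
  by apply: procM => //; apply: procX; exact: proc_step_increment.
rewrite esup_dyadic//; last by case: pf.
apply: le_limn_einf => y /ereal_sup_gt [_ [n _ <-]]; rewrite lte_fin.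
have /andP[q0 q1] := @dyadic_itv R n.
set x := s0 + (t - s0) * dyadic n.
have s0x : s0 <= x by rewrite lerDl mulr_ge0// subr_ge0.
have Mq0 k : 0 <= M k (2 ^ k) w ^+ (2 * q) by rewrite exprn_ge0.
have [->|ax] := a01 x w.
  by rewrite mul0r => y0; apply: nearW => k; rewrite lee_fin (le_trans (ltW y0)).
have [m [mk mE]] := dyadic_grid s0 t n.
rewrite ax mul1r => yx.
have Sx : S k (m k) w ^+ (2 * q) @[k --> \oo] --> step_increment x w ^+ (2 * q).
  by apply: cvgX; exact: S_cvg.
near=> k; rewrite lee_fin; apply: (@le_trans _ _ (S k (m k) w ^+ (2 * q))).
  by apply: ltW; near: k; exact: cvgr_gt Sx _ yx.
rewrite !exprM; apply: lerXn2r; rewrite ?nnegrE ?sqr_ge0//.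
rewrite -[leLHS]normr_sqr// ler_sqr ?nnegrE//.
exact: discrete_integral_le_max.
Unshelve. all: by end_near. Qed.

Let measurable_M k n : meas (M k n).
Proof.
have [c _ hc] := psi_bound.
have G00 : 0 <= G k 0 by [].
exact: (measurable_running_max cF BM G00 (Gmono k) (Fpsi k)).
Qed.

Lemma step_maximal_limit q (u : nat -> \bar R) l :
  (forall k, (\E[P]_w (M k (2 ^ k) w ^+ (2 * q)) <= u k)%E) -> u @ \oo --> l ->
  (\int[P]_w esup (fun s w => a s w * step_increment s w ^+ (2 * q))%R s0 t w <= l)%E.
Proof.
move=> Mu ul.
have pf : proc (fun s w => a s w * step_increment s w ^+ (2 * q)).
  by apply: procM => //; apply: procX; exact: proc_step_increment.
apply: (@int_fatou _ _ _ P _ (fun k w => (M k (2 ^ k) w ^+ (2 * q))%:E) u).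
- exact: measurable_esup.
- move=> w; apply: esup_ge0 => // s; apply: mulr_ge0.
    by case: (a01 s w) => ->.
  by rewrite exprM exprn_ge0// sqr_ge0.
- by move=> k; apply/measurable_EFinP; apply: measurable_funX.
- by move=> k w; rewrite lee_fin exprn_ge0.
- by apply: aeW => w; exact: step_sup_le.
- exact: Mu.
- exact: ul.
Qed.

Let VE k w : V k (2 ^ k) w = \sum_(i < 2 ^ k) psi (G k i) w ^+ 2 * ((t - s0) / 2 ^+ k).
Proof. by rewrite /V /discrete_bracket; apply: eq_bigr => i _; rewrite gridS. Qed.

Let measurable_V k : meas (V k (2 ^ k)).
Proof.
have G00 : 0 <= G k 0 by [].
exact: (measurable_discrete_bracket cF G00 (Gmono k) (Fpsi k)).
Qed.

(** Step processes are bounded, so the discrete brackets are bounded uniformly in the grid; their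
    powers then converge in mean by domination. *)
Let V_bound : exists2 K : R, 0 <= K & forall k w, 0 <= V k (2 ^ k) w <= K.
Proof.
have [c c0 hc] := psi_bound; exists (c ^+ 2 * (t - s0)).
  by rewrite mulr_ge0 ?sqr_ge0// subr_ge0.
have h0 k : 0 <= (t - s0) / 2 ^+ k by rewrite divr_ge0 ?subr_ge0// exprn_ge0.
move=> k w; rewrite VE; apply/andP; split.
  by apply: sumr_ge0 => i _; rewrite mulr_ge0// sqr_ge0.
apply: (@le_trans _ _ (\sum_(i < 2 ^ k) c ^+ 2 * ((t - s0) / 2 ^+ k))).
  apply: ler_sum => i _; rewrite ler_wpM2r//.
  by rewrite -[leLHS]normr_sqr// ler_sqr ?nnegrE.
rewrite sumr_const card_ord -[leLHS]mulr_natr natrX -!mulrA mulVf ?mulr1// expf_neq0.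
Qed.

Let psq : proc (fun s w => psi s w ^+ 2).
Proof. by apply: procX; exact: proc_stopped_step. Qed.

Lemma step_bracket_cvg q :
  \E[P]_w (V k (2 ^ k) w ^+ q) @[k --> \oo] --> \E[P]_w (tint (fun s w => psi s w ^+ 2) s0 t w ^+ q).
Proof.
have [K K0 VK] := V_bound.
have := @dominated_convergence _ _ R P setT measurableT (fun k w => (V k (2 ^ k) w ^+ q)%:E)
  (fun w => (tint (fun s w => psi s w ^+ 2) s0 t w ^+ q)%:E) (cst (K ^+ q)%:E).
case => //.
- by move=> k; apply/measurable_EFinP/measurable_funX.
- by apply/measurable_EFinP/measurable_funX; exact: measurable_tint.
- apply: aeW => w _; apply: cvg_EFin; first exact: nearW.
  apply: cvgX.
  under eq_fun do rewrite VE.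
  exact: riemann_left.
- apply/integrableP; split => //; rewrite integral_cst//=.
  by rewrite probability_setT mule1 ltry.
- apply: aeW => w k _; have /andP[V0 V1] := VK k w.
  by rewrite lee_fin ger0_norm ?exprn_ge0// lerXn2r ?nnegrE.
Qed.

Lemma step_maximal2 :
  (\int[P]_w esup (fun s w => a s w * step_increment s w ^+ 2)%R s0 t w <=
   32%:E * Ex P (tint (fun s w => psi s w ^+ 2)%R s0 t))%E.
Proof.
have [c _ hc] := psi_bound.
apply: (@step_maximal_limit 1 (fun k => 32%:E * Ex P (V k (2 ^ k)))%E) => [k|].
  have G00 : 0 <= G k 0 by [].
  exact: (discrete_doob2 cF BM G00 (Gmono k) (Fpsi k) (fun i => hc _)).
apply: cvgeZl => //; exact: (@step_bracket_cvg 1%N).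
Qed.

Lemma step_maximal4 :
  (\int[P]_w esup (fun s w => a s w * step_increment s w ^+ 4)%R s0 t w <=
   (2 * (128 * (32 * 8)))%:E * \E[P]_w (tint (fun s w => psi s w ^+ 2) s0 t w ^+ 2))%E.
Proof.
have [c _ hc] := psi_bound; have [K K0 VK] := V_bound.
(* The second summand carries the mesh of the grid and tends to 0. *)
pose u k := ((2 * (128 * (32 * 8)))%:E * \E[P]_w (V k (2 ^ k) w ^+ 2) +
  (2 * (12 * 128 * c ^+ 2 * (t - s0) * K) / 2 ^+ k)%:E)%E.
apply: (@step_maximal_limit 2 u) => [k|]; last first.
  rewrite -[X in _ --> X]adde0; apply: cvgeD.
  - by rewrite fin_num_adde_defl.
  - by apply: cvgeZl => //; exact: (@step_bracket_cvg 2%N).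
  - apply: cvg_EFin; first exact: nearW.
    rewrite -(mulr0 (2 * (12 * 128 * c ^+ 2 * (t - s0) * K))).
    by apply: cvgM; [exact: cvg_cst|exact: cvg_inv_pow2].
have G00 : 0 <= G k 0 by [].
have h0 : 0 <= (t - s0) / 2 ^+ k by rewrite divr_ge0 ?subr_ge0// exprn_ge0.
have hG i : G k i.+1 - G k i <= (t - s0) / 2 ^+ k by rewrite gridS.
apply: (le_trans (discrete_doob4 cF BM G00 (Gmono k) (Fpsi k) (fun i => hc _) (2 ^ k) hG)).
rewrite -/(V k (2 ^ k)).
have V0 w : 0 <= V k (2 ^ k) w by case/andP: (VK k w).
have mV := measurable_V k.
have c20 := sqr_ge0 c.
rewrite ExD; try side.
rewrite ExZ; try side.
rewrite ExZ; try side.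
rewrite [leLHS]muleDr//; last first.
  by rewrite ge0_adde_def// inE; apply: mule_ge0; rewrite ?lee_fin ?Ex_ge0//; nneg.
rewrite /u muleA -EFinM; apply: leeD => //.
apply: (@le_trans _ _ (2%:E * ((12 * 128 * c ^+ 2 * ((t - s0) / 2 ^+ k))%:E * K%:E))%E).
  apply: lee_wpmul2l => //; apply: lee_wpmul2l; first by rewrite lee_fin; nneg.
  apply: (@le_trans _ _ (Ex P (fun=> K))).
    by apply: Ex_le => // w; case/andP: (VK k w).
  by rewrite Ex_cst.
rewrite -!EFinM lee_fin; apply: eq_leW.
move: (2 ^+ k)^-1 => z; ring.
Qed.

End one_grid.
End step_maximal.

(** * Convergence in probability and almost surely *)

Section convergence_in_probability.
Context {R : realType} {d} {T : measurableType d} (P : probability T R).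
Implicit Types (Z : nat -> T -> \bar R).

Let measurable_ge (f : T -> \bar R) (e : R) : meas f ->
  measurable [set w | (e%:E <= f w)%E].
Proof.
move=> mf; rewrite -[X in measurable X]setTI.
exact: (emeasurable_fun_le measurableT).
Qed.

Lemma cvg0_in_probabilityD Z Z' : (forall n, meas (Z n)) ->
  (forall n, meas (Z' n)) -> (forall n w, (0 <= Z n w)%E) ->
  (forall n w, (0 <= Z' n w)%E) ->
  cvg0_in_probability P Z -> cvg0_in_probability P Z' ->
  cvg0_in_probability P (fun n w => Z n w + Z' n w)%E.
Proof.
move=> mZ mZ' Z0 Z'0 cZ cZ' e e0.
have e20 : 0 < e / 2 by rewrite divr_gt0.
apply: (@squeeze_cvge _ _ _ _ (fun=> 0%E) _
  (fun n => P [set w | ((e / 2)%:E <= Z n w)%E] + P [set w | ((e / 2)%:E <= Z' n w)%E])%E).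
- apply: nearW => n; rewrite measure_ge0/=.
  apply: (@le_trans _ _ (P ([set w | ((e / 2)%:E <= Z n w)%E] `|` [set w | ((e / 2)%:E <= Z' n w)%E]))).
    apply: le_measure; rewrite ?inE.
    + by apply: measurable_ge; exact: emeasurable_funD.
    + by apply: measurableU; exact: measurable_ge.
    + move=> w /= eZ; apply/orP; rewrite leNgt [X in _ || X]leNgt -negb_and; apply/negP => /andP[h h'].
      move: eZ; rewrite leNgt => /negP; apply.
      rewrite [X in (_ < X%:E)%E](splitr e) EFinD; exact: lteD.
  exact: measureU2 (measurable_ge _ _) (measurable_ge _ _).
- exact: cvg_cst.
- rewrite -[X in _ --> X](adde0 0%E); apply: cvgeD => //; [exact: cZ|exact: cZ'].
Qed.

(** Indices are chosen so that exceeding [2^-(l+1)] has probability below [2^-(l+1)]; the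
    Borel-Cantelli lemma leaves a null set outside which the subsequence tends to 0. *)
Lemma cvg0_in_probability_subseq Z : (forall n, meas (Z n)) ->
  (forall n w, (0 <= Z n w)%E) -> cvg0_in_probability P Z ->
  exists n : nat -> nat, {ae P, forall w, Z (n l) w @[l --> \oo] --> 0%E}.
Proof.
move=> mZ Z0 cZ.
pose e l : R := 1 / (2 ^ l.+1)%:R.
have e0 l : 0 < e l by rewrite divr_gt0// ltr0n expn_gt0.
have ex l : exists n, (P [set w | ((e l)%:E <= Z n w)%E] < (e l)%:E)%E.
  have := cZ _ (e0 l) => /fine_cvgP[].
  move=> [N1 _ fN] /cvgrPdist_lt /(_ _ (e0 l))[N2 _ hN].
  exists (maxn N1 N2).
  have := hN (maxn N1 N2) (leq_maxr _ _); rewrite /= sub0r normrN.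
  have /= /fineK h1 := fN (maxn N1 N2) (leq_maxl _ _).
  rewrite -lte_fin => /(le_lt_trans _); apply.
  by rewrite -[leLHS]h1 lee_fin ler_norm.
pose n l := sval (cid (ex l)).
have nP l : (P [set w | ((e l)%:E <= Z (n l) w)%E] < (e l)%:E)%E by rewrite /n; case: cid.
pose A l := [set w | ((e l)%:E <= Z (n l) w)%E].
have mA l : measurable (A l) by exact: measurable_ge.
exists n; exists (lim_sup_set A); split.
- by apply: bigcap_measurable => // k _; apply: bigcup_measurable => j _.
- apply: lim_sup_set_cvg0 => //.
  apply: (@le_lt_trans _ _ (\sum_(k <oo) (e k)%:E)%E); last first.
    by apply: le_lt_trans (epsilon_trick0 xpredT ler01) _; exact: ltry.
  by apply: lee_nneseries => // k _; exact: ltW (nP k).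
- move=> w /= nZ; apply: contrapT => h; apply: nZ.
  have {h} [N hN] : exists N, forall l, (N <= l)%N -> ~ A l w.
    apply: contrapT => hh; apply: h => k _; apply: contrapT => h; apply: hh.
    by exists k => l kl Al; apply: h; exists l.
  apply: (@squeeze_cvge _ _ _ _ (fun=> 0%E) _ (fun l => (e l)%:E)).
  + exists N => // l /= Nl; rewrite Z0/= ltW// ltNge; apply/negP; exact: hN.
  + exact: cvg_cst.
  + apply: cvg_EFin; first exact: nearW.
    rewrite (_ : e = fun l => 2^-1 * (2 ^+ l)^-1); last first.
      by apply/funext => l; rewrite /e div1r natrX exprS invfM.
    by rewrite -(mulr0 2^-1); apply: cvgM; [exact: cvg_cst|exact: cvg_inv_pow2].
Qed.

End convergence_in_probability.

(** * Cut-offs by energy *)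

Section truncation.
Context {R : realType} {d} {T : measurableType d}.
Implicit Types f : R -> T -> R.

Lemma tint_lipschitz f t w : proc f -> exists2 c : R, 0 <= c &
  forall u v, 0 <= u -> u <= v -> v <= t -> `|tint f 0 v w - tint f 0 u w| <= c * (v - u).
Proof.
move=> pf; have [_ _ /(_ w t) [c hc]] := pf.
have [t0|t0] := leP 0 t; last first.
  by exists 0 => // u v u0 uv vt; move: (le_lt_trans (le_trans u0 (le_trans uv vt)) t0); rewrite ltxx.
exists c; first by apply: le_trans (hc 0 _) => //; rewrite lexx.
move=> u v u0 uv vt; rewrite (tint_cat w (lexx 0) u0 uv pf) addrAC subrr add0r.
rewrite (le_trans (norm_tint v w u0 pf))// -(tint_cst c w uv); apply: tint_le => //.
- exact: proc_abs.
- exact: (@proc_const _ _ _ (fun=> c)).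
- by move=> s /andP[us sv]; apply: hc; rewrite (le_trans u0)//= (le_trans sv).
Qed.

Lemma cvg_tint f w s (u : nat -> R) : proc f -> 0 <= s -> (forall k, 0 <= u k <= s) ->
  u @ \oo --> s -> tint f 0 (u k) w @[k --> \oo] --> tint f 0 s w.
Proof.
move=> pf s0 us cu; have [c c0 hc] := tint_lipschitz s w pf.
apply/cvgrPdist_le => e e0; near=> k.
have /andP[u0 uks] := us k.
rewrite (le_trans (hc _ _ u0 uks (lexx _)))//.
apply: (@le_trans _ _ (c * (e / (c + 1)))).
  apply: ler_wpM2l => //; rewrite -[leLHS]ger0_norm ?subr_ge0//.
  by near: k; apply: cvgr_dist_le => //; rewrite divr_gt0// ltr_wpDl.
by rewrite mulrCA ler_piMr ?(ltW e0)// ler_pdivrMr ?ltr_wpDl// mul1r lerDl.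
Unshelve. all: by end_near. Qed.

Lemma proc_tint f : proc f -> proc (fun s w => tint f 0 s w).
Proof.
move=> pf; split.
- by move=> s s_ge0; exact: measurable_tint.
- by move=> w s u s_ge0 us cu; exact: cvg_tint.
- move=> w t; have [c c0 hc] := tint_lipschitz t w pf; exists (c * t) => s /andP[s_ge0 st].
  rewrite -[tint _ _ _ _]subr0 -[X in _ - X](tint_point f 0 w).
  rewrite (le_trans (hc _ _ (lexx _) s_ge0 st))// subr0; exact: ler_wpM2l.
Qed.

(** Replaces stopping when the energy passes [c]. Keeping the value 1 as long as the energy is at
    most [c] makes the cut-off left continuous, and monotonicity of the energy makes it
    decreasing. *)
Definition energy_cut f (c : R) (s : R) (w : T) : R := (tint f 0 s w <= c)%R%:R.

Lemma energy_cut01 f c s w : energy_cut f c s w = 0 \/ energy_cut f c s w = 1.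
Proof. by rewrite /energy_cut; case: (_ <= _); [right|left]. Qed.

Lemma tint_mono f u v w : proc f -> (forall s w, 0 <= f s w) -> 0 <= u -> u <= v ->
  tint f 0 u w <= tint f 0 v w.
Proof.
by move=> pf f0 u0 uv; rewrite (tint_cat w (lexx 0) u0 uv pf) lerDl tint_ge0.
Qed.

Lemma energy_cut_mono f c s s' w : proc f -> (forall s w, 0 <= f s w) -> 0 <= s -> s <= s' ->
  energy_cut f c s' w <= energy_cut f c s w.
Proof.
move=> pf f0 s0 ss'; rewrite /energy_cut; case: (leP (tint f 0 s' w) c) => // h.
by rewrite (le_trans (tint_mono w pf f0 s0 ss') h).
Qed.

Lemma proc_energy_cut f c : proc f -> (forall s w, 0 <= f s w) -> proc (energy_cut f c).
Proof.
move=> pf f0; split.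
- move=> s s0; rewrite (_ : energy_cut f c s = fun w => \1_(`]-oo, c]) (tint f 0 s w)).
    apply: measurableT_comp; [exact: measurable_indic|exact: measurable_tint].
  by apply/funext => w; rewrite indicE mem_setE in_itv.
- move=> w s u s0 us cu; rewrite /energy_cut; case: (leP (tint f 0 s w) c) => h.
    apply: cvg_near_cst; apply: nearW => k; have /andP[u0 uks] := us k.
    by rewrite (le_trans (tint_mono w pf f0 u0 uks) h).
  have cc := @cvg_tint f w s u pf s0 us cu.
  apply: cvg_near_cst; near=> k; rewrite leNgt.
  have -> // : c < tint f 0 (u k) w.
  by near: k; exact: cvgr_gt cc _ h.
- by move=> w t; exists 1 => s _; case: (energy_cut01 f c s w) => ->; rewrite ?normr0 ?normr1.
Unshelve. all: by end_near. Qed.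

Lemma tint_energy_cut f c a t w : proc f -> (forall s w, 0 <= f s w) -> 0 <= c -> 0 <= a -> a <= t ->
  tint (fun s w => energy_cut f c s w * f s w) a t w <= c + 1.
Proof.
move=> pf f0 c0 a0 at_.
have pc := proc_energy_cut c pf f0.
have pcf : proc (fun s w => energy_cut f c s w * f s w) by exact: procM.
have cf0 s w' : 0 <= energy_cut f c s w' * f s w'.
  by apply: mulr_ge0 => //; rewrite ler0n.
have cfle s w' : energy_cut f c s w' * f s w' <= f s w'.
  by case: (energy_cut01 f c s w') => ->; rewrite ?mul0r ?mul1r.
have t0 : 0 <= t by exact: le_trans at_.
apply: (@le_trans _ _ (tint (fun s w => energy_cut f c s w * f s w) 0 t w)).
  by rewrite [leRHS](tint_cat w (lexx 0) a0 at_ pcf) lerDr tint_ge0.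
have [h|h] := leP (tint f 0 t w) (c + 1).
  by apply: le_trans (tint_le _ pcf pf _) h => // s _.
have cont : {within `[0, t], continuous (fun s => tint f 0 s w)}.
  exact: (parameterized_integral_continuous t0 (proc_integrable w t (lexx 0) pf)).
have c1t : Num.min (tint f 0 0 w) (tint f 0 t w) <= c + 1 <= Num.max (tint f 0 0 w) (tint f 0 t w).
  by rewrite tint_point ge_min le_max addr_ge0//= (ltW h) orbT.
(* The energy is continuous, so it takes the value [c + 1] at some [x]; the extra 1 makes the
   cut-off already 0 there and ever after. *)
have [x] := IVT t0 cont c1t; rewrite in_itv/= => /andP[x0 xt] xE.
rewrite (tint_cat w (lexx 0) x0 xt pcf).
have -> : tint (fun s w => energy_cut f c s w * f s w) x t w = tint (fun _ _ => 0) x t w.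
  apply: tint_eq => s /andP[xs st].
  rewrite /energy_cut leNgt (_ : c < tint f 0 s w) ?mul0r//.
  by apply: lt_le_trans (tint_mono w pf f0 x0 xs); rewrite xE ltrDl.
rewrite tint_cst// mul0r addr0 -xE; exact: tint_le.
Qed.

End truncation.

Section squares.
Context {R : realType}.
Implicit Types x y u v a z e : R.

Lemma sqr_sub_split x y u v :
  (x - y) ^+ 2 <= 2 * (u - v) ^+ 2 + (4 * (x - u) ^+ 2 + 4 * (y - v) ^+ 2).
Proof.
rewrite -subr_ge0 (_ : _ - _ = ((u - v) - ((x - u) - (y - v))) ^+ 2 + 2 * ((x - u) + (y - v)) ^+ 2); last by ring.
apply: addr_ge0; first exact: sqr_ge0.
by apply: mulr_ge0 => //; exact: sqr_ge0.
Qed.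

Lemma weighted_sqr_split a e z x y u v : a = 0 \/ a = 1 -> e = 0 \/ e = 1 -> z ^+ 2 <= 1 ->
  (a * e * (z * (x - y))) ^+ 2 <=
  2 * (a * (z * (u - v))) ^+ 2 + (4 * (x - u) ^+ 2 + 4 * (y - v) ^+ 2).
Proof.
move=> a01 e01 z1.
have p0 : 0 <= 4 * (x - u) ^+ 2 + 4 * (y - v) ^+ 2.
  by apply: addr_ge0; apply: mulr_ge0 => //; exact: sqr_ge0.
have r0 : 0 <= 2 * (a * (z * (u - v))) ^+ 2 + (4 * (x - u) ^+ 2 + 4 * (y - v) ^+ 2).
  by apply: addr_ge0 => //; apply: mulr_ge0 => //; exact: sqr_ge0.
case: a01 => ea; first by apply: le_trans r0; rewrite ea !mul0r expr0n.
case: e01 => ->; first by apply: le_trans r0; rewrite mulr0 mul0r expr0n.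
rewrite ea.
rewrite !mul1r !exprMn; apply: le_trans (ler_wpM2l (sqr_ge0 z) (sqr_sub_split x y u v)) _.
rewrite mulrDr mulrCA lerD2l; exact: ler_piMl.
Qed.

End squares.

(** * From step processes to Ito integrals *)

Section ito.
Context {R : realType} {d} {Om : measurableType d} (P : probability Om R).
Variables (F : R -> set (set Om)) (B : R -> Om -> R).
Hypotheses (cF : complete_filtration P F) (BM : brownian_motion P F B).

(** Errors on the integrand and on the integral are added up, so that one almost surely convergent
    subsequence serves for both. *)
Definition ito_error (phi : step_process R Om) (H I : R -> Om -> R) (t : R) (w : Om) : \bar R :=
  ((tint (fun s w => (step_eval phi s w - H s w) ^+ 2) 0 t w)%:E +
   esup (fun s w => `|step_integral B phi s w - I s w|%R) 0 t w)%E.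

Lemma proc_adapted (X : R -> Om -> R) : adapted F X -> continuous_paths X -> proc X.
Proof.
move=> aX cX; apply: proc_continuous => // s s0.
exact: (filtration_measurable cF s0 (aX s s0)).
Qed.

(** Frozen after time [s], an adapted process is a process over the space equipped with [F s];
    measurability of time integrals and of suprema over that space is adaptedness over the original
    one. *)
Lemma proc_capped (f : R -> Om -> R) s : 0 <= s -> proc f -> adapted F f ->
  proc (fun r (w : g_sigma_algebraType (F s)) => f (Num.min r s) w).
Proof.
move=> s_ge0 [_ lf bf] af; split.
- move=> r r0; have m0 : 0 <= Num.min r s by rewrite le_min r0.
  apply: (wrt_fun cF) => //; apply: (wrt_mono cF m0 _ (af _ m0)).
  by rewrite ge_min lexx orbT.
- move=> w r u r0 ur cu; apply: lf.
  + by rewrite le_min r0.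
  + move=> k; have /andP[u0 uk] := ur k; rewrite le_min u0 s_ge0/=.
    by rewrite le_min ge_min uk/= ge_min lexx orbT.
  + by apply: (@continuous_cvg _ _ _ _ _ _ (fun x => Num.min x s)) => //; apply: continuous_min => //; exact: cvg_cst.
- move=> w r; have [c hc] := bf w s; exists c => v /andP[v0 vr].
  by apply: hc; rewrite le_min v0 s_ge0/= ge_min lexx orbT.
Qed.

Lemma adapted_tint (f : R -> Om -> R) s : 0 <= s -> proc f -> adapted F f ->
  measurable_wrt (F s) (tint f 0 s).
Proof.
move=> s0 pf af; apply: (fun_wrt cF) => //.
rewrite (_ : tint f 0 s = tint (fun r w => f (Num.min r s) w) 0 s).
  exact: (measurable_tint s (lexx 0) (proc_capped s0 pf af)).
by apply/funext => w; apply: tint_eq => r /andP[_ rs]; rewrite min_l.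
Qed.

Lemma proc_ito H I : ito_integral P F B H I -> proc I.
Proof. by move=> [aI cI _]; exact: proc_adapted. Qed.

Lemma ito_error_ge0 phi H I t w : 0 <= t -> (0 <= ito_error phi H I t w)%E.
Proof.
move=> t0; apply: adde_ge0; last by apply: esup_ge0.
by rewrite lee_fin; apply: tint_ge0 => s _; exact: sqr_ge0.
Qed.

Lemma measurable_ito_error phi H I t : 0 <= t -> proc H -> proc I -> simple_process F phi ->
  meas (ito_error phi H I t).
Proof.
move=> t0 pH pI sphi; apply: emeasurable_funD.
  by apply/measurable_EFinP/measurable_tint => //; apply: procX; apply: procB => //; exact: (proc_step_eval cF).
apply: measurable_esup => //; apply: proc_abs; apply: procB => //.
exact: (proc_step_integral cF BM).
Qed.

Lemma ito_approx H I t : 0 <= t -> proc H -> ito_integral P F B H I ->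
  exists phi : nat -> step_process R Om, (forall n, simple_process F (phi n)) /\
    cvg0_in_probability P (fun n w => ito_error (phi n) H I t w).
Proof.
move=> t0 pH iI; have pI := proc_ito iI; case: iI => _ _ [phi [sphi cphi]].
have [c1 c2] := cphi t t0.
exists phi; split => //.
have pd n : proc (fun s w => (step_eval (phi n) s w - H s w) ^+ 2).
  by apply: procX; apply: procB => //; exact: (proc_step_eval cF).
apply: cvg0_in_probabilityD.
- by move=> n; apply/measurable_EFinP/measurable_tint.
- move=> n; apply: measurable_esup => //; apply: proc_abs; apply: procB => //.
  exact: (proc_step_integral cF BM).
- by move=> n w; rewrite lee_fin; apply: tint_ge0 => s _; exact: sqr_ge0.
- by move=> n w; apply: esup_ge0.
- rewrite (_ : (fun n w => _) = (fun n w => (\int[lebesgue_measure]_(s in `[0%R, t])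
              ((step_eval (phi n) s w - H s w) ^+ 2)%:E)%E)) //.
  by apply/funext => n; apply/funext => w; rewrite tint_ge0E.
- exact: c2.
Qed.

Lemma ito_integral0 H I : proc H -> ito_integral P F B H I -> {ae P, forall w, I 0 w = 0}.
Proof.
move=> pH iI; have pI := proc_ito iI.
have [phi [sphi cphi]] := ito_approx (lexx 0) pH iI.
have [n nP] := cvg0_in_probability_subseq
  (fun n => measurable_ito_error (lexx 0) pH pI (sphi n))
  (fun n w => ito_error_ge0 (phi n) H I w (lexx 0)) cphi.
apply: filterS nP => w cw.
have ge l : ((`|I 0 w|)%:E <= ito_error (phi (n l)) H I 0 w)%E.
  apply: le_trans (leeDr _ _); last by rewrite lee_fin; apply: tint_ge0 => s _; exact: sqr_ge0.
  apply: le_trans (esup_ubound _ _ (s := 0) _); last by rewrite lexx.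
  rewrite lee_fin; suff -> : step_integral B (phi (n l)) 0 w = 0 by rewrite sub0r normrN.
  have [t0 tm _ _] := sphi (n l).
  rewrite /step_integral big1// => k _; rewrite !min_r ?subrr ?mulr0//.
    exact: le_trans t0 (tm 0%N k _).
  exact: le_trans t0 (tm 0%N k.+1 _).
have : ((`|I 0%R w|)%:E <= 0)%E.
  rewrite -(cvg_lim _ cw)//; apply: lime_ge; last exact: nearW.
  by apply/cvg_ex; eexists; exact: cw.
by rewrite lee_fin normr_le0 => /eqP.
Qed.

Section maximal.
Variables (H I H' I' : R -> Om -> R).
Hypotheses (pH : proc H) (pH' : proc H').
Hypotheses (iI : ito_integral P F B H I) (iI' : ito_integral P F B H' I').
Variables (a : R -> Om -> R) (zeta : Om -> R) (s0 t : R).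
Hypotheses (a01 : forall s w, a s w = 0 \/ a s w = 1).
Hypotheses (amono : forall s s' w, 0 <= s -> s <= s' -> a s' w <= a s w).
Hypotheses (pa : proc a) (Fa : forall s, 0 <= s -> measurable_wrt (F s) (a s)).
Hypotheses (Fz : measurable_wrt (F 0) zeta) (z1 : forall w, `|zeta w| <= 1).
Hypotheses (s00 : 0 <= s0) (s0t : s0 <= t).

Definition ito_increment s w := zeta w * ((I s w - I s0 w) - (I' s w - I' s0 w)).
Definition weighted_integrand s w := (a s w * (zeta w * (H s w - H' s w))) ^+ 2.

Let t0 : 0 <= t := le_trans s00 s0t.
Let pI := proc_ito iI.
Let pI' := proc_ito iI'.
Let mz : meas zeta := filtration_measurable cF (lexx 0) Fz.

Let phiP := ito_approx t0 pH iI.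
Let phi := sval (cid phiP).
Let sphi n : simple_process F (phi n). Proof. by rewrite /phi; case: cid => ? []. Qed.
Let phiP' := ito_approx t0 pH' iI'.
Let phi' := sval (cid phiP').
Let sphi' n : simple_process F (phi' n). Proof. by rewrite /phi'; case: cid => ? []. Qed.

Let err n w : \bar R := (ito_error (phi n) H I t w + ito_error (phi' n) H' I' t w)%E.

Let err_subseq : exists n : nat -> nat, {ae P, forall w, err (n l) w @[l --> \oo] --> 0%E}.
Proof.
apply: cvg0_in_probability_subseq.
- by move=> n; apply: emeasurable_funD; exact: measurable_ito_error.
- by move=> n w; apply: adde_ge0; exact: ito_error_ge0.
- apply: cvg0_in_probabilityD.
  + by move=> n; exact: measurable_ito_error.
  + by move=> n; exact: measurable_ito_error.
  + by move=> n w; exact: ito_error_ge0.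
  + by move=> n w; exact: ito_error_ge0.
  + by rewrite /phi; case: cid => ? [].
  + by rewrite /phi'; case: cid => ? [].
Qed.

Let n := sval (cid err_subseq).
Let nP : {ae P, forall w, err (n l) w @[l --> \oo] --> 0%E}.
Proof. by rewrite /n; case: cid. Qed.

Let f l s w := (step_eval (phi (n l)) s w - step_eval (phi' (n l)) s w) ^+ 2.
Let pf l : proc (f l).
Proof. by apply: procX; apply: procB; exact: (proc_step_eval cF). Qed.
Let f0 l s w : 0 <= f l s w. Proof. exact: sqr_ge0. Qed.

(** Without the energy cut the expected energies of the approximations need not converge. The level
    [2 j + 1] leaves the cut inactive for large [l] on the event where the energy of [H - H'] is at
    most [j]: the approximating energy is at most [2 j] plus a term tending to 0. *)
Let b (j l : nat) s w : R := a s w * energy_cut (f l) (2 * j%:R + 1) s w.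
Let b01 j l s w : b j l s w = 0 \/ b j l s w = 1.
Proof.
rewrite /b; case: (a01 s w) => ->; first by left; rewrite mul0r.
by rewrite mul1r; exact: energy_cut01.
Qed.
Let bmono j l s s' w : 0 <= s -> s <= s' -> b j l s' w <= b j l s w.
Proof.
move=> s_ge0 ss'; rewrite /b; apply: ler_pM.
- by case: (a01 s' w) => ->.
- by rewrite ler0n.
- exact: amono.
- exact: energy_cut_mono.
Qed.
Let pb j l : proc (b j l).
Proof. by apply: procM => //; exact: proc_energy_cut. Qed.
Let Fb j l s : 0 <= s -> measurable_wrt (F s) (b j l s).
Proof.
move=> s_ge0; apply: (fun_wrt cF) => //; apply: measurable_funM.
  by apply: (wrt_fun cF) => //; exact: Fa.
rewrite (_ : energy_cut (f l) (2 * j%:R + 1) s = fun w => \1_(`]-oo, 2 * j%:R + 1]) (tint (f l) 0 s w)).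
  have mt : measurable_fun (T := g_sigma_algebraType (F s)) setT (tint (f l) 0 s).
    apply: (wrt_fun cF) => //; apply: adapted_tint => // r r0.
    apply: (fun_wrt cF) => //; apply: measurable_funX.
    by apply: measurable_funB; apply: (wrt_fun cF) => //; exact: (step_eval_wrt cF).
  have mi : meas (\1_(`]-oo, 2 * j%:R + 1]) : R -> R) by exact: measurable_indic.
  exact: (measurableT_comp mi mt).
by apply/funext => w; rewrite indicE mem_setE in_itv.
Qed.

Let ed l w : R := tint (fun s w => (step_eval (phi (n l)) s w - H s w) ^+ 2) 0 t w +
  tint (fun s w => (step_eval (phi' (n l)) s w - H' s w) ^+ 2) 0 t w.
Let Vfull w : R := tint (fun s w => (H s w - H' s w) ^+ 2) 0 t w.
Let V w : R := tint weighted_integrand s0 t w.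
Let inc l := step_increment B (phi (n l)) (phi' (n l)) zeta s0.
Let W j l w : R := tint (fun s w => stopped_step (phi (n l)) (phi' (n l)) (b j l) zeta s w ^+ 2) s0 t w.

Let pe1 l : proc (fun s w => (step_eval (phi (n l)) s w - H s w) ^+ 2).
Proof. by apply: procX; apply: procB => //; exact: (proc_step_eval cF). Qed.
Let pe2 l : proc (fun s w => (step_eval (phi' (n l)) s w - H' s w) ^+ 2).
Proof. by apply: procX; apply: procB => //; exact: (proc_step_eval cF). Qed.
Let pHH : proc (fun s w => (H s w - H' s w) ^+ 2).
Proof. by apply: procX; exact: procB. Qed.
Let pw : proc weighted_integrand.
Proof. by apply: procX; apply: procM => //; apply: procM; [exact: proc_const|exact: procB]. Qed.
Let pinc l : proc (inc l).
Proof. exact: (proc_step_increment cF BM). Qed.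
Let pst j l : proc (fun s w => stopped_step (phi (n l)) (phi' (n l)) (b j l) zeta s w ^+ 2).
Proof. by apply: procX; exact: (proc_stopped_step cF). Qed.

Let ed_ge0 l w : 0 <= ed l w.
Proof. by apply: addr_ge0; apply: tint_ge0 => s _; exact: sqr_ge0. Qed.
Let V_ge0 w : 0 <= V w.
Proof. by apply: tint_ge0 => s _; exact: sqr_ge0. Qed.

Let cvg_of_le_err (x : nat -> R) w : err (n l) w @[l --> \oo] --> 0%E ->
  (forall l, 0 <= x l) -> (forall l, ((x l)%:E <= err (n l) w)%E) -> x @ \oo --> 0.
Proof.
move=> cw x0 xe; have : (x l)%:E @[l --> \oo] --> 0%E.
  apply: (@squeeze_cvge _ _ _ _ (fun=> 0%E) _ (fun l => err (n l) w)) => //.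
    by apply: nearW => l; rewrite lee_fin x0 xe.
  exact: cvg_cst.
by move/fine_cvgP => [].
Qed.

Let cvg_d w : err (n l) w @[l --> \oo] --> 0%E -> ed l w @[l --> \oo] --> 0.
Proof.
move=> cw; apply: (cvg_of_le_err cw) => // l.
rewrite /err /ito_error /ed EFinD; apply: leeD.
  by apply: leeDl; exact: esup_ge0.
by apply: leeDl; exact: esup_ge0.
Qed.

Let cvg_step (w : Om) s : err (n l) w @[l --> \oo] --> 0%E -> 0 <= s <= t ->
  step_integral B (phi (n l)) s w @[l --> \oo] --> I s w /\
  step_integral B (phi' (n l)) s w @[l --> \oo] --> I' s w.
Proof.
move=> cw st; split.
  apply/subr_cvg0/norm_cvg0P; apply: (cvg_of_le_err cw) => [//|l].
  rewrite /err; apply: (@le_trans _ _ (ito_error (phi (n l)) H I t w)); last first.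
    by apply: leeDl; exact: ito_error_ge0.
  rewrite /ito_error; apply: (le_trans (esup_ubound (fun s w => `|step_integral B (phi (n l)) s w - I s w|) w st)).
  by apply: leeDr; rewrite lee_fin; apply: tint_ge0 => ? _; exact: sqr_ge0.
apply/subr_cvg0/norm_cvg0P; apply: (cvg_of_le_err cw) => [//|l].
rewrite /err; apply: (@le_trans _ _ (ito_error (phi' (n l)) H' I' t w)); last first.
  by apply: leeDr; exact: ito_error_ge0.
rewrite /ito_error; apply: (le_trans (esup_ubound (fun s w => `|step_integral B (phi' (n l)) s w - I' s w|) w st)).
by apply: leeDr; rewrite lee_fin; apply: tint_ge0 => ? _; exact: sqr_ge0.
Qed.

Let f_le l s w : f l s w <= 2 * (H s w - H' s w) ^+ 2 +
  (4 * (step_eval (phi (n l)) s w - H s w) ^+ 2 + 4 * (step_eval (phi' (n l)) s w - H' s w) ^+ 2).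
Proof. exact: sqr_sub_split. Qed.

Let tint_4d l w : tint (fun s w => 4 * (step_eval (phi (n l)) s w - H s w) ^+ 2 +
   4 * (step_eval (phi' (n l)) s w - H' s w) ^+ 2) 0 t w = 4 * ed l w.
Proof.
have p4 g : proc g -> proc (fun s (w : Om) => (4 : R) * g s w).
  by apply: procM; exact: (@proc_const _ _ _ (fun=> 4)).
rewrite tintD//; [|exact: p4|exact: p4].
by rewrite !tintZ// /ed mulrDr.
Qed.

Let p2 : proc (fun s w => 2 * (H s w - H' s w) ^+ 2).
Proof. by apply: procM => //; exact: (@proc_const _ _ _ (fun=> 2)). Qed.
Let p44 l : proc (fun s w => 4 * (step_eval (phi (n l)) s w - H s w) ^+ 2 +
   4 * (step_eval (phi' (n l)) s w - H' s w) ^+ 2).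
Proof. by apply: procD; apply: procM => //; exact: (@proc_const _ _ _ (fun=> 4)). Qed.

Let tint_f_le l w : tint (f l) 0 t w <= 2 * Vfull w + 4 * ed l w.
Proof.
rewrite -tint_4d /Vfull -tintZ// -tintD//.
by apply: tint_le => //; exact: (procD p2 (p44 l)).
Qed.

Let zeta2 w : zeta w ^+ 2 <= 1.
Proof. by rewrite -[leLHS]normr_sqr// expr_le1. Qed.

Let W_le1 j l w : W j l w <= (2 * j%:R + 1) + 1.
Proof.
have c0 : 0 <= 2 * j%:R + 1 :> R by rewrite addr_ge0// mulr_ge0.
apply: le_trans (@tint_energy_cut _ _ _ (f l) (2 * j%:R + 1) s0 t w (pf l) (f0 l) c0 s00 s0t).
apply: tint_le => //.
  by apply: procM => //; exact: proc_energy_cut.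
move=> s _; rewrite /stopped_step /b !exprMn /f.
have h : energy_cut (f l) (2 * j%:R + 1) s w ^+ 2 = energy_cut (f l) (2 * j%:R + 1) s w.
  by case: (energy_cut01 (f l) (2 * j%:R + 1) s w) => ->; rewrite ?expr0n ?expr1n.
rewrite [energy_cut _ _ s w ^+ 2]h.
have := zeta2 w; set c := energy_cut _ _ _ _.
have c01 : 0 <= c by rewrite ler0n.
set y := (_ - _) ^+ 2; have y0 : 0 <= y by exact: sqr_ge0.
move: (zeta w ^+ 2) (sqr_ge0 (zeta w)) => z z0 zz.
have cy : 0 <= c * y by exact: mulr_ge0.
case: (a01 s w) => ->; first by rewrite expr0n !mul0r.
by rewrite expr1n mul1r [z * y]mulrC mulrA ler_piMr.
Qed.

Let W_le2 j l w : W j l w <= 2 * V w + 4 * ed l w.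
Proof.
have pw2 : proc (fun s w => 2 * weighted_integrand s w).
  by apply: procM => //; exact: (@proc_const _ _ _ (fun=> 2)).
apply: (@le_trans _ _ (2 * V w + tint (fun s w => 4 * (step_eval (phi (n l)) s w - H s w) ^+ 2 +
   4 * (step_eval (phi' (n l)) s w - H' s w) ^+ 2) s0 t w)); last first.
  rewrite lerD2l -tint_4d [leRHS](tint_cat w (lexx 0) s00 s0t (p44 l)) lerDr.
  by apply: tint_ge0 => s _; nneg.
rewrite /V -tintZ// -tintD//; apply: tint_le => //; first exact: procD.
move=> s _; apply: weighted_sqr_split => //; exact: energy_cut01.
Qed.

Let W_ge0 j l w : 0 <= W j l w.
Proof. by apply: tint_ge0 => s _; exact: sqr_ge0. Qed.

Let measurable_ed l : meas (ed l).
Proof. by apply: measurable_funD; exact: measurable_tint. Qed.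
Let measurable_V : meas V.
Proof. exact: measurable_tint. Qed.
Let measurable_W j l : meas (W j l).
Proof. exact: measurable_tint. Qed.

(** The constant bound [W_le1] dominates and the bound [W_le2] converges; their minimum has both
    properties, so the limit is taken even when the moment on the right is infinite. *)
Let ExW_cvg j q : exists2 u : nat -> \bar R, (forall l, (\E[P]_w (W j l w ^+ q) <= u l)%E) &
  exists2 x : \bar R, u @ \oo --> x & (x <= \E[P]_w ((2 * V w) ^+ q))%E.
Proof.
pose K : R := (2 * j%:R + 1) + 1.
have K0 : 0 <= K by rewrite !addr_ge0// mulr_ge0.
pose U l w := Num.min (K ^+ q) ((2 * V w + 4 * ed l w) ^+ q).
pose Uoo w := Num.min (K ^+ q) ((2 * V w) ^+ q).
have vd0 l w : 0 <= 2 * V w + 4 * ed l w by rewrite addr_ge0 ?mulr_ge0.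
have mU l : meas (U l).
  by apply: measurable_minr => //; apply: measurable_funX; apply: measurable_funD; apply: measurable_funM.
have mUoo : meas Uoo.
  by apply: measurable_minr => //; apply: measurable_funX; apply: measurable_funM.
exists (fun l => Ex P (U l)).
  move=> l; apply: Ex_le => //; first by move=> w; rewrite exprn_ge0.
    exact: measurable_funX.
  move=> w; rewrite /U le_min; apply/andP; split; apply: lerXn2r; rewrite ?nnegrE ?W_ge0 ?vd0//.
exists (Ex P Uoo); last first.
  apply: Ex_le => //.
  - by move=> w; rewrite /Uoo le_min !exprn_ge0// mulr_ge0.
  - by apply: measurable_funX; exact: measurable_funM.
  - by move=> w; rewrite /Uoo ge_min lexx orbT.
have := @dominated_convergence _ _ R P setT measurableT (fun l w => (U l w)%:E)
  (fun w => (Uoo w)%:E) (cst (K ^+ q)%:E).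
case => //.
- by move=> l; exact/measurable_EFinP.
- exact/measurable_EFinP.
- apply: filterS nP => w cw _; apply: cvg_EFin; first exact: nearW.
  apply: (@continuous_cvg _ _ _ _ _ _ (fun z => Num.min (K ^+ q) z)).
    by apply: continuous_min => //; exact: cvg_cst.
  apply: cvgX; rewrite -[X in _ --> X]addr0 -(mulr0 4).
  by apply: cvgD; [exact: cvg_cst|apply: cvgM; [exact: cvg_cst|exact: cvg_d]].
- apply/integrableP; split => //; rewrite integral_cst//=.
  by rewrite probability_setT mule1 ltry.
- apply: aeW => w l _; rewrite /U lee_fin ger0_norm; last by rewrite le_min !exprn_ge0.
  by rewrite ge_min lexx.
Qed.

Let pgoal q : proc (fun s w => a s w * ito_increment s w ^+ (2 * q)).
Proof.
apply: procM => //; apply: procX; apply: procM; first exact: proc_const.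
have pc J : proc J -> proc (fun (_ : R) (w : Om) => J s0 w : R).
  by move=> [+ _ _] => /(_ s0 s00); exact: proc_const.
by apply: procB; apply: procB => //; exact: pc.
Qed.

Let goal_ge0 q s w : 0 <= a s w * ito_increment s w ^+ (2 * q).
Proof.
by apply: mulr_ge0; [case: (a01 s w) => ->|rewrite exprM exprn_ge0// sqr_ge0].
Qed.

Let binc_ge0 j q l s w : 0 <= b j l s w * inc l s w ^+ (2 * q).
Proof.
by apply: mulr_ge0; [case: (b01 j l s w) => ->|rewrite exprM exprn_ge0// sqr_ge0].
Qed.

Let pbinc j q l : proc (fun s w => b j l s w * inc l s w ^+ (2 * q)).
Proof. by apply: procM => //; exact: procX. Qed.

Let pathwise_limit j q w : err (n l) w @[l --> \oo] --> 0%E ->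
  ((\1_[set w | Vfull w <= j%:R] w)%:E * esup (fun s w => a s w * ito_increment s w ^+ (2 * q))%R s0 t w <=
   limn_einf (fun l => esup (fun s w => b j l s w * inc l s w ^+ (2 * q))%R s0 t w))%E.
Proof.
move=> cw; have G0 l : (0 <= esup (fun s w => b j l s w * inc l s w ^+ (2 * q))%R s0 t w)%E.
  by apply: esup_ge0.
have cd := cvg_d cw.
rewrite indicE; case: (boolP (w \in _)) => [|_]; last first.
  rewrite mul0e; apply: le_limn_einf => y y0; apply: nearW => l.
  by apply: le_trans (G0 l); exact: ltW.
rewrite inE/= => Vj; rewrite mul1e.
apply: le_limn_einf => y /ereal_sup_gt [_ [s /= + <-]]; rewrite in_itv/= => st; rewrite lte_fin => ys.
have [as0|as1] := a01 s w.
  move: ys; rewrite as0 mul0r => y0; apply: nearW => l.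
  by apply: le_trans (G0 l); rewrite lee_fin ltW.
have s_ge0 : 0 <= s by case/andP: st => /(le_trans s00).
have st0 : 0 <= s <= t by rewrite s_ge0; case/andP: st.
have [c1 c1'] := cvg_step cw st0.
have [|c2 c2'] := @cvg_step w s0 cw; first by rewrite s00.
have ci : inc l s w ^+ (2 * q) @[l --> \oo] --> ito_increment s w ^+ (2 * q).
  apply: cvgX; apply: cvgM; first exact: cvg_cst.
  by apply: cvgB; exact: cvgB.
move: ys; rewrite as1 mul1r => ys.
near=> l.
have bl : b j l s w = 1.
  rewrite /b as1 mul1r /energy_cut (_ : (_ <= _) = true)//.
  apply: (@le_trans _ _ (tint (f l) 0 t w)); first by apply: tint_mono => //; case/andP: st.
  apply: (le_trans (tint_f_le l w)); apply: lerD.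
    by rewrite ler_pM2l.
  rewrite -ler_pdivlMl//; apply: ltW; near: l; apply: (cvgr_lt _ cd).
  by rewrite mulr_gt0// invr_gt0.
apply: le_trans (esup_ubound _ w st); rewrite lee_fin bl mul1r.
by apply: ltW; near: l; exact: cvgr_gt ci _ ys.
Unshelve. all: by end_near. Qed.

(** Two limits by Fatou: [l] grows for fixed [j] on the event where the energy is at most [j], then
    [j] grows and the events exhaust the space. The factor 2 in [2 V] is the price of replacing the
    approximating integrands by [H - H']. *)
Let ito_maximal_gen (q : nat) (C : R) : 0 <= C ->
  (forall j l, (\int[P]_w esup (fun s w => b j l s w * inc l s w ^+ (2 * q))%R s0 t w <=
     C%:E * \E[P]_w (W j l w ^+ q))%E) ->
  (\int[P]_w esup (fun s w => a s w * ito_increment s w ^+ (2 * q))%R s0 t w <=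
   C%:E * \E[P]_w ((2 * V w) ^+ q))%E.
Proof.
move=> C0 HC.
have mV : meas Vfull by exact: measurable_tint.
have mset j : measurable [set w | Vfull w <= j%:R].
  rewrite (_ : [set w | _] = Vfull @^-1` `]-oo, j%:R]); last by apply/seteqP; split => w /=; rewrite in_itv.
  by rewrite -[X in measurable X]setTI; exact: mV.
pose g j w := ((\1_[set w | Vfull w <= j%:R] w)%:E *
  esup (fun s w => a s w * ito_increment s w ^+ (2 * q))%R s0 t w)%E.
have mg j : meas (g j).
  apply: emeasurable_funM; last exact: measurable_esup.
  by apply/measurable_EFinP; exact: measurable_indic.
have g0 j w : (0 <= g j w)%E.
  by apply: mule_ge0; [rewrite lee_fin indicE ler0n|exact: esup_ge0].
have gle j : (\int[P]_w g j w <= C%:E * \E[P]_w ((2 * V w) ^+ q))%E.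
  have [u Wu [x ux xV]] := ExW_cvg j q.
  apply: (@le_trans _ _ (C%:E * x)%E); last by apply: lee_wpmul2l.
  apply: (@int_fatou _ _ _ P _ (fun l => esup (fun s w => b j l s w * inc l s w ^+ (2 * q))%R s0 t) (fun l => C%:E * u l)%E) => //.
  - by move=> l; exact: measurable_esup.
  - by move=> l w; exact: esup_ge0.
  - by apply: filterS nP => w; exact: pathwise_limit.
  - by move=> l; apply: (le_trans (HC j l)); exact: lee_wpmul2l.
  - exact: cvgeZl.
apply: (@int_fatou _ _ _ P _ g (fun=> (C%:E * \E[P]_w ((2 * V w) ^+ q))%E)) => //.
- exact: measurable_esup.
- by move=> w; exact: esup_ge0.
- apply: aeW => w; apply: le_limn_einf => y ye.
  near=> j; rewrite /g indicE mem_set ?mul1e; first exact: ltW.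
  rewrite /=; apply: (@le_trans _ _ (Num.truncn (Vfull w)).+1%:R); first exact/ltW/truncnS_gt.
  rewrite ler_nat; near: j; exact: nbhs_infty_ge.
- exact: cvg_cst.
Unshelve. all: by end_near. Qed.

Lemma ito_maximal2 :
  (\int[P]_w esup (fun s w => a s w * ito_increment s w ^+ 2)%R s0 t w <=
   64%:E * Ex P (tint weighted_integrand s0 t))%E.
Proof.
apply: (le_trans (@ito_maximal_gen 1 32 _ _)) => // [j l|].
  exact: (step_maximal2 cF BM (sphi (n l)) (sphi' (n l)) (b01 j l) (bmono j l) (pb j l) (Fb j l)).
rewrite (_ : (fun w => (2 * V w) ^+ 1) = fun w => 2 * V w)// ExZ//.
by rewrite muleA -EFinM (_ : 32 * 2 = 64)//; ring.
Qed.

Lemma ito_maximal4 :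
  (\int[P]_w esup (fun s w => a s w * ito_increment s w ^+ 4)%R s0 t w <=
   (2 * (128 * (32 * 8)) * 4)%:E * \E[P]_w (tint weighted_integrand s0 t w ^+ 2))%E.
Proof.
have C0 : 0 <= 2 * (128 * (32 * 8)) :> R by rewrite !mulr_ge0.
have HC j l := step_maximal4 cF BM (sphi (n l)) (sphi' (n l)) (b01 j l) (bmono j l) (pb j l) (Fb j l) Fz z1 s00 s0t.
apply: (le_trans (@ito_maximal_gen 2 _ C0 HC)).
rewrite (_ : (fun w => (2 * V w) ^+ 2) = fun w => 4 * V w ^+ 2); last by apply/funext => w; ring.
rewrite ExZ//; last exact: measurable_funX.
by rewrite muleA -EFinM.
by move=> w; exact: sqr_ge0.
Qed.

End maximal.
End ito.

(** * Moments of solutions *)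

Section amplitude_cut.
Context {R : realType} {d} {Om : measurableType d}.
Implicit Types f : R -> Om -> R.

(* A decreasing adapted {0,1}-valued process, used in place of a stopping time. *)
Definition amplitude_cut f (c s : R) (w : Om) : R :=
  `[< forall r, 0 <= r <= s -> `|f r w| <= c >]%:R.

Lemma amplitude_cut01 f c s w : amplitude_cut f c s w = 0 \/ amplitude_cut f c s w = 1.
Proof. by rewrite /amplitude_cut; case: asboolP => _; [right|left]. Qed.

Lemma amplitude_cut_le f c s w r : amplitude_cut f c s w = 1 -> 0 <= r <= s -> `|f r w| <= c.
Proof.
rewrite /amplitude_cut; case: asboolP => [h _ rs|_ /eqP]; first exact: h.
by rewrite eq_sym oner_eq0.
Qed.

Lemma amplitude_cut_mono f c s s' w : 0 <= s -> s <= s' ->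
  amplitude_cut f c s' w <= amplitude_cut f c s w.
Proof.
move=> s0 ss'; rewrite /amplitude_cut; case: asboolP => // h.
rewrite asboolT// => r /andP[r0 rs]; apply: h.
by rewrite r0 (le_trans rs).
Qed.

Lemma amplitude_cut_eventually f s w : locbdd f ->
  \forall n \near \oo, amplitude_cut f n%:R s w = 1.
Proof.
move=> /(_ w s)[c hc]; near=> n.
rewrite /amplitude_cut asboolT// => r rs; apply: (le_trans (hc r rs)).
apply: (@le_trans _ _ (Num.truncn c).+1%:R); first exact/ltW/truncnS_gt.
by rewrite ler_nat; near: n; exact: nbhs_infty_ge.
Unshelve. all: by end_near. Qed.

Lemma amplitude_cut_esup f c s w :
  amplitude_cut f c s w = (esup (fun s w => `|f s w|%R) 0 s w <= c%:E)%E%:R.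
Proof.
rewrite /amplitude_cut; congr (_ %:R); congr nat_of_bool; apply/asboolP/idP.
  by move=> h; apply: esup_le => r rs; rewrite lee_fin; exact: h.
by move=> h r rs; rewrite -lee_fin; apply: le_trans h; exact: (esup_ubound _ _ rs).
Qed.

Lemma measurable_amplitude_cut f c s : 0 <= s -> proc f ->
  meas (amplitude_cut f c s).
Proof.
move=> s0 pf; rewrite (_ : amplitude_cut f c s =
   fun w => \1_([set x | (x <= c%:E)%E]) (esup (fun s w => `|f s w|%R) 0 s w)).
  apply: measurableT_comp.
    apply: measurable_indic; rewrite -[X in measurable X]setTI.
    exact: (emeasurable_fun_le measurableT).
  by apply: measurable_esup => //; exact: proc_abs.
apply/funext => w; rewrite amplitude_cut_esup indicE; congr (nat_of_bool _)%:R.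
by apply/idP/idP; rewrite inE.
Qed.

Lemma proc_amplitude_cut f c : proc f -> proc (amplitude_cut f c).
Proof.
move=> pf; split.
- by move=> s s0; exact: measurable_amplitude_cut.
- move=> w s u s0 us cu; have [h|h] := amplitude_cut01 f c s w; last first.
    rewrite h; apply: cvg_near_cst; apply: nearW => k; have /andP[u0 uks] := us k.
    have := amplitude_cut_mono f c w u0 uks; rewrite h.
    by case: (amplitude_cut01 f c (u k) w) => -> //; rewrite ler10.
  rewrite h; apply: cvg_near_cst.
  have [r /andP[r0 rs] cr] : exists2 r, 0 <= r <= s & c < `|f r w|.
    apply: contrapT => hh; move: h; rewrite /amplitude_cut asboolT; first by move/eqP; rewrite oner_eq0.
    by move=> r rs; rewrite leNgt; apply/negP => cr; apply: hh; exists r.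
  suff : \forall k \near \oo, exists2 v, 0 <= v <= u k & c < `|f v w|.
    apply: filterS => k [v vu cv]; rewrite /amplitude_cut asboolF// => hv.
    by have := hv v vu; rewrite leNgt cv.
  (* The level is exceeded at some [r <= s]. For [r < s] the times [u k] eventually pass [r]; for
     [r = s], left continuity of [f] makes the level exceeded at [u k] itself. *)
  move: rs; rewrite le_eqVlt => /orP[/eqP rs|rs].
    have [_ lf _] := proc_abs pf.
    have cf := lf w s u s0 us cu; rewrite -rs in cf.
    apply: filterS (cvgr_gt _ cf _ cr) => k ck.
    by exists (u k) => //; rewrite lexx andbT; case/andP: (us k).
  apply: filterS (cvgr_gt _ cu _ rs) => k rk.
  by exists r => //; rewrite r0 ltW.
- by move=> w t; exists 1 => s _; case: (amplitude_cut01 f c s w) => ->; rewrite ?normr0 ?normr1.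
Qed.

End amplitude_cut.

Lemma adapted_amplitude_cut {R : realType} {d} {Om : measurableType d} (P : probability Om R) (F : R -> set (set Om)) (f : R -> Om -> R) c :
  complete_filtration P F -> proc f -> adapted F f -> adapted F (amplitude_cut f c).
Proof.
move=> cF pf af s s0; apply: (fun_wrt cF) => //.
have e : (amplitude_cut f c s : g_sigma_algebraType (F s) -> R) =
    amplitude_cut (fun r (w : g_sigma_algebraType (F s)) => f (Num.min r s) w) c s; last first.
  by rewrite e; exact: (measurable_amplitude_cut c s0 (proc_capped cF s0 pf af)).
apply/funext => w; rewrite /amplitude_cut; congr (_ %:R); congr nat_of_bool.
by apply/asboolP/asboolP => h r rs; have := h r rs; rewrite min_l//; case/andP: rs.
Qed.

Lemma powD2_le {R : realType} (x y : R) : (x + y) ^+ (2 * 1) <= 2 * (x ^+ (2 * 1) + y ^+ (2 * 1)).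
Proof. by rewrite muln1; have := sqr_ge0 (x - y); nra. Qed.

Lemma powD4_le {R : realType} (x y : R) : (x + y) ^+ (2 * 2) <= 8 * (x ^+ (2 * 2) + y ^+ (2 * 2)).
Proof.
rewrite !exprM; apply: (@le_trans _ _ ((2 * (x ^+ 2 + y ^+ 2)) ^+ 2)).
  by apply: lerXn2r; rewrite ?nnegrE ?sqr_ge0//; nneg; have := sqr_ge0 (x - y); nra.
by have := sqr_ge0 (x ^+ 2 - y ^+ 2); nra.
Qed.

(** * Drift and stochastic integral together *)

Section noise.
Context {R : realType} {d} {Om : measurableType d} (P : probability Om R).
Variables (F : R -> set (set Om)) (B : R -> Om -> R).
Hypotheses (cF : complete_filtration P F) (BM : brownian_motion P F B).

(** Taken as second process, it specialises the inequalities for differences of two processes to a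
    single one. *)
Lemma ito_integral_zero : ito_integral P F B (fun _ _ => 0) (fun _ _ => 0).
Proof.
split.
- by move=> t t0; apply: (fun_wrt cF) => //; exact: measurable_cst.
- by move=> w; exact: (@continuous_subspaceT _ _ _ _ (@cst_continuous _ _ 0)).
exists (fun=> StepProcess 0 (fun=> 0) (fun _ _ => 0)); split.
  move=> _; split => //=; last by exists 0 => k w; rewrite normr0.
  by move=> k; apply: (fun_wrt cF) => //; exact: measurable_cst.
move=> t t0; split => e e0.
  rewrite (_ : (fun n => _) = fun=> 0%E); first exact: cvg_cst.
  apply/funext => n; rewrite (_ : [set w | _] = set0) ?measure0//.
  apply/seteqP; split => w //=; rewrite integral0_eq ?lee_fin ?leNgt ?e0// => s _.
  by rewrite /step_eval big_ord0 subrr expr0n.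
rewrite (_ : (fun n => _) = fun=> 0%E); first exact: cvg_cst.
apply/funext => n; rewrite (_ : [set w | _] = set0) ?measure0//.
apply/seteqP; split => w //=; apply/negP; rewrite -ltNge.
apply: (@le_lt_trans _ _ 0%E); rewrite ?lte_fin//.
apply: ge_ereal_sup => _ [s _ <-].
by rewrite /step_integral big_ord0 subrr normr0.
Qed.

Variables (beta H I beta' H' I' : R -> Om -> R).
Hypotheses (pbeta : proc beta) (pbeta' : proc beta') (pH : proc H) (pH' : proc H').
Hypotheses (iI : ito_integral P F B H I) (iI' : ito_integral P F B H' I').
Variables (a : R -> Om -> R) (zeta : Om -> R) (s0 t : R).
Hypotheses (a01 : forall s w, a s w = 0 \/ a s w = 1).
Hypotheses (amono : forall s s' w, 0 <= s -> s <= s' -> a s' w <= a s w).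
Hypotheses (pa : proc a) (Fa : forall s, 0 <= s -> measurable_wrt (F s) (a s)).
Hypotheses (Fz : measurable_wrt (F 0) zeta) (z1 : forall w, `|zeta w| <= 1).
Hypotheses (s00 : 0 <= s0) (s0t : s0 <= t).

Definition noise (beta I : R -> Om -> R) s w := tint beta 0 s w + I s w.
Definition noise_increment s w := zeta w *
  ((noise beta I s w - noise beta I s0 w) - (noise beta' I' s w - noise beta' I' s0 w)).
Definition weighted_drift s w := a s w * `|zeta w * (beta s w - beta' s w)|.

Let mz : meas zeta := filtration_measurable cF (lexx 0) Fz.
Let pz : proc (fun (_ : R) w => zeta w) := proc_const mz.
Let pinc : proc (ito_increment I I' zeta s0).
Proof.
apply: procM => //.
have pc J : proc J -> proc (fun (_ : R) (w : Om) => J s0 w : R).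
  by move=> [+ _ _] => /(_ s0 s00); exact: proc_const.
have := proc_ito cF iI; have := proc_ito cF iI' => p p'.
by apply: procB; apply: procB => //; exact: pc.
Qed.
Let pD : proc (fun s w => zeta w * (beta s w - beta' s w)).
Proof. by apply: procM => //; exact: procB. Qed.
Let pwd : proc weighted_drift.
Proof. by apply: procM => //; exact: proc_abs. Qed.
Let pai q : proc (fun s w => a s w * ito_increment I I' zeta s0 s w ^+ (2 * q)).
Proof. by apply: procM => //; exact: procX. Qed.
Let a_ge0 s w : 0 <= a s w. Proof. by case: (a01 s w) => ->. Qed.
Let even_ge0 (x : R) q : 0 <= x ^+ (2 * q). Proof. by rewrite exprM exprn_ge0// sqr_ge0. Qed.

Lemma weighted_drift_ge0 s w : 0 <= weighted_drift s w.
Proof. by rewrite mulr_ge0. Qed.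

Lemma noise_pathwise q (k : R) s w : (forall x y : R, (x + y) ^+ (2 * q) <= k * (x ^+ (2 * q) + y ^+ (2 * q))) ->
  0 <= k -> s0 <= s <= t -> a s w * noise_increment s w ^+ (2 * q) <=
  k * (tint weighted_drift s0 t w ^+ (2 * q) + a s w * ito_increment I I' zeta s0 s w ^+ (2 * q)).
Proof.
move=> hk k0 /andP[s0s st]; have s_ge0 : 0 <= s by exact: le_trans s0s.
case: (a01 s w) => as_; rewrite as_; first by rewrite !mul0r addr0 mulr_ge0.
rewrite !mul1r (_ : noise_increment s w = tint (fun s w => zeta w * (beta s w - beta' s w)) s0 s w +
   ito_increment I I' zeta s0 s w); last first.
  rewrite /noise_increment /noise (tint_cat w (lexx 0) s00 s0s pbeta) (tint_cat w (lexx 0) s00 s0s pbeta').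
  rewrite (_ : tint (fun s w => zeta w * (beta s w - beta' s w)) s0 s w =
     zeta w * tint (fun s w => beta s w - beta' s w) s0 s w); last first.
    by rewrite -(tintZ (zeta w) s w s00 (procB pbeta pbeta')); exact: tint_eq.
  by rewrite tintB// /ito_increment; ring.
apply: (le_trans (hk _ _)); rewrite ler_wpM2l// lerD2r.
rewrite !exprM; apply: lerXn2r; rewrite ?nnegrE ?sqr_ge0//.
rewrite -[leLHS]normr_sqr//; apply: lerXn2r; rewrite ?nnegrE//.
  by apply: tint_ge0 => r _; exact: weighted_drift_ge0.
apply: (le_trans (norm_tint s w s00 pD)).
apply: (@le_trans _ _ (tint weighted_drift s0 s w)).
  apply: tint_le => //; first exact: proc_abs.
  move=> r /andP[s0r rs]; rewrite /weighted_drift.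
  have r0 : 0 <= r by exact: le_trans s0r.
  by have := amono w r0 rs; rewrite as_; case: (a01 r w) => ->; rewrite ?ler10// mul1r.
rewrite [leRHS](tint_cat w s00 s0s st pwd) lerDl; apply: tint_ge0 => r _; exact: weighted_drift_ge0.
Qed.

Lemma noise_maximal q (k : R) : (forall x y : R, (x + y) ^+ (2 * q) <= k * (x ^+ (2 * q) + y ^+ (2 * q))) ->
  0 <= k ->
  (\int[P]_w esup (fun s w => a s w * noise_increment s w ^+ (2 * q))%R s0 t w <=
   k%:E * \E[P]_w (tint weighted_drift s0 t w ^+ (2 * q)) +
   k%:E * \int[P]_w esup (fun s w => a s w * ito_increment I I' zeta s0 s w ^+ (2 * q))%R s0 t w)%E.
Proof.
move=> hk k0.
have mwd : meas (fun w => tint weighted_drift s0 t w ^+ (2 * q)).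
  by apply: measurable_funX; exact: measurable_tint.
have mes : meas (esup (fun s w => a s w * ito_increment I I' zeta s0 s w ^+ (2 * q))%R s0 t).
  exact: measurable_esup.
have es0 w : (0 <= esup (fun s w => a s w * ito_increment I I' zeta s0 s w ^+ (2 * q))%R s0 t w)%E.
  by apply: esup_ge0 => // s; rewrite mulr_ge0.
rewrite -muleDr; last 2 first.
- by [].
- by rewrite ge0_adde_def// inE; [exact: Ex_ge0|exact: integral_ge0].
rewrite /Ex -ge0_integralD//; last 2 first.
- by move=> w _; rewrite lee_fin.
- exact/measurable_EFinP.
rewrite -ge0_integralZl//; last 2 first.
- by apply: emeasurable_funD => //; exact/measurable_EFinP.
- by move=> w _; rewrite adde_ge0// lee_fin.
apply: ge0_le_integral => //.
- by move=> w _; apply: esup_ge0 => // s; rewrite mulr_ge0.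
- apply: measurable_esup => //; apply: procM => //; apply: procX; apply: procM => //.
  have pn b J : proc b -> proc J -> proc (noise b J).
    by move=> pb pJ; apply: procD => //; exact: proc_tint.
  have pc b J : proc b -> proc J -> proc (fun (_ : R) w => noise b J s0 w).
    by move=> pb pJ; apply: proc_const; have [h _ _] := pn b J pb pJ; exact: h.
  have p1 := proc_ito cF iI; have p2 := proc_ito cF iI'.
  by apply: procB; apply: procB; [exact: pn|exact: pc|exact: pn|exact: pc].
- apply: measurable_funeM; apply: emeasurable_funD => //; exact/measurable_EFinP.
- move=> w _; apply: esup_le => s st.
  apply: (@le_trans _ _ (k * (tint weighted_drift s0 t w ^+ (2 * q) + a s w * ito_increment I I' zeta s0 s w ^+ (2 * q)))%:E).
    by rewrite lee_fin; exact: noise_pathwise.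
  rewrite EFinM lee_wpmul2l ?lee_fin// EFinD leeD2lE//.
  exact: (esup_ubound (fun s w => a s w * ito_increment I I' zeta s0 s w ^+ (2 * q))).
Qed.

Lemma noise_maximal2 :
  (\int[P]_w esup (fun s w => a s w * noise_increment s w ^+ 2)%R s0 t w <=
   2%:E * \E[P]_w (tint weighted_drift s0 t w ^+ 2) +
   (2 * 64)%:E * Ex P (tint (weighted_integrand H H' a zeta) s0 t))%E.
Proof.
apply: (le_trans (@noise_maximal 1 2 powD2_le _)) => //.
rewrite EFinM -muleA; apply: leeD => //; apply: lee_wpmul2l => //.
exact: (ito_maximal2 cF BM pH pH').
Qed.

Lemma noise_maximal4 :
  (\int[P]_w esup (fun s w => a s w * noise_increment s w ^+ 4)%R s0 t w <=
   8%:E * \E[P]_w (tint weighted_drift s0 t w ^+ 4) +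
   (8 * (2 * (128 * (32 * 8)) * 4))%:E *
     \E[P]_w (tint (weighted_integrand H H' a zeta) s0 t w ^+ 2))%E.
Proof.
apply: (le_trans (@noise_maximal 2 8 powD4_le _)) => //.
rewrite EFinM -muleA; apply: leeD => //; apply: lee_wpmul2l => //.
exact: (ito_maximal4 cF BM pH pH').
Qed.

End noise.

Section real_inequalities.
Context {R : realType}.
Implicit Types x y z : R.

Lemma sqrD3_le x y z : (x + y + z) ^+ 2 <= 3 * (x ^+ 2 + y ^+ 2 + z ^+ 2).
Proof. by have := sqr_ge0 (x - y); have := sqr_ge0 (y - z); have := sqr_ge0 (x - z); nra. Qed.

Lemma pow4D3_le x y z : (x + y + z) ^+ 4 <= 27 * (x ^+ 4 + y ^+ 4 + z ^+ 4).
Proof.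
have e u : u ^+ 4 = (u ^+ 2) ^+ 2 :> R by rewrite -exprM.
rewrite !e; apply: (@le_trans _ _ ((3 * (x ^+ 2 + y ^+ 2 + z ^+ 2)) ^+ 2)).
  by apply: lerXn2r; rewrite ?nnegrE ?sqr_ge0 ?sqrD3_le//; nneg.
by rewrite exprMn; have := sqrD3_le (x ^+ 2) (y ^+ 2) (z ^+ 2); lra.
Qed.

Lemma sqrD_le x y : (x + y) ^+ 2 <= 2 * (x ^+ 2 + y ^+ 2).
Proof. exact: powD2_le. Qed.

Lemma pow4D_le8 x y : (x + y) ^+ 4 <= 8 * (x ^+ 4 + y ^+ 4).
Proof. exact: powD4_le. Qed.

Variables (g : R -> R) (L : R).
Hypotheses (L0 : 0 <= L) (g0 : `|g 0| <= L) (gL : lip L g).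

Lemma lip_growth x : `|g x| <= L * (1 + `|x|).
Proof.
rewrite -[g x](subrK (g 0)) (le_trans (ler_normD _ _))// mulrDr mulr1 addrC.
by apply: lerD => //; have := gL x 0; rewrite subr0.
Qed.

Lemma lip_growth2 x : g x ^+ 2 <= 2 * L ^+ 2 * (1 + x ^+ 2).
Proof.
rewrite -[leLHS]normr_sqr//; apply: (@le_trans _ _ ((L * (1 + `|x|)) ^+ 2)).
  by apply: lerXn2r; rewrite ?nnegrE ?lip_growth//; nneg.
rewrite exprMn (_ : 2 * L ^+ 2 * (1 + x ^+ 2) = L ^+ 2 * (2 * (1 + x ^+ 2))); last by ring.
apply: ler_wpM2l; first exact: sqr_ge0.
by have := sqrD_le 1 `|x|; rewrite normr_sqr// expr1n.
Qed.

Lemma lip_growth4 x : g x ^+ 4 <= 8 * L ^+ 4 * (1 + x ^+ 4).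
Proof.
have e u : u ^+ 4 = (u ^+ 2) ^+ 2 :> R by rewrite -exprM.
rewrite [leLHS]e; apply: (@le_trans _ _ ((2 * L ^+ 2 * (1 + x ^+ 2)) ^+ 2)).
  by apply: lerXn2r; rewrite ?nnegrE ?sqr_ge0 ?lip_growth2//; nneg.
have := sqrD_le 1 (x ^+ 2); rewrite expr1n -!e => h.
rewrite exprMn exprMn -e (_ : 8 * L ^+ 4 * (1 + x ^+ 4) = 2 ^+ 2 * L ^+ 4 * (2 * (1 + x ^+ 4))); last by ring.
by apply: ler_wpM2l => //; nneg.
Qed.

End real_inequalities.

Lemma Ex_le_ae {d} {T : measurableType d} {R : realType} (P : {measure set T -> \bar R})
  (f g : T -> R) : (forall w, 0 <= f w) -> (forall w, 0 <= g w) -> meas f ->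
  meas g -> {ae P, forall w, f w <= g w} -> (Ex P f <= Ex P g)%E.
Proof.
move=> f0 g0 mf mg fg; apply: ae_ge0_le_integral => //.
- by move=> w _; rewrite lee_fin.
- exact/measurable_EFinP.
- by move=> w _; rewrite lee_fin.
- exact/measurable_EFinP.
- by apply: filterS fg => w h _; rewrite lee_fin.
Qed.

(** Iterating from the a priori bound [K] gives [2 c0 + K / 2^k], and [c0 + N / 2] has the fixed
    point [2 c0]. Working with exponential bounds avoids integrating [u] itself. *)
Lemma gronwall_weighted {R : realType} (u : R -> \bar R) (T K c0 lam : R) : 0 <= c0 -> 0 <= K -> 0 <= lam ->
  (forall t, 0 <= t <= T -> (u t <= K%:E)%E) ->
  (forall N, 0 <= N -> (forall t, 0 <= t <= T -> (u t <= (N * expR (lam * t))%:E)%E) ->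
    forall t, 0 <= t <= T -> (u t <= ((c0 + N / 2) * expR (lam * t))%:E)%E) ->
  forall t, 0 <= t <= T -> (u t <= (2 * c0 * expR (lam * t))%:E)%E.
Proof.
move=> c00 K0 lam0 uK step t tT.
have it k s : 0 <= s <= T -> (u s <= ((2 * c0 + K / 2 ^+ k) * expR (lam * s))%:E)%E.
  elim: k s => [|k IH] s sT.
    apply: (le_trans (uK s sT)); rewrite lee_fin expr0 divr1.
    have := @expR_ge1Dx _ (lam * s); have : 0 <= lam * s by rewrite mulr_ge0//; case/andP: sT.
    move=> h1 h2; have h3 : 1 <= expR (lam * s) by lra.
    by apply: (@le_trans _ _ (2 * c0 + K)); [lra|apply: ler_peMr h3; lra].
  have N0 : 0 <= 2 * c0 + K / 2 ^+ k by rewrite addr_ge0 ?mulr_ge0 ?divr_ge0// exprn_ge0.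
  apply: (le_trans (step _ N0 IH s sT)); rewrite lee_fin ler_wpM2r ?expR_ge0//.
  by rewrite exprS invfM; lra.
apply/lee_addgt0Pr => e e0.
have cv : K / 2 ^+ k * expR (lam * t) @[k --> \oo] --> (0 : R).
  rewrite -[X in _ --> X](mul0r (expR (lam * t))); apply: cvgM; last exact: cvg_cst.
  by rewrite -(mulr0 K); apply: cvgM; [exact: cvg_cst|exact: cvg_inv_pow2].
have [k _ hk] : \forall k \near \oo, K / 2 ^+ k * expR (lam * t) < e by apply: (cvgr_lt 0 cv).
apply: (le_trans (it k t tT)); rewrite -EFinD lee_fin mulrDl lerD2l.
exact: ltW (hk k (leqnn k)).
Qed.

(** * Time integrals under exponential moment bounds *)

Section exponential_moments.
Context {R : realType} {d} {T : measurableType d} (P : probability T R).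
Variables (g : R -> T -> R) (pg : proc g).

(** Half of the rate [c] is spent on the weight in Cauchy-Schwarz and half remains to be integrated;
    each half contributes [2 / c]. *)
Lemma Ex_sqr_tint_expR (k c t : R) : 0 <= t -> 0 < c -> 0 <= k ->
  (forall s, 0 <= s <= t -> (\E[P]_w (g s w ^+ 2) <= (k * expR (c * s))%:E)%E) ->
  (\E[P]_w (tint g 0 t w ^+ 2) <= (k * (4 / c ^+ 2) * expR (c * t))%:E)%E.
Proof.
move=> t0 c0 k0 hg; have c20 : 0 < c / 2 by rewrite divr_gt0.
have pe : proc (fun s (w : T) => g s w ^+ 2 * expR (- (c / 2) * s)).
  by apply: procM; [exact: procX|exact: proc_expR].
have mt : meas (tint (fun s w => g s w ^+ 2 * expR (- (c / 2) * s)) 0 t) by exact: measurable_tint.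
have e0 : 0 <= expR (c / 2 * t) / (c / 2) by rewrite divr_ge0 ?expR_ge0// ltW.
have g0 s w : 0 <= g s w ^+ 2 * expR (- (c / 2) * s) by rewrite mulr_ge0 ?sqr_ge0 ?expR_ge0.
apply: (@le_trans _ _ (\E[P]_w (expR (c / 2 * t) / (c / 2) *
    tint (fun s w => g s w ^+ 2 * expR (- (c / 2) * s)) 0 t w))).
  apply: Ex_le => //.
  - by move=> w; exact: sqr_ge0.
  - by apply: measurable_funX; exact: measurable_tint.
  - by mea.
  - by move=> w; exact: sqr_tint_expR.
rewrite ExZ//; last by move=> w; apply: tint_ge0.
apply: (@le_trans _ _ ((expR (c / 2 * t) / (c / 2))%:E * (k * (expR (c / 2 * t) / (c / 2)))%:E)%E).
  apply: lee_wpmul2l; first by rewrite lee_fin.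
  apply: Ex_tint_expR => // s st.
  have [mg _ _] := pg; have mgs : meas (g s) by apply: mg; case/andP: st.
  rewrite (_ : (fun w => g s w ^+ 2 * _) = fun w => expR (- (c / 2) * s) * g s w ^+ 2); last first.
    by apply/funext => w; rewrite mulrC.
  rewrite ExZ ?expR_ge0//; [|by move=> w; exact: sqr_ge0|by mea].
  apply: (le_trans (lee_wpmul2l _ (hg s st))); first by rewrite lee_fin expR_ge0.
  rewrite -EFinM lee_fin mulrCA -expRD le_eqVlt (_ : - (c / 2) * s + c * s = c / 2 * s) ?eqxx//; by field.
rewrite -EFinM lee_fin; apply: eq_leW.
rewrite (_ : c * t = c / 2 * t + c / 2 * t); last by field.
by rewrite expRD; field; rewrite gt_eqF.
Qed.

Lemma Ex_tint_expRZ (k c t : R) : 0 <= t -> 0 < c -> 0 <= k -> (forall s w, 0 <= g s w) ->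
  (forall s, 0 <= s <= t -> (Ex P (g s) <= (k * expR (c * s))%:E)%E) ->
  (Ex P (tint g 0 t) <= (k * c^-1 * expR (c * t))%:E)%E.
Proof.
move=> t0 c0 k0 g0 hg; apply: (le_trans (Ex_tint_expR t0 c0 k0 pg g0 hg)).
by rewrite lee_fin -mulrA [c^-1 * _]mulrC.
Qed.

Lemma Ex_sqr_tint_cst (a t k : R) : 0 <= a -> a <= t -> 0 <= k ->
  (forall s, a <= s <= t -> (\E[P]_w (g s w ^+ 2) <= k%:E)%E) ->
  (\E[P]_w (tint g a t w ^+ 2) <= (k * (t - a) ^+ 2)%:E)%E.
Proof.
move=> a0 at_ k0 hg; have p2 : proc (fun s w => g s w ^+ 2) by exact: procX.
have ta : 0 <= t - a by rewrite subr_ge0.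
have mt : meas (tint (fun s w => g s w ^+ 2) a t) by exact: measurable_tint.
apply: (@le_trans _ _ (\E[P]_w ((t - a) * tint (fun s w => g s w ^+ 2) a t w))).
  apply: Ex_le => //.
  - by move=> w; exact: sqr_ge0.
  - by apply: measurable_funX; exact: measurable_tint.
  - by mea.
  - by move=> w; exact: sqr_tint.
rewrite ExZ//; last by move=> w; apply: tint_ge0 => s _; exact: sqr_ge0.
rewrite expr2 mulrA mulrC EFinM; apply: lee_wpmul2l; first by rewrite lee_fin.
by apply: Ex_tint_cst => // s w; exact: sqr_ge0.
Qed.

End exponential_moments.

Section exponential_moments4.
Context {R : realType} {d} {T : measurableType d} (P : probability T R).
Variables (g : R -> T -> R) (pg : proc g).

(** Cauchy-Schwarz with rate [c / 4] in the weight reduces it to the second moment of the integral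
    of [g'], whose square has rate [c / 2]; altogether [(4/c)^2 . 4/(c/2)^2 = (4/c)^4]. *)
Lemma Ex_pow4_tint_expR (k c t : R) : 0 <= t -> 0 < c -> 0 <= k ->
  (forall s, 0 <= s <= t -> (\E[P]_w (g s w ^+ 4) <= (k * expR (c * s))%:E)%E) ->
  (\E[P]_w (tint g 0 t w ^+ 4) <= (k * (4 / c) ^+ 4 * expR (c * t))%:E)%E.
Proof.
move=> t0 c0 k0 hg; have c40 : 0 < c / 4 by rewrite divr_gt0.
have c20 : 0 < c / 2 by rewrite divr_gt0.
pose g' s (w : T) := g s w ^+ 2 * expR (- (c / 4) * s).
have pe : proc g' by apply: procM; [exact: procX|exact: proc_expR].
have mt : meas (tint g' 0 t) by exact: measurable_tint.
have g0 s w : 0 <= g' s w by rewrite mulr_ge0 ?sqr_ge0 ?expR_ge0.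
pose e := expR (c / 4 * t) / (c / 4).
have e0 : 0 <= e by rewrite divr_ge0 ?expR_ge0// ltW.
apply: (@le_trans _ _ (\E[P]_w (e ^+ 2 * tint g' 0 t w ^+ 2))).
  apply: Ex_le => //.
  - by move=> w; rewrite exprn_even_ge0.
  - by apply: measurable_funX; exact: measurable_tint.
  - by mea.
  - move=> w; rewrite -exprMn (_ : _ ^+ 4 = (tint g 0 t w ^+ 2) ^+ 2); last by rewrite -exprM.
    apply: lerXn2r; rewrite ?nnegrE ?sqr_ge0//.
      by rewrite mulr_ge0//; apply: tint_ge0.
    exact: sqr_tint_expR.
rewrite ExZ ?sqr_ge0//; [|by move=> w; exact: sqr_ge0|by mea].
apply: (@le_trans _ _ ((e ^+ 2)%:E * (k * (4 / (c / 2) ^+ 2) * expR (c / 2 * t))%:E)%E).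
  apply: lee_wpmul2l; first by rewrite lee_fin sqr_ge0.
  apply: Ex_sqr_tint_expR => // s st.
  have [mg _ _] := pg; have mgs : meas (g s) by apply: mg; case/andP: st.
  rewrite (_ : (fun w => g' s w ^+ 2) = fun w => expR (- (c / 2) * s) * g s w ^+ 4); last first.
    apply/funext => w; rewrite /g' exprMn -exprM mulrC; congr (_ * _).
    by rewrite expr2 -expRD; congr expR; field.
  rewrite ExZ ?expR_ge0//; [|by move=> w; rewrite exprn_even_ge0|by mea].
  apply: (le_trans (lee_wpmul2l _ (hg s st))); first by rewrite lee_fin expR_ge0.
  rewrite -EFinM lee_fin mulrCA -expRD le_eqVlt (_ : - (c / 2) * s + c * s = c / 2 * s) ?eqxx//; by field.
rewrite -EFinM lee_fin; apply: eq_leW.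
rewrite (_ : c * t = c / 2 * t + (c / 4 * t + c / 4 * t)); last by field.
rewrite /e expRD [expR (_ + _)]expRD; field; by rewrite gt_eqF.
Qed.

Lemma Ex_pow4_tint_cst (a t k : R) : 0 <= a -> a <= t -> 0 <= k ->
  (forall s, a <= s <= t -> (\E[P]_w (g s w ^+ 4) <= k%:E)%E) ->
  (\E[P]_w (tint g a t w ^+ 4) <= (k * (t - a) ^+ 4)%:E)%E.
Proof.
move=> a0 at_ k0 hg; have p2 : proc (fun s w => g s w ^+ 2) by exact: procX.
have ta : 0 <= t - a by rewrite subr_ge0.
have mt : meas (tint (fun s w => g s w ^+ 2) a t) by exact: measurable_tint.
apply: (@le_trans _ _ (\E[P]_w ((t - a) ^+ 2 * tint (fun s w => g s w ^+ 2) a t w ^+ 2))).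
  apply: Ex_le => //.
  - by move=> w; rewrite exprn_even_ge0.
  - by apply: measurable_funX; exact: measurable_tint.
  - by mea.
  - move=> w; rewrite -exprMn (_ : _ ^+ 4 = (tint g a t w ^+ 2) ^+ 2); last by rewrite -exprM.
    apply: lerXn2r; rewrite ?nnegrE ?sqr_ge0//.
      by rewrite mulr_ge0//; apply: tint_ge0 => s _; exact: sqr_ge0.
    exact: sqr_tint.
rewrite ExZ ?sqr_ge0//; [|by move=> w; exact: sqr_ge0|by mea].
apply: (@le_trans _ _ (((t - a) ^+ 2)%:E * (k * (t - a) ^+ 2)%:E)%E); last first.
  by rewrite -EFinM lee_fin mulrCA -exprD.
apply: lee_wpmul2l; first by rewrite lee_fin sqr_ge0.
apply: Ex_sqr_tint_cst => // s st.
by rewrite (_ : (fun w => _) = fun w => g s w ^+ 4); [exact: hg|apply/funext => w; rewrite -exprM].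
Qed.

End exponential_moments4.

Section single_noise.
Context {R : realType} {d} {Om : measurableType d} (P : probability Om R).
Variables (F : R -> set (set Om)) (B : R -> Om -> R).
Hypotheses (cF : complete_filtration P F) (BM : brownian_motion P F B).
Variables (beta H I : R -> Om -> R) (pbeta : proc beta) (pH : proc H).
Hypothesis iI : ito_integral P F B H I.

Lemma proc_noise : proc (noise beta I).
Proof. by apply: procD; [exact: proc_tint|exact: (proc_ito cF iI)]. Qed.

Variables (a : R -> Om -> R) (zeta : Om -> R) (s0 t : R).
Hypotheses (a01 : forall s w, a s w = 0 \/ a s w = 1).
Hypotheses (amono : forall s s' w, 0 <= s -> s <= s' -> a s' w <= a s w).
Hypotheses (pa : proc a) (Fa : adapted F a).
Hypotheses (Fz : measurable_wrt (F 0) zeta) (z1 : forall w, `|zeta w| <= 1).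
Hypotheses (s00 : 0 <= s0) (s0t : s0 <= t).

Let D w := zeta w * (noise beta I t w - noise beta I s0 w).

Let mz : meas zeta := filtration_measurable cF (lexx 0) Fz.
Let pz : proc (fun (_ : R) w => zeta w) := proc_const mz.

Let DE w : noise_increment beta I (fun _ _ => 0) (fun _ _ => 0) zeta s0 t w = D w.
Proof.
have t0 := le_trans s00 s0t.
by rewrite /noise_increment /D {3 4}/noise (tint_cst 0 w t0) (tint_cst 0 w s00) !mul0r !addr0 !subr0.
Qed.

Let measurable_at : meas (a t).
Proof. by have [h _ _] := pa; apply: h; exact: le_trans s0t. Qed.
Let measurable_noise s : 0 <= s -> meas (noise beta I s).
Proof. by have [h _ _] := proc_noise; exact: h. Qed.
Let mD : meas D.
Proof.
have m1 := measurable_noise s00; have m2 := measurable_noise (le_trans s00 s0t).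
by rewrite /D; mea.
Qed.

Let Ex_le_esup q : (\E[P]_w (a t w * D w ^+ (2 * q)) <=
  \int[P]_w esup (fun s w => a s w * noise_increment beta I (fun _ _ => 0) (fun _ _ => 0) zeta s0 s w ^+ (2 * q))%R s0 t w)%E.
Proof.
apply: ge0_le_integral => //.
- move=> w _; rewrite lee_fin mulr_ge0//; first by case: (a01 t w) => ->.
  by rewrite exprM exprn_ge0// sqr_ge0.
- by apply/measurable_EFinP; mea.
- apply: measurable_esup => //; apply: procM => //; apply: procX; apply: procM => //.
  have pc (J : R -> Om -> R) : proc J -> proc (fun (_ : R) (w : Om) => J s0 w : R).
    by move=> [+ _ _] => /(_ s0 s00); exact: proc_const.
  have p0 : proc (noise (fun _ _ => 0) (fun _ _ => 0) : R -> Om -> R).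
    apply: procD; last exact: (@proc_const _ _ _ (fun=> 0)).
    by apply: proc_tint; exact: (@proc_const _ _ _ (fun=> 0)).
  by apply: procB; apply: procB; [exact: proc_noise|exact: (pc _ proc_noise)|exact: p0|exact: pc].
- move=> w _; rewrite -DE.
  apply: (esup_ubound (fun s w => a s w * noise_increment beta I (fun _ _ => 0) (fun _ _ => 0) zeta s0 s w ^+ (2 * q))).
  by rewrite s0t lexx.
Qed.

Let pb : proc (fun s w => a s w * zeta w * beta s w).
Proof. by apply: procM => //; exact: procM. Qed.
Let ph : proc (fun s w => (a s w * zeta w * H s w) ^+ 2).
Proof. by apply: procX; apply: procM => //; exact: procM. Qed.
Let a_ge0 s w : 0 <= a s w. Proof. by case: (a01 s w) => ->. Qed.

Let wdE w : tint (weighted_drift beta (fun _ _ => 0) a zeta) s0 t w =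
  tint (fun s w => `|a s w * zeta w * beta s w|) s0 t w.
Proof.
by apply: tint_eq => s _; rewrite /weighted_drift subr0 -mulrA [RHS]normrM (ger0_norm (a_ge0 s w)).
Qed.

Let wiE w : tint (weighted_integrand H (fun _ _ => 0) a zeta) s0 t w =
  tint (fun s w => (a s w * zeta w * H s w) ^+ 2) s0 t w.
Proof. by apply: tint_eq => s _; rewrite /weighted_integrand subr0 mulrA. Qed.

Lemma single_noise2 :
  (\E[P]_w (a t w * D w ^+ 2) <=
   2%:E * \E[P]_w (tint (fun s w => `|a s w * zeta w * beta s w|) s0 t w ^+ 2) +
   (2 * 64)%:E * Ex P (tint (fun s w => (a s w * zeta w * H s w) ^+ 2)%R s0 t))%E.
Proof.
have := Ex_le_esup 1; change (2 * 1)%N with 2%N => /le_trans; apply.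
have p0 := @proc_const R _ Om (fun=> 0) (measurable_cst _).
apply: (le_trans (noise_maximal2 cF BM pbeta p0 pH p0 iI (ito_integral_zero B cF)
  a01 amono pa Fa Fz z1 s00 s0t)).
rewrite (_ : tint (weighted_integrand _ _ _ _) _ _ = tint (fun s w => (a s w * zeta w * H s w) ^+ 2)%R s0 t); last exact/funext.
by under [in leLHS]eq_fun do rewrite wdE.
Qed.

Lemma single_noise4 :
  (\E[P]_w (a t w * D w ^+ 4) <=
   8%:E * \E[P]_w (tint (fun s w => `|a s w * zeta w * beta s w|) s0 t w ^+ 4) +
   (8 * (2 * (128 * (32 * 8)) * 4))%:E *
     \E[P]_w (tint (fun s w => (a s w * zeta w * H s w) ^+ 2)%R s0 t w ^+ 2))%E.
Proof.
have := Ex_le_esup 2; change (2 * 2)%N with 4%N => /le_trans; apply.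
have p0 := @proc_const R _ Om (fun=> 0) (measurable_cst _).
apply: (le_trans (noise_maximal4 cF BM pbeta p0 pH p0 iI (ito_integral_zero B cF)
  a01 amono pa Fa Fz z1 s00 s0t)).
rewrite (_ : tint (weighted_integrand _ _ _ _) _ _ = tint (fun s w => (a s w * zeta w * H s w) ^+ 2)%R s0 t); last exact/funext.
by under [in leLHS]eq_fun do rewrite wdE.
Qed.

End single_noise.

Lemma lee_finD {R : realType} (x y : \bar R) (a b : R) :
  (x <= a%:E -> y <= b%:E -> x + y <= (a + b)%R%:E)%E.
Proof. by move=> h h'; rewrite EFinD; exact: leeD. Qed.

Lemma lee_finZ {R : realType} (x : \bar R) (c a : R) :
  0 <= c -> (x <= a%:E -> c%:E * x <= (c * a)%R%:E)%E.
Proof. by move=> c0 h; rewrite EFinM; apply: lee_wpmul2l. Qed.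

Lemma inv_shift_sqr_measurable {R : realType} (Q : R) : 1 <= Q -> meas (fun x : R => (Q + x ^+ 2)^-1).
Proof.
move=> Q1; apply: continuous_measurable_fun => x; apply: cvgV.
  by rewrite gt_eqF// ltr_pwDl ?sqr_ge0// (lt_le_trans _ Q1).
by apply: cvgD; [exact: cvg_cst|exact: exprn_continuous].
Qed.

Lemma Ex_leZ {d} {T : measurableType d} {R : realType} (P : {measure set T -> \bar R})
  (f g : T -> R) (c k : R) : (forall w, 0 <= f w) -> (forall w, 0 <= g w) -> 0 <= c ->
  meas f -> meas g -> (forall w, f w <= c * g w) ->
  (Ex P g <= k%:E)%E -> (Ex P f <= (c * k)%:E)%E.
Proof.
move=> f0 g0 c0 mf mg fg gk; apply: (@le_trans _ _ (\E[P]_w (c * g w))).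
  by apply: Ex_le => //; mea.
by rewrite ExZ// EFinM; apply: lee_wpmul2l.
Qed.

Section constants.
Context {R : realType}.
(** The drift contributes the first summand, the stochastic integral the second; in both,
    [2 * L ^+ 2] comes from the linear growth of the coefficients. *)
Definition noise2_cst (L : R) : R := 2 * (2 * L ^+ 2 * 4) + 2 * 64 * (2 * L ^+ 2).
(** The factor of the squared bracket in [noise_maximal4], a Burkholder-Davis-Gundy constant for
    fourth moments. *)
Definition bdg4 : R := 8 * (2 * (128 * (32 * 8)) * 4).
Definition noise4_cst (L : R) : R := 8 * (8 * L ^+ 4 * 4 ^+ 4) + bdg4 * (8 * L ^+ 4 * 4).
Lemma bdg4_ge0 : 0 <= bdg4.
Proof. by rewrite /bdg4 !mulr_ge0. Qed.
End constants.

(** * Moment bounds for solutions with a deterministic reflection *)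

Section sde.
Context {R : realType} {d} {Om : measurableType d} (P : probability Om R).
Variables (F : R -> set (set Om)) (B : R -> Om -> R).
Hypotheses (cF : complete_filtration P F) (BM : brownian_motion P F B).
Variables (b sg : R -> R) (L : R).
Hypotheses (L1 : 1 <= L) (b0 : `|b 0| <= L) (bL : lip L b).
Hypotheses (sg0 : `|sg 0| <= L) (sgL : lip L sg).
Variables (X I : R -> Om -> R).
Hypotheses (aX : adapted F X) (cX : continuous_paths X).
Hypothesis iI : ito_integral P F B (fun t w => sg (X t w)) I.

Definition sde_noise (b : R -> R) (X I : R -> Om -> R) := noise (fun t w => b (X t w)) I.
Local Notation V := (sde_noise b X I).

Let L0 : 0 <= L. Proof. exact: le_trans L1. Qed.
Let pX : proc X := proc_adapted cF aX cX.
Let pb : proc (fun t w => b (X t w)). Proof. exact: (proc_lip L0 bL pX). Qed.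
Let psg : proc (fun t w => sg (X t w)). Proof. exact: (proc_lip L0 sgL pX). Qed.

Lemma proc_sde_noise : proc V. Proof. exact: (proc_noise cF pb iI). Qed.

Lemma sde_noise0 : {ae P, forall w, V 0 w = 0}.
Proof.
apply: filterS (ito_integral0 cF BM psg iI) => w h.
by rewrite /sde_noise /noise h tint_point addr0.
Qed.

Section weights.
Variables (a : R -> Om -> R) (zeta : Om -> R).
Hypotheses (a01 : forall s w, a s w = 0 \/ a s w = 1).
Hypotheses (amono : forall s s' w, 0 <= s -> s <= s' -> a s' w <= a s w).
Hypotheses (pa : proc a) (Fa : adapted F a).
Hypotheses (Fz : measurable_wrt (F 0) zeta) (z1 : forall w, `|zeta w| <= 1).

Let mz : meas zeta := filtration_measurable cF (lexx 0) Fz.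
Let pz : proc (fun (_ : R) w => zeta w) := proc_const mz.
Let a_ge0 s w : 0 <= a s w. Proof. by case: (a01 s w) => ->. Qed.
Let aX2 s w : 0 <= a s w * (zeta w ^+ 2 * (1 + X s w ^+ 2)).
Proof. by rewrite mulr_ge0// mulr_ge0 ?sqr_ge0// addr_ge0 ?sqr_ge0. Qed.
Let aX4 s w : 0 <= a s w * (zeta w ^+ 4 * (1 + X s w ^+ 4)).
Proof. by rewrite mulr_ge0// mulr_ge0 ?exprn_even_ge0// addr_ge0 ?exprn_even_ge0. Qed.

Let Xm s : 0 <= s -> meas (X s). Proof. by have [h _ _] := pX; exact: h. Qed.
Let am s : 0 <= s -> meas (a s). Proof. by have [h _ _] := pa; exact: h. Qed.
Let mX2 s : 0 <= s -> meas (fun w => a s w * (zeta w ^+ 2 * (1 + X s w ^+ 2))).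
Proof. by move=> s0; have := Xm s0; have := am s0 => h h'; mea. Qed.
Let mX4 s : 0 <= s -> meas (fun w => a s w * (zeta w ^+ 4 * (1 + X s w ^+ 4))).
Proof. by move=> s0; have := Xm s0; have := am s0 => h h'; mea. Qed.

Let wg2 g s N : (forall x, g x ^+ 2 <= 2 * L ^+ 2 * (1 + x ^+ 2)) -> proc (fun t w => g (X t w)) ->
  0 <= s -> (\E[P]_w (a s w * (zeta w ^+ 2 * (1 + X s w ^+ 2))) <= N%:E)%E ->
  (\E[P]_w ((a s w * zeta w * g (X s w)) ^+ 2) <= (2 * L ^+ 2 * N)%:E)%E.
Proof.
move=> hg [pg _ _] s0; apply: Ex_leZ => //.
- by move=> w; exact: sqr_ge0.
- by nneg.
- by have := pg s s0; have := am s0 => h h'; mea.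
- exact: mX2.
- move=> w; case: (a01 s w) => ->; first by rewrite !mul0r expr0n/= mulr0.
  by rewrite !mul1r exprMn [leRHS]mulrCA ler_wpM2l ?sqr_ge0.
Qed.

Let wg4 g s N : (forall x, g x ^+ 4 <= 8 * L ^+ 4 * (1 + x ^+ 4)) -> proc (fun t w => g (X t w)) ->
  0 <= s -> (\E[P]_w (a s w * (zeta w ^+ 4 * (1 + X s w ^+ 4))) <= N%:E)%E ->
  (\E[P]_w ((a s w * zeta w * g (X s w)) ^+ 4) <= (8 * L ^+ 4 * N)%:E)%E.
Proof.
move=> hg [pg _ _] s0; apply: Ex_leZ => //.
- by move=> w; rewrite exprn_even_ge0.
- by nneg.
- by have := pg s s0; have := am s0 => h h'; mea.
- exact: mX4.
- move=> w; case: (a01 s w) => ->; first by rewrite !mul0r expr0n/= mulr0.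
  by rewrite !mul1r exprMn [leRHS]mulrCA ler_wpM2l ?exprn_even_ge0.
Qed.

Let pag g : proc (fun t w => g (X t w)) -> proc (fun s w => a s w * zeta w * g (X s w)).
Proof. by move=> pg; apply: procM => //; exact: procM. Qed.

Let bX2 := lip_growth2 L0 b0 bL.
Let sX2 := lip_growth2 L0 sg0 sgL.
Let bX4 := lip_growth4 L0 b0 bL.
Let sX4 := lip_growth4 L0 sg0 sgL.
Let abs_pow (x : R) n : `|x| ^+ (2 * n) = x ^+ (2 * n).
Proof. by rewrite !exprM normr_sqr. Qed.

Let D0 s t w := zeta w * (V t w - V s w).
Let mD s t : 0 <= s -> 0 <= t -> meas (D0 s t).
Proof. by move=> s0 t0; have [h _ _] := proc_sde_noise; have := h s s0; have := h t t0 => h1 h2; rewrite /D0; mea. Qed.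
Let mV t : 0 <= t -> meas (V t).
Proof. by have [h _ _] := proc_sde_noise; exact: h. Qed.

(** The gain is the factor [1 / lam]: integrating an exponential bound of rate [lam] divides by
    [lam] at least once. A suitable choice of [lam] then makes Gronwall's step halve the bound. *)
Lemma noise_moment2 lam N t : 1 <= lam -> 0 <= N -> 0 <= t ->
  (forall s, 0 <= s <= t -> (\E[P]_w (a s w * (zeta w ^+ 2 * (1 + X s w ^+ 2))) <= (N * expR (lam * s))%:E)%E) ->
  (\E[P]_w (a t w * (zeta w * V t w) ^+ 2) <= (noise2_cst L * (N / lam) * expR (lam * t))%:E)%E.
Proof.
move=> lam1 N0 t0 hN; have lam0 : 0 < lam by exact: lt_le_trans lam1.
apply: (@le_trans _ _ (\E[P]_w (a t w * D0 0 t w ^+ 2))).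
  have h1 := mV t0; have h2 := am t0; have h3 := mD (lexx 0) t0.
  apply: Ex_le_ae.
  - by move=> w; rewrite mulr_ge0 ?sqr_ge0.
  - by move=> w; rewrite mulr_ge0 ?sqr_ge0.
  - by mea.
  - by mea.
  - by apply: filterS sde_noise0 => w h; rewrite /D0 h subr0.
apply: (le_trans (single_noise2 cF BM pb psg iI a01 amono pa Fa Fz z1 (lexx 0) t0)).
have k0 : 0 <= 2 * L ^+ 2 * N by nneg.
have hb s : 0 <= s <= t -> (\E[P]_w (`|a s w * zeta w * b (X s w)| ^+ 2) <= (2 * L ^+ 2 * N * expR (lam * s))%:E)%E.
  move=> /[dup] /andP[s0 _] st; rewrite -mulrA.
  by under [in leLHS]eq_fun do rewrite (abs_pow _ 1); exact: wg2 (hN s st).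
have hs s : 0 <= s <= t -> (\E[P]_w ((a s w * zeta w * sg (X s w)) ^+ 2) <= (2 * L ^+ 2 * N * expR (lam * s))%:E)%E.
  by move=> /[dup] /andP[s0 _] st; rewrite -mulrA; exact: wg2 (hN s st).
apply: (@le_trans _ _ (2%:E * (2 * L ^+ 2 * N * (4 / lam ^+ 2) * expR (lam * t))%:E +
   (2 * 64)%:E * (2 * L ^+ 2 * N * lam^-1 * expR (lam * t))%:E)%E).
  apply: leeD; apply: lee_wpmul2l; rewrite ?lee_fin ?mulr_ge0//.
    by apply: Ex_sqr_tint_expR => //; exact: proc_abs (pag pb).
  apply: Ex_tint_expRZ => //; first exact: procX (pag psg).
  by move=> s w; exact: sqr_ge0.
rewrite -!EFinM -EFinD lee_fin /noise2_cst [X in X + _]mulrA [X in _ + X]mulrA -mulrDl ler_wpM2r ?expR_ge0//.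
have li : lam ^- 2 <= lam^-1.
  by rewrite lef_pV2 ?posrE ?exprn_gt0// expr2 ler_peMl// ltW.
have Li : 0 <= L ^+ 2 * N by nneg.
have := ler_wpM2l Li li; rewrite (_ : 2 * (2 * L ^+ 2 * N * (4 / lam ^+ 2)) = 16 * (L ^+ 2 * N * lam ^- 2)); last by ring.
move: (lam^-1) (lam ^- 2) => u v h.
rewrite [leRHS](_ : _ = 16 * (L ^+ 2 * N * u) + 128 * (2 * (L ^+ 2 * N * u))); last by ring.
rewrite [leLHS](_ : _ = 16 * (L ^+ 2 * N * v) + 128 * (2 * (L ^+ 2 * N * u))); last by ring.
by lra.
Qed.

Lemma noise_moment4 lam N t : 1 <= lam -> 0 <= N -> 0 <= t ->
  (forall s, 0 <= s <= t -> (\E[P]_w (a s w * (zeta w ^+ 4 * (1 + X s w ^+ 4))) <= (N * expR (lam * s))%:E)%E) ->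
  (\E[P]_w (a t w * (zeta w * V t w) ^+ 4) <= (noise4_cst L * (N / lam) * expR (lam * t))%:E)%E.
Proof.
move=> lam1 N0 t0 hN; have lam0 : 0 < lam by exact: lt_le_trans lam1.
apply: (@le_trans _ _ (\E[P]_w (a t w * D0 0 t w ^+ 4))).
  have h1 := mV t0; have h2 := am t0; have h3 := mD (lexx 0) t0.
  apply: Ex_le_ae.
  - by move=> w; rewrite mulr_ge0 ?exprn_even_ge0.
  - by move=> w; rewrite mulr_ge0 ?exprn_even_ge0.
  - by mea.
  - by mea.
  - by apply: filterS sde_noise0 => w h; rewrite /D0 h subr0.
apply: (le_trans (single_noise4 cF BM pb psg iI a01 amono pa Fa Fz z1 (lexx 0) t0)).
have k0 : 0 <= 8 * L ^+ 4 * N by nneg.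
have hb s : 0 <= s <= t -> (\E[P]_w (`|a s w * zeta w * b (X s w)| ^+ 4) <= (8 * L ^+ 4 * N * expR (lam * s))%:E)%E.
  move=> /[dup] /andP[s0 _] st; rewrite -mulrA.
  by under [in leLHS]eq_fun do rewrite (abs_pow _ 2); exact: wg4 (hN s st).
have hs s : 0 <= s <= t -> (\E[P]_w (((a s w * zeta w * sg (X s w)) ^+ 2) ^+ 2) <= (8 * L ^+ 4 * N * expR (lam * s))%:E)%E.
  move=> /[dup] /andP[s0 _] st; rewrite -mulrA.
  by under [in leLHS]eq_fun do rewrite -exprM; exact: wg4 (hN s st).
apply: (@le_trans _ _ (8%:E * (8 * L ^+ 4 * N * (4 / lam) ^+ 4 * expR (lam * t))%:E +
   bdg4%:E * (8 * L ^+ 4 * N * (4 / lam ^+ 2) * expR (lam * t))%:E)%E).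
  apply: leeD; apply: lee_wpmul2l; rewrite ?lee_fin ?mulr_ge0//.
    by apply: Ex_pow4_tint_expR => //; exact: proc_abs (pag pb).
  by apply: Ex_sqr_tint_expR => //; exact: procX (pag psg).
rewrite -!EFinM -EFinD lee_fin /noise4_cst [X in X + _]mulrA [X in _ + X]mulrA -mulrDl ler_wpM2r ?expR_ge0//.
have li : lam ^- 2 <= lam^-1.
  by rewrite lef_pV2 ?posrE ?exprn_gt0// expr2 ler_peMl// ltW.
have li4 : lam ^- 4 <= lam^-1.
  by rewrite lef_pV2 ?posrE ?exprn_gt0// exprS ler_peMr ?exprn_ege1// ltW.
have Li : 0 <= L ^+ 4 * N by nneg.
have := ler_wpM2l Li li; have := ler_wpM2l Li li4.
rewrite (_ : 8 * (8 * L ^+ 4 * N * (4 / lam) ^+ 4) = 64 * (4 ^+ 4 * (L ^+ 4 * N * lam ^- 4))); last first.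
  by rewrite exprMn exprVn; ring.
have := @bdg4_ge0 R; move: bdg4 (lam^-1) (lam ^- 2) (lam ^- 4) => K u v v' K0 h h'.
have h'' := ler_wpM2l K0 h'.
rewrite [leRHS](_ : _ = 64 * (4 ^+ 4 * (L ^+ 4 * N * u)) + 32 * (K * (L ^+ 4 * N * u))); last by ring.
rewrite [leLHS](_ : _ = 64 * (4 ^+ 4 * (L ^+ 4 * N * v')) + 32 * (K * (L ^+ 4 * N * v))); last by ring.
by apply: lerD; rewrite ler_wpM2l// ler_wpM2l// exprn_ge0.
Qed.

Hypothesis a1 : forall s w, a s w = 1.

Lemma noise_increment_moment2 s t N : 0 <= s -> s <= t -> 0 <= N ->
  (forall r, s <= r <= t -> (\E[P]_w (zeta w ^+ 2 * (1 + X r w ^+ 2)) <= N%:E)%E) ->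
  (\E[P]_w ((zeta w * (V t w - V s w)) ^+ 2) <=
   (2 * (2 * L ^+ 2 * N * (t - s) ^+ 2) + 2 * 64 * (2 * L ^+ 2 * N * (t - s)))%:E)%E.
Proof.
move=> s0 st N0 hN.
rewrite (_ : (fun w => _) = (fun w => a t w * D0 s t w ^+ 2)); last by apply/funext => w; rewrite a1 mul1r.
apply: (le_trans (single_noise2 cF BM pb psg iI a01 amono pa Fa Fz z1 s0 st)).
have hNa r : s <= r <= t -> (\E[P]_w (a r w * (zeta w ^+ 2 * (1 + X r w ^+ 2))) <= N%:E)%E.
  by move=> rt; under [in leLHS]eq_fun do rewrite a1 mul1r; exact: hN.
rewrite [leRHS]EFinD; apply: leeD; rewrite [leRHS]EFinM; apply: lee_wpmul2l; rewrite ?lee_fin ?mulr_ge0//.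
  apply: Ex_sqr_tint_cst => //; first exact: proc_abs (pag pb).
    by nneg.
  move=> r /[dup] /andP[sr _] rt; have r0 := le_trans s0 sr.
  by under [in leLHS]eq_fun do rewrite (abs_pow _ 1); exact: wg2 (hNa r rt).
apply: Ex_tint_cst => //; first exact: procX (pag psg).
  by move=> r w; exact: sqr_ge0.
by move=> r /[dup] /andP[sr _] rt; have r0 := le_trans s0 sr; exact: wg2 (hNa r rt).
Qed.

Lemma noise_increment_moment4 s t N : 0 <= s -> s <= t -> 0 <= N ->
  (forall r, s <= r <= t -> (\E[P]_w (zeta w ^+ 4 * (1 + X r w ^+ 4)) <= N%:E)%E) ->
  (\E[P]_w ((zeta w * (V t w - V s w)) ^+ 4) <=
   (8 * (8 * L ^+ 4 * N * (t - s) ^+ 4) + bdg4 * (8 * L ^+ 4 * N * (t - s) ^+ 2))%:E)%E.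
Proof.
move=> s0 st N0 hN.
rewrite (_ : (fun w => _) = (fun w => a t w * D0 s t w ^+ 4)); last by apply/funext => w; rewrite a1 mul1r.
apply: (le_trans (single_noise4 cF BM pb psg iI a01 amono pa Fa Fz z1 s0 st)).
have hNa r : s <= r <= t -> (\E[P]_w (a r w * (zeta w ^+ 4 * (1 + X r w ^+ 4))) <= N%:E)%E.
  by move=> rt; under [in leLHS]eq_fun do rewrite a1 mul1r; exact: hN.
rewrite [leRHS]EFinD; apply: leeD; rewrite [leRHS]EFinM; apply: lee_wpmul2l; rewrite ?lee_fin ?mulr_ge0//.
  apply: Ex_pow4_tint_cst => //; first exact: proc_abs (pag pb).
    by nneg.
  move=> r /[dup] /andP[sr _] rt; have r0 := le_trans s0 sr.
  by under [in leLHS]eq_fun do rewrite (abs_pow _ 2); exact: wg4 (hNa r rt).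
apply: Ex_sqr_tint_cst => //; first exact: procX (pag psg).
  by nneg.
move=> r /[dup] /andP[sr _] rt; have r0 := le_trans s0 sr.
by under [in leLHS]eq_fun do rewrite -exprM; exact: wg4 (hNa r rt).
Qed.

End weights.

Variables (X0 : Om -> R) (kappa : R -> R) (Q : R).
Hypothesis F0 : measurable_wrt (F 0) X0.
Hypothesis eqX : {ae P, forall w, forall t, 0 <= t -> X t w = X0 w + V t w + kappa t}.
Hypotheses (Q1 : 1 <= Q) (X0Q : (\E[P]_w (X0 w ^+ 2) <= Q%:E)%E).
Let mX0 : meas X0 := filtration_measurable cF (lexx 0) F0.
Let mX t : 0 <= t -> meas (X t). Proof. by have [h _ _] := pX; exact: h. Qed.
Let mV t : 0 <= t -> meas (V t).
Proof. by have [h _ _] := proc_sde_noise; exact: h. Qed.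
Let Q0 : 0 <= Q. Proof. exact: le_trans Q1. Qed.
Let cut n := amplitude_cut X n%:R.
Let pcut n : proc (cut n). Proof. exact: proc_amplitude_cut. Qed.
Let mcut n t : 0 <= t -> meas (cut n t).
Proof. by have [h _ _] := pcut n; exact: h. Qed.
Let cut01 n s w : cut n s w = 0 \/ cut n s w = 1 := amplitude_cut01 X n%:R s w.
Let cut_ge0 n s w : 0 <= cut n s w. Proof. by case: (cut01 n s w) => ->. Qed.

(** Removes the localisation: on each path the cut-off is eventually 1, as paths are bounded on
    bounded intervals, and Fatou's lemma keeps the uniform bound. *)
Lemma Ex_cut_limit (f : Om -> R) t (C : R) : 0 <= t -> (forall w, 0 <= f w) -> meas f ->
  (forall n, (\E[P]_w (amplitude_cut X n%:R t w * f w) <= C%:E)%E) -> (Ex P f <= C%:E)%E.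
Proof.
move=> t0 f0 mf hC.
apply: (@int_fatou _ _ _ P (fun w => (f w)%:E) (fun n w => (cut n t w * f w)%:E) (fun=> C%:E)) => //.
- exact/measurable_EFinP.
- by move=> n; apply/measurable_EFinP; have := mcut n t0 => h; mea.
- by move=> n w; rewrite lee_fin mulr_ge0.
- apply: aeW => w; apply: le_limn_einf => y; rewrite lte_fin => yf.
  have [_ _ lb] := pX.
  apply: filterS (amplitude_cut_eventually t w lb) => n h.
  by rewrite lee_fin /cut h mul1r ltW.
- exact: cvg_cst.
Qed.

Let const1 : R -> Om -> R := fun _ _ => 1.
Let p1 : proc const1. Proof. exact: (@proc_const _ _ _ (fun=> 1)). Qed.
Let F1 (x : R) s : 0 <= s -> measurable_wrt (F s) (fun=> x).
Proof. by move=> s0; apply: (fun_wrt cF) => //; exact: measurable_cst. Qed.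
Let c01 s w : const1 s w = 0 \/ const1 s w = 1. Proof. by right. Qed.
Let cmono s s' w : 0 <= s -> s <= s' -> const1 s' w <= const1 s w. Proof. by []. Qed.
Let n1 : forall w : Om, `|(fun=> 1 : R) w| <= 1. Proof. by move=> w; rewrite normr1. Qed.

Let step2 (a : R -> Om -> R) t k : (forall s w, a s w = 0 \/ a s w = 1) -> meas (a t) -> 0 <= t -> kappa t ^+ 2 <= k ->
  (\E[P]_w (a t w * (1 ^+ 2 * (1 + X t w ^+ 2))) <=
   (1 + 3 * Q + 3 * k)%:E + 3%:E * \E[P]_w (a t w * (1 * V t w) ^+ 2))%E.
Proof.
move=> a01 ma t0 hk; have h1 := mV t0; have h2 := mX t0.
have a0 w : 0 <= a t w by case: (a01 t w) => ->.
have k0 : 0 <= k by apply: le_trans hk; exact: sqr_ge0.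
apply: (@le_trans _ _ (\E[P]_w (((1 + 3 * k) + 3 * X0 w ^+ 2) + 3 * (a t w * (1 * V t w) ^+ 2)))).
  apply: Ex_le_ae.
  - by move=> w; nneg.
  - by move=> w; nneg.
  - by mea.
  - by mea.
  - apply: filterS eqX => w /(_ t t0) ->; rewrite expr1n !mul1r.
    have := sqrD3_le (X0 w) (V t w) (kappa t).
    have := sqr_ge0 (X0 w).
    by case: (a01 t w) => ->; lra.
rewrite ExD; try side.
rewrite ExD; try side.
rewrite Ex_cst ExZ//; try side.
rewrite ExZ//; try side.
apply: leeD => //.
rewrite (_ : 1 + 3 * Q + 3 * k = (1 + 3 * k) + 3 * Q); last by ring.
by apply: lee_finD => //; exact: lee_finZ.
Qed.

Lemma sde_moment2 (T k : R) : (forall t, 0 <= t <= T -> kappa t ^+ 2 <= k) ->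
  forall t, 0 <= t <= T -> (\E[P]_w (1 + X t w ^+ 2) <=
    (2 * (1 + 3 * Q + 3 * k) * expR ((1 + 6 * noise2_cst L) * t))%:E)%E.
Proof.
move=> hk t tT; have /andP[t0 _] := tT.
have k0 : 0 <= k by apply: le_trans (hk t tT); exact: sqr_ge0.
have c0 : 0 <= noise2_cst L by rewrite /noise2_cst; nneg.
(* The noise enters with the factor 3, so this rate makes [3 * noise2_cst L / lam] at most [1/2]. *)
pose lam := 1 + 6 * noise2_cst L; have lam1 : 1 <= lam by rewrite lerDl mulr_ge0.
have lam0 : 0 < lam by exact: lt_le_trans lam1.
have h2 := mX t0; apply: (Ex_cut_limit t0) => [w||n]; try side.
pose u s := \E[P]_w (cut n s w * (1 ^+ 2 * (1 + X s w ^+ 2))).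
have -> : \E[P]_w (amplitude_cut X n%:R t w * (1 + X t w ^+ 2)) = u t.
  by rewrite /u; under [in RHS]eq_fun do rewrite expr1n mul1r.
have C0 : 0 <= 1 + 3 * Q + 3 * k by nneg.
have K0 : 0 <= 1 + n%:R ^+ 2 :> R by nneg.
apply: (@gronwall_weighted _ u T _ _ lam C0 K0 (ltW lam0) _ _ t tT).
  move=> s /andP[s0 _]; rewrite /u -[leRHS](Ex_cst P).
  have h := mX s0; have h' := mcut n s0.
  apply: Ex_le => //; [by move=> w; rewrite mulr_ge0//; nneg|by mea|].
  move=> w; rewrite expr1n mul1r; case: (cut01 n s w) => [->|h1].
    by rewrite mul0r; nneg.
  rewrite h1 mul1r lerD2l -[leLHS]normr_sqr//; apply: lerXn2r; rewrite ?nnegrE//.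
  by apply: (amplitude_cut_le h1); rewrite s0 lexx.
move=> N N0 hN s sT; have /andP[s0 sT'] := sT.
apply: (le_trans (step2 (cut01 n) (mcut n s0) s0 (hk s sT))).
have := @noise_moment2 (cut n) (fun=> 1) (cut01 n)
  (fun s s' w => amplitude_cut_mono X n%:R w) (pcut n) (adapted_amplitude_cut _ cF pX aX) (F1 1 (lexx 0)) n1 lam N s lam1 N0 s0.
move=> h; apply: (le_trans (leeD (lexx _) (lee_wpmul2l _ (h _)))) => //.
  by move=> r /andP[r0 rs]; apply: hN; rewrite r0 (le_trans rs).
rewrite -EFinM -EFinD lee_fin [leRHS]mulrDl; apply: lerD.
  apply: ler_peMr; first by nneg.
  by rewrite -expR0 ler_expR; apply: mulr_ge0 => //; exact: ltW.
rewrite mulrA ler_wpM2r ?expR_ge0// [leLHS](_ : _ = (6 * noise2_cst L) * (N / 2) / lam); last by field; rewrite gt_eqF.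
rewrite ler_pdivrMr// mulrC ler_wpM2l//; first by nneg.
by rewrite lerDr.
Qed.

(** Here the reflection is controlled by the noise itself, so the bound no longer contains [kappa].
    That control involves moments of the uncut noise and cannot be localised path by path, which is
    why the iteration starts from a finite bound [B2]. *)
Lemma sde_moment2_self (T rho B2 : R) : 0 <= B2 ->
  (forall t, 0 <= t <= T -> (\E[P]_w (1 + X t w ^+ 2) <= B2%:E)%E) ->
  (forall t v, 0 <= t <= T -> 0 <= v -> (forall s, 0 <= s <= t -> (\E[P]_w (V s w ^+ 2) <= v%:E)%E) ->
    kappa t ^+ 2 <= rho ^+ 2 * v) ->
  forall t, 0 <= t <= T -> (\E[P]_w (1 + X t w ^+ 2) <=
    (2 * (1 + 3 * Q) * expR ((1 + 6 * (1 + rho ^+ 2) * noise2_cst L) * t))%:E)%E.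
Proof.
move=> B20 hB hk t tT.
have c0 : 0 <= noise2_cst L by rewrite /noise2_cst; nneg.
pose lam := 1 + 6 * (1 + rho ^+ 2) * noise2_cst L; have lam1 : 1 <= lam by rewrite lerDl; nneg.
have lam0 : 0 < lam by exact: lt_le_trans lam1.
have C0 : 0 <= 1 + 3 * Q by nneg.
apply: (@gronwall_weighted _ (fun t => \E[P]_w (1 + X t w ^+ 2)) T B2 _ lam C0 B20 (ltW lam0) hB _ t tT).
move=> N N0 hN s sT; have /andP[s0 sT'] := sT.
have hV r : 0 <= r <= s -> (\E[P]_w (V r w ^+ 2) <= (noise2_cst L * (N / lam) * expR (lam * r))%:E)%E.
  move=> /andP[r0 rs].
  have := @noise_moment2 const1 (fun=> 1) c01
    cmono p1 (F1 1) (F1 1 (lexx 0)) n1 lam N r lam1 N0 r0.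
  move=> h; under [in leLHS]eq_fun do rewrite -[V r _]mul1r -[_ ^+ 2]mul1r.
  apply: h.
  move=> q /andP[q0 qr]; under [in leLHS]eq_fun do rewrite expr1n !mul1r.
  by apply: hN; rewrite q0 (le_trans qr)// (le_trans rs).
pose v := noise2_cst L * (N / lam) * expR (lam * s).
have v0 : 0 <= v by rewrite /v; nneg; exact: ltW.
have kv : kappa s ^+ 2 <= rho ^+ 2 * v.
  apply: hk => // r rs; apply: (le_trans (hV r rs)); rewrite lee_fin ler_wpM2l//; first by nneg; exact: ltW.
  by rewrite ler_expR ler_pM2l//; case/andP: rs.
have := step2 c01 (measurable_cst _) s0 kv; rewrite /const1.
rewrite (_ : (fun w => 1 * (1 ^+ 2 * (1 + X s w ^+ 2))) = fun w => 1 + X s w ^+ 2); last first.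
  by apply/funext => w; rewrite expr1n !mul1r.
rewrite (_ : (fun w => 1 * (1 * V s w) ^+ 2) = fun w => V s w ^+ 2); last by apply/funext => w; rewrite !mul1r.
move=> h; apply: (le_trans h).
have hVs : (\E[P]_w (V s w ^+ 2) <= v%:E)%E by apply: hV; rewrite s0 lexx.
apply: (le_trans (leeD (lexx _) (lee_finZ _ hVs))) => //.
rewrite -EFinD lee_fin.
rewrite [leLHS](_ : _ = (1 + 3 * Q) + 3 * (1 + rho ^+ 2) * v); last by ring.
rewrite [leRHS]mulrDl; apply: lerD.
  apply: ler_peMr; first by nneg.
  by rewrite -expR0 ler_expR; apply: mulr_ge0 => //; exact: ltW.
rewrite /v mulrA ler_wpM2r ?expR_ge0// [leLHS](_ : _ = (6 * (1 + rho ^+ 2) * noise2_cst L) * (N / 2) / lam); last by field; rewrite gt_eqF.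
rewrite ler_pdivrMr// mulrC ler_wpM2l//; first by nneg.
by rewrite lerDr.
Qed.

Lemma sde_increment_moment2 (s t A k : R) : 0 <= s -> s <= t ->
  (\E[P]_w ((V t w - V s w) ^+ 2) <= A%:E)%E -> (kappa t - kappa s) ^+ 2 <= k ->
  (\E[P]_w ((X t w - X s w) ^+ 2) <= (2 * A + 2 * k)%:E)%E.
Proof.
move=> s0 st hA hk; have t0 := le_trans s0 st.
have h1 := mV t0; have h2 := mX t0; have h3 := mV s0; have h4 := mX s0.
have k0 : 0 <= k by apply: le_trans hk; exact: sqr_ge0.
apply: (@le_trans _ _ (\E[P]_w (2 * (V t w - V s w) ^+ 2 + 2 * k))).
  apply: Ex_le_ae; try side.
  apply: filterS eqX => w h; rewrite (h t t0) (h s s0).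
  rewrite [leLHS](_ : _ = ((V t w - V s w) + (kappa t - kappa s)) ^+ 2); last by ring.
  have := sqrD_le (V t w - V s w) (kappa t - kappa s); lra.
rewrite ExD; try side.
rewrite Ex_cst ExZ//; try side.
by apply: lee_finD => //; exact: lee_finZ.
Qed.

Section weighted.
(* [zeta ^+ 4] is the weight [1 / (Q + X0 ^+ 2)]. *)
Variable zeta : Om -> R.
Hypotheses (Fz : measurable_wrt (F 0) zeta) (z1 : forall w, `|zeta w| <= 1).
Hypothesis zQ : forall w, zeta w ^+ 4 * (Q + X0 w ^+ 2) = 1.

Let mz : meas zeta := filtration_measurable cF (lexx 0) Fz.
Let z4_ge0 w : 0 <= zeta w ^+ 4. Proof. by rewrite exprn_even_ge0. Qed.
Let z4 w : zeta w ^+ 4 <= 1.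
Proof. by apply: le_trans (ler_norm _) _; rewrite normrX exprn_ile1. Qed.
(** This is where two moments of [X0] replace four: the weight divides the fourth power by at least
    [X0^2]. *)
Let zX0 w : zeta w ^+ 4 * X0 w ^+ 4 <= X0 w ^+ 2.
Proof.
rewrite (_ : X0 w ^+ 4 = X0 w ^+ 2 * X0 w ^+ 2); last by rewrite -exprD.
by rewrite mulrA ler_piMl ?sqr_ge0// -(zQ w) ler_wpM2l// lerDr.
Qed.
(** Deterministic terms gain [1 / Q] from the weight; as they are squares of quantities of order
    [Q], the bounds stay linear in [Q]. *)
Let zQi w : zeta w ^+ 4 <= Q^-1.
Proof.
rewrite -[leRHS]mul1r ler_pdivlMr; last exact: lt_le_trans Q1.
by rewrite -(zQ w) ler_wpM2l// lerDl sqr_ge0.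
Qed.

Let step4 (a : R -> Om -> R) t k : (forall s w, a s w = 0 \/ a s w = 1) -> meas (a t) -> 0 <= t -> kappa t ^+ 4 <= k ->
  (\E[P]_w (a t w * (zeta w ^+ 4 * (1 + X t w ^+ 4))) <=
   (1 + 27 * (Q + k / Q))%:E + 27%:E * \E[P]_w (a t w * (zeta w * V t w) ^+ 4))%E.
Proof.
move=> a01 ma t0 hk; have h1 := mV t0; have h2 := mX t0.
have a0 w : 0 <= a t w by case: (a01 t w) => ->.
have k0 : 0 <= k by apply: le_trans hk; rewrite exprn_even_ge0.
apply: (@le_trans _ _ (\E[P]_w (((1 + 27 * (k / Q)) + 27 * X0 w ^+ 2) + 27 * (a t w * (zeta w * V t w) ^+ 4)))).
  apply: Ex_le_ae; try side.
  apply: filterS eqX => w /(_ t t0) ->.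
  have h := pow4D3_le (X0 w) (V t w) (kappa t).
  have hz := ler_wpM2l (z4_ge0 w) h.
  have hzk : zeta w ^+ 4 * kappa t ^+ 4 <= k / Q.
    by rewrite mulrC; apply: ler_pM => //; rewrite exprn_even_ge0.
  have := zX0 w; have := z4 w; have := sqr_ge0 (X0 w).
  have kQ0 : 0 <= k / Q by rewrite divr_ge0.
  case: (a01 t w) => ->; first by rewrite !mul0r mulr0 addr0; lra.
  rewrite !mul1r exprMn => h5 h6 h7.
  rewrite mulrDr mulr1; move: hz.
  rewrite (_ : zeta w ^+ 4 * (27 * _) = 27 * (zeta w ^+ 4 * X0 w ^+ 4 + zeta w ^+ 4 * V t w ^+ 4 + zeta w ^+ 4 * kappa t ^+ 4)); last by ring.
  by lra.
rewrite ExD; try side.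
rewrite ExD; try side.
rewrite Ex_cst ExZ//; try side.
rewrite ExZ//; try side.
apply: leeD => //.
rewrite (_ : 1 + 27 * (Q + k / Q) = (1 + 27 * (k / Q)) + 27 * Q); last by ring.
by apply: lee_finD => //; exact: lee_finZ.
Qed.

Lemma sde_moment4 (T k : R) : (forall t, 0 <= t <= T -> kappa t ^+ 4 <= k) ->
  forall t, 0 <= t <= T -> (\E[P]_w (zeta w ^+ 4 * (1 + X t w ^+ 4)) <=
    (2 * (1 + 27 * (Q + k / Q)) * expR ((1 + 54 * noise4_cst L) * t))%:E)%E.
Proof.
move=> hk t tT; have /andP[t0 _] := tT.
have k0 : 0 <= k by apply: le_trans (hk t tT); rewrite exprn_even_ge0.
have c0 : 0 <= noise4_cst L by rewrite /noise4_cst; have := @bdg4_ge0 R; nneg.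
pose lam := 1 + 54 * noise4_cst L; have lam1 : 1 <= lam by rewrite lerDl mulr_ge0.
have lam0 : 0 < lam by exact: lt_le_trans lam1.
have h2 := mX t0; apply: (Ex_cut_limit t0) => [w||n]; try side.
pose u s := \E[P]_w (cut n s w * (zeta w ^+ 4 * (1 + X s w ^+ 4))).
have C0 : 0 <= 1 + 27 * (Q + k / Q) by nneg.
have K0 : 0 <= 1 + n%:R ^+ 4 :> R by nneg.
apply: (@gronwall_weighted _ u T _ _ lam C0 K0 (ltW lam0) _ _ t tT).
  move=> s /andP[s0 _]; rewrite /u -[leRHS](Ex_cst P).
  have h := mX s0; have h' := mcut n s0.
  apply: Ex_le => //; [by move=> w; rewrite mulr_ge0//; nneg|by mea|].
  move=> w; case: (cut01 n s w) => [->|h1].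
    by rewrite mul0r; nneg.
  rewrite h1 mul1r; apply: (@le_trans _ _ (1 + X s w ^+ 4)).
    by apply: ler_piMl => //; nneg.
  rewrite lerD2l; apply: le_trans (ler_norm _) _; rewrite normrX; apply: lerXn2r; rewrite ?nnegrE//.
  by apply: (amplitude_cut_le h1); rewrite s0 lexx.
move=> N N0 hN s sT; have /andP[s0 sT'] := sT.
apply: (le_trans (step4 (cut01 n) (mcut n s0) s0 (hk s sT))).
have := @noise_moment4 (cut n) zeta (cut01 n)
  (fun s s' w => amplitude_cut_mono X n%:R w) (pcut n) (adapted_amplitude_cut _ cF pX aX) Fz z1 lam N s lam1 N0 s0.
move=> h; apply: (le_trans (leeD (lexx _) (lee_wpmul2l _ (h _)))) => //.
  by move=> r /andP[r0 rs]; apply: hN; rewrite r0 (le_trans rs).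
rewrite -EFinM -EFinD lee_fin [leRHS]mulrDl; apply: lerD.
  apply: ler_peMr; first by nneg.
  by rewrite -expR0 ler_expR; apply: mulr_ge0 => //; exact: ltW.
rewrite mulrA ler_wpM2r ?expR_ge0// [leLHS](_ : _ = (54 * noise4_cst L) * (N / 2) / lam); last by field; rewrite gt_eqF.
rewrite ler_pdivrMr// mulrC ler_wpM2l//; first by nneg.
by rewrite lerDr.
Qed.

Lemma sde_increment_moment4 (s t A k : R) : 0 <= s -> s <= t ->
  (\E[P]_w ((zeta w * (V t w - V s w)) ^+ 4) <= A%:E)%E -> (kappa t - kappa s) ^+ 4 <= k ->
  (\E[P]_w (zeta w ^+ 4 * (X t w - X s w) ^+ 4) <= (8 * A + 8 * (k / Q))%:E)%E.
Proof.
move=> s0 st hA hk; have t0 := le_trans s0 st.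
have h1 := mV t0; have h2 := mX t0; have h3 := mV s0; have h4 := mX s0.
have k0 : 0 <= k by apply: le_trans hk; rewrite exprn_even_ge0.
apply: (@le_trans _ _ (\E[P]_w (8 * (zeta w * (V t w - V s w)) ^+ 4 + 8 * (k / Q)))).
  apply: Ex_le_ae; try side.
  apply: filterS eqX => w h; rewrite (h t t0) (h s s0).
  rewrite (_ : _ - (_ + _ + _) = (V t w - V s w) + (kappa t - kappa s)); last by ring.
  have hz := ler_wpM2l (z4_ge0 w) (pow4D_le8 (V t w - V s w) (kappa t - kappa s)).
  have hzk : zeta w ^+ 4 * (kappa t - kappa s) ^+ 4 <= k / Q.
    by rewrite mulrC; apply: ler_pM => //; rewrite exprn_even_ge0.
  apply: (le_trans hz); rewrite exprMn mulrCA -mulrDr ler_pM2l// mulrDr lerD2l//.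
rewrite ExD; try side.
rewrite Ex_cst ExZ//; try side.
by apply: lee_finD => //; exact: lee_finZ.
Qed.

End weighted.

Variable T : R.
Let aone : adapted F const1.
Proof. by move=> t t0; apply/(measurable_wrtP _ (filtration_sigma cF t0)); exact: measurable_cst. Qed.
Let oneE s w : const1 s w = 1. Proof. by []. Qed.

(** The drift contributes a higher power of [t - s] than the stochastic integral; [T] absorbs the
    surplus power. *)
Definition incr2_cst (L S T : R) := 2 * (2 * L ^+ 2 * S * T) + 2 * 64 * (2 * L ^+ 2 * S).
Definition incr4_cst (L S T : R) := 8 * (8 * L ^+ 4 * S * T ^+ 2) + bdg4 * (8 * L ^+ 4 * S).

Lemma noise_incr2 S s t : 0 <= S -> (forall r, 0 <= r <= T -> (\E[P]_w (1 + X r w ^+ 2) <= S%:E)%E) ->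
  0 <= s -> s <= t -> t <= T -> (\E[P]_w ((V t w - V s w) ^+ 2) <= (incr2_cst L S T * (t - s))%:E)%E.
Proof.
move=> S0 hS s0 st tT.
have := noise_increment_moment2 c01 cmono p1 aone (F1 1 (lexx 0)) n1 oneE s0 st S0.
rewrite (_ : Ex P _ = \E[P]_w ((V t w - V s w) ^+ 2)); last by apply: eq_integral => w _; rewrite mul1r.
move=> H; apply: (le_trans (H _)).
  move=> r /andP[sr rt]; apply: le_trans (hS r _).
    by apply: eq_leW; apply: eq_integral => w _; rewrite expr1n mul1r.
  by rewrite (le_trans s0 sr)/= (le_trans rt).
rewrite lee_fin [leRHS](_ : _ = 2 * (2 * L ^+ 2 * S * (T * (t - s))) + 2 * 64 * (2 * L ^+ 2 * S * (t - s))); last first.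
  by rewrite /incr2_cst; ring.
rewrite lerD2r ler_pM2l//; apply: ler_wpM2l; first by nneg.
by rewrite expr2 ler_wpM2r ?subr_ge0// lerBlDr (le_trans tT)// lerDl.
Qed.

Lemma sde_incr2 S A k s t : 0 <= S -> (forall r, 0 <= r <= T -> (\E[P]_w (1 + X r w ^+ 2) <= S%:E)%E) ->
  0 <= s -> s <= t -> t <= T -> incr2_cst L S T <= A -> (kappa t - kappa s) ^+ 2 <= k * (t - s) ->
  (\E[P]_w ((X t w - X s w) ^+ 2) <= ((2 * A + 2 * k) * (t - s))%:E)%E.
Proof.
move=> S0 hS s0 st tT SA hk.
have := noise_incr2 S0 hS s0 st tT => hV.
have hV' : (\E[P]_w ((V t w - V s w) ^+ 2) <= (A * (t - s))%:E)%E.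
  by apply: (le_trans hV); rewrite lee_fin ler_wpM2r ?subr_ge0.
have := sde_increment_moment2 s0 st hV' hk.
by rewrite !mulrA -mulrDl.
Qed.

Section weighted.
Let zeta (w : Om) : R := Num.sqrt (Num.sqrt ((Q + X0 w ^+ 2)^-1)).

Let shift1 w : 1 <= Q + X0 w ^+ 2. Proof. by rewrite (le_trans Q1)// lerDl sqr_ge0. Qed.
Let zeta4 w : zeta w ^+ 4 = (Q + X0 w ^+ 2)^-1.
Proof.
rewrite /zeta (_ : forall x : R, x ^+ 4 = (x ^+ 2) ^+ 2); last by move=> x; rewrite -exprM.
by rewrite !sqr_sqrtr// ?sqrtr_ge0// invr_ge0 (le_trans _ (shift1 w)).
Qed.
Let Fz : measurable_wrt (F 0) zeta.
Proof.
have sF := filtration_sigma cF (lexx 0); move/(measurable_wrtP _ sF): F0 => wX0.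
apply/(measurable_wrtP _ sF).
have ms : meas (@Num.sqrt R) by apply: continuous_measurable_fun; exact: sqrt_continuous.
apply: (measurableT_comp ms); apply: (measurableT_comp ms).
exact: (measurableT_comp (inv_shift_sqr_measurable Q1) wX0).
Qed.
Let z1 w : `|zeta w| <= 1.
Proof.
have i1 : (Q + X0 w ^+ 2)^-1 <= 1 by rewrite invf_le1 ?shift1// (lt_le_trans _ (shift1 w)).
rewrite ger0_norm ?sqrtr_ge0// /zeta -sqrtr1 ler_sqrt// -[leRHS]sqrtr1.
by rewrite ler_sqrt.
Qed.
Let zQ w : zeta w ^+ 4 * (Q + X0 w ^+ 2) = 1.
Proof. by rewrite zeta4 mulVf// gt_eqF// (lt_le_trans _ (shift1 w)). Qed.

Lemma sde_incr4 k A l s t : (forall t, 0 <= t <= T -> kappa t ^+ 4 <= k) -> 0 <= k ->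
  0 <= s -> s <= t -> t <= T ->
  incr4_cst L (2 * (1 + 27 * (Q + k / Q)) * expR ((1 + 54 * noise4_cst L) * T)) T <= A ->
  (kappa t - kappa s) ^+ 2 <= l * (t - s) ->
  (\E[P]_w ((Q + X0 w ^+ 2)^-1 * (X t w - X s w) ^+ 4) <= ((8 * A + 8 * (l ^+ 2 / Q)) * (t - s) ^+ 2)%:E)%E.
Proof.
set S := 2 * _ * _ => hk k0 s0 st tT SA hl.
have Qp : 0 < Q by exact: lt_le_trans Q1.
have kQ0 : 0 <= k / Q by rewrite divr_ge0// ltW.
have n40 : 0 <= noise4_cst L by have := @bdg4_ge0 R; rewrite /noise4_cst; nneg.
have S0 : 0 <= S by rewrite /S; nneg.
have hS r : 0 <= r <= T -> (\E[P]_w (zeta w ^+ 4 * (1 + X r w ^+ 4)) <= S%:E)%E.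
  move=> rT; apply: (le_trans (sde_moment4 Fz z1 zQ hk rT)).
  rewrite lee_fin ler_wpM2l ?ler_expR//; first by nneg.
  by rewrite ler_wpM2l//; [nneg|case/andP: rT].
have := noise_increment_moment4 c01 cmono p1 aone Fz z1 oneE s0 st S0.
move=> H; have {}H : (\E[P]_w ((zeta w * (V t w - V s w)) ^+ 4) <= (A * (t - s) ^+ 2)%:E)%E.
  apply: (le_trans (H _)).
    by move=> r /andP[sr rt]; apply: hS; rewrite (le_trans s0 sr)/= (le_trans rt).
  rewrite lee_fin; apply: (@le_trans _ _ (incr4_cst L S T * (t - s) ^+ 2)); last first.
    by rewrite ler_wpM2r ?sqr_ge0.
  rewrite [leRHS](_ : _ = 8 * (8 * L ^+ 4 * S * (T ^+ 2 * (t - s) ^+ 2)) + bdg4 * (8 * L ^+ 4 * S * (t - s) ^+ 2)); last first.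
    by rewrite /incr4_cst; move: bdg4 => z; ring.
  rewrite lerD2r ler_pM2l//; apply: ler_wpM2l; first by nneg.
  rewrite (_ : (t - s) ^+ 4 = (t - s) ^+ 2 * (t - s) ^+ 2); last by rewrite -exprD.
  rewrite ler_wpM2r ?sqr_ge0//.
  apply: lerXn2r; rewrite ?nnegrE ?subr_ge0//; first exact: le_trans s0 (le_trans st tT).
  by rewrite lerBlDr (le_trans tT)// lerDl.
have hl4 : (kappa t - kappa s) ^+ 4 <= (l * (t - s)) ^+ 2.
  rewrite (_ : (kappa t - kappa s) ^+ 4 = ((kappa t - kappa s) ^+ 2) ^+ 2); last by rewrite -exprM.
  by apply: lerXn2r; rewrite ?nnegrE ?sqr_ge0// (le_trans (sqr_ge0 _) hl).
have := sde_increment_moment4 Fz zQ s0 st H hl4.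
rewrite (_ : Ex P _ = \E[P]_w ((Q + X0 w ^+ 2)^-1 * (X t w - X s w) ^+ 4)); last first.
  by apply: eq_integral => w _; rewrite zeta4.
move/le_trans; apply; rewrite lee_fin; apply: eq_leW; field.
by rewrite gt_eqF.
Qed.
End weighted.
End sde.

(** * The functional [G0] *)

Section reflection_functional.
Context {R : realType}.
Variables (h : R -> R) (nu : set R -> \bar R).

Lemma G0_le x : 0 <= x -> (0 <= \int[nu]_z (h (x + z)%R)%:E)%E -> G0 h nu <= x.
Proof. by move=> x0 hx; apply: ge_inf; [exists 0 => y []|split]. Qed.

Lemma G0_ge0 : 0 <= G0 h nu.
Proof.
rewrite /G0; have [->|/set0P ne] := eqVneq [set x | 0 <= x /\ (0 <= \int[nu]_z (h (x + z))%:E)%E] set0.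
  (* The infimum of the empty set is 0 by convention. *)
  by rewrite inf0.
by apply: lb_le_inf => // x [].
Qed.

(** Approximation by admissible shifts, in place of attainment of the infimum, which would rest on
    continuity of the mean in the shift. *)
Lemma G0_lt x y : 0 <= x -> (0 <= \int[nu]_z (h (x + z)%R)%:E)%E -> G0 h nu < y ->
  exists2 z, z < y & 0 <= z /\ (0 <= \int[nu]_u (h (z + u)%R)%:E)%E.
Proof.
move=> x0 hx Gy; have [|z hz zy] := @inf_lt _ [set x | 0 <= x /\ (0 <= \int[nu]_z (h (x + z))%:E)%E] y _ Gy.
  by exists x; split.
by exists z.
Qed.

End reflection_functional.

Lemma lip_max0 {R : realType} (x y : R) : `|Num.max x 0 - Num.max y 0| <= `|x - y|.
Proof.
have h1 := ler_norm (x - y); have := ler_norm (y - x); rewrite distrC => h2.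
by rewrite ler_norml; case: (leP x 0) => ?; case: (leP y 0) => ?; apply/andP; split; lra.
Qed.

Lemma lip_measurable {R : realType} (h : R -> R) (M : R) : 0 <= M ->
  lip M h -> meas h.
Proof.
move=> M0 hM; apply: continuous_measurable_fun => x; apply/cvgrPdist_le => e e0.
have eL : 0 < e / (M + 1) by rewrite divr_gt0// ltr_wpDl.
near=> y; apply: le_trans (hM x y) _.
apply: (@le_trans _ _ (M * (e / (M + 1)))).
  by apply: ler_wpM2l => //; near: y; exact: cvgr_dist_le.
by rewrite mulrCA ler_piMr ?(ltW e0)// ler_pdivrMr ?ltr_wpDl// mul1r lerDl.
Unshelve. all: by end_near. Qed.

Lemma measurable_Ex {R : realType} {d} {T : measurableType d} (P : probability T R)
  (f : R -> T -> R) (a t : R) : 0 <= a -> proc f -> (forall s w, 0 <= f s w) ->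
  measurable_fun (`[a, t] : set (measurableTypeR R)) (fun s => Ex P (f s)).
Proof.
move=> a0 pf f0.
pose F (p : measurableTypeR R * T) := (f (pos_time p.1) p.2)%:E.
have mF : meas F by apply/measurable_EFinP; exact: proc_joint.
have F0 p : (0 <= F p)%E by rewrite lee_fin.
have h : meas (fun s => \int[P]_w F (s, w))%E by exact: measurable_fun_fubini_tonelli_F.
apply: (@eq_measurable_fun _ _ _ _ _ (fun s => \int[P]_w F (s, w))%E); last exact: measurable_funTS.
move=> s; rewrite inE/= in_itv/= => /andP[as_ _].
by apply: eq_integral => w _; rewrite /F/= /pos_time max_r// (le_trans a0).
Qed.

Lemma Ex_normr_le {d} {T : measurableType d} {R : realType} (P : probability T R)
  (f : T -> R) (e : R) : 0 < e -> meas f ->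
  (\E[P]_w (f w ^+ 2) <= (e ^+ 2)%:E)%E -> (\E[P]_w (`|f w|%R) <= e%:E)%E.
Proof.
move=> e0 mf fe.
have e2 : 0 <= (2 * e)^-1 by rewrite invr_ge0 mulr_ge0// ltW.
have e20 : 0 <= e / 2 by rewrite divr_ge0// ltW.
apply: (@le_trans _ _ (\E[P]_w (e / 2 + (2 * e)^-1 * f w ^+ 2))).
  apply: Ex_le; try side.
  move=> w; rewrite -[f w ^+ 2]normr_sqr//.
  move: `|_| => x; rewrite -subr_ge0 (_ : _ - _ = (2 * e)^-1 * (x - e) ^+ 2).
    by rewrite mulr_ge0 ?sqr_ge0.
  by field; rewrite gt_eqF.
rewrite ExD; try side.
rewrite Ex_cst ExZ//; try side.
apply: (@le_trans _ _ ((e / 2)%:E + ((2 * e)^-1 * e ^+ 2)%:E)%E).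
  by apply: leeD => //; exact: lee_finZ.
rewrite -EFinD lee_fin; apply: eq_leW.
by field; rewrite gt_eqF.
Qed.

(** * Lipschitz functions of square integrable variables *)

Section integrable_lipschitz.
Context {R : realType} {d} {T : measurableType d} (P : probability T R).
Variables (h : R -> R) (M : R).
Hypotheses (M0 : 0 <= M) (hM : lip M h).

Lemma lip_integrable (Y : T -> R) : meas Y -> (\E[P]_w (Y w ^+ 2) < +oo)%E ->
  P.-integrable setT (EFin \o (h \o Y)).
Proof.
move=> mY Y2; apply: Ex_lty_integrable.
  by apply: measurableT_comp => //; exact: lip_measurable hM.
have mh : meas (h \o Y) by apply: measurableT_comp => //; exact: lip_measurable hM.
apply: (@le_lt_trans _ _ (\E[P]_w ((`|h 0| + M) + M * Y w ^+ 2))).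
  apply: Ex_le; try side.
  move=> w; rewrite /= -[h (Y w)](subrK (h 0)) (le_trans (ler_normD _ _))//.
  have := hM (Y w) 0; rewrite subr0 => hY.
  have : `|Y w| <= 1 + Y w ^+ 2.
    rewrite -[Y w ^+ 2]normr_sqr//; have := sqr_ge0 (`|Y w| - 1).
    by have := normr_ge0 (Y w); nra.
  by move=> /(ler_wpM2l M0); rewrite mulrDr mulr1; lra.
rewrite ExD; try side.
rewrite Ex_cst ExZ//; try side.
by apply: lte_add_pinfty; [exact: ltry|apply: lte_mul_pinfty].
Qed.

Lemma integral_shift_le (Y Z D : T -> R) (c : R) : P.-integrable setT (EFin \o Y) ->
  P.-integrable setT (EFin \o Z) -> meas D -> (forall w, 0 <= D w) ->
  (Ex P D <= c%:E)%E -> (forall w, Y w <= Z w + D w) ->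
  (\int[P]_w (Y w)%:E <= \int[P]_w (Z w)%:E + c%:E)%E.
Proof.
move=> iY iZ mD D0 Dc YZ.
have iD : P.-integrable setT (EFin \o D).
  apply: Ex_lty_integrable => //; apply: le_lt_trans (ltry c).
  by under [in leLHS]eq_fun do rewrite ger0_norm//.
apply: (@le_trans _ _ (\int[P]_w ((Z w)%:E + (D w)%:E))%E).
  by apply: le_integral => //; [exact: integrableD|move=> w _; rewrite -EFinD lee_fin].
by rewrite integralD//; apply: leeD.
Qed.

Lemma integral_law (Y : T -> R) (x : R) : meas Y -> (\E[P]_w (Y w ^+ 2) < +oo)%E ->
  (\int[law P Y]_z (h (x + z)%R)%:E = \int[P]_w (h (x + Y w)%R)%:E)%E.
Proof.
move=> mY Y2; have mh := lip_measurable M0 hM.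
have mx : meas (fun z : R => h (x + z)).
  by apply: (measurableT_comp mh); apply: measurable_funD.
have ix : P.-integrable setT ((fun z => (h (x + z))%:E) \o Y).
  apply: (@lip_integrable (fun w => x + Y w)); first by apply: measurable_funD.
  apply: (@le_lt_trans _ _ (\E[P]_w (2 * x ^+ 2 + 2 * Y w ^+ 2))).
    apply: Ex_le; try side.
    by move=> w; have := sqrD_le x (Y w); lra.
  rewrite ExD; try side.
  rewrite Ex_cst ExZ//; try side.
  by apply: lte_add_pinfty; [exact: ltry|apply: lte_mul_pinfty].
rewrite /law (integral_pushforward mY) //; exact/measurable_EFinP.
Qed.

End integrable_lipschitz.

(** * The Euler scheme *)

Section clip.
Context {R : realType}.

Definition clip (c x : R) := Num.max (- c) (Num.min c x).

Lemma clip_le c x : 0 <= c -> `|clip c x| <= c.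
Proof.
move=> c0; rewrite ler_norml /clip le_max lexx ge_max ge_min lexx /= andbT.
by rewrite (le_trans _ c0)// oppr_le0.
Qed.

Lemma clip_id c x : `|x| <= c -> clip c x = x.
Proof. by rewrite ler_norml => /andP[? ?]; rewrite /clip min_r// max_r. Qed.

Lemma clip_lip c x y : `|clip c x - clip c y| <= `|x - y|.
Proof.
have h1 := ler_norm (x - y); have := ler_norm (y - x); rewrite distrC => h2.
rewrite ler_norml /clip; case: (leP c x) => ?; case: (leP c y) => ?;
  rewrite /Num.max; case: ifPn; rewrite -?leNgt => ?; try (case: ifPn; rewrite -?leNgt => ?);
  apply/andP; split; lra.
Qed.

Lemma clip_sub_le c x : 0 <= c -> `|x - clip c x| <= `|x|.
Proof.
move=> c0; have h1 := ler_norm x; have := ler_norm (- x); rewrite normrN => h2.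
rewrite ler_norml /clip; case: (leP c x) => ?; rewrite /Num.max; case: ifPn; rewrite -?leNgt => ?;
  apply/andP; split; lra.
Qed.

End clip.

Lemma discrete_gronwall {R : realType} (x : nat -> \bar R) (A c : R) (n : nat) : 0 <= A -> 0 <= c ->
  (forall j, (j <= n)%N -> (x j <= A%:E + \sum_(i < j) c%:E * x i)%E) ->
  forall j, (j <= n)%N -> (x j <= (A * (1 + c) ^+ j)%:E)%E.
Proof.
move=> A0 c0 hx j; elim/ltn_ind: j => j IH jn; apply: (le_trans (hx j jn)).
apply: (@le_trans _ _ (A%:E + \sum_(i < j) (c * (A * (1 + c) ^+ i))%:E)%E).
  apply: leeD => //; apply: lee_sum => i _; apply: lee_finZ => //.
  by apply: IH => //; exact: leq_trans (ltnW (ltn_ord i)) jn.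
rewrite sumEFin -EFinD lee_fin; apply: eq_leW.
elim: j {IH jn} => [|j ih]; first by rewrite big_ord0 addr0 expr0 mulr1.
by rewrite big_ord_recr/= addrA ih exprS; ring.
Qed.

Section grids.
Context {R : realType} {d} {T : measurableType d}.
Implicit Types f g : R -> T -> R.

Lemma grid_ge0 (t : R) n k : 0 <= t -> 0 <= grid 0 t n k.
Proof. by move=> t0; rewrite /grid add0r subr0 mulr_ge0// divr_ge0// exprn_ge0. Qed.

Lemma tint_le_oc f g a t w : 0 <= a -> proc f -> proc g ->
  (forall s, a < s <= t -> f s w <= g s w) -> tint f a t w <= tint g a t w.
Proof.
move=> a0 pf pg fg.
have sub : `]a, t] `<=` (`[a, t] : set R) by apply: subset_itvr; rewrite bnd_simp.
have ioc f' : proc f' -> lebesgue_measure.-integrable (`]a, t] : set R) (EFin \o (fun s => f' s w)).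
  by move=> pf'; apply: (integrableS _ _ _ (proc_integrable w t a0 pf')).
have tE f' : proc f' -> tint f' a t w = \int[lebesgue_measure]_(s in `]a, t]) f' s w.
  move=> pf'; rewrite /tint Rintegral_itv_obnd_cbnd//.
  exact: ioc.
rewrite !tE//; exact: (le_Rintegral _ (ioc _ pf) (ioc _ pg)).
Qed.

Lemma tint_grid f (t : R) n j w : 0 <= t -> proc f ->
  tint f 0 (grid 0 t n j) w = \sum_(i < j) tint f (grid 0 t n i) (grid 0 t n i.+1) w.
Proof.
move=> t0 pf; elim: j => [|j ih]; first by rewrite grid0 tint_point big_ord0.
have g0 : 0 <= grid 0 t n j by exact: grid_ge0.
by rewrite (tint_cat w (lexx 0) g0 (grid_le n t0 (leqnSn j)) pf) ih big_ord_recr.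
Qed.

Variables (t : R) (n : nat) (c : nat -> T -> R).
Hypotheses (t0 : 0 <= t) (mc : forall k, meas (c k)).

Definition step_path (s : R) (w : T) : R :=
  \sum_(k < 2 ^ n) c k w * \1_(`]grid 0 t n k, grid 0 t n k.+1]) s.

Lemma proc_step_path : proc step_path.
Proof.
apply: (@proc_sum _ _ _ _ (fun k s w => c k w * \1_(`]grid 0 t n k, grid 0 t n k.+1]) s)) => k.
by apply: procM; [exact: proc_const|exact: proc_indic_oc].
Qed.

Lemma step_pathE i s w : (i < 2 ^ n)%N -> grid 0 t n i < s <= grid 0 t n i.+1 -> step_path s w = c i w.
Proof.
move=> ltn /andP[is_ si]; rewrite /step_path (bigD1 (Ordinal ltn))//= indic_ocE is_ si mulr1.
rewrite big1 ?addr0// => k ki; rewrite indic_ocE.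
have [|ik] := ltnP k i.
  move=> ki'; rewrite [X in _ && X](_ : _ = false) ?andbF ?mulr0//.
  by apply/negbTE; rewrite -ltNge (le_lt_trans _ is_)// grid_le.
rewrite [X in X && _](_ : _ = false) ?mulr0//; apply/negbTE; rewrite -leNgt (le_trans si)// grid_le//.
by rewrite ltn_neqAle ik andbT eq_sym; apply: contra ki => /eqP ki; apply/eqP/val_inj.
Qed.

Lemma tint_step_path j w : (j <= 2 ^ n)%N ->
  tint step_path 0 (grid 0 t n j) w = \sum_(i < j) c i w * (t / 2 ^+ n).
Proof.
move=> jn; rewrite tint_grid//; last exact: proc_step_path.
apply: eq_bigr => i _; have iN : (i < 2 ^ n)%N by exact: leq_trans jn.
have g0 : 0 <= grid 0 t n i by exact: grid_ge0.
have gS : grid 0 t n i <= grid 0 t n i.+1 by rewrite grid_le.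
have p1 := proc_step_path; have p2 : proc (fun (_ : R) w => c i w) by exact: proc_const.
have -> : c i w * (t / 2 ^+ n) = tint (fun (_ : R) w => c i w) (grid 0 t n i) (grid 0 t n i.+1) w.
  rewrite (_ : tint _ _ _ _ = tint (fun _ _ => c i w) (grid 0 t n i) (grid 0 t n i.+1) w)//.
  by rewrite tint_cst// gridS subr0.
by apply/eqP; rewrite eq_le !tint_le_oc// => s si; rewrite (step_pathE _ iN si).
Qed.

End grids.

Section euler.
Context {R : realType} {d} {Om : measurableType d}.
Variables (b sg : R -> R) (kappa : R -> R) (T : R) (n : nat).
Local Notation tg := (grid 0 T n).
Local Notation dl := (T / 2 ^+ n).

(* The diffusion coefficient is clipped because simple processes are bounded. *)
Definition euler_map (j : nat) (x y : R) : R :=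
  x + b x * dl + clip n%:R (sg x) * y + (kappa (tg j.+1) - kappa (tg j)).

Fixpoint euler (B : R -> Om -> R) (X0 : Om -> R) (j : nat) (w : Om) : R :=
  if j is k.+1 then euler_map k (euler B X0 k w) (B (tg k.+1) w - B (tg k) w) else X0 w.

End euler.

Section euler_convergence.
Context {R : realType} {d} {Om : measurableType d} (P : probability Om R).
Variables (F : R -> set (set Om)) (B : R -> Om -> R).
Hypotheses (cF : complete_filtration P F) (BM : brownian_motion P F B).
Variables (b sg : R -> R) (L : R).
Hypotheses (L1 : 1 <= L) (bL : lip L b).
Hypotheses (sgL : lip L sg).
Variables (X0 : Om -> R) (X I : R -> Om -> R) (kappa : R -> R).
Hypotheses (aX : adapted F X) (cX : continuous_paths X).
Hypothesis iI : ito_integral P F B (fun t w => sg (X t w)) I.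
Hypothesis F0 : measurable_wrt (F 0) X0.
Hypothesis eqX : {ae P, forall w, forall t, 0 <= t -> X t w = X0 w + sde_noise b X I t w + kappa t}.
Hypothesis kappa0 : kappa 0 = 0.
Variables (T D2 S2 : R).
Hypotheses (T0 : 0 <= T) (D20 : 0 <= D2).
Hypothesis X_incr : forall s t, 0 <= s -> s <= t -> t <= T ->
  (\E[P]_w ((X t w - X s w) ^+ 2) <= (D2 * (t - s))%:E)%E.
Hypothesis X_sg : (Ex P (tint (fun s w => sg (X s w) ^+ 2)%R 0 T) <= S2%:E)%E.

Let L0 : 0 <= L. Proof. exact: le_trans L1. Qed.
Let pX : proc X := proc_adapted cF aX cX.
Let pb : proc (fun t w => b (X t w)). Proof. exact: (proc_lip L0 bL pX). Qed.
Let psg : proc (fun t w => sg (X t w)). Proof. exact: (proc_lip L0 sgL pX). Qed.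
Let mX t : 0 <= t -> meas (X t). Proof. by have [+ _ _] := pX; apply. Qed.
Let mb := lip_measurable L0 bL.
Let msg := lip_measurable L0 sgL.
Local Notation V := (sde_noise b X I).

Section one_level.
Variable n : nat.
Local Notation tg := (grid 0 T n).
Local Notation dl := (T / 2 ^+ n).
Local Notation e := (euler b sg kappa T n B X0).

Let tg0 k : 0 <= tg k. Proof. exact: grid_ge0. Qed.
Let tgS k : tg k <= tg k.+1. Proof. by rewrite grid_le. Qed.
Let dl0 : 0 <= dl. Proof. by rewrite divr_ge0// exprn_ge0. Qed.
Let clipL x y : `|clip n%:R (sg x) - clip n%:R (sg y)| <= L * `|x - y|.
Proof. exact: le_trans (clip_lip _ _ _) (sgL x y). Qed.
Let mclip := lip_measurable L0 clipL.

Lemma euler_adapted j : measurable_wrt (F (tg j)) (e j).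
Proof.
elim: j => [|j ih]; first by rewrite grid0.
apply: (fun_wrt cF) => //; rewrite /= /euler_map.
have me : measurable_fun (T := g_sigma_algebraType (F (tg j.+1))) setT (e j).
  by apply: (wrt_fun cF) => //; exact: (wrt_mono cF (tg0 j) (tgS j) ih).
have mB : measurable_fun (T := g_sigma_algebraType (F (tg j.+1))) setT (B (tg j)).
  by apply: (wrt_fun cF) => //; exact: (wrt_mono cF (tg0 j) (tgS j) (brownian_adapted BM (tg0 j))).
have mB' : measurable_fun (T := g_sigma_algebraType (F (tg j.+1))) setT (B (tg j.+1)).
  by apply: (wrt_fun cF) => //; exact: (brownian_adapted BM (tg0 _)).
apply: measurable_funD; last exact: measurable_cst.
apply: measurable_funD; last first.
  by apply: measurable_funM; [exact: (measurableT_comp mclip me)|exact: measurable_funB].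
by apply: measurable_funD => //; apply: measurable_funM; [exact: (measurableT_comp mb me)|exact: measurable_cst].
Qed.

Lemma measurable_euler j : meas (e j).
Proof. exact: (filtration_measurable cF (tg0 j) (euler_adapted j)). Qed.

Let cb k w := b (e k w).
Let cs k w := clip n%:R (sg (e k w)).
Let mcb k : meas (cb k). Proof. exact: (measurableT_comp mb (measurable_euler k)). Qed.
Let mcs k : meas (cs k). Proof. exact: (measurableT_comp mclip (measurable_euler k)). Qed.
Let phi := StepProcess (2 ^ n) tg cs.

Let sphi : simple_process F phi.
Proof.
split => //=; first by move=> i j ij; exact: grid_le.
- move=> k; apply: (fun_wrt cF) => //.
  have me := wrt_fun cF (tg0 k) (euler_adapted k).
  exact: (measurableT_comp mclip me).
- by exists n%:R => k w; exact: clip_le.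
Qed.

(** The scheme has its own step process as integrand, approximated by the constant sequence; the
    maximal inequality for a difference of two Ito integrals thus compares [X] with the scheme. *)
Let ito_phi : ito_integral P F B (step_eval phi) (step_integral B phi).
Proof.
have pS := proc_step_integral cF BM sphi.
split.
- move=> t t0; apply: (fun_wrt cF) => //; rewrite /step_integral.
  apply: measurable_sum => k; have [kt|tk] := leP t (tg k).
    rewrite (_ : (fun w => _) = fun _ => 0); first exact: measurable_cst.
    by apply/funext => w /=; rewrite !min_r ?subrr ?mulr0// (le_trans kt).
  have mBt u : 0 <= u -> u <= t -> measurable_fun (T := g_sigma_algebraType (F t)) setT (B u).
    by move=> u0 ut; apply: (wrt_fun cF) => //; exact: (wrt_mono cF u0 ut (brownian_adapted BM u0)).
  apply: measurable_funM.
    apply: (wrt_fun cF) => //; apply: (wrt_mono cF (tg0 k) (ltW tk)).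
    by case: sphi => _ _ /(_ k).
  apply: measurable_funB; last exact: (mBt _ (tg0 k) (ltW tk)).
  by apply: (mBt (Num.min (tg k.+1) t)); rewrite ?le_min ?tg0 ?t0// ge_min lexx orbT.
- move=> w; apply/subspace_continuousP => x /=; rewrite in_itv/= andbT => x0.
  have cB : {within `[0, +oo[, continuous (B^~ w)} by case: BM => _ /(_ ord0).
  have cmin u : 0 <= u -> B (Num.min u s) w @[s --> within `[0, +oo[ (nbhs x)] --> B (Num.min u x) w.
    move=> u0; have mx : `[0, +oo[%classic (Num.min u x) by rewrite /= in_itv/= andbT le_min u0.
    have /subspace_continuousP/(_ _ mx) hB := cB.
    apply: (cvg_comp _ _ _ hB) => S hS.
    have cm : Num.min u s @[s --> x] --> Num.min u x.
      by apply: continuous_min => //; exact: cvg_cst.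
    have hn : nbhs x (fun s => `[0, +oo[%classic (Num.min u s) -> S (Num.min u s)) := cm _ hS.
    change (nbhs x (fun s => `[0, +oo[%classic s -> S (Num.min u s))).
    apply: filterS hn => s hs; rewrite /= in_itv/= andbT => s0.
    by apply: hs; rewrite /= in_itv/= andbT le_min u0.
  pose f k s := cs k w * (B (Num.min (tg k.+1) s) w - B (Num.min (tg k) s) w).
  have cf N : \sum_(k < N) f k s @[s --> within `[0, +oo[ (nbhs x)] --> \sum_(k < N) f k x.
    elim: N => [|N ih]; first by under eq_fun do rewrite big_ord0; rewrite big_ord0; exact: cvg_cst.
    under eq_fun do rewrite big_ord_recr; rewrite big_ord_recr; apply: cvgD => //.
    by apply: cvgM; [exact: cvg_cst|apply: cvgB; exact: cmin].
  exact: (cf (2 ^ n)%N).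
- exists (fun=> phi); split => // t t0; split => ep ep0.
    rewrite (_ : (fun n => _) = fun=> 0%E); first exact: cvg_cst.
    apply/funext => k; rewrite (_ : [set w | _] = set0) ?measure0//.
    apply/seteqP; split => w //=; rewrite integral0_eq ?lee_fin ?leNgt ?ep0// => s _.
    by rewrite subrr expr0n.
  rewrite (_ : (fun n => _) = fun=> 0%E); first exact: cvg_cst.
  apply/funext => k; rewrite (_ : [set w | _] = set0) ?measure0//.
  apply/seteqP; split => w //=; apply/negP; rewrite -ltNge.
  apply: (@le_lt_trans _ _ 0%E); rewrite ?lte_fin//.
  by apply: ge_ereal_sup => _ [s _ <-]; rewrite subrr normr0.
Qed.

Let beta' := step_path T n cb.
Let pbeta' : proc beta'. Proof. exact: proc_step_path. Qed.

Let step_integral_grid j w : (j <= 2 ^ n)%N -> step_integral B phi (tg j) w =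
  \sum_(i < j) cs i w * (B (tg i.+1) w - B (tg i) w).
Proof.
move=> jn; rewrite /step_integral /= (big_ord_widen _ (fun i => cs i w * (B (tg i.+1) w - B (tg i) w)) jn).
rewrite [RHS]big_mkcond; apply: eq_bigr => i _; case: ltnP => ij.
  by rewrite !min_l// grid_le// ltnW.
by rewrite !min_r ?subrr ?mulr0// grid_le// leqW.
Qed.

(** At the nodes the scheme satisfies the equation of [X] with coefficients frozen on each cell, so
    its error is a difference of two noises. *)
Let eulerE j w : (j <= 2 ^ n)%N -> e j w = X0 w + noise beta' (step_integral B phi) (tg j) w + kappa (tg j).
Proof.
move=> jn; rewrite /noise tint_step_path// step_integral_grid//.
elim: j jn => [|j ih] jn; first by rewrite !big_ord0 grid0 kappa0 !addr0.
by rewrite !big_ord_recr/= /euler_map {1}(ih (ltnW jn)) /cb /cs; ring.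
Qed.

Definition clip_error (s : R) (w : Om) : R := (sg (X s w) - clip n%:R (sg (X s w))) ^+ 2.
Lemma proc_clip_error : proc clip_error.
Proof. by apply: procX; apply: procB => //; exact: proc_lip L0 clipL pX. Qed.

Let D j := \E[P]_w ((X (tg j) w - e j w) ^+ 2).

Let mXe j : meas (fun w => (X (tg j) w - e j w) ^+ 2).
Proof. by have := mX (tg0 j); have := measurable_euler j => ? ?; mea. Qed.

Let error_le_noise j : (j <= 2 ^ n)%N -> (D j <=
  2%:E * \E[P]_w (tint (fun s w => `|b (X s w) - beta' s w|) 0 (tg j) w ^+ 2) +
  (2 * 64)%:E * Ex P (tint (fun s w => (sg (X s w) - step_eval phi s w) ^+ 2)%R 0 (tg j)))%E.
Proof.
move=> jn.
pose one : R -> Om -> R := fun _ _ => 1.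
have p1 : proc one by exact: (@proc_const _ _ _ (fun=> 1)).
have F1 s : 0 <= s -> measurable_wrt (F s) (fun=> 1 : R).
  by move=> s0; apply: (fun_wrt cF) => //; exact: measurable_cst.
have c01 s w : one s w = 0 \/ one s w = 1 by right.
have cmono s s' w : 0 <= s -> s <= s' -> one s' w <= one s w by [].
have n1 (w : Om) : `|(fun=> 1 : R) w| <= 1 by rewrite normr1.
have pphi := proc_step_eval cF sphi.
have := noise_maximal2 cF BM pb pbeta' psg pphi iI ito_phi c01 cmono p1 F1 (F1 0 (lexx 0)) n1 (lexx 0) (tg0 j).
rewrite (_ : tint (weighted_integrand _ _ _ _) 0 (tg j) = tint (fun s w => (sg (X s w) - step_eval phi s w) ^+ 2)%R 0 (tg j)); last first.
  by apply/funext => w; apply: tint_eq => s _; rewrite /weighted_integrand !mul1r.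
rewrite (_ : (fun w => tint (weighted_drift _ _ _ _) 0 (tg j) w ^+ 2) = fun w => tint (fun s w => `|b (X s w) - beta' s w|) 0 (tg j) w ^+ 2); last first.
  by apply/funext => w; congr (_ ^+ 2); apply: tint_eq => s _; rewrite /weighted_drift !mul1r.
apply: le_trans; rewrite /D /Ex.
pose g s w := one s w * noise_increment (fun t w => b (X t w)) I beta' (step_integral B phi) (fun=> 1) 0 s w ^+ 2.
have pg : proc g.
  have p2 := proc_noise cF pb iI; have p3 := proc_noise cF pbeta' ito_phi.
  have pc (J : R -> Om -> R) : proc J -> proc (fun (_ : R) (w : Om) => J 0 w : R).
    by move=> [+ _ _] => /(_ 0 (lexx 0)); exact: proc_const.
  apply: procM => //; apply: procX; apply: procM => //.
  by apply: procB; apply: procB; [exact: p2|exact: pc p2|exact: p3|exact: pc p3].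
apply: ae_ge0_le_integral => //.
- by move=> w _; rewrite lee_fin sqr_ge0.
- by apply/measurable_EFinP; exact: mXe.
- by move=> w _; apply: esup_ge0 => // s; rewrite mul1r sqr_ge0.
- exact: (measurable_esup (lexx 0) (tg0 j) pg).
apply: filterS2 eqX (sde_noise0 cF BM b L1 sgL aX cX iI) => w eX V0 _.
apply: le_trans (esup_ubound g w (s := tg j) _); last by rewrite lexx tg0.
rewrite lee_fin /g /one !mul1r /noise_increment mul1r.
rewrite (eX _ (tg0 j)) eulerE//; move: V0; rewrite /sde_noise => ->.
rewrite (_ : noise beta' (step_integral B phi) 0 w = 0).
  by apply: eq_leW; congr (_ ^+ 2); ring.
by rewrite /noise tint_point add0r -[X in step_integral _ _ X _](grid0 0 T n) step_integral_grid// big_ord0.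
Qed.

Let pincr i : proc (fun s w => (X s w - X (tg i) w) ^+ 2).
Proof. by apply: procX; apply: procB => //; apply: proc_const; exact: mX. Qed.

(** What a cell contributes beyond clipping: the movement of [X] inside the cell and the error
    already present at its left node, the latter being fed to the discrete Gronwall inequality. *)
Let remainder i w := 4 * L ^+ 2 * tint (fun s w => (X s w - X (tg i) w) ^+ 2) (tg i) (tg i.+1) w +
  4 * L ^+ 2 * dl * (X (tg i) w - e i w) ^+ 2.

Let remainder_ge0 i w : 0 <= remainder i w.
Proof.
apply: addr_ge0; last by nneg.
by apply: mulr_ge0; [nneg|apply: tint_ge0 => s _; exact: sqr_ge0].
Qed.

Let mtincr i : meas (tint (fun s w => (X s w - X (tg i) w) ^+ 2) (tg i) (tg i.+1)).
Proof. exact: measurable_tint. Qed.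

Let measurable_remainder i : meas (remainder i).
Proof.
have h := mtincr i; have h' := mXe i.
by rewrite /remainder; apply: measurable_funD; apply: measurable_funM.
Qed.

Let piece (g : R -> Om -> R) i w : (i < 2 ^ n)%N -> proc g ->
  (forall s, tg i < s <= tg i.+1 -> g s w <= 2 * clip_error s w +
     (4 * L ^+ 2 * (X s w - X (tg i) w) ^+ 2 + 4 * L ^+ 2 * (X (tg i) w - e i w) ^+ 2)) ->
  tint g (tg i) (tg i.+1) w <= 2 * tint clip_error (tg i) (tg i.+1) w + remainder i w.
Proof.
move=> iN pg hg.
have p1 : proc (fun s w => 2 * clip_error s w).
  by apply: procM; [exact: (@proc_const _ _ _ (fun=> 2))|exact: proc_clip_error].
have p2 : proc (fun s w => 4 * L ^+ 2 * (X s w - X (tg i) w) ^+ 2).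
  by apply: procM => //; exact: (@proc_const _ _ _ (fun=> 4 * L ^+ 2)).
have p3 : proc (fun (_ : R) w => 4 * L ^+ 2 * (X (tg i) w - e i w) ^+ 2).
  by apply: proc_const; apply: measurable_funM => //; exact: mXe.
apply: (@le_trans _ _ (tint (fun s w => 2 * clip_error s w + (4 * L ^+ 2 * (X s w - X (tg i) w) ^+ 2 +
    4 * L ^+ 2 * (X (tg i) w - e i w) ^+ 2)) (tg i) (tg i.+1) w)).
  by apply: tint_le_oc => //; apply: procD => //; exact: procD.
have e1 := tintZ 2 (tg i.+1) w (tg0 i) proc_clip_error.
have e2 := tintZ (4 * L ^+ 2) (tg i.+1) w (tg0 i) (pincr i).
have e3 : tint (fun (_ : R) w => 4 * L ^+ 2 * (X (tg i) w - e i w) ^+ 2) (tg i) (tg i.+1) w =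
    4 * L ^+ 2 * dl * (X (tg i) w - e i w) ^+ 2.
  rewrite (_ : tint _ _ _ _ = tint (fun _ _ => 4 * L ^+ 2 * (X (tg i) w - e i w) ^+ 2) (tg i) (tg i.+1) w)//.
  by rewrite tint_cst// gridS subr0 mulrAC.
rewrite (tintD _ _ (tg0 i) p1 (procD p2 p3)) (tintD _ _ (tg0 i) p2 p3) e1 e2 e3.
exact: lexx.
Qed.

Let total (g : R -> Om -> R) j w : (j <= 2 ^ n)%N -> proc g ->
  (forall i s, (i < 2 ^ n)%N -> tg i < s <= tg i.+1 -> g s w <= 2 * clip_error s w +
     (4 * L ^+ 2 * (X s w - X (tg i) w) ^+ 2 + 4 * L ^+ 2 * (X (tg i) w - e i w) ^+ 2)) ->
  tint g 0 (tg j) w <= 2 * tint clip_error 0 (tg j) w + \sum_(i < j) remainder i w.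
Proof.
move=> jn pg hg; rewrite !tint_grid//; last exact: proc_clip_error.
rewrite mulr_sumr -big_split /=; apply: ler_sum => i _.
have iN : (i < 2 ^ n)%N by exact: leq_trans jn.
by apply: piece => // s; exact: hg.
Qed.

Let drift_total j w : (j <= 2 ^ n)%N -> tint (fun s w => `|b (X s w) - beta' s w|) 0 (tg j) w ^+ 2 <=
  T * (2 * tint clip_error 0 (tg j) w + \sum_(i < j) remainder i w).
Proof.
move=> jn; have tT : tg j <= T by rewrite -[leRHS](grid_end 0 T n) grid_le.
have pa : proc (fun s w => `|b (X s w) - beta' s w|) by apply: proc_abs; exact: procB.
apply: (le_trans (sqr_tint w (lexx 0) (tg0 j) pa)); rewrite subr0.
apply: ler_pM => //; first by apply: tint_ge0 => s _; exact: sqr_ge0.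
apply: total => //; first exact: procX.
move=> i s iN si; rewrite normr_sqr// /beta' (step_pathE _ T0 _ iN si) /cb.
apply: (@le_trans _ _ (L ^+ 2 * (X s w - e i w) ^+ 2)).
  by rewrite -exprMn -[leLHS]normr_sqr// -[leRHS]normr_sqr//;
    apply: lerXn2r; rewrite ?nnegrE// normrM (ger0_norm L0).
rewrite (_ : X s w - e i w = (X s w - X (tg i) w) + (X (tg i) w - e i w)); last by ring.
apply: (le_trans (ler_wpM2l (sqr_ge0 L) (sqrD_le _ _))).
have : 0 <= clip_error s w by exact: sqr_ge0.
have : 0 <= L ^+ 2 * (X s w - X (tg i) w) ^+ 2 by nneg.
have : 0 <= L ^+ 2 * (X (tg i) w - e i w) ^+ 2 by nneg.
set x := (X s w - _) ^+ 2; set y := (_ - _) ^+ 2 => h1 h2 h3.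
rewrite (_ : L ^+ 2 * (2 * (x + y)) = 2 * (L ^+ 2 * x) + 2 * (L ^+ 2 * y)); last by ring.
by rewrite -[4 * _ * x]mulrA -[4 * _ * y]mulrA; lra.
Qed.

Let noise_total j w : (j <= 2 ^ n)%N -> tint (fun s w => (sg (X s w) - step_eval phi s w) ^+ 2) 0 (tg j) w <=
  2 * tint clip_error 0 (tg j) w + \sum_(i < j) remainder i w.
Proof.
move=> jn; apply: total => //; first by apply: procX; apply: procB => //; exact: (proc_step_eval cF sphi).
move=> i s iN si; rewrite (_ : step_eval phi s w = step_path T n cs s w)//.
rewrite (step_pathE _ T0 _ iN si) /cs /clip_error.
set u := sg (X s w); set v := clip _ u; set y := clip _ _.
have -> : u - y = (u - v) + (v - y) by ring.
apply: (le_trans (sqrD_le _ _)); rewrite mulrDr lerD2l.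
apply: (@le_trans _ _ (2 * (L ^+ 2 * (X s w - e i w) ^+ 2))).
  rewrite ler_pM2l// -exprMn -[leLHS]normr_sqr// -[leRHS]normr_sqr//.
  by apply: lerXn2r; rewrite ?nnegrE// normrM (ger0_norm L0); exact: clipL.
rewrite (_ : X s w - e i w = (X s w - X (tg i) w) + (X (tg i) w - e i w)); last by ring.
rewrite (_ : 4 * L ^+ 2 * _ + 4 * L ^+ 2 * _ = 2 * (L ^+ 2 * (2 * ((X s w - X (tg i) w) ^+ 2 + (X (tg i) w - e i w) ^+ 2)))); last by ring.
by rewrite ler_pM2l// ler_wpM2l ?sqr_ge0// sqrD_le.
Qed.

(** Discrete Gronwall over the cells. The factor stays bounded in [n] because [(1 + c)^j <= e^(j c)]
    and the first [j] cells have total length at most [T]. *)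
Lemma euler_error r : 0 <= r -> (Ex P (tint clip_error 0 T) <= r%:E)%E -> forall j, (j <= 2 ^ n)%N ->
  (D j <= ((2 * T + 2 * 64) * (2 * r + 4 * L ^+ 2 * D2 * T * dl) * expR ((2 * T + 2 * 64) * (4 * L ^+ 2) * T))%:E)%E.
Proof.
move=> r0 hr.
pose q := 2 * T + 2 * 64; have q0 : 0 <= q by rewrite /q; nneg.
pose c := q * (4 * L ^+ 2) * dl; have c0 : 0 <= c by rewrite /c; nneg.
pose A := q * (2 * r + 4 * L ^+ 2 * D2 * T * dl).
have A0 : 0 <= A by rewrite /A; nneg.
have mce : meas (tint clip_error 0 T) by apply: measurable_tint => //; exact: proc_clip_error.
have ce0 s t w : 0 <= tint clip_error s t w by apply: tint_ge0 => ? _; exact: sqr_ge0.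
have Dj j : (j <= 2 ^ n)%N -> (D j <= A%:E + \sum_(i < j) c%:E * D i)%E.
  move=> jn; apply: (le_trans (error_le_noise jn)).
  have tT : tg j <= T by rewrite -[leRHS](grid_end 0 T n) grid_le.
  pose S w := 2 * tint clip_error 0 T w + \sum_(i < j) remainder i w.
  have mS : meas S.
    by apply: measurable_funD; [exact: measurable_funM|apply: measurable_sum => i].
  have S0 w : 0 <= S w by apply: addr_ge0; [exact: mulr_ge0|apply: sumr_ge0].
  have leS w : 2 * tint clip_error 0 (tg j) w + \sum_(i < j) remainder i w <= S w.
    rewrite lerD2r ler_pM2l// [leRHS](tint_cat w (lexx 0) (tg0 j) tT proc_clip_error) lerDl//.
  have pb' : proc (fun s w => `|b (X s w) - beta' s w|) by apply: proc_abs; exact: procB.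
  have pn' : proc (fun s w => (sg (X s w) - step_eval phi s w) ^+ 2).
    by apply: procX; apply: procB => //; exact: (proc_step_eval cF sphi).
  have m1 := measurable_tint (tg j) (lexx 0) pb'; have m2 := measurable_tint (tg j) (lexx 0) pn'.
  apply: (@le_trans _ _ (q%:E * Ex P S)%E).
    have -> : (q%:E * Ex P S = (2 * T)%:E * Ex P S + (2 * 64)%:E * Ex P S)%E.
      by rewrite /q EFinD ge0_muleDl ?lee_fin ?mulr_ge0.
    apply: leeD.
      rewrite EFinM -muleA; apply: lee_wpmul2l => //; rewrite -ExZ//.
      apply: Ex_le; [by nneg|by mea|by mea|move=> w].
      by apply: (le_trans (drift_total w jn)); exact: ler_wpM2l.
    apply: lee_wpmul2l => //; apply: Ex_le; [|by mea|by mea|].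
      by move=> w; apply: tint_ge0 => s _; exact: sqr_ge0.
    by move=> w; apply: (le_trans (noise_total w jn)).
  have ER i : (i < j)%N -> (Ex P (remainder i) <= (4 * L ^+ 2 * (D2 * dl * dl))%:E + (4 * L ^+ 2 * dl)%:E * D i)%E.
    move=> ij; have h1 := mtincr i; have h2 := mXe i.
    have tS : tg i.+1 <= T by rewrite -[leRHS](grid_end 0 T n) grid_le// (leq_trans ij).
    rewrite /remainder ExD; last 4 first.
    - by move=> w; apply: mulr_ge0; [nneg|apply: tint_ge0 => s _; exact: sqr_ge0].
    - by nneg.
    - by mea.
    - by mea.
    rewrite ExZ//; [|by nneg|by move=> w; apply: tint_ge0 => s _; exact: sqr_ge0].
    rewrite ExZ//; try side.
    apply: leeD => //; apply: lee_finZ; first by nneg.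
    have hdl : tg i.+1 - tg i = dl by rewrite gridS subr0.
    rewrite -{2}hdl.
    apply: Ex_tint_cst => //; first by move=> s w; exact: sqr_ge0.
    move=> s /andP[is_ si]; apply: (le_trans (X_incr (tg0 i) is_ (le_trans si tS))).
    by rewrite lee_fin ler_wpM2l// -hdl lerD2r.
  rewrite /S ExD//; last 4 first.
  - by move=> w; exact: mulr_ge0.
  - by move=> w; apply: sumr_ge0 => i _.
  - by apply: measurable_funM.
  - by apply: measurable_sum => i.
  rewrite ExZ// (Ex_sum P j remainder_ge0 measurable_remainder).
  apply: (@le_trans _ _ (q%:E * ((2 * r)%:E + ((4 * L ^+ 2 * D2 * T * dl)%:E + \sum_(i < j) (4 * L ^+ 2 * dl)%:E * D i))))%E.
    apply: lee_wpmul2l => //; apply: leeD; first exact: lee_finZ.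
    apply: (@le_trans _ _ (\sum_(i < j) ((4 * L ^+ 2 * (D2 * dl * dl))%:E + (4 * L ^+ 2 * dl)%:E * D i))%E).
      by apply: lee_sum => i _; exact: ER.
    rewrite big_split/=; apply: leeD => //.
    rewrite sumEFin lee_fin sumr_const card_ord -[leLHS]mulr_natr.
    rewrite (_ : 4 * L ^+ 2 * (D2 * dl * dl) * j%:R = 4 * L ^+ 2 * D2 * dl * (j%:R * dl)); last by ring.
    rewrite (_ : 4 * L ^+ 2 * D2 * T * dl = 4 * L ^+ 2 * D2 * dl * T); last by ring.
    apply: ler_wpM2l; first by nneg.
    by move: tT; rewrite /grid add0r subr0.
  have D0 i : (0 <= D i)%E by apply: Ex_ge0 => w; exact: sqr_ge0.
  rewrite addeA -EFinD ge0_muleDr; last 2 first.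
  - by rewrite lee_fin; nneg.
  - by apply: sume_ge0 => i _; apply: mule_ge0 => //; rewrite lee_fin; nneg.
  rewrite -EFinM -/A leeD2lE// ge0_sume_distrr; last first.
    by move=> i _; apply: mule_ge0 => //; rewrite lee_fin; nneg.
  by apply: lee_sum => i _; rewrite muleA -EFinM /c -[q * _ * dl]mulrA.
move=> j jn; apply: (le_trans (discrete_gronwall A0 c0 Dj jn)).
rewrite lee_fin; apply: ler_wpM2l => //.
apply: (@le_trans _ _ (expR c ^+ j)).
  by apply: lerXn2r; rewrite ?nnegrE ?addr_ge0 ?expR_ge0// expR_ge1Dx.
rewrite -expRM_natl ler_expR (_ : j%:R * c = q * (4 * L ^+ 2) * (j%:R * dl)); last by rewrite /c mulrCA.
apply: ler_wpM2l; first by nneg.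
have tT : tg j <= T by rewrite -[leRHS](grid_end 0 T n) grid_le.
by move: tT; rewrite /grid add0r subr0.
Qed.

End one_level.

(** On each path the diffusion coefficient is bounded, so clipping at [n] is eventually without
    effect; the unclipped energy dominates. *)
Lemma clip_error_cvg : Ex P (tint (clip_error n) 0 T) @[n --> \oo] --> 0%E.
Proof.
have ptn n : meas (tint (clip_error n) 0 T).
  by apply: measurable_tint => //; exact: proc_clip_error.
have ps2 : proc (fun s w => sg (X s w) ^+ 2) by exact: procX.
have ms2 : meas (tint (fun s w => sg (X s w) ^+ 2) 0 T) by exact: measurable_tint.
have t20 w : 0 <= tint (fun s w => sg (X s w) ^+ 2) 0 T w by apply: tint_ge0 => s _; exact: sqr_ge0.
have := @dominated_convergence _ _ R P setT measurableT (fun n w => (tint (clip_error n) 0 T w)%:E)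
  (cst 0%E) (fun w => (tint (fun s w => sg (X s w) ^+ 2) 0 T w)%:E).
case => //.
- by move=> n; exact/measurable_EFinP.
- apply: aeW => w _; apply: cvg_near_cst.
  have [_ _ /(_ w T) [c hc]] := psg.
  near=> n; congr EFin; rewrite (_ : tint _ _ _ _ = tint (fun _ _ => 0) 0 T w); last first.
    apply: tint_eq => s sT; rewrite /clip_error clip_id ?subrr ?expr0n//.
    apply: (le_trans (hc s sT)); apply: (@le_trans _ _ (Num.truncn c).+1%:R); first exact/ltW/truncnS_gt.
    by rewrite ler_nat; near: n; exact: nbhs_infty_ge.
  by rewrite tint_cst// mul0r.
- apply: Ex_lty_integrable => //; under [in ltLHS]eq_fun do rewrite ger0_norm//.
  exact: le_lt_trans X_sg (ltry _).
- apply: aeW => w n _; rewrite lee_fin ger0_norm; last by apply: tint_ge0 => s _; exact: sqr_ge0.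
  apply: tint_le => //; first exact: proc_clip_error.
  move=> s _; rewrite /clip_error -[leLHS]normr_sqr// -[leRHS]normr_sqr//.
  by apply: lerXn2r; rewrite ?nnegrE ?clip_sub_le.
move=> _ _; rewrite integral_cst//= mul0e; exact.
Unshelve. all: by end_near. Qed.

Lemma euler_cvg eps : 0 < eps -> \forall n \near \oo, forall j, (j <= 2 ^ n)%N ->
  (\E[P]_w ((X (grid 0 T n j) w - euler b sg kappa T n B X0 j w) ^+ 2) <= eps%:E)%E.
Proof.
move=> e0.
pose C := (2 * T + 2 * 64) * expR ((2 * T + 2 * 64) * (4 * L ^+ 2) * T).
have C0 : 0 <= C by rewrite /C; nneg.
pose k := C * (2 + 4 * L ^+ 2 * D2 * T * T).
have k0 : 0 <= k by rewrite /k; nneg.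
pose r := eps / (k + 1).
have r0 : 0 < r by rewrite divr_gt0// ltr_wpDl.
near=> n => j jn.
have hr : (Ex P (tint (clip_error n) 0 T) <= r%:E)%E.
  apply: ltW; near: n; move/fine_cvgP: clip_error_cvg => [fin /cvgrPdist_lt /(_ _ r0) h].
  apply: filterS2 fin h => n /= fn; rewrite sub0r normrN => h.
  by rewrite -(fineK fn) lte_fin (le_lt_trans (ler_norm _) h).
have hd : (2 ^+ n)^-1 <= r.
  apply: ltW; near: n; exact: cvgr_lt 0 cvg_inv_pow2 _ r0.
apply: (le_trans (euler_error (ltW r0) hr jn)); rewrite lee_fin.
apply: (@le_trans _ _ (k * r)).
  rewrite [leLHS](_ : _ = C * (2 * r + 4 * L ^+ 2 * D2 * T * (T / 2 ^+ n))); last by rewrite /C mulrAC.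
  rewrite [leRHS](_ : _ = C * ((2 + 4 * L ^+ 2 * D2 * T * T) * r)); last by rewrite /k mulrA.
  apply: ler_wpM2l => //; rewrite [X in _ <= X]mulrDl lerD2l mulrA.
  by apply: ler_wpM2l => //; nneg.
by rewrite /r mulrCA ler_piMr ?(ltW e0)// ler_pdivrMr ?ltr_wpDl// mul1r lerDl.
Unshelve. all: by end_near. Qed.

End euler_convergence.

(** * Independence of groups of particles *)

Section generated_independence.
Context {R : realType} {d} {Om : measurableType d} (P : probability Om R).

(** Dynkin's argument: the events independent of a fixed [C] form a lambda-system, which contains
    the sigma-algebra as soon as it contains a generating pi-system. *)
Lemma indep_generated (E : set (set Om)) (C : set Om) : E `<=` measurable -> setI_closed E ->
  measurable C -> (forall A, E A -> P (A `&` C) = (P A * P C)%E) ->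
  forall A, <<s E >> A -> P (A `&` C) = (P A * P C)%E.
Proof.
move=> mE EI mC EC A sA.
pose H := [set A | measurable A /\ P (A `&` C) = (P A * P C)%E].
suff lH : lambda_system setT H.
  have /(_ A sA)[] // : <<s E >> `<=` H.
  by apply: (lambda_system_subset EI lH) => // B EB; split; [exact: mE|exact: EC].
have fP B : measurable B -> P B \is a fin_num by move=> mB; rewrite fin_num_measure.
split => //.
- by split => //; rewrite setTI probability_setT mul1e.
- move=> X Y YX [mX eX] [mY eY]; split; first exact: measurableD.
  have mXC : measurable (X `&` C) by exact: measurableI.
  have mYC : measurable (Y `&` C) by exact: measurableI.
  rewrite (_ : (X `\` Y) `&` C = (X `&` C) `\` (Y `&` C)); last first.
    by apply/seteqP; split => w /=; [move=> [[Xw nY] Cw]; split => // -[]|move=> [[Xw Cw] n]; split => //; split => // Yw; apply: n].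
  rewrite measureD//; last by rewrite ltey_eq fP.
  rewrite [X in (_ - P X)%E](_ : _ = Y `&` C); last first.
    by apply/seteqP; split => w /= => [[_ //]|[Yw Cw]]; split => //; split => //; exact: YX.
  rewrite measureD//; last by rewrite ltey_eq fP.
  have e : (P (X `&` C) - P (Y `&` C) = P X * P C - P Y * P C)%E by rewrite eX eY.
  apply: (etrans e); rewrite (setIidr YX) muleBl ?fP//.
  by rewrite fin_num_adde_defr// fP.
- move=> X ndX HX; have mX k : measurable (X k) by case: (HX k).
  split; first exact: bigcup_measurable.
  have c1 : P (X k `&` C) @[k --> \oo] --> P ((\bigcup_k X k) `&` C).
    rewrite setI_bigcupl; apply: nondecreasing_cvg_mu.
    + by move=> k; exact: measurableI.
    + by apply: bigcup_measurable => k _; exact: measurableI.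
    + by move=> i j ij; apply/subsetPset; apply: setSI; apply/subsetPset; exact: ndX.
  have c2 : P (X k `&` C) @[k --> \oo] --> (P (\bigcup_k X k) * P C)%E.
    under eq_fun do rewrite (HX _).2.
    apply: cvgeZr; first exact: fP.
    by apply: nondecreasing_cvg_mu => //; exact: bigcup_measurable.
  exact: cvg_unique c1 c2.
Qed.

Lemma indep_generated2 (E E' : set (set Om)) : E `<=` measurable -> setI_closed E ->
  E' `<=` measurable -> setI_closed E' ->
  (forall A C, E A -> E' C -> P (A `&` C) = (P A * P C)%E) ->
  forall A C, <<s E >> A -> <<s E' >> C -> P (A `&` C) = (P A * P C)%E.
Proof.
move=> mE EI mE' EI' EE A C sA sC.
have msub G : G `<=` measurable -> <<s G >> `<=` (measurable : set (set Om)).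
  by move=> mG; apply: smallest_sub => //; exact: sigma_algebra_measurable.
rewrite setIC muleC; apply: (indep_generated mE' EI' (msub _ mE _ sA)) sC => C' EC'.
rewrite setIC muleC; apply: (indep_generated mE EI (mE' _ EC')) sA => A' EA'.
exact: EE.
Qed.

End generated_independence.

Section groups.
Context {R : realType} {d} {Om : measurableType d} (P : probability Om R).
Variables (F : R -> set (set Om)) (N : nat) (Bs : 'I_N -> R -> Om -> R) (X0s : 'I_N -> Om -> R).
Hypotheses (cF : complete_filtration P F) (BM : brownian_family P F Bs).
Variable (mu0 : set R -> \bar R).
Hypotheses (mu0T : mu0 setT = 1%E) (F0 : forall i, measurable_wrt (F 0) (X0s i)).
Hypothesis X0P : forall D : 'I_N -> set R, (forall i, measurable (D i)) ->
  P [set w | forall i, D i (X0s i w)] = (\prod_(i < N) mu0 (D i))%E.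
Variable s : nat -> R.
Hypotheses (s00 : s 0%N = 0) (smono : forall k, s k < s k.+1).

Let s_ge0 k : 0 <= s k.
Proof. by elim: k => [|k ih]; rewrite ?s00// (le_trans ih)// ltW. Qed.

Definition cylinder (S : pred 'I_N) (f : 'I_N -> Om -> R) (D : 'I_N -> set R) : set Om :=
  [set w | forall i, S i -> D i (f i w)].

Definition increments k i w := Bs i (s k.+1) w - Bs i (s k) w.

(* [group S k] is generated by the initial values and the first [k] increments
   of the Brownian motions of index in [S]. *)
Fixpoint group (S : pred 'I_N) (k : nat) : set (set Om) :=
  if k is k'.+1 then <<s [set A | exists A0 D, [/\ group S k' A0, forall i, measurable (D i) &
    A = A0 `&` cylinder S (increments k') D]] >>
  else <<s [set A | exists2 D, forall i, measurable (D i) & A = cylinder S X0s D] >>.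

Lemma group_sigma S k : sigma_algebra setT (group S k).
Proof. by case: k => [|k]; exact: smallest_sigma_algebra. Qed.

Let cylinder_wrt S f D t : 0 <= t -> (forall i, measurable_wrt (F t) (f i)) -> (forall i, measurable (D i)) ->
  F t (cylinder S f D).
Proof.
move=> t0 mf mD.
have -> : cylinder S f D = \big[setI/setT]_(i < N | S i) (f i @^-1` D i).
  by rewrite -bigcap_seq_cond /cylinder; apply/seteqP; split => w h i; [move=> /andP[_ /h]|move=> Si; apply: h; rewrite /= mem_index_enum].
have sF := filtration_sigma cF t0.
have FI A C : F t A -> F t C -> F t (A `&` C).
  move=> FA FC; have := @measurableI _ (g_sigma_algebraType (F t)) A C.
  by rewrite /measurable/= (sigma_algebra_id sF); exact.
have FT : F t setT by case: sF => F_0 /(_ _ F_0); rewrite setD0.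
by elim/big_ind : _ => // i _; apply: mf.
Qed.

Lemma brownian_family_adapted i t : 0 <= t -> measurable_wrt (F t) (Bs i t).
Proof. by case: BM => /(_ i) + _ _ _; apply. Qed.

Lemma increments_wrt k i : measurable_wrt (F (s k.+1)) (increments k i).
Proof.
apply: (fun_wrt cF) => //; apply: measurable_funB; apply: (wrt_fun cF) => //.
  exact: brownian_family_adapted.
exact: (wrt_mono cF (s_ge0 k) (ltW (smono k)) (brownian_family_adapted i (s_ge0 k))).
Qed.

Lemma group_filtration S k : group S k `<=` F (s k).
Proof.
elim: k => [|k ih] /=.
  rewrite s00; apply: smallest_sub; first exact: (filtration_sigma cF).
  by move=> _ [D mD ->]; exact: cylinder_wrt.
apply: smallest_sub; first exact: (filtration_sigma cF).
move=> _ [A0 [D [gA0 mD ->]]].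
have sF := filtration_sigma cF (s_ge0 k.+1).
have := @measurableI _ (g_sigma_algebraType (F (s k.+1))) A0 (cylinder S (increments k) D).
rewrite /measurable/= (sigma_algebra_id sF); apply.
  exact: (filtration_sub cF (s_ge0 k) (ltW (smono k)) (ih _ gA0)).
by apply: cylinder_wrt => // i; exact: increments_wrt.
Qed.

Lemma group_measurable S k : group S k `<=` measurable.
Proof.
move=> A /group_filtration FA; case: cF => _ _ + _ _.
by move=> /(_ _ (s_ge0 k)); exact.
Qed.

Let cylinderI S f D D' : cylinder S f D `&` cylinder S f D' = cylinder S f (fun i => D i `&` D' i).
Proof.
by apply/seteqP; split => w /=; [move=> [h h'] i Si; split; [exact: h|exact: h']|move=> h; split => i /h[]].
Qed.

Let cylinderT f D : cylinder xpredT f D = [set w | forall i, D i (f i w)].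
Proof. by apply/seteqP; split => w h i => [|_]; apply: h. Qed.

Let restrict (S : pred 'I_N) (D : 'I_N -> set R) i : set R := if S i then D i else setT.
Let cylinder_restrict S f D : cylinder S f D = [set w | forall i, restrict S D i (f i w)].
Proof.
apply/seteqP; split => w h i; rewrite /restrict; first by case: ifPn => // /h.
by move=> Si; have := h i; rewrite /restrict Si.
Qed.

Let measurable_restrict S D : (forall i, measurable (D i)) -> forall i, measurable (restrict S D i).
Proof. by move=> mD i; rewrite /restrict; case: ifP. Qed.

Let cylinder2 S S' f D D' : (forall i, ~~ (S i && S' i)) -> cylinder S f D `&` cylinder S' f D' =
  [set w | forall i, (restrict S D i `&` restrict S' D' i) (f i w)].
Proof.
move=> SS'; rewrite !cylinder_restrict.
by apply/seteqP; split => w /=; [move=> [h h'] i; split; [exact: h|exact: h']|move=> h; split => i; case: (h i)].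
Qed.

Let restrict_prod (mu : set R -> \bar R) S S' D D' : mu setT = 1%E -> (forall i, ~~ (S i && S' i)) ->
  (\prod_(i < N) mu (restrict S D i `&` restrict S' D' i) =
   (\prod_(i < N) mu (restrict S D i)) * (\prod_(i < N) mu (restrict S' D' i)))%E.
Proof.
move=> muT SS'; rewrite -big_split/=; apply: eq_bigr => i _; have := SS' i; rewrite /restrict.
by case: ifP => Si; case: ifP => S'i //= _; rewrite ?setIT ?setTI ?muT ?mule1 ?mul1e.
Qed.

Let normalT k : normal_prob 0 (Num.sqrt (s k.+1 - s k)) setT = 1%E.
Proof. exact: probability_setT. Qed.

Let group_step S k A0 D : group S k A0 -> (forall i, measurable (D i)) ->
  P (A0 `&` cylinder S (increments k) D) =
  (P A0 * \prod_(i < N) normal_prob 0 (Num.sqrt (s k.+1 - s k)) (restrict S D i))%E.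
Proof.
move=> gA mD; case: BM => _ _ _ h; rewrite cylinder_restrict.
by apply: h => //; [exact: group_filtration gA|exact: measurable_restrict].
Qed.

(** Induction on [k]. For disjoint groups, two cylinders meet in a cylinder over all coordinates,
    trivial outside both groups; the product formula for initial values, then for Brownian
    increments over the last cell, factorises it. *)
Lemma group_indep S S' k : (forall i, ~~ (S i && S' i)) -> forall A C, group S k A -> group S' k C ->
  P (A `&` C) = (P A * P C)%E.
Proof.
move=> SS'; elim: k => [|k ih].
  apply: indep_generated2.
  - by move=> A hA; apply: (@group_measurable S 0%N); exact: sub_gen_smallest.
  - move=> _ _ [D mD ->] [D' mD' ->]; rewrite cylinderI; eexists; last reflexivity.
    by move=> i; exact: measurableI.
  - by move=> A hA; apply: (@group_measurable S' 0%N); exact: sub_gen_smallest.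
  - move=> _ _ [D mD ->] [D' mD' ->]; rewrite cylinderI; eexists; last reflexivity.
    by move=> i; exact: measurableI.
  - move=> _ _ [D mD ->] [D' mD' ->]; rewrite cylinder2// !cylinder_restrict.
    have mD1 := measurable_restrict S mD; have mD2 := measurable_restrict S' mD'.
    have mD3 i : measurable (restrict S D i `&` restrict S' D' i) by exact: measurableI.
    rewrite (X0P mD1) (X0P mD2) (X0P mD3).
    exact: restrict_prod.
apply: indep_generated2.
- by move=> A hA; apply: (@group_measurable S k.+1); exact: sub_gen_smallest.
- move=> _ _ [A0 [D [gA mD ->]]] [A0' [D' [gA' mD' ->]]]; rewrite setIACA cylinderI.
  exists (A0 `&` A0'), (fun i => D i `&` D' i); split => //; last by move=> i; exact: measurableI.
  have := @measurableI _ (g_sigma_algebraType (group S k)) A0 A0'.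
  by rewrite /measurable/= (sigma_algebra_id (group_sigma S k)); exact.
- by move=> A hA; apply: (@group_measurable S' k.+1); exact: sub_gen_smallest.
- move=> _ _ [A0 [D [gA mD ->]]] [A0' [D' [gA' mD' ->]]]; rewrite setIACA cylinderI.
  exists (A0 `&` A0'), (fun i => D i `&` D' i); split => //; last by move=> i; exact: measurableI.
  have := @measurableI _ (g_sigma_algebraType (group S' k)) A0 A0'.
  by rewrite /measurable/= (sigma_algebra_id (group_sigma S' k)); exact.
- move=> _ _ [A0 [D [gA mD ->]]] [A0' [D' [gA' mD' ->]]].
  rewrite (group_step gA mD) (group_step gA' mD') setIACA cylinder2// muleACA -(ih _ _ gA gA').
  rewrite -restrict_prod//; case: BM => _ _ _ h; apply: h => //.
    have sF := filtration_sigma cF (s_ge0 k).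
    have := @measurableI _ (g_sigma_algebraType (F (s k))) A0 A0'.
    by rewrite /measurable/= (sigma_algebra_id sF); apply; apply: group_filtration; eassumption.
  by move=> i; apply: measurableI; exact: measurable_restrict.
Qed.

Lemma group_mono S k : group S k `<=` group S k.+1.
Proof.
move=> A gA; apply: sub_gen_smallest; exists A, (fun=> setT); split => //.
by apply/seteqP; split => w // -[].
Qed.

Lemma group_mono_le S k k' : (k <= k')%N -> group S k `<=` group S k'.
Proof.
move=> kk'; rewrite -(subnKC kk'); elim: (k' - k)%N => [|j ih]; first by rewrite addn0.
by rewrite addnS; apply: subset_trans ih _; exact: group_mono.
Qed.

Let single (i : 'I_N) (D : set R) (j : 'I_N) : set R := if j == i then D else setT.
Let cylinder_single (S : pred 'I_N) f i D : S i -> cylinder S f (single i D) = f i @^-1` D.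
Proof.
move=> Si; apply/seteqP; split => w /=; first by move=> /(_ i Si); rewrite /single eqxx.
by move=> Dw j _; rewrite /single; case: eqVneq => // ->.
Qed.
Let measurable_single i D : measurable D -> forall j, measurable (single i D j).
Proof. by move=> mD j; rewrite /single; case: ifP. Qed.

Lemma group_initial (S : pred 'I_N) i : S i -> measurable_wrt (group S 0) (X0s i).
Proof.
move=> Si D mD; apply: sub_gen_smallest; exists (single i D); first exact: measurable_single.
by rewrite cylinder_single.
Qed.

Lemma group_increments (S : pred 'I_N) i k : S i -> measurable_wrt (group S k.+1) (increments k i).
Proof.
move=> Si D mD; apply: sub_gen_smallest; exists setT, (single i D); split.
- by case: (group_sigma S k) => h0 /(_ _ h0); rewrite setD0.
- exact: measurable_single.
- by rewrite cylinder_single// setTI.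
Qed.

Lemma group_indep_law S S' k (Z W : Om -> R) (mW : measurable_fun (U := measurableTypeR R) setT W) :
  (forall i, ~~ (S i && S' i)) ->
  measurable_wrt (group S k) Z -> measurable_wrt (group S' k) W ->
  indep_of_law P Z W (@distribution _ _ Om (measurableTypeR R) R P (@mfun_Sub _ _ Om (measurableTypeR R) W (mem_set mW))).
Proof.
by move=> SS' mZ gW A C mA mC; rewrite (group_indep SS' (mZ _ mA) (gW _ mC)).
Qed.

Lemma group_centered S S' k (Z W : Om -> R) : (forall i, ~~ (S i && S' i)) ->
  measurable_wrt (group S k) Z -> measurable_wrt (group S' k) W ->
  (\E[P]_w (`|Z w|%R) < +oo)%E -> (\E[P]_w (`|W w|%R) < +oo)%E ->
  (\int[P]_w (W w)%:E = 0)%E ->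
  P.-integrable setT (EFin \o (fun w => Z w * W w)) /\ (\int[P]_w (Z w * W w)%:E = 0)%E.
Proof.
move=> SS' gZ gW Zfin Wfin W0.
have mZ := measurable_wrt_measurable (@group_measurable S k) gZ.
have mW0 := measurable_wrt_measurable (@group_measurable S' k) gW.
have mW : measurable_fun (U := measurableTypeR R) setT W by exact: mW0.
have ind := group_indep_law mW SS' gZ gW.
pose Wm : {mfun Om >-> measurableTypeR R} := @mfun_Sub _ _ Om (measurableTypeR R) W (mem_set mW).
pose nu : probability (measurableTypeR R) R := @distribution _ _ Om (measurableTypeR R) R P Wm.
have ExW (f : R -> R) : (forall x, 0 <= f x) -> meas f -> Ex nu f = Ex P (f \o W).
  move=> f0 mf; rewrite /Ex (@ge0_integral_distribution _ _ Om (measurableTypeR R) R P Wm (EFin \o f))//.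
  exact/measurable_EFinP.
have mmax (f : R -> R) : meas f -> meas (fun x => Num.max (f x) 0).
  by move=> mf; exact: measurable_maxr.
apply: (@indep_centered _ _ _ P nu Z W mZ mW0 ind Zfin).
  by rewrite ExW//; mea.
rewrite ExW; [|by move=> x; rewrite le_max lexx orbT|exact: mmax].
rewrite ExW; [|by move=> x; rewrite le_max lexx orbT|by apply: mmax; exact: measurable_funN].
have iW := Ex_lty_integrable mW0 Wfin.
move: W0; rewrite integralE => /eqP; rewrite sube_eq; last 2 first.
- exact: integrable_pos_fin_num.
- by rewrite fin_num_adde_defl//; exact: integrable_neg_fin_num.
rewrite add0e => /eqP e; rewrite /Ex.
rewrite (_ : (fun w => (((fun x => Num.max x 0) \o W) w)%:E) = (fun w => (W w)%:E)^\+%E); last first.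
  by apply/funext => w; rewrite unlock/= EFin_max.
rewrite e; congr integral; apply/funext => w.
by rewrite unlock -EFinN EFin_max.
Qed.

End groups.

(** * Type 2 of the norm of l^4 *)

Section type_two.
Context {R : realType}.
Implicit Types (x y u v : nat -> R).

Lemma sum_cauchy_schwarz q u v :
  (\sum_(k < q) u k * v k) ^+ 2 <= (\sum_(k < q) u k ^+ 2) * (\sum_(k < q) v k ^+ 2).
Proof.
elim: q => [|q ih]; first by rewrite !big_ord0 expr0n mul0r.
rewrite !big_ord_recr/=; move: ih.
have : 0 <= \sum_(k < q) u k ^+ 2 by apply: sumr_ge0 => k _; exact: sqr_ge0.
have : 0 <= \sum_(k < q) v k ^+ 2 by apply: sumr_ge0 => k _; exact: sqr_ge0.
move: (\sum_(k < q) u k ^+ 2) (\sum_(k < q) v k ^+ 2) (\sum_(k < q) u k * v k) => U V S V0 U0 SUV.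
move: (u q) (v q) => a b.
have h : 2 * S * (a * b) <= U * b ^+ 2 + V * a ^+ 2.
  have r0 : 0 <= U * b ^+ 2 + V * a ^+ 2 by nneg.
  apply: (le_trans (ler_norm _)); rewrite -(@ler_pXn2r _ 2) ?nnegrE// normr_sqr//.
  have := ler_wpM2r (sqr_ge0 (2 * (a * b))) SUV.
  have := sqr_ge0 (U * b ^+ 2 - V * a ^+ 2).
  rewrite !exprMn; lra.
by rewrite sqrrD exprMn; lra.
Qed.

(* [Psi] dominates the maximum of the squares, and is smooth enough for sums of
   independent centred vectors; [dPsi] is half its gradient. *)
Definition Psi q x : R := Num.sqrt (\sum_(k < q) x k ^+ 4).
Definition dPsi q x k : R := x k ^+ 3 / Psi q x.

Let sum4_ge0 q x : 0 <= \sum_(k < q) x k ^+ 4.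
Proof. by apply: sumr_ge0 => k _; rewrite exprn_even_ge0. Qed.

Lemma Psi_ge0 q x : 0 <= Psi q x. Proof. exact: sqrtr_ge0. Qed.
Lemma sqr_Psi q x : Psi q x ^+ 2 = \sum_(k < q) x k ^+ 4.
Proof. by rewrite sqr_sqrtr. Qed.

Lemma sqr_le_Psi q x k : (k < q)%N -> x k ^+ 2 <= Psi q x.
Proof.
move=> kq; rewrite -(@ler_pXn2r _ 2) ?nnegrE ?sqr_ge0 ?Psi_ge0// sqr_Psi -exprM.
by rewrite (bigD1 (Ordinal kq))//= lerDl; apply: sumr_ge0 => j _; rewrite exprn_even_ge0.
Qed.

Lemma norm_dPsi_le q x k : (k < q)%N -> `|dPsi q x k| <= `|x k|.
Proof.
move=> kq; rewrite /dPsi normrM exprS normrM -mulrA ler_piMr//.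
rewrite normfV ger0_norm ?sqr_ge0// ger0_norm ?Psi_ge0//.
have [->|P0] := eqVneq (Psi q x) 0; first by rewrite invr0 mulr0.
by rewrite ler_pdivrMr ?mul1r ?sqr_le_Psi// lt_def P0 Psi_ge0.
Qed.

Lemma Psi_le_sum q x : Psi q x <= \sum_(k < q) x k ^+ 2.
Proof.
have s0 : 0 <= \sum_(k < q) x k ^+ 2 by apply: sumr_ge0 => k _; exact: sqr_ge0.
rewrite -(@ler_pXn2r _ 2) ?nnegrE ?Psi_ge0// sqr_Psi.
elim: q {s0} => [|q ih]; first by rewrite !big_ord0 expr0n.
rewrite !big_ord_recr/= sqrrD -exprM -addrA lerD// lerDr mulrn_wge0// mulr_ge0 ?sqr_ge0//.
by apply: sumr_ge0 => k _; exact: sqr_ge0.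
Qed.

Let sum22 q x y : \sum_(k < q) x k ^+ 2 * y k ^+ 2 <= Psi q x * Psi q y.
Proof.
have s0 : 0 <= \sum_(k < q) x k ^+ 2 * y k ^+ 2 by apply: sumr_ge0 => k _; nneg.
rewrite -(@ler_pXn2r _ 2) ?nnegrE ?mulr_ge0 ?Psi_ge0// exprMn !sqr_Psi.
have := sum_cauchy_schwarz q (fun k => x k ^+ 2) (fun k => y k ^+ 2).
by under [X in _ <= X * _ -> _]eq_bigr do rewrite -exprM;
  under [X in _ <= _ * X -> _]eq_bigr do rewrite -exprM.
Qed.

Let sum31 q x y : Psi q x <= Psi q y -> `|\sum_(k < q) x k ^+ 3 * y k| <= Psi q x * Psi q y.
Proof.
move=> xy; rewrite -(@ler_pXn2r _ 2) ?nnegrE ?mulr_ge0 ?Psi_ge0// normr_sqr//.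
have := sum_cauchy_schwarz q (fun k => x k ^+ 2) (fun k => x k * y k).
rewrite (_ : \sum_(k < q) x k ^+ 2 * (x k * y k) = \sum_(k < q) x k ^+ 3 * y k); last first.
  by apply: eq_bigr => k _; ring.
move/le_trans; apply; rewrite exprMn.
rewrite (_ : \sum_(k < q) (x k ^+ 2) ^+ 2 = Psi q x ^+ 2); last first.
  by rewrite sqr_Psi; apply: eq_bigr => k _; rewrite -exprM.
apply: ler_wpM2l; first exact: sqr_ge0.
under eq_bigr do rewrite exprMn; apply: (le_trans (sum22 _ _ _)).
by rewrite expr2; apply: ler_wpM2r => //; exact: Psi_ge0.
Qed.

(** If [Psi q x <= Psi q y], the crude bound [3 (Psi x + Psi y)] suffices, also when [Psi q x] is 0
    and [dPsi] vanishes because the inverse of 0 is 0. Otherwise the fourth powers are expanded, and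
    the square root is removed by [2 a z <= a^2 + z^2] with [a] and [z] the values of [Psi] at [x]
    and at the sum. *)
Lemma PsiD q x y : Psi q (fun k => x k + y k) <=
  Psi q x + 2 * (\sum_(k < q) dPsi q x k * y k) + 8 * Psi q y.
Proof.
have a0 := Psi_ge0 q x; have b0 := Psi_ge0 q y; have z0 := Psi_ge0 q (fun k => x k + y k).
have eJ : \sum_(k < q) dPsi q x k * y k = (\sum_(k < q) x k ^+ 3 * y k) / Psi q x.
  by rewrite mulr_suml; apply: eq_bigr => k _; rewrite /dPsi mulrAC.
rewrite eJ; set S := \sum_(k < q) x k ^+ 3 * y k.
have [ab|ba] := leP (Psi q x) (Psi q y).
  have hS : - Psi q y <= S / Psi q x.
    have [->|P0] := eqVneq (Psi q x) 0; first by rewrite invr0 mulr0 oppr_le0.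
    have {}P0 : 0 < Psi q x by rewrite lt_def P0 a0.
    rewrite ler_pdivlMr// mulNr mulrC lerNl.
    by apply: le_trans (sum31 ab); rewrite -normrN ler_norm.
  have hz : Psi q (fun k => x k + y k) <= 3 * (Psi q x + Psi q y).
    rewrite -(@ler_pXn2r _ 2) ?nnegrE ?mulr_ge0 ?addr_ge0// sqr_Psi.
    apply: (@le_trans _ _ (8 * (Psi q x ^+ 2 + Psi q y ^+ 2))).
      by rewrite !sqr_Psi -big_split/= mulr_sumr; apply: ler_sum => k _; exact: pow4D_le8.
    by have := mulr_ge0 a0 b0; have := sqr_ge0 (Psi q x); have := sqr_ge0 (Psi q y); rewrite !expr2; lra.
  by lra.
have aP : 0 < Psi q x by exact: le_lt_trans ba.
have hW : \sum_(k < q) (x k + y k) ^+ 4 <= Psi q x ^+ 2 + 4 * S + 8 * (Psi q x * Psi q y) + 3 * Psi q y ^+ 2.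
  apply: (@le_trans _ _ (\sum_(k < q) (x k ^+ 4 + 4 * (x k ^+ 3 * y k) + 8 * (x k ^+ 2 * y k ^+ 2) + 3 * y k ^+ 4))).
    apply: ler_sum => k _; have := pow4D_le (x k) (y k); lra.
  rewrite !big_split/= -!mulr_sumr -!sqr_Psi !lerD2r lerD2l ler_pM2l//; exact: sum22.
have := sqr_ge0 (Psi q (fun k => x k + y k) - Psi q x).
rewrite -(sqr_Psi q (fun k => x k + y k)) in hW => hsq.
have : 2 * Psi q x * Psi q (fun k => x k + y k) <= 2 * Psi q x * (Psi q x + 2 * (S / Psi q x) + 8 * Psi q y).
  rewrite (_ : 2 * Psi q x * (_ + _ + _) = 2 * Psi q x ^+ 2 + 4 * S + 16 * (Psi q x * Psi q y)); last first.
    by field; rewrite gt_eqF.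
  have : Psi q y ^+ 2 <= Psi q x * Psi q y by rewrite expr2 ler_wpM2r// ltW.
  have := mulr_ge0 a0 b0; move: hsq; rewrite sqrrB; lra.
by rewrite ler_pM2l ?mulr_gt0.
Qed.

Lemma PsiD_le q x y : Psi q (fun k => x k + y k) <= 3 * (Psi q x + Psi q y).
Proof.
have a0 := Psi_ge0 q x; have b0 := Psi_ge0 q y.
rewrite -(@ler_pXn2r _ 2) ?nnegrE ?mulr_ge0 ?addr_ge0 ?Psi_ge0// sqr_Psi.
apply: (@le_trans _ _ (8 * (Psi q x ^+ 2 + Psi q y ^+ 2))).
  by rewrite !sqr_Psi -big_split/= mulr_sumr; apply: ler_sum => k _; exact: pow4D_le8.
by have := mulr_ge0 a0 b0; have := sqr_ge0 (Psi q x); have := sqr_ge0 (Psi q y); rewrite !expr2; lra.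
Qed.

End type_two.

Lemma measurable_Psi {R : realType} {d} {T : measurableType d} q (f : nat -> T -> R) :
  (forall k, meas (f k)) -> meas (fun w => Psi q (fun k => f k w)).
Proof.
move=> mf; apply: (measurableT_comp (f := @Num.sqrt R)); first exact: (continuous_measurable_fun (@sqrt_continuous R)).
by apply: measurable_sum => k; exact: measurable_funX.
Qed.

Lemma brownian_family_motion {R : realType} {d} {Om : measurableType d} (P : probability Om R)
  (F : R -> set (set Om)) N (Bs : 'I_N -> R -> Om -> R) i :
  brownian_family P F Bs -> brownian_motion P F (Bs i).
Proof.
move=> [aB cB zB pB]; split; [by []|by []|by []|].
move=> s t A D s0 st FA mD; rewrite big_ord1.
have := pB s t A (fun j => if j == i then D ord0 else setT) s0 st FA.
rewrite (bigD1 i)//= eqxx big1 ?mule1; last first.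
  by move=> j ji; rewrite (negbTE ji); exact: probability_setT.
move=> <-; last by move=> j; case: ifP.
congr (P (_ `&` _)); apply/seteqP; split => w /= h j.
  by case: eqVneq => // ->; exact: h.
by have := h i; rewrite eqxx (ord1 j).
Qed.

(** * Law of the Euler scheme *)

Section euler_law.
Context {R : realType} {d d'} {Om : measurableType d} {Om' : measurableType d'}.
Variables (P : probability Om R) (F : R -> set (set Om)) (B : R -> Om -> R) (X0 : Om -> R).
Variables (P' : probability Om' R) (F' : R -> set (set Om')) (B' : R -> Om' -> R) (X0' : Om' -> R).
Hypotheses (cF : complete_filtration P F) (BM : brownian_motion P F B) (F0 : measurable_wrt (F 0) X0).
Hypotheses (cF' : complete_filtration P' F') (BM' : brownian_motion P' F' B') (F0' : measurable_wrt (F' 0) X0').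
Hypothesis X0_law : forall D : set R, measurable D -> P' (X0' @^-1` D) = P (X0 @^-1` D).
Variables (b sg kappa : R -> R) (L T : R) (n : nat).
Hypotheses (L1 : 1 <= L) (bL : lip L b).
Hypotheses (sgL : lip L sg) (T0 : 0 < T).
Local Notation tg := (grid 0 T n).
Local Notation e := (euler b sg kappa T n B X0).
Local Notation e' := (euler b sg kappa T n B' X0').

Let tg0 k : 0 <= tg k. Proof. exact: grid_ge0 (ltW T0). Qed.
Let tgS k : tg k < tg k.+1.
Proof. by rewrite -subr_gt0 gridS subr0 divr_gt0// exprn_gt0. Qed.
Let L0 : 0 <= L. Proof. exact: le_trans L1. Qed.
Let clipL x y : `|clip n%:R (sg x) - clip n%:R (sg y)| <= L * `|x - y|.
Proof. exact: le_trans (clip_lip _ _ _) (sgL x y). Qed.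

Lemma measurable_euler_map j : meas
  (fun p : R * measurableTypeR R => euler_map b sg kappa T n j p.1 p.2 : R).
Proof.
have m1 : meas (fun p : R * measurableTypeR R => p.1) by exact: measurable_fst.
have m2 : meas (fun p : R * measurableTypeR R => p.2 : R) by exact: measurable_snd.
have mb : meas (fun p : R * measurableTypeR R => b p.1).
  exact: (measurableT_comp (lip_measurable L0 bL) m1).
have ms : meas (fun p : R * measurableTypeR R => clip n%:R (sg p.1)).
  exact: (measurableT_comp (lip_measurable L0 clipL) m1).
by rewrite /euler_map; mea.
Qed.

(** Induction on the step: on both spaces the current value is independent of the next Brownian
    increment, whose law is the same, so one more step integrates [f] against the same kernel. *)
Lemma euler_law j (f : R -> \bar R) : (forall x, (0 <= f x)%E) -> meas f ->
  (\int[P']_w f (e' j w) = \int[P]_w f (e j w))%E.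
Proof.
elim: j f => [|j ih] f f0 mf /=.
  have mX0 := filtration_measurable cF (lexx 0) F0.
  have mX0' := filtration_measurable cF' (lexx 0) F0'.
  transitivity (\int[pushforward P' X0']_x f x)%E; first by rewrite ge0_integral_pushforward.
  transitivity (\int[pushforward P X0]_x f x)%E; last by rewrite ge0_integral_pushforward.
  by apply: eq_measure_integral => //= D mD _; exact: X0_law.
pose nu : probability (measurableTypeR R) R := normal_prob 0 (Num.sqrt (tg j.+1 - tg j)).
pose g (p : R * measurableTypeR R) := f (euler_map b sg kappa T n j p.1 p.2).
have mg : meas g by exact: (measurableT_comp mf (measurable_euler_map j)).
have g0 p : (0 <= g p)%E by exact: f0.
have me := measurable_euler cF BM L1 bL sgL kappa F0 (ltW T0) n j.
have me' := measurable_euler cF' BM' L1 bL sgL kappa F0' (ltW T0) n j.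
have Fe := euler_adapted cF BM L1 bL sgL kappa F0 (ltW T0) n j.
have Fe' := euler_adapted cF' BM' L1 bL sgL kappa F0' (ltW T0) n j.
have mB := brownian_incr_measurable cF BM (tg0 j) (ltW (tgS j)).
have mB' := brownian_incr_measurable cF' BM' (tg0 j) (ltW (tgS j)).
have i1 := brownian_indep BM (tg0 j) (tgS j) Fe.
have i1' := brownian_indep BM' (tg0 j) (tgS j) Fe'.
have h := @indep_ge0_integral _ _ _ P nu (e j) _ me mB i1 g g0 mg.
have h' := @indep_ge0_integral _ _ _ P' nu (e' j) _ me' mB' i1' g g0 mg.
rewrite /g/= in h h'; rewrite h h'.
apply: (ih (fun x => \int[nu]_v f (euler_map b sg kappa T n j x v))%E).
  by move=> x; apply: integral_ge0.
exact: (@measurable_fun_fubini_tonelli_F _ _ _ _ _ nu g).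
Qed.

End euler_law.

(** * Second moments and centring *)

Section second_moments.
Context {R : realType} {d} {T : measurableType d} (P : probability T R).
Implicit Types f g : T -> R.

Lemma Ex_sqr_integrable f : meas f -> (\E[P]_w (f w ^+ 2) < +oo)%E ->
  P.-integrable setT (EFin \o f).
Proof.
move=> mf f2; apply: Ex_lty_integrable => //.
apply: (@le_lt_trans _ _ (\E[P]_w (1 + f w ^+ 2))).
  apply: Ex_le; [by nneg|by mea|by mea|move=> w].
  rewrite -[f w ^+ 2]normr_sqr//; have := sqr_ge0 (`|f w| - 1); have := normr_ge0 (f w); nra.
by rewrite ExD; [rewrite Ex_cst; apply: lte_add_pinfty => //; exact: ltry|by nneg|by nneg|by mea|by mea].
Qed.

Lemma Ex_sqr_lty f : (\E[P]_w (f w ^+ 2) < +oo)%E ->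
  exists2 v : R, 0 <= v & (\E[P]_w (f w ^+ 2) <= v%:E)%E.
Proof.
move=> f2; have f0 : (0 <= \E[P]_w (f w ^+ 2))%E by apply: Ex_ge0 => w; exact: sqr_ge0.
exists (fine (\E[P]_w (f w ^+ 2))); first exact: fine_ge0.
by rewrite fineK// ge0_fin_numE.
Qed.

Lemma Ex_sqr_comb f g (a c v v' : R) : meas f -> meas g ->
  (\E[P]_w (f w ^+ 2) <= v%:E)%E -> (\E[P]_w (g w ^+ 2) <= v'%:E)%E ->
  (\E[P]_w ((a * f w + c * g w) ^+ 2) <= (2 * a ^+ 2 * v + 2 * c ^+ 2 * v')%:E)%E.
Proof.
move=> mf mg fv gv.
apply: (@le_trans _ _ (\E[P]_w (2 * a ^+ 2 * f w ^+ 2 + 2 * c ^+ 2 * g w ^+ 2))).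
  apply: Ex_le; [by nneg|by mea|by mea|move=> w].
  by have := sqrD_le (a * f w) (c * g w); rewrite !exprMn; lra.
rewrite ExD; try side.
rewrite ExZ; try side.
rewrite ExZ; try side.
by apply: lee_finD; apply: lee_finZ => //; nneg.
Qed.

Lemma sqr_mean_le f v : meas f -> (\E[P]_w (f w ^+ 2) <= v%:E)%E ->
  fine (\int[P]_w (f w)%:E) ^+ 2 <= v.
Proof.
move=> mf fv; have f2 : (\E[P]_w (f w ^+ 2) < +oo)%E by exact: le_lt_trans fv (ltry v).
have if_ := Ex_sqr_integrable mf f2.
have if2 : P.-integrable setT (EFin \o (fun w => f w ^+ 2)).
  apply: Ex_lty_integrable; first by mea.
  by under [in ltLHS]eq_fun do rewrite ger0_norm ?sqr_ge0//.
set mu := fine _; have emu : (\int[P]_w (f w)%:E)%E = mu%:E by rewrite fineK//; exact: integrable_fin_num.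
have ic : P.-integrable setT (EFin \o (fun=> mu ^+ 2)) by exact: finite_measure_integrable_cst.
have i2 : P.-integrable setT (fun w => (2 * mu)%:E * (f w)%:E)%E by exact: integrableZl.
rewrite -lee_fin; apply: le_trans fv.
have -> : (mu ^+ 2)%:E = (\int[P]_w ((2 * mu)%:E * (f w)%:E - (mu ^+ 2)%:E))%E.
  have eC : (\int[P]_w (mu ^+ 2)%:E = (mu ^+ 2)%:E)%E := Ex_cst P (mu ^+ 2).
  rewrite integralB// integralZl// emu eC.
  by rewrite -EFinM -EFinB; congr EFin; ring.
apply: le_integral => //; first exact: integrableB.
by move=> w _; rewrite -EFinM -EFinB lee_fin; have := sqr_ge0 (f w - mu); rewrite sqrrB; lra.
Qed.

Lemma Ex_sqr_centered f v : meas f -> (\E[P]_w (f w ^+ 2) <= v%:E)%E ->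
  (\E[P]_w ((f w - fine (\int[P]_w (f w)%:E)) ^+ 2) <= (4 * v)%:E)%E.
Proof.
move=> mf fv; have mv := sqr_mean_le mf fv; set mu := fine _ in mv *.
have h : (Ex P (fun=> mu ^+ 2)%R <= v%:E)%E by rewrite Ex_cst lee_fin.
have mc : meas (fun _ : T => mu) by exact: measurable_cst.
have := Ex_sqr_comb 1 (-1) mf mc fv h.
rewrite (_ : (fun w => _) = fun w => (f w - mu) ^+ 2); last by apply/funext => w; rewrite mul1r mulN1r.
by move/le_trans; apply; rewrite lee_fin sqrrN expr1n; lra.
Qed.

Lemma centered_mean0 f : meas f -> (\E[P]_w (f w ^+ 2) < +oo)%E ->
  (\int[P]_w (f w - fine (\int[P]_w (f w)%:E))%:E = 0)%E.
Proof.
move=> mf f2; have if_ := Ex_sqr_integrable mf f2.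
set mu := fine _; have emu : (\int[P]_w (f w)%:E)%E = mu%:E by rewrite fineK//; exact: integrable_fin_num.
under eq_integral do rewrite EFinB.
have ic : P.-integrable setT (EFin \o (fun=> mu)) by exact: finite_measure_integrable_cst.
by rewrite integralB// emu -[X in (_ - X)%E]/(Ex P (fun=> mu)) Ex_cst subee.
Qed.

Lemma Ex_sqr_sum n (f : 'I_n -> T -> R) v : (forall i, meas (f i)) -> 0 <= v ->
  (forall i, (\E[P]_w (f i w ^+ 2) <= v%:E)%E) ->
  (\E[P]_w ((\sum_i f i w) ^+ 2) <= (n%:R ^+ 2 * v)%:E)%E.
Proof.
move=> mf v0 fv.
have h w : (\sum_i f i w) ^+ 2 <= n%:R * \sum_i f i w ^+ 2.
  have [n0|] := posnP n; first by subst n; rewrite !big_ord0 expr0n mulr0.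
  case: n f {mf fv} => // n f _.
  have := sum_cauchy_schwarz n.+1 (fun=> 1) (fun k => f (inord k) w).
  under [X in X ^+ 2 <= _ -> _]eq_bigr => i _ do rewrite mul1r inord_val.
  under [X in _ <= _ * X -> _]eq_bigr => i _ do rewrite inord_val.
  by rewrite expr1n sumr_const card_ord.
have ms : meas (fun w => \sum_i f i w ^+ 2) by apply: measurable_sum => i; exact: measurable_funX.
have ms' : meas (fun w => \sum_i f i w) by exact: measurable_sum.
apply: (@le_trans _ _ (\E[P]_w (n%:R * \sum_i f i w ^+ 2))).
  by apply: Ex_le; try side.
rewrite ExZ//; last by move=> w; apply: sumr_ge0 => i _; exact: sqr_ge0.
rewrite expr2 -mulrA; apply: lee_finZ => //; rewrite /Ex.
under eq_integral do rewrite -sumEFin.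
rewrite ge0_integral_sum//; last 2 first.
- by move=> i; apply/measurable_EFinP; exact: measurable_funX.
- by move=> i w _; rewrite lee_fin sqr_ge0.
apply: (@le_trans _ _ (\sum_(i < n) v%:E)%E); first by apply: lee_sum => i _; exact: fv.
by rewrite sumEFin lee_fin sumr_const card_ord mulr_natl.
Qed.

Lemma Ex_Psi_le q (f : nat -> T -> R) v : (forall k, meas (f k)) ->
  (forall k, (k < q)%N -> (\E[P]_w (f k w ^+ 2) <= v%:E)%E) ->
  (\E[P]_w (Psi q (fun k => f k w)) <= (q%:R * v)%:E)%E.
Proof.
move=> mf fv.
have ms : meas (fun w => \sum_(k < q) f k w ^+ 2) by apply: measurable_sum => k; exact: measurable_funX.
apply: (@le_trans _ _ (\E[P]_w (\sum_(k < q) f k w ^+ 2))).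
  apply: Ex_le => //; [by move=> w; exact: Psi_ge0|exact: measurable_Psi|by move=> w; exact: Psi_le_sum].
rewrite (Ex_sum P q (f := fun k w => f k w ^+ 2)); last 2 first.
- by move=> i w; exact: sqr_ge0.
- by move=> i; exact: measurable_funX.
apply: (@le_trans _ _ (\sum_(i < q) v%:E)%E); first by apply: lee_sum => i _; exact: fv.
by rewrite sumEFin lee_fin sumr_const card_ord mulr_natl.
Qed.

End second_moments.

(** * Sums of independent centred vectors *)

Section type_two_independent.
Context {R : realType} {d} {Om : measurableType d} (P : probability Om R).
Variables (F : R -> set (set Om)) (N : nat) (Bs : 'I_N -> R -> Om -> R) (X0s : 'I_N -> Om -> R).
Hypotheses (cF : complete_filtration P F) (BM : brownian_family P F Bs).
Variable (mu0 : set R -> \bar R).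
Hypotheses (mu0T : mu0 setT = 1%E) (F0 : forall i, measurable_wrt (F 0) (X0s i)).
Hypothesis X0P : forall D : 'I_N -> set R, (forall i, measurable (D i)) ->
  P [set w | forall i, D i (X0s i w)] = (\prod_(i < N) mu0 (D i))%E.
Variable s : nat -> R.
Hypotheses (s00 : s 0%N = 0) (smono : forall k, s k < s k.+1).
Local Notation G := (group Bs X0s s).

Variables (K q : nat) (xi : 'I_N -> nat -> Om -> R).
Hypothesis Gxi : forall (S : pred 'I_N) i k, S i -> measurable_wrt (G S K) (xi i k).
Hypothesis xi2 : forall i k, (\E[P]_w (xi i k w ^+ 2) < +oo)%E.
Hypothesis xi0 : forall i k, (\int[P]_w (xi i k w)%:E = 0)%E.

Let mxi i k : meas (xi i k).
Proof.
apply: (measurable_wrt_measurable (@group_measurable _ _ _ P F N Bs X0s cF BM F0 s s00 smono (pred1 i) K)).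
by apply: Gxi => /=.
Qed.

Let partial m k w := \sum_(i < N | (i < m)%N) xi i k w.

Let partialS m (mN : (m < N)%N) k w : partial m.+1 k w = partial m k w + xi (Ordinal mN) k w.
Proof.
rewrite /partial (bigD1 (Ordinal mN)) ?ltnSn//= addrC; congr (_ + _); apply: eq_bigl => i.
by rewrite ltnS ltn_neqAle andbC -val_eqE.
Qed.

Let partial_wrt m k : measurable_wrt (G (fun i => (i < m)%N) K) (partial m k).
Proof.
apply/measurable_wrtP; first exact: group_sigma.
pose f (i : 'I_N) (w : Om) := if (i < m)%N then xi i k w else 0.
rewrite (_ : partial m k = fun w => \sum_(i < N) f i w); last first.
  by apply/funext => w; rewrite /partial [LHS]big_mkcond.
have h (i : 'I_N) : measurable_fun (T := g_sigma_algebraType (G (fun i => (i < m)%N) K)) setT (f i).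
  have [im|im] := boolP (i < m)%N.
    rewrite (_ : f i = xi i k); last by apply/funext => w; rewrite /f im.
    by apply/measurable_wrtP; [exact: group_sigma|exact: Gxi].
  rewrite (_ : f i = fun=> 0); last by apply/funext => w; rewrite /f (negbTE im).
  exact: measurable_cst.
exact: measurable_sum.
Qed.

Let measurable_partial m k : meas (partial m k).
Proof.
apply: (measurable_wrt_measurable (@group_measurable _ _ _ P F N Bs X0s cF BM F0 s s00 smono (fun i => (i < m)%N) K)).
exact: partial_wrt.
Qed.

Let partial2 m k : (m <= N)%N -> (\E[P]_w (partial m k w ^+ 2) < +oo)%E.
Proof.
elim: m => [_|m ih mN].
  rewrite (_ : (fun w => _) = fun=> 0); first by rewrite Ex_cst ltry.
  by apply/funext => w; rewrite /partial big_pred0// expr0n.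
have [v v0 hv] := Ex_sqr_lty (ih (ltnW mN)); have [v' v'0 hv'] := Ex_sqr_lty (xi2 (Ordinal mN) k).
have := Ex_sqr_comb 1 1 (measurable_partial m k) (mxi (Ordinal mN) k) hv hv'.
rewrite (_ : (fun w => _) = fun w => partial m.+1 k w ^+ 2); last by apply/funext => w; rewrite !mul1r partialS.
by move/le_lt_trans; apply; exact: ltry.
Qed.

Let lty_norm (f : Om -> R) : meas f -> (\E[P]_w (f w ^+ 2) < +oo)%E -> (\E[P]_w (`|f w|%R) < +oo)%E.
Proof. by move=> mf f2; have /integrableP[_] := Ex_sqr_integrable mf f2. Qed.

(** The vectors are added one by one. In [PsiD] the gradient at the partial sum depends on the
    earlier particles only and is independent of the new centred vector, so the linear term has mean
    0 and each vector costs 8 times its own [Psi]. *)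
Lemma type_two_groups : (\E[P]_w (Psi q (fun k => \sum_(i < N) xi i k w)) <=
  8%:E * \sum_(i < N) \E[P]_w (Psi q (fun k => xi i k w)))%E.
Proof.
have mPsi i : meas (fun w => Psi q (fun k => xi i k w)) by exact: measurable_Psi.
have mPp m : meas (fun w => Psi q (fun k => partial m k w)) by exact: measurable_Psi.
have E0 i : (0 <= \E[P]_w (Psi q (fun k => xi i k w)))%E by apply: Ex_ge0 => w; exact: Psi_ge0.
suff claim m : (m <= N)%N -> (\E[P]_w (Psi q (fun k => partial m k w)) <=
    8%:E * \sum_(i < N | (i < m)%N) \E[P]_w (Psi q (fun k => xi i k w)))%E.
  have := claim N (leqnn N); rewrite /partial.
  rewrite (_ : (fun w => Psi q (fun k => \sum_(i < N | (i < N)%N) xi i k w)) = (fun w => Psi q (fun k => \sum_(i < N) xi i k w))).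
    by move/le_trans; apply; rewrite (eq_bigl xpredT)// => i; rewrite ltn_ord.
  apply/funext => w; congr (Psi q _); apply/funext => k; apply: eq_bigl => i; exact: ltn_ord.
elim: m => [_|m ih mN].
  rewrite (_ : (fun w => _) = fun=> 0); first by rewrite Ex_cst mule_ge0// sume_ge0.
  apply/funext => w; rewrite /Psi big1 ?sqrtr0// => k _.
  by rewrite /partial big_pred0// expr0n.
pose i := Ordinal mN.
have SS' (j : 'I_N) : ~~ ((j < m)%N && pred1 i j).
  by apply/negP => /andP[jm /eqP ji]; move: jm; rewrite ji ltnn.
have cen k : (k < q)%N -> P.-integrable setT (EFin \o (fun w => dPsi q (fun k => partial m k w) k * xi i k w)) /\
    (\int[P]_w (dPsi q (fun k => partial m k w) k * xi i k w)%:E = 0)%E.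
  move=> kq.
  have mJ : measurable_wrt (G (fun i => (i < m)%N) K) (fun w => dPsi q (fun k => partial m k w) k).
    apply/measurable_wrtP; first exact: group_sigma.
    have mp j := (measurable_wrtP (partial m j) (group_sigma _ _ _ (fun i => (i < m)%N) K)).1 (partial_wrt m j).
    rewrite /dPsi; apply: measurable_funM; first exact: measurable_funX.
    have mP : measurable_fun (T := g_sigma_algebraType (G (fun i => (i < m)%N) K)) setT
      (fun w => Psi q (fun k => partial m k w)) by exact: measurable_Psi.
    rewrite (_ : (fun w => _) = fun w => Psi q (fun k => partial m k w) `^ (-1)); last first.
      by apply/funext => w; rewrite powR_inv1// Psi_ge0.
    exact: (measurableT_comp (@measurable_powR R (-1)) mP).
  have mJ' := measurable_wrt_measurable (@group_measurable _ _ _ P F N Bs X0s cF BM F0 s s00 smono (fun i => (i < m)%N) K) mJ.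
  apply: (@group_centered _ _ _ P F N Bs X0s cF BM mu0 mu0T F0 X0P s s00 smono _ _ K _ _ SS' mJ) => //.
  - by apply: Gxi => /=.
  - apply: le_lt_trans (lty_norm (measurable_partial m k) (partial2 k (ltnW mN))).
    have h := measurable_partial m k.
    by apply: Ex_le; [by nneg|by mea|by mea|move=> w; exact: norm_dPsi_le].
  - exact: lty_norm.
pose Z w := \sum_(k < q) 2 * (dPsi q (fun k => partial m k w) k * xi i k w).
have iZk (k : 'I_q) : P.-integrable setT (EFin \o (fun w => 2 * (dPsi q (fun k => partial m k w) k * xi i k w))).
  by have [h _] := cen k (ltn_ord k); apply: (integrableZl measurableT 2 h).
have iZ : P.-integrable setT (EFin \o Z).
  apply: (@eq_integrable _ _ _ _ setT measurableT (fun w => \sum_(k < q) (2 * (dPsi q (fun k => partial m k w) k * xi i k w))%:E)%E).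
    by move=> w _; rewrite sumEFin.
  by apply: integrable_sum => // k _; exact: iZk.
have Z0 : (\int[P]_w (Z w)%:E = 0)%E.
  under eq_integral do rewrite /Z -sumEFin.
  rewrite integral_sum//.
  apply: big1 => k _; under eq_integral do rewrite EFinM.
  by have [h e] := cen k (ltn_ord k); rewrite integralZl// e mule0.
apply: (@le_trans _ _ (\E[P]_w (Psi q (fun k => partial m k w) + 8 * Psi q (fun k => xi i k w)))).
  have h1 := mPp m; have h2 := mPsi i.
  apply: (Ex_le_centered (Z := Z)) => //.
  - by move=> w; exact: Psi_ge0.
  - by move=> w; rewrite addr_ge0 ?mulr_ge0 ?Psi_ge0.
  - by mea.
  - move=> w; rewrite (_ : (fun k => partial m.+1 k w) = fun k => partial m k w + xi i k w); last first.
      by apply/funext => k; exact: partialS.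
    by apply: (le_trans (PsiD _ _ _)); rewrite /Z -mulr_sumr addrAC.
rewrite ExD; [|by move=> w; exact: Psi_ge0|by move=> w; rewrite mulr_ge0 ?Psi_ge0|exact: mPp|by have := mPsi i => h; mea].
rewrite ExZ//; last by move=> w; exact: Psi_ge0.
apply: (le_trans (leeD (ih (ltnW mN)) (lexx _))).
rewrite -ge0_muleDr//; last by apply: sume_ge0.
apply: lee_wpmul2l => //.
rewrite [leRHS](bigD1 i) ?ltnSn//= addeC leeD2l//; apply: eq_leW; apply: eq_bigl => j.
by rewrite ltnS ltn_neqAle andbC -val_eqE.
Qed.

End type_two_independent.

Lemma grid_refine {R : realType} (T : R) l n k : (l <= n)%N -> grid 0 T l k = grid 0 T n (k * 2 ^ (n - l)).
Proof.
move=> ln; have e : (2 : R) ^+ n = 2 ^+ l * 2 ^+ (n - l) by rewrite -exprD subnKC.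
rewrite /grid !add0r natrM natrX -mulrA; congr (_ * _); rewrite e.
by field; rewrite !expf_neq0.
Qed.

(** * Transfer from Euler schemes to the copies *)

Section euler_groups.
Context {R : realType} {d} {Om : measurableType d} (P : probability Om R).
Variables (F : R -> set (set Om)) (N : nat) (Bs : 'I_N -> R -> Om -> R) (X0s : 'I_N -> Om -> R).
Hypotheses (cF : complete_filtration P F) (BM : brownian_family P F Bs).
Variable (mu0 : set R -> \bar R).
Hypotheses (mu0T : mu0 setT = 1%E) (F0 : forall i, measurable_wrt (F 0) (X0s i)).
Hypothesis X0P : forall D : 'I_N -> set R, (forall i, measurable (D i)) ->
  P [set w | forall i, D i (X0s i w)] = (\prod_(i < N) mu0 (D i))%E.
Variables (b sg : R -> R) (L : R) (kappa : R -> R) (T : R).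
Hypotheses (L1 : 1 <= L) (bL : lip L b).
Hypotheses (sgL : lip L sg).
Hypotheses (T0 : 0 < T) (kappa0 : kappa 0 = 0).

Let L0 : 0 <= L. Proof. exact: le_trans L1. Qed.
Let BMi i := brownian_family_motion i BM.

Lemma euler_group n (S : pred 'I_N) i k : S i ->
  measurable_wrt (group Bs X0s (grid 0 T n) S k) (euler b sg kappa T n (Bs i) (X0s i) k).
Proof.
move=> Si; elim: k => [|k ih]; first exact: group_initial.
pose Gk := group Bs X0s (grid 0 T n) S k.+1.
have sG : sigma_algebra setT Gk by exact: group_sigma.
have clipL x y : `|clip n%:R (sg x) - clip n%:R (sg y)| <= L * `|x - y|.
  exact: le_trans (clip_lip _ _ _) (sgL x y).
have me : measurable_fun (T := g_sigma_algebraType Gk) setT (euler b sg kappa T n (Bs i) (X0s i) k).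
  by apply/(measurable_wrtP _ sG); apply: measurable_wrtS ih; exact: group_mono.
have mB : measurable_fun (T := g_sigma_algebraType Gk) setT (increments Bs (grid 0 T n) k i).
  by apply/(measurable_wrtP _ sG); exact: group_increments.
apply/(measurable_wrtP _ sG); rewrite /= /euler_map.
apply: measurable_funD; last exact: measurable_cst.
apply: measurable_funD; last first.
  by apply: measurable_funM => //; exact: (measurableT_comp (lip_measurable L0 clipL) me).
apply: measurable_funD => //; apply: measurable_funM; last exact: measurable_cst.
exact: (measurableT_comp (lip_measurable L0 bL) me).
Qed.

Variables (Ys Is : 'I_N -> R -> Om -> R) (D2 S2 : R).
Hypotheses (aY : forall i, adapted F (Ys i)) (cY : forall i, continuous_paths (Ys i)).
Hypothesis iI : forall i, ito_integral P F (Bs i) (fun t w => sg (Ys i t w)) (Is i).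
Hypothesis eqY : forall i, {ae P, forall w, forall t, 0 <= t ->
  Ys i t w = X0s i w + sde_noise b (Ys i) (Is i) t w + kappa t}.
Hypothesis D20 : 0 <= D2.
Hypothesis Y_incr : forall i s t, 0 <= s -> s <= t -> t <= T ->
  (\E[P]_w ((Ys i t w - Ys i s w) ^+ 2) <= (D2 * (t - s))%:E)%E.
Hypothesis Y_sg : forall i, (Ex P (tint (fun s w => sg (Ys i s w) ^+ 2)%R 0 T) <= S2%:E)%E.
Hypothesis Y2 : forall i t, 0 <= t <= T -> (\E[P]_w (Ys i t w ^+ 2) < +oo)%E.
Variables (h : R -> R) (M : R).
Hypotheses (M0 : 0 <= M) (hM : lip M h).

Let mh := lip_measurable M0 hM.
Let mY i t : 0 <= t -> meas (Ys i t).
Proof. by have [+ _ _] := proc_adapted cF (@aY i) (@cY i); apply. Qed.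

Lemma euler_cvg_all l (eps : R) : 0 < eps -> exists2 n, (l <= n)%N & forall i j, (j <= 2 ^ n)%N ->
  (\E[P]_w ((Ys i (grid 0 T n j) w - euler b sg kappa T n (Bs i) (X0s i) j w) ^+ 2) <= eps%:E)%E.
Proof.
move=> e0.
have H i := euler_cvg cF (BMi i) L1 bL sgL (@aY i) (@cY i) (iI i) (F0 i) (eqY i) kappa0 (ltW T0) D20 (@Y_incr i) (Y_sg i) e0.
have ex i : exists n0, forall n, (n0 <= n)%N -> forall j, (j <= 2 ^ n)%N ->
  (\E[P]_w ((Ys i (grid 0 T n j) w - euler b sg kappa T n (Bs i) (X0s i) j w) ^+ 2) <= eps%:E)%E.
  by have [n0 _ hn] := H i; exists n0 => n; exact: hn.
exists (l + \sum_(i < N) sval (cid (ex i)))%N; first exact: leq_addr.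
move=> i j; apply: (svalP (cid (ex i))); apply: leq_trans (leq_addl _ _).
by rewrite (bigD1 i)//= leq_addr.
Qed.

Variables (l q : nat) (a a' : nat -> nat) (theta : R).
Hypotheses (al : forall k, (a k <= 2 ^ l)%N) (al' : forall k, (a' k <= 2 ^ l)%N).

(** With [theta = 1] this is an increment of [h] between two nodes, with [theta = 0] a value of [h],
    so one inequality covers the chaining increments and the initial error. The factor [r] converts
    node indices to those of a finer grid. *)
Definition observable (Y : nat -> Om -> R) (r : nat) k w := h (Y (a k * r)%N w) - theta * h (Y (a' k * r)%N w).
Definition centered_observable Y r k w := observable Y r k w - fine (\int[P]_w' (observable Y r k w')%:E).
Let Yg i j := Ys i (grid 0 T l j).

Let g_itv n j : (j <= 2 ^ n)%N -> 0 <= grid 0 T n j <= T.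
Proof.
by move=> jn; rewrite grid_ge0 ?(ltW T0)//= -[leRHS](grid_end 0 T n) grid_le// ltW.
Qed.

Let hY2 (Y : Om -> R) : meas Y -> (\E[P]_w (Y w ^+ 2) < +oo)%E -> (\E[P]_w (h (Y w) ^+ 2) < +oo)%E.
Proof.
move=> mYw /Ex_sqr_lty[v v0 hv]; have mhY : meas (fun w => h (Y w)) by exact: (measurableT_comp mh).
apply: (@le_lt_trans _ _ (2 * h 0 ^+ 2 + 2 * M ^+ 2 * v)%:E); last exact: ltry.
apply: (@le_trans _ _ (\E[P]_w (2 * h 0 ^+ 2 + 2 * M ^+ 2 * Y w ^+ 2))).
  apply: Ex_le; [by nneg|by mea|by mea|move=> w].
  have := sqrD_le (h 0) (h (Y w) - h 0); rewrite [h 0 + _]addrC subrK.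
  have : (h (Y w) - h 0) ^+ 2 <= M ^+ 2 * Y w ^+ 2.
    rewrite -exprMn -[leLHS]normr_sqr// -[leRHS]normr_sqr//.
    apply: lerXn2r; rewrite ?nnegrE// normrM (ger0_norm M0).
    by have := hM (Y w) 0; rewrite subr0.
  by rewrite -[_ * _ * Y w ^+ 2]mulrA; lra.
rewrite ExD; try side.
by rewrite Ex_cst ExZ; [apply: lee_finD => //; apply: lee_finZ => //; nneg|by nneg|by nneg|by mea].
Qed.

Let m_obs (Y : nat -> Om -> R) r : (forall j, meas (Y j)) -> forall k, meas (observable Y r k).
Proof.
move=> mYj k; have h1 := measurableT_comp mh (mYj (a k * r)%N); have h2 := measurableT_comp mh (mYj (a' k * r)%N).
apply: measurable_funB; first exact: h1.
by apply: measurable_funM; [exact: measurable_cst|exact: h2].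
Qed.

Let obs2 (Y : nat -> Om -> R) r : (forall j, meas (Y j)) -> (forall j, (j <= 2 ^ l * r)%N -> (\E[P]_w (Y j w ^+ 2) < +oo)%E) ->
  forall k, (\E[P]_w (observable Y r k w ^+ 2) < +oo)%E.
Proof.
move=> mYj Yj k.
have [|v v0 hv] := Ex_sqr_lty (hY2 (mYj (a k * r)%N) (Yj _ _)); first by rewrite leq_mul2r al orbT.
have [|v' v'0 hv'] := Ex_sqr_lty (hY2 (mYj (a' k * r)%N) (Yj _ _)); first by rewrite leq_mul2r al' orbT.
have h1 := measurableT_comp mh (mYj (a k * r)%N); have h2 := measurableT_comp mh (mYj (a' k * r)%N).
have := Ex_sqr_comb 1 (- theta) h1 h2 hv hv'.
rewrite (_ : (fun w => _) = fun w => observable Y r k w ^+ 2).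
  by move/le_lt_trans; apply; exact: ltry.
by apply/funext => w; rewrite /observable /= mul1r mulNr.
Qed.

Let eta := 2 * M ^+ 2 + 2 * theta ^+ 2 * M ^+ 2.
Let eta0 : 0 <= eta. Proof. by rewrite /eta; nneg. Qed.

Let obs_diff (Y Y' : nat -> Om -> R) r r' eps : 0 <= eps -> (forall j, meas (Y j)) -> (forall j, meas (Y' j)) ->
  (forall j, (j <= 2 ^ l)%N -> (\E[P]_w ((Y (j * r)%N w - Y' (j * r')%N w) ^+ 2) <= eps%:E)%E) ->
  forall k, (\E[P]_w ((observable Y r k w - observable Y' r' k w) ^+ 2) <= (2 * eta * eps)%:E)%E.
Proof.
move=> e0 mYj mYj' hj k.
have hd j : (j <= 2 ^ l)%N -> (\E[P]_w ((h (Y (j * r)%N w) - h (Y' (j * r')%N w)) ^+ 2) <= (M ^+ 2 * eps)%:E)%E.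
  move=> jl; have h1 := mYj (j * r)%N; have h2 := mYj' (j * r')%N.
  have h3 := measurableT_comp mh h1; have h4 := measurableT_comp mh h2.
  apply: (Ex_leZ (g := fun w => (Y (j * r)%N w - Y' (j * r')%N w) ^+ 2)) => //; [by nneg|by nneg|by nneg|by mea|by mea|move=> w|exact: hj].
  rewrite -exprMn -[leLHS]normr_sqr// -[leRHS]normr_sqr//.
  by apply: lerXn2r; rewrite ?nnegrE// normrM (ger0_norm M0).
have h1 := measurableT_comp mh (mYj (a k * r)%N); have h2 := measurableT_comp mh (mYj (a' k * r)%N).
have h1' := measurableT_comp mh (mYj' (a k * r')%N); have h2' := measurableT_comp mh (mYj' (a' k * r')%N).
have := Ex_sqr_comb 1 (- theta) (measurable_funB h1 h1') (measurable_funB h2 h2') (hd _ (al k)) (hd _ (al' k)).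
rewrite (_ : (fun w => _) = fun w => (observable Y r k w - observable Y' r' k w) ^+ 2); last first.
  by apply/funext => w; rewrite /observable /=; congr (_ ^+ 2); ring.
move/le_trans; apply; rewrite lee_fin sqrrN /eta expr1n.
have : 0 <= theta ^+ 2 * M ^+ 2 * eps by nneg.
have : 0 <= M ^+ 2 * eps by nneg.
move: (M ^+ 2) (theta ^+ 2) => x y; lra.
Qed.

(** Independence is exact for the Euler schemes of a fine grid, whose [L^2] distance to the copies
    is at most [eps]. Passing to the schemes and back costs a factor 3 each time, hence
    [72 = 3 . 8 . 3]; the constant [C] collects all that multiplies [eps]. *)
Lemma type_two_copies :
  (\E[P]_w (Psi q (fun k => \sum_(i < N) centered_observable (Yg i) 1 k w)) <=
   72%:E * \sum_(i < N) \E[P]_w (Psi q (fun k => centered_observable (Yg i) 1 k w)))%E.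
Proof.
have mYg i j : meas (Yg i j) by apply: mY; exact: grid_ge0 (ltW T0).
have Yg2 i j : (j <= 2 ^ l * 1)%N -> (\E[P]_w (Yg i j w ^+ 2) < +oo)%E.
  by rewrite muln1 => jl; apply: Y2; exact: g_itv.
have mcent Y r k : meas (observable Y r k) -> meas (centered_observable Y r k).
  by move=> mo; rewrite /centered_observable; apply: measurable_funB => //; exact: measurable_cst.
apply/lee_addgt0Pr => e e0.
pose C : R := 24 * (N%:R * (3 * (q%:R * (4 * (2 * eta))))) + 3 * (q%:R * (N%:R ^+ 2 * (4 * (2 * eta)))).
have C0 : 0 <= C by rewrite /C; nneg.
pose eps := e / (C + 1); have eps0 : 0 < eps by rewrite divr_gt0// ltr_wpDl.
have [n ln hn] := euler_cvg_all l eps0.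
pose r := (2 ^ (n - l))%N.
pose E i := euler b sg kappa T n (Bs i) (X0s i).
have mE i j : meas (E i j).
  exact: (measurable_euler cF (BMi i) L1 bL sgL kappa (F0 i) (ltW T0) n j).
have rn : (2 ^ l * r = 2 ^ n)%N by rewrite /r -expnD subnKC.
have dYE i j : (j <= 2 ^ l)%N -> (\E[P]_w ((Yg i (j * 1)%N w - E i (j * r)%N w) ^+ 2) <= eps%:E)%E.
  move=> jl; rewrite muln1 /Yg (grid_refine _ _ ln); apply: hn.
  by rewrite -rn leq_mul2r jl orbT.
have E2 i j : (j <= 2 ^ l * r)%N -> (\E[P]_w (E i j w ^+ 2) < +oo)%E.
  rewrite rn => jn.
  have mYn : meas (Ys i (grid 0 T n j)) by apply: mY; exact: grid_ge0 (ltW T0).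
  have [v v0 hv] := Ex_sqr_lty (Y2 i (g_itv jn)).
  have := Ex_sqr_comb 1 (-1) mYn (measurable_funB mYn (mE i j)) hv (hn i j jn).
  rewrite (_ : (fun w => _) = fun w => E i j w ^+ 2).
    by move/le_lt_trans; apply; exact: ltry.
  by apply/funext => w /=; congr (_ ^+ 2); ring.
pose xi i k w := centered_observable (E i) r k w.
pose ze i k w := centered_observable (Yg i) 1 k w.
have mo i := m_obs r (mE i). have moY i := m_obs 1 (mYg i).
have mxi i k : meas (xi i k) by exact: mcent.
have mze i k : meas (ze i k) by exact: mcent.
have o2 i := obs2 (mE i) (@E2 i). have oY2 i := obs2 (mYg i) (@Yg2 i).
have dd i k : (\E[P]_w ((xi i k w - ze i k w) ^+ 2) <= (4 * (2 * eta * eps))%:E)%E.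
  have h1 := mo i k; have h2 := moY i k.
  have := Ex_sqr_centered (measurable_funB h2 h1) (obs_diff (ltW eps0) (mYg i) (mE i) (dYE i) k).
  congr (_ <= _)%E; congr (Ex P _); apply/funext => w.
  rewrite /xi /ze /centered_observable.
  rewrite (_ : (\int[P]_w0 _)%E = (\int[P]_w' (observable (Yg i) 1 k w')%:E - \int[P]_w' (observable (E i) r k w')%:E)%E); last first.
    under eq_integral do rewrite EFinB.
    by rewrite integralB//; exact: Ex_sqr_integrable.
  rewrite fineB; [|exact: integrable_fin_num (Ex_sqr_integrable h2 (oY2 i k))|exact: integrable_fin_num (Ex_sqr_integrable h1 (o2 i k))].
  by rewrite -[RHS]sqrrN /=; congr (_ ^+ 2); ring.
have s0 : grid 0 T n 0 = 0 by rewrite grid0.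
have smono k : grid 0 T n k < grid 0 T n k.+1 by rewrite -subr_gt0 gridS subr0 divr_gt0// exprn_gt0.
have t2 : (\E[P]_w (Psi q (fun k => \sum_(i < N) xi i k w)) <=
    8%:E * \sum_(i < N) \E[P]_w (Psi q (fun k => xi i k w)))%E.
  apply: (@type_two_groups _ _ _ P F N Bs X0s cF BM mu0 mu0T F0 X0P (grid 0 T n) s0 smono (2 ^ n) q xi).
  - move=> S i k Si.
    have Ew j : (j <= 2 ^ n)%N -> measurable_wrt (group Bs X0s (grid 0 T n) S (2 ^ n)) (E i j).
      by move=> jn; apply: measurable_wrtS (euler_group n j Si); exact: group_mono_le.
    apply/measurable_wrtP; first exact: group_sigma.
    have h1 : measurable_fun (T := g_sigma_algebraType (group Bs X0s (grid 0 T n) S (2 ^ n))) setT (E i (a k * r)%N).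
      by apply/measurable_wrtP; [exact: group_sigma|apply: Ew; rewrite -rn leq_mul2r al orbT].
    have h2 : measurable_fun (T := g_sigma_algebraType (group Bs X0s (grid 0 T n) S (2 ^ n))) setT (E i (a' k * r)%N).
      by apply/measurable_wrtP; [exact: group_sigma|apply: Ew; rewrite -rn leq_mul2r al' orbT].
    apply: measurable_funB; last exact: measurable_cst.
    apply: measurable_funB; first exact: (measurableT_comp mh h1).
    by apply: measurable_funM; [exact: measurable_cst|exact: (measurableT_comp mh h2)].
  - move=> i k; have [v v0 hv] := Ex_sqr_lty (o2 i k).
    exact: le_lt_trans (Ex_sqr_centered (mo i k) hv) (ltry _).
  - by move=> i k; exact: centered_mean0.
have mP (f : nat -> Om -> R) : (forall k, meas (f k)) -> meas (fun w => Psi q (fun k => f k w)).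
  by move=> mf; exact: measurable_Psi.
have ExPsi3 (f g : nat -> Om -> R) : (forall k, meas (f k)) -> (forall k, meas (g k)) ->
    (\E[P]_w (Psi q (fun k => f k w + g k w)%R) <=
     3%:E * (\E[P]_w (Psi q (fun k => f k w)) + \E[P]_w (Psi q (fun k => g k w))))%E.
  move=> mf mg; have h1 := mP _ mf; have h2 := mP _ mg.
  have h3 : meas (fun w => Psi q (fun k => f k w + g k w)) by apply: mP => k; exact: measurable_funD.
  apply: (@le_trans _ _ (\E[P]_w (3 * (Psi q (fun k => f k w) + Psi q (fun k => g k w))))).
    by apply: Ex_le => //; [move=> w; exact: Psi_ge0|mea|move=> w; exact: PsiD_le].
  rewrite ExZ//; [|by move=> w; rewrite addr_ge0 ?Psi_ge0|by mea].
  by rewrite ExD// => w; exact: Psi_ge0.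
have mS (f : 'I_N -> nat -> Om -> R) : (forall i k, meas (f i k)) ->
    forall k, meas (fun w => \sum_(i < N) f i k w).
  by move=> mf k; exact: measurable_sum.
pose df i k w := ze i k w - xi i k w.
have mdf i k : meas (df i k) by exact: measurable_funB.
have dd' i k : (\E[P]_w (df i k w ^+ 2) <= (4 * (2 * eta) * eps)%:E)%E.
  rewrite (_ : 4 * (2 * eta) * eps = 4 * (2 * eta * eps)); last by rewrite -!mulrA.
  by under [in leLHS]eq_fun do rewrite /df -sqrrN opprB.
have e1 := ExPsi3 _ _ (mS _ mxi) (mS _ mdf).
rewrite (_ : (fun w => Psi q (fun k => _ + _)) = (fun w => Psi q (fun k => \sum_(i < N) ze i k w))) in e1; last first.
  apply/funext => w; congr (Psi q _); apply/funext => k.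
  by rewrite -big_split/=; apply: eq_bigr => i _; rewrite /df addrC subrK.
apply: (le_trans e1).
have e2 i := ExPsi3 _ _ (mze i) (fun k => measurable_funB (mxi i k) (mze i k)).
have b1 : (\E[P]_w (Psi q (fun k => \sum_(i < N) df i k w)) <= (q%:R * (N%:R ^+ 2 * (4 * (2 * eta) * eps)))%:E)%E.
  apply: Ex_Psi_le; first exact: mS.
  by move=> k _; apply: Ex_sqr_sum => //; have := ltW eps0 => ?; nneg.
have b2 i : (\E[P]_w (Psi q (fun k => xi i k w)) <=
    3%:E * \E[P]_w (Psi q (fun k => ze i k w)) + (3 * (q%:R * (4 * (2 * eta) * eps)))%:E)%E.
  have := e2 i.
  rewrite (_ : (fun w => Psi q (fun k => _ + _)) = (fun w => Psi q (fun k => xi i k w))); last first.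
    by apply/funext => w; congr (Psi q _); apply/funext => k /=; rewrite addrC subrK.
  move/le_trans; apply; rewrite ge0_muleDr; [|by apply: Ex_ge0 => w; exact: Psi_ge0|by apply: Ex_ge0 => w; exact: Psi_ge0].
  apply: leeD => //; apply: lee_finZ => //; apply: Ex_Psi_le; first by move=> k; exact: measurable_funB.
  by move=> k _; rewrite (_ : 4 * (2 * eta) * eps = 4 * (2 * eta * eps)) ?dd//; rewrite -!mulrA.
pose SZ := (\sum_(i < N) \E[P]_w (Psi q (fun k => ze i k w)))%E.
have E0 i : (0 <= \E[P]_w (Psi q (fun k => ze i k w)))%E by apply: Ex_ge0 => w; exact: Psi_ge0.
have SZ0 : (0 <= SZ)%E by exact: sume_ge0.
have b3 : (\sum_(i < N) \E[P]_w (Psi q (fun k => xi i k w)) <= 3%:E * SZ + (N%:R * (3 * (q%:R * (4 * (2 * eta) * eps))))%:E)%E.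
  apply: (le_trans (lee_sum _ (fun i _ => b2 i))); rewrite big_split/=; apply: leeD.
    by rewrite ge0_sume_distrr.
  by rewrite sumEFin lee_fin sumr_const card_ord -[leLHS]mulr_natl.
apply: (@le_trans _ _ (3%:E * (8%:E * (3%:E * SZ + (N%:R * (3 * (q%:R * (4 * (2 * eta) * eps))))%:E) + (q%:R * (N%:R ^+ 2 * (4 * (2 * eta) * eps)))%:E))%E).
  apply: lee_wpmul2l => //; apply: leeD => //.
  by apply: (le_trans t2); exact: lee_wpmul2l.
rewrite ge0_muleDr; [|by rewrite mule_ge0// adde_ge0 ?mule_ge0// lee_fin; nneg; exact: ltW|by rewrite lee_fin; nneg; exact: ltW].
rewrite muleA -EFinM ge0_muleDr; [|by rewrite mule_ge0|by rewrite lee_fin; nneg; exact: ltW].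
rewrite muleA -!EFinM -addeA -EFinD; apply: leeD.
  by apply: eq_leW; congr (_%:E * _)%E; ring.
rewrite lee_fin [leLHS](_ : _ = C * eps); last by rewrite /C; ring.
by rewrite /eps mulrCA ler_piMr ?(ltW e0)// ler_pdivrMr ?ltr_wpDl// mul1r lerDl.
Qed.

End euler_groups.

(** * The law of large numbers uniform in time *)

Section two_spaces.
Context {R : realType} {d d'} {Om : measurableType d} {Om' : measurableType d'}.
Variables (P : probability Om R) (P' : probability Om' R).
Variables (h : R -> R) (M : R).
Hypotheses (M0 : 0 <= M) (hM : lip M h).

Lemma mean_shift_le {d0} {T : measurableType d0} (Q : probability T R) (Y Z : T -> R) (e : R) : 0 < e ->
  meas Y -> meas Z ->
  (\E[Q]_w (Y w ^+ 2) < +oo)%E -> (\E[Q]_w (Z w ^+ 2) < +oo)%E ->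
  (\E[Q]_w ((Y w - Z w) ^+ 2) <= ((e / (M + 1)) ^+ 2)%:E)%E ->
  (\int[Q]_w (h (Y w))%:E <= \int[Q]_w (h (Z w))%:E + e%:E)%E.
Proof.
move=> e0 mY mZ Y2 Z2 YZ.
have M1 : 0 < M + 1 by rewrite ltr_wpDl.
have e1 : 0 < e / (M + 1) by rewrite divr_gt0.
apply: (@integral_shift_le _ _ _ Q (h \o Y) (h \o Z) (fun w => M * `|Y w - Z w|)).
- exact: (lip_integrable M0 hM mY Y2).
- exact: (lip_integrable M0 hM mZ Z2).
- by mea.
- by move=> w; rewrite mulr_ge0.
- rewrite ExZ//; last by mea.
  apply: (@le_trans _ _ (M * (e / (M + 1)))%:E).
    by apply: lee_finZ => //; apply: Ex_normr_le => //; mea.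
  by rewrite lee_fin mulrCA ler_piMr ?(ltW e0)// ler_pdivrMr// mul1r lerDl.
- by move=> w; have := hM (Y w) (Z w); have := ler_norm (h (Y w) - h (Z w)) => /=; lra.
Qed.

(** Only the approximations [Z] and [Z'] are known to have the same law; Lipschitz continuity
    carries the equality of their means over to [Y] and [Y'], up to [e]. One inequality is enough,
    since the roles can be exchanged. *)
Lemma mean_le_of_common_law (Y : Om -> R) (Y' : Om' -> R) :
  meas Y -> meas Y' ->
  (\E[P]_w (Y w ^+ 2) < +oo)%E -> (\E[P']_w (Y' w ^+ 2) < +oo)%E ->
  (forall e : R, 0 < e -> exists Z : Om -> R, exists2 Z' : Om' -> R, [/\ meas Z, (\E[P]_w (Z w ^+ 2) < +oo)%E
      & (\E[P]_w ((Z w - Y w) ^+ 2) <= (e ^+ 2)%:E)%E] &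
     [/\ meas Z', (\E[P']_w (Z' w ^+ 2) < +oo)%E,
       (\E[P']_w ((Y' w - Z' w) ^+ 2) <= (e ^+ 2)%:E)%E &
       forall f : R -> \bar R, (forall x, (0 <= f x)%E) -> meas f ->
         (\int[P']_w f (Z' w) = \int[P]_w f (Z w))%E]) ->
  (\int[P']_w (h (Y' w))%:E <= \int[P]_w (h (Y w))%:E)%E.
Proof.
move=> mY mY' Y2 Y'2 H; apply/lee_addgt0Pr => e e0.
have e2 : 0 < e / 2 by rewrite divr_gt0.
have [Z [Z' [mZ Z2 ZY] [mZ' Z'2 YZ' law]]] := H (e / 2 / (M + 1)) (divr_gt0 e2 (ltr_wpDl M0 ltr01)).
apply: (le_trans (mean_shift_le e2 mY' mZ' Y'2 Z'2 YZ')).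
have -> : (\int[P']_w (h (Z' w))%:E = \int[P]_w (h (Z w))%:E)%E.
  have mh : meas (EFin \o h) by apply/measurable_EFinP; exact: lip_measurable hM.
  rewrite integralE [RHS]integralE; congr (_ - _)%E.
    have := law ((EFin \o h)^\+)%E; rewrite unlock; apply.
      by move=> x; rewrite le_max lexx orbT.
    by have := measurable_funepos mh; rewrite unlock.
  have := law ((EFin \o h)^\-)%E; rewrite unlock; apply.
    by move=> x; rewrite le_max lexx orbT.
  by have := measurable_funeneg mh; rewrite unlock.
rewrite [in leRHS](splitr e) EFinD addeA; apply: leeD => //.
exact: (mean_shift_le e2 mZ mY Z2 Y2 ZY).
Qed.

End two_spaces.

(** * Dyadic chaining *)

Section scalar_chaining.
Context {R : realType}.

Lemma PsiZ q (c : R) x : Psi q (fun k => c * x k) = c ^+ 2 * Psi q x.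
Proof.
rewrite /Psi; under eq_bigr do rewrite exprMn.
rewrite -mulr_sumr sqrtrM ?exprn_even_ge0// -[c ^+ 4](_ : (c ^+ 2) ^+ 2 = _); last by rewrite -exprM.
by rewrite sqrtr_sqr ger0_norm ?sqr_ge0.
Qed.

Lemma Psi_mono q (x y : nat -> R) : (forall k, (k < q)%N -> `|x k| <= `|y k|) -> Psi q x <= Psi q y.
Proof.
move=> xy; rewrite ler_sqrt; last by apply: sumr_ge0 => k _; rewrite exprn_even_ge0.
apply: ler_sum => k _; rewrite (_ : x k ^+ 4 = `|x k| ^+ 4); last by rewrite -normrX ger0_norm// exprn_even_ge0.
rewrite (_ : y k ^+ 4 = `|y k| ^+ 4); last by rewrite -normrX ger0_norm// exprn_even_ge0.
by apply: lerXn2r; rewrite ?nnegrE// xy.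
Qed.

Lemma Psi_ext q (x y : nat -> R) : (forall k, (k < q)%N -> x k = y k) -> Psi q x = Psi q y.
Proof. by move=> xy; rewrite /Psi; congr Num.sqrt; apply: eq_bigr => k _; rewrite xy. Qed.

Lemma Psi1 (x : nat -> R) : Psi 1 x = x 0%N ^+ 2.
Proof. by rewrite /Psi big_ord1 (_ : _ ^+ 4 = (x 0%N ^+ 2) ^+ 2) ?sqrtr_sqr ?ger0_norm ?sqr_ge0// -exprM. Qed.

Lemma geometric_le (r : R) n : 0 <= r -> r < 1 -> \sum_(l < n) r ^+ l <= (1 - r)^-1.
Proof.
move=> r0 r1; have r10 : 0 < 1 - r by rewrite subr_gt0.
rewrite -[leRHS]mul1r ler_pdivlMr//.
suff -> : (\sum_(l < n) r ^+ l) * (1 - r) = 1 - r ^+ n by rewrite gerBl exprn_ge0.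
elim: n => [|n ih]; first by rewrite big_ord0 mul0r expr0 subrr.
by rewrite big_ord_recr/= mulrDl ih exprS; ring.
Qed.

Variables (T : R) (f : R -> R).
Definition level_incr l k := f (grid 0 T l k.+1) - f (grid 0 T l k).

(** A node of the next level is either a node of the previous one or follows one immediately,
    according to the parity of its index; each level thus adds at most one increment, bounded by the
    root of [Psi]. *)
Lemma chain_bound n k : (k <= 2 ^ n)%N ->
  `|f (grid 0 T n k)| <= `|f 0| + \sum_(l < n.+1) Num.sqrt (Psi (2 ^ l) (level_incr l)).
Proof.
have inc l k' : (k' < 2 ^ l)%N -> `|level_incr l k'| <= Num.sqrt (Psi (2 ^ l) (level_incr l)).
  move=> kl; rewrite -sqrtr_sqr ler_sqrt ?Psi_ge0//; exact: sqr_le_Psi.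
have s0 n' : 0 <= \sum_(l < n') Num.sqrt (Psi (2 ^ l) (level_incr l)).
  by apply: sumr_ge0 => l _; exact: sqrtr_ge0.
elim: n k => [|n ih] k kn.
  have := inc 0%N 0%N isT; rewrite big_ord1 /level_incr grid0 => h.
  case: k kn => [|[|//]] _; first by rewrite grid0 lerDl sqrtr_ge0.
  rewrite -[f (grid 0 T 0 1)](subrK (f 0)) addrC (le_trans (ler_normD _ _))//.
  by rewrite lerD2l.
have even j : (j <= 2 ^ n)%N -> `|f (grid 0 T n.+1 (j * 2))| <= `|f 0| + \sum_(l < n.+1) Num.sqrt (Psi (2 ^ l) (level_incr l)).
  move=> jn; have := ih j jn; rewrite (@grid_refine _ T n n.+1 j (leqnSn n)).
  by rewrite subSnn expn1.
rewrite big_ord_recr/= addrA.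
rewrite -(odd_double_half k) -muln2; case: (boolP (odd k)) => ok /=; last first.
  rewrite add0n (le_trans (even _ _)) ?lerDl ?sqrtr_ge0//.
  by rewrite -leq_double -!muln2 -expnSr (leq_trans _ kn)// -[leqRHS]odd_double_half muln2 leq_addl.
have kh : (k./2 * 2 < 2 ^ n.+1)%N.
  by rewrite (leq_trans _ kn)// -[leqRHS]odd_double_half ok muln2.
have jn : (k./2 <= 2 ^ n)%N by rewrite -leq_double -!muln2 -expnSr ltnW.
rewrite add1n -[f (grid 0 T n.+1 _)](subrK (f (grid 0 T n.+1 (k./2 * 2)))) addrC.
by rewrite (le_trans (ler_normD _ _))// lerD ?even// inc.
Qed.

(* [64 / 49] is the square of [8 / 7], the weight in Cauchy-Schwarz. *)
Lemma chain_bound_sqr n k : (k <= 2 ^ n)%N ->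
  f (grid 0 T n k) ^+ 2 <= 2 * f 0 ^+ 2 +
    2 * 5 * \sum_(l < n.+1) (64 / 49) ^+ l * Psi (2 ^ l) (level_incr l).
Proof.
move=> kn; rewrite -[leLHS]normr_sqr//.
set S := \sum_(l < n.+1) Num.sqrt (Psi (2 ^ l) (level_incr l)).
have S0 : 0 <= S by apply: sumr_ge0 => l _; exact: sqrtr_ge0.
have hS : S ^+ 2 <= 5 * \sum_(l < n.+1) (64 / 49) ^+ l * Psi (2 ^ l) (level_incr l).
  have := sum_cauchy_schwarz n.+1 (fun l => (7 / 8) ^+ l) (fun l => (8 / 7) ^+ l * Num.sqrt (Psi (2 ^ l) (level_incr l))).
  rewrite (_ : \sum_(k0 < n.+1) _ = S); last first.
    apply: eq_bigr => l _; rewrite mulrA -exprMn (_ : 7 / 8 * (8 / 7) = 1) ?expr1n ?mul1r//.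
    by field.
  move/le_trans; apply; apply: ler_pM.
  - by apply: sumr_ge0 => l _; exact: sqr_ge0.
  - by apply: sumr_ge0 => l _; exact: sqr_ge0.
  - under eq_bigr do rewrite exprAC.
    apply: (le_trans (geometric_le _ _ _)); [by nneg|by rewrite expr2; lra|].
    rewrite (_ : (1 - (7 / 8) ^+ 2)^-1 = 64 / 15 :> R); last by field.
    by lra.
  - apply: ler_sum => l _; rewrite exprMn sqr_sqrtr ?Psi_ge0// exprAC.
    by rewrite (_ : (8 / 7) ^+ 2 = 64 / 49 :> R)//; field.
apply: (@le_trans _ _ ((`|f 0| + S) ^+ 2)).
  by apply: lerXn2r; rewrite ?nnegrE ?addr_ge0//; exact: chain_bound.
apply: (le_trans (sqrD_le _ _)); rewrite normr_sqr// mulrDr lerD2l -mulrA.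
by rewrite ler_pM2l.
Qed.

End scalar_chaining.

(** * Continuity of means and weighted bounds for [Psi] *)

Section holder.
Context {R : realType}.

Lemma holder_continuous (g : R -> R) (D : R) : 0 <= D ->
  (forall x y, (g x - g y) ^+ 2 <= D * `|x - y|) -> continuous g.
Proof.
move=> D0 gD x; apply/cvgrPdist_lt => e e0.
have D1 : 0 < D + 1 by rewrite ltr_wpDl.
have d0 : 0 < e ^+ 2 / (D + 1) by rewrite divr_gt0// exprn_gt0.
near=> y.
have xy : `|x - y| < e ^+ 2 / (D + 1).
  by near: y; apply: cvgr_dist_lt => //; exact: cvg_id.
rewrite -(ltr_pXn2r (n := 2)) ?nnegrE ?(ltW e0)// normr_sqr//.
apply: (le_lt_trans (gD x y)); move: xy; rewrite ltr_pdivlMr// => xy.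
apply: (le_lt_trans _ xy); rewrite mulrC ler_wpM2l//.
by lra.
Unshelve. all: by end_near. Qed.

Lemma holder_bounded (g : R -> R) (D t : R) : 0 <= D ->
  (forall x y, (g x - g y) ^+ 2 <= D * `|x - y|) ->
  exists c : R, forall s, 0 <= s <= t -> `|g s| <= c.
Proof.
move=> D0 gD; exists (`|g 0| + (1 + D * t)) => s /andP[s0 st].
rewrite -[g s](subrK (g 0)) addrC (le_trans (ler_normD _ _))// lerD2l.
have := gD s 0; rewrite subr0 ger0_norm// => h.
have : D * s <= D * t by rewrite ler_wpM2l.
have : `|g s - g 0| ^+ 2 = (g s - g 0) ^+ 2 by rewrite normr_sqr.
have := sqr_ge0 (`|g s - g 0| - 1); have := normr_ge0 (g s - g 0); nra.
Qed.

Definition clamp (T s : R) := Num.max 0 (Num.min s T).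

Lemma clamp_itv T s : 0 <= T -> 0 <= clamp T s <= T.
Proof. by move=> T0; rewrite /clamp le_max lexx/= ge_max T0 ge_min lexx orbT. Qed.

Lemma clamp_id T s : 0 <= s <= T -> clamp T s = s.
Proof. by move=> /andP[s0 sT]; rewrite /clamp (min_idPl sT) (max_idPr s0). Qed.

Lemma clamp_lip T x y : `|clamp T x - clamp T y| <= `|x - y|.
Proof.
rewrite /clamp; have mm (u v : R) : `|Num.min u T - Num.min v T| <= `|u - v|.
  rewrite ler_norml; have := ler_norm (u - v); have := ler_norm (- (u - v)); rewrite normrN.
  by case: (leP u T) => ?; case: (leP v T) => ?; lra.
apply: (le_trans _ (mm x y)); rewrite ![Num.max 0 _]maxC; exact: lip_max0.
Qed.

(* [10 / 7] is a rational upper bound of the square root of 2. *)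
Lemma Psi_cst_le l (x : nat -> R) (c : R) : 0 <= c -> (forall k, (k < 2 ^ l)%N -> x k ^+ 2 <= c) ->
  Psi (2 ^ l) x <= (10 / 7) ^+ l * c.
Proof.
move=> c0 xc; rewrite -(ler_pXn2r (n := 2)) ?nnegrE ?Psi_ge0 ?mulr_ge0 ?exprn_ge0//.
rewrite sqr_Psi; apply: (@le_trans _ _ (2 ^+ l * c ^+ 2)).
  apply: (@le_trans _ _ (\sum_(k < 2 ^ l) c ^+ 2)); last first.
    by rewrite sumr_const card_ord -[leLHS]mulr_natl natrX.
  apply: ler_sum => k _; rewrite (_ : x k ^+ 4 = (x k ^+ 2) ^+ 2); last by rewrite -exprM.
  by apply: lerXn2r; rewrite ?nnegrE ?sqr_ge0//; exact: xc.
rewrite exprMn -exprM mulnC exprM ler_wpM2r ?sqr_ge0//.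
by apply: lerXn2r; rewrite ?nnegrE//; lra.
Qed.

(** Young's inequality for the square root. With the random weight [p = Q + X0^2], the first term
    needs two moments of [X0], and the second is the weighted fourth moment, which is finite. *)
Lemma Psi_weighted q (x : nat -> R) (lam p : R) : 0 < lam -> 0 < p ->
  Psi q x <= 2^-1 * (lam * p + lam^-1 * \sum_(k < q) p^-1 * x k ^+ 4).
Proof.
move=> l0 p0; rewrite -mulr_sumr -sqr_Psi.
have lp : 0 < lam * p by rewrite mulr_gt0.
rewrite mulrA -invfM -(ler_pM2l (x := 2))// mulrA mulfV ?mul1r ?pnatr_eq0//.
rewrite -subr_ge0 (_ : _ - _ = (lam * p - Psi q x) ^+ 2 / (lam * p)).
  by rewrite divr_ge0 ?sqr_ge0// ltW.
by field; rewrite !gt_eqF.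
Qed.
End holder.

Lemma Ex_sqr_dist_lty {R : realType} {d} {T : measurableType d} (P : probability T R) (f g : T -> R) (u v : R) :
  meas f -> meas g -> (\E[P]_w (f w ^+ 2) <= u%:E)%E ->
  (\E[P]_w ((f w - g w) ^+ 2) <= v%:E)%E -> (\E[P]_w (g w ^+ 2) < +oo)%E.
Proof.
move=> mf mg fu fg; have := Ex_sqr_comb 1 (-1) mf (measurable_funB mf mg) fu fg.
rewrite (_ : Ex P _ = \E[P]_w (g w ^+ 2)); last first.
  by apply: eq_integral => w _; congr ((_ ^+ 2)%:E); rewrite /=; ring.
by move/le_lt_trans; apply; rewrite ltry.
Qed.

(** * Uniform error of the empirical mean *)

Section law_of_large_numbers.
Context {R : realType} {d d'} {Om : measurableType d} {Om' : measurableType d'}.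
Variables (P : probability Om R) (F : R -> set (set Om)) (B : R -> Om -> R) (X0 : Om -> R).
Hypotheses (cF : complete_filtration P F) (BM : brownian_motion P F B) (F0 : measurable_wrt (F 0) X0).
Variables (P' : probability Om' R) (F' : R -> set (set Om')) (N : nat).
Variables (Bs : 'I_N -> R -> Om' -> R) (X0s : 'I_N -> Om' -> R).
Hypotheses (cF' : complete_filtration P' F') (BM' : brownian_family P' F' Bs).
Hypothesis F0' : forall i, measurable_wrt (F' 0) (X0s i).
Hypothesis X0P : forall D : 'I_N -> set R, (forall i, measurable (D i)) ->
  P' [set w | forall i, D i (X0s i w)] = (\prod_(i < N) law P X0 (D i))%E.
Variables (b sg : R -> R) (L : R) (kappa : R -> R) (T : R).
Hypotheses (L1 : 1 <= L) (bL : lip L b).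
Hypotheses (sgL : lip L sg).
Hypotheses (T0 : 0 < T) (kappa0 : kappa 0 = 0).
Variables (X I : R -> Om -> R) (Ys Is : 'I_N -> R -> Om' -> R) (D2 S1 S2 : R).
Hypotheses (aX : adapted F X) (cX : continuous_paths X).
Hypothesis iX : ito_integral P F B (fun t w => sg (X t w)) I.
Hypothesis eqX : {ae P, forall w, forall t, 0 <= t -> X t w = X0 w + sde_noise b X I t w + kappa t}.
Hypotheses (aY : forall i, adapted F' (Ys i)) (cY : forall i, continuous_paths (Ys i)).
Hypothesis iY : forall i, ito_integral P' F' (Bs i) (fun t w => sg (Ys i t w)) (Is i).
Hypothesis eqY : forall i, {ae P', forall w, forall t, 0 <= t ->
  Ys i t w = X0s i w + sde_noise b (Ys i) (Is i) t w + kappa t}.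
Hypothesis D20 : 0 <= D2.
Hypothesis X_incr : forall s t, 0 <= s -> s <= t -> t <= T ->
  (\E[P]_w ((X t w - X s w) ^+ 2) <= (D2 * (t - s))%:E)%E.
Hypothesis Y_incr : forall i s t, 0 <= s -> s <= t -> t <= T ->
  (\E[P']_w ((Ys i t w - Ys i s w) ^+ 2) <= (D2 * (t - s))%:E)%E.
Hypothesis X_sg : (Ex P (tint (fun s w => sg (X s w) ^+ 2)%R 0 T) <= S2%:E)%E.
Hypothesis Y_sg : forall i, (Ex P' (tint (fun s w => sg (Ys i s w) ^+ 2)%R 0 T) <= S2%:E)%E.
Hypothesis X2 : forall t, 0 <= t <= T -> (\E[P]_w (X t w ^+ 2) <= S1%:E)%E.
Hypothesis Y2 : forall i t, 0 <= t <= T -> (\E[P']_w (Ys i t w ^+ 2) <= S1%:E)%E.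
Variables (h : R -> R) (M : R).
Hypotheses (M0 : 0 <= M) (hM : lip M h).

Let T0' : 0 <= T := ltW T0.

Let mX t : 0 <= t -> meas (X t).
Proof. by move=> t0; exact: (filtration_measurable cF t0 (aX t0)). Qed.

Let mY i t : 0 <= t -> meas (Ys i t).
Proof. by move=> t0; exact: (filtration_measurable cF' t0 (aY i t0)). Qed.

Lemma law_initial i (D : set R) : measurable D -> P' (X0s i @^-1` D) = P (X0 @^-1` D).
Proof.
move=> mD; pose D' j := if j == i then D else setT.
have mD' j : measurable (D' j) by rewrite /D'; case: ifP.
have := X0P mD'.
rewrite (_ : [set w | _] = X0s i @^-1` D); last first.
  apply/seteqP; split => w /=; first by move/(_ i); rewrite /D' eqxx.
  by move=> Dw j; rewrite /D'; case: eqP => // ->.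
move=> ->; rewrite (bigD1 i)//= {1}/D' eqxx big1 ?mule1// => j /negbTE ji.
by rewrite /D' ji /law /pushforward preimage_setT probability_setT.
Qed.

(** One grid level, finer than [l], is chosen to serve on both spaces, so that the two schemes share
    their law. *)
Lemma common_euler i l k (e : R) : (k <= 2 ^ l)%N -> 0 < e ->
  exists Z : Om -> R, exists2 Z' : Om' -> R,
    [/\ meas Z, (\E[P]_w (Z w ^+ 2) < +oo)%E
      & (\E[P]_w ((X (grid 0 T l k) w - Z w) ^+ 2) <= (e ^+ 2)%:E)%E] &
    [/\ meas Z', (\E[P']_w (Z' w ^+ 2) < +oo)%E,
       (\E[P']_w ((Ys i (grid 0 T l k) w - Z' w) ^+ 2) <= (e ^+ 2)%:E)%E &
       forall f : R -> \bar R, (forall x, (0 <= f x)%E) -> meas f ->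
         (\int[P']_w f (Z' w) = \int[P]_w f (Z w))%E].
Proof.
move=> kl e0; have e2 : 0 < e ^+ 2 by rewrite exprn_gt0.
have BMi := brownian_family_motion i BM'.
have H1 := euler_cvg cF BM L1 bL sgL aX cX iX F0 eqX kappa0 T0' D20 X_incr X_sg e2.
have H2 := euler_cvg cF' BMi L1 bL sgL (aY i) (@cY i) (iY i) (F0' i) (eqY i) kappa0 T0' D20 (@Y_incr i) (@Y_sg i) e2.
have [n [[h1 h2] ln]] := filter_ex (filterI (filterI H1 H2) (nbhs_infty_ge l)).
have kn : (k * 2 ^ (n - l) <= 2 ^ n)%N.
  by rewrite -[leqRHS](_ : (2 ^ l * 2 ^ (n - l) = 2 ^ n)%N) ?leq_mul2r ?kl ?orbT// -expnD subnKC.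
have gT : 0 <= grid 0 T l k <= T.
  by rewrite grid_ge0//= -[leRHS](grid_end 0 T l) grid_le.
exists (euler b sg kappa T n B X0 (k * 2 ^ (n - l))), (euler b sg kappa T n (Bs i) (X0s i) (k * 2 ^ (n - l))).
- have mE := measurable_euler cF BM L1 bL sgL kappa F0 T0' n (k * 2 ^ (n - l)).
  have hE : (\E[P]_w ((X (grid 0 T l k) w - euler b sg kappa T n B X0 (k * 2 ^ (n - l)) w) ^+ 2) <= (e ^+ 2)%:E)%E.
    by rewrite (grid_refine _ _ ln); exact: h1.
  split => //.
  have mx : meas (X (grid 0 T l k)) by apply: mX; case/andP: gT.
  exact: (Ex_sqr_dist_lty mx mE (X2 gT) hE).
- have mE := measurable_euler cF' BMi L1 bL sgL kappa (F0' i) T0' n (k * 2 ^ (n - l)).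
  have hE : (\E[P']_w ((Ys i (grid 0 T l k) w - euler b sg kappa T n (Bs i) (X0s i) (k * 2 ^ (n - l)) w) ^+ 2) <= (e ^+ 2)%:E)%E.
    by rewrite (grid_refine _ _ ln); exact: h2.
  split => //; last first.
    move=> f f0 mf; apply: (euler_law cF BM F0 cF' BMi (F0' i) (law_initial i) kappa _ L1 bL sgL T0) => //.
  have mx : meas (Ys i (grid 0 T l k)) by apply: mY; case/andP: gT.
  exact: (Ex_sqr_dist_lty mx mE (Y2 i gT) hE).
Qed.

Let sqr_subC {d0} {T1 : measurableType d0} (Q : probability T1 R) (f g : T1 -> R) :
  \E[Q]_w ((f w - g w) ^+ 2) = \E[Q]_w ((g w - f w) ^+ 2).
Proof. by apply: eq_integral => w _; rewrite -sqrrN opprB. Qed.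

(** Grid nodes are all that the chaining looks at; equality of the means at other times follows
    nowhere and is not asked for. *)
Lemma copies_mean i l k : (k <= 2 ^ l)%N ->
  (\int[P']_w (h (Ys i (grid 0 T l k) w))%:E = \int[P]_w (h (X (grid 0 T l k) w))%:E)%E.
Proof.
move=> kl.
have gT : 0 <= grid 0 T l k <= T.
  by rewrite grid_ge0//= -[leRHS](grid_end 0 T l) grid_le.
have g0 : 0 <= grid 0 T l k by case/andP: gT.
have fX : (\E[P]_w (X (grid 0 T l k) w ^+ 2) < +oo)%E.
  by apply: (le_lt_trans (X2 gT)); rewrite ltry.
have fY : (\E[P']_w (Ys i (grid 0 T l k) w ^+ 2) < +oo)%E.
  by apply: (le_lt_trans (Y2 i gT)); rewrite ltry.
apply/eqP; rewrite eq_le; apply/andP; split.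
- apply: (mean_le_of_common_law M0 hM (mX g0) (mY i g0) fX fY) => e e0.
  have [Z [Z' [mZ Z2 hZ] [mZ' Z2' hZ' law]]] := common_euler i kl e0.
  by exists Z, Z'; split => //; rewrite sqr_subC.
- apply: (mean_le_of_common_law M0 hM (mY i g0) (mX g0) fY fX) => e e0.
  have [Z [Z' [mZ Z2 hZ] [mZ' Z2' hZ' law]]] := common_euler i kl e0.
  exists Z', Z; first by split => //; rewrite sqr_subC.
  by split => // f f0 mf; rewrite law.
Qed.

(** Clamping the time extends the mean as a constant beyond [[0, T]], which makes it Holder
    continuous on the whole line and hence a process. *)
Definition mean_path (s : R) : R := fine (\int[P]_w (h (X (clamp T s) w))%:E).

Lemma mean_path_holder s t : (mean_path s - mean_path t) ^+ 2 <= M ^+ 2 * D2 * `|s - t|.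
Proof.
have H u v : 0 <= u -> u <= v -> v <= T ->
  (fine (\int[P]_w (h (X v w))%:E) - fine (\int[P]_w (h (X u w))%:E)) ^+ 2 <= M ^+ 2 * D2 * (v - u).
  move=> u0 uv vT.
  have uT : 0 <= u <= T by rewrite u0 (le_trans uv).
  have vT' : 0 <= v <= T by rewrite vT (le_trans u0).
  have v0 : 0 <= v by rewrite (le_trans u0).
  have iu : P.-integrable setT (EFin \o (h \o X u)).
    by apply: (lip_integrable M0 hM (mX u0)); apply: (le_lt_trans (X2 uT)); rewrite ltry.
  have iv : P.-integrable setT (EFin \o (h \o X v)).
    by apply: (lip_integrable M0 hM (mX v0)); apply: (le_lt_trans (X2 vT')); rewrite ltry.
  have -> : fine (\int[P]_w (h (X v w))%:E) - fine (\int[P]_w (h (X u w))%:E) =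
      fine (\int[P]_w (h (X v w) - h (X u w))%:E).
    rewrite -fineB ?integrable_fin_num//; congr fine.
    by rewrite -integralB.
  have mhv := lip_measurable M0 hM; have mv := mX v0; have mu := mX u0.
  apply: sqr_mean_le; first by mea.
  rewrite -mulrA; apply: (Ex_leZ (g := fun w => (X v w - X u w) ^+ 2)); rewrite ?sqr_ge0//.
  - by nneg.
  - by nneg.
  - by mea.
  - by mea.
  - move=> w; rewrite -[leLHS]normr_sqr// -[X in _ <= _ * X]normr_sqr// -exprMn.
    by apply: lerXn2r; rewrite ?nnegrE ?mulr_ge0.
  - exact: X_incr.
have [sa sb] := andP (clamp_itv s T0'); have [ta tb] := andP (clamp_itv t T0').
apply: (@le_trans _ _ (M ^+ 2 * D2 * `|clamp T s - clamp T t|)); last first.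
  by rewrite ler_wpM2l ?mulr_ge0 ?sqr_ge0// clamp_lip.
rewrite /mean_path; case: (leP (clamp T s) (clamp T t)) => st.
  by rewrite -sqrrN opprB distrC ger0_norm ?subr_ge0//; exact: H.
by rewrite ger0_norm ?subr_ge0 ?(ltW st)//; apply: H => //; exact: ltW.
Qed.

Definition mean_error (s : R) (w : Om') : R := N%:R^-1 * \sum_(i < N) (h (Ys i s w) - mean_path s).

Lemma proc_mean_error : proc mean_error.
Proof.
have D' : 0 <= M ^+ 2 * D2 by rewrite mulr_ge0 ?sqr_ge0.
apply: procM; first exact: proc_const.
(* The family over ['I_N] is extended by 0 to all integers, the index set of [proc_sum]. *)
rewrite (_ : (fun s w => _) = fun s w => \sum_(i < N) (fun k s w => if insub k is Some i then h (Ys i s w) - mean_path s else 0) i s w); last first.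
  by apply/funext => s; apply/funext => w; apply: eq_bigr => i _; rewrite valK.
apply: (@proc_sum R d' Om' N (fun k s w => if insub k is Some i then h (Ys i s w) - mean_path s else 0)) => k.
case: insub => [i|]; last by apply: proc_const; exact: measurable_cst.
apply: procB; first by apply: (proc_lip M0 hM); exact: (proc_adapted cF' (aY i) (@cY i)).
apply: proc_time; first exact: (holder_continuous D' mean_path_holder).
by move=> t; exact: (holder_bounded t D' mean_path_holder).
Qed.

Hypothesis N0 : (0 < N)%N.

(** Truncated at [2 ^ l], since the inequality for observables asks for grid nodes at every integer
    [k]. *)
Let next_node l k := minn k.+1 (2 ^ l).
Let this_node l k := minn k (2 ^ l).
Let centered_incr l i := centered_observable P' h (next_node l) (this_node l) 1 (fun j => Ys i (grid 0 T l j)) 1.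

Let integrable_h i t : 0 <= t <= T -> P'.-integrable setT (EFin \o (fun w => h (Ys i t w))).
Proof.
move=> tT; apply: (lip_integrable M0 hM (mY i _)); first by case/andP: tT.
by apply: (le_lt_trans (Y2 i tT)); rewrite ltry.
Qed.

Let grid_itv l k : (k <= 2 ^ l)%N -> 0 <= grid 0 T l k <= T.
Proof. by move=> kl; rewrite grid_ge0//= -[leRHS](grid_end 0 T l) grid_le. Qed.

Let mean_path_grid i l k : (k <= 2 ^ l)%N ->
  mean_path (grid 0 T l k) = fine (\int[P']_w (h (Ys i (grid 0 T l k) w))%:E).
Proof. by move=> kl; rewrite (copies_mean _ kl) /mean_path clamp_id ?grid_itv. Qed.

Lemma level_incr_mean_error l k w : (k < 2 ^ l)%N ->
  level_incr T (mean_error^~ w) l k = N%:R^-1 * \sum_(i < N) centered_incr l i k w.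
Proof.
move=> kl; rewrite /level_incr /mean_error -mulrBr -sumrB; congr (_ * _); apply: eq_bigr => i _.
have kl' := ltnW kl.
rewrite /centered_incr /centered_observable /observable /next_node /this_node !muln1 (minn_idPl kl) (minn_idPl kl').
rewrite (_ : (fun w' => _) = fun w' => ((h (Ys i (grid 0 T l k.+1) w'))%:E - (h (Ys i (grid 0 T l k) w'))%:E)%E); last first.
  by apply/funext => w'; rewrite mul1r.
rewrite integralB_EFin//; [|by apply: integrable_h; exact: grid_itv|by apply: integrable_h; exact: grid_itv].
rewrite fineB ?integrable_fin_num//; [|by apply: integrable_h; exact: grid_itv|by apply: integrable_h; exact: grid_itv].
by rewrite -!mean_path_grid// mul1r; ring.
Qed.

Variables (Q D4 : R).
Hypotheses (Q1 : 1 <= Q) (D40 : 0 <= D4).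
Hypothesis X0Q : forall i, (\E[P']_w (X0s i w ^+ 2) <= Q%:E)%E.
Hypothesis Y_incr4 : forall i s t, 0 <= s -> s <= t -> t <= T ->
  (\E[P']_w ((Q + X0s i w ^+ 2)^-1 * (Ys i t w - Ys i s w) ^+ 4) <= (D4 * (t - s) ^+ 2)%:E)%E.

Lemma measurable_centered_incr l i k : meas (centered_incr l i k).
Proof.
have mh := lip_measurable M0 hM.
have m1 k' : meas (Ys i (grid 0 T l k')) by apply: mY; exact: grid_ge0.
by rewrite /centered_incr /centered_observable /observable; apply: measurable_funB; mea.
Qed.

Definition level_cst := 3 * (M ^+ 2 * (Q + T ^+ 2 * D4 / 2)) + 3 * (M ^+ 2 * (D2 * T)).

(** [Psi_weighted] with [lam = (5/7)^l]. The [2^l] fourth moments, each of order [(T / 2^l)^2], add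
    up to [T^2 2^-l], and dividing by [lam] leaves at most [lam T^2] because [1/2 <= (5/7)^2]. *)
Lemma Ex_Psi_increments l i :
  (\E[P']_w (Psi (2 ^ l) (fun k => Ys i (grid 0 T l (next_node l k)) w - Ys i (grid 0 T l (this_node l k)) w)) <=
   ((5 / 7) ^+ l * (Q + T ^+ 2 * D4 / 2))%:E)%E.
Proof.
have m1 k' : meas (Ys i (grid 0 T l k')) by apply: mY; exact: grid_ge0.
have mX0 : meas (X0s i) by apply: (filtration_measurable cF' (lexx 0)); exact: F0'.
have p0 w : 0 < Q + X0s i w ^+ 2 by rewrite ltr_pwDl ?sqr_ge0// (lt_le_trans _ Q1).
have mp : meas (fun w => (Q + X0s i w ^+ 2)^-1).
  exact: (measurableT_comp (inv_shift_sqr_measurable Q1) mX0).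
pose lam : R := (5 / 7) ^+ l.
have l0 : 0 < lam by rewrite exprn_gt0//; lra.
pose x k w := Ys i (grid 0 T l (next_node l k)) w - Ys i (grid 0 T l (this_node l k)) w.
have mx k : meas (x k) by rewrite /x; mea.
have il0 : 0 <= lam^-1 by rewrite invr_ge0 ltW.
have ip0 w : 0 <= (Q + X0s i w ^+ 2)^-1 by rewrite invr_ge0 ltW.
have n4 k w : 0 <= (Q + X0s i w ^+ 2)^-1 * x k w ^+ 4 by rewrite mulr_ge0// exprn_even_ge0.
have Q0 : 0 <= Q by exact: le_trans Q1.
apply: (@le_trans _ _ (\E[P']_w (2^-1 * (lam * (Q + X0s i w ^+ 2) +
    lam^-1 * \sum_(k < 2 ^ l) (Q + X0s i w ^+ 2)^-1 * x k w ^+ 4)))).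
  apply: Ex_le.
  - by move=> w; exact: Psi_ge0.
  - exact: measurable_Psi.
  - have mn k : meas (fun w => (Q + X0s i w ^+ 2)^-1 * x k w ^+ 4) by mea.
    by mea.
  - by move=> w; exact: Psi_weighted.
have mn k : meas (fun w => (Q + X0s i w ^+ 2)^-1 * x k w ^+ 4) by mea.
have s0 w : 0 <= \sum_(k < 2 ^ l) (Q + X0s i w ^+ 2)^-1 * x k w ^+ 4 by apply: sumr_ge0.
have l0' := ltW l0.
rewrite ExZ//; try side.
rewrite ExD//; try side.
rewrite ExZ//; try side.
rewrite ExD//; try side.
rewrite ExZ//; last by mea.
rewrite Ex_cst (@Ex_sum _ _ _ P' (2 ^ l) (fun k w => (Q + X0s i w ^+ 2)^-1 * x k w ^+ 4))//.
have hs : (\sum_(k < 2 ^ l) \E[P']_w ((Q + X0s i w ^+ 2)^-1 * x k w ^+ 4) <=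
    (2 ^+ l * (D4 * (T / 2 ^+ l) ^+ 2))%:E)%E.
  apply: (@le_trans _ _ (\sum_(k < 2 ^ l) (D4 * (T / 2 ^+ l) ^+ 2)%:E)%E); last first.
    by rewrite sumEFin sumr_const card_ord -[X in (X%:E <= _)%E]mulr_natl natrX.
  apply: lee_sum => k _; rewrite /x /next_node /this_node (minn_idPl (ltn_ord k)) (minn_idPl (ltnW (ltn_ord k))).
  have := gridS 0 T l k; rewrite subr0 => <-; apply: Y_incr4.
  - exact: grid_ge0.
  - exact: grid_le.
  - by have /andP[] := grid_itv (ltn_ord k).
apply: (le_trans (lee_finZ _ (lee_finD (lee_finZ l0' (lee_finD (lexx _) (X0Q i))) (lee_finZ il0 hs)))) => //.
rewrite lee_fin -/lam.
suff hl : lam^-1 * (2 ^+ l * (D4 * (T / 2 ^+ l) ^+ 2)) <= lam * (T ^+ 2 * D4).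
  by apply: (@le_trans _ _ (2^-1 * (lam * (Q + Q) + lam * (T ^+ 2 * D4)))); [rewrite ler_pM2l// lerD2l|apply: eq_leW; field].
rewrite mulrC ler_pdivrMr// (_ : 2 ^+ l * _ = (1 / 2) ^+ l * (T ^+ 2 * D4)); last first.
  by rewrite mul1r exprVn; field; rewrite expf_neq0.
rewrite [leRHS]mulrAC; apply: ler_wpM2r; first by rewrite mulr_ge0 ?sqr_ge0.
rewrite -expr2 /lam -exprM mulnC exprM; apply: lerXn2r; rewrite ?nnegrE; lra.
Qed.

(** The increment of [h] is at most [M] times that of the copy. The subtracted means have squares of
    order [T / 2^l], and [Psi_cst_le] multiplies this by [(10/7)^l], giving again [(5/7)^l]. *)
Lemma centered_incr_bound l i :
  (\E[P']_w (Psi (2 ^ l) (fun k => centered_incr l i k w)) <= ((5 / 7) ^+ l * level_cst)%:E)%E.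
Proof.
have m1 k' : meas (Ys i (grid 0 T l k')) by apply: mY; exact: grid_ge0.
have mh := lip_measurable M0 hM.
pose o k w := observable h (next_node l) (this_node l) 1 (fun j => Ys i (grid 0 T l j)) 1 k w.
pose x k w := Ys i (grid 0 T l (next_node l k)) w - Ys i (grid 0 T l (this_node l k)) w.
have mo k : meas (o k) by rewrite /o /observable; mea.
have mx k : meas (x k) by rewrite /x; mea.
have ox k w : `|o k w| <= `|M * x k w|.
  by rewrite /o /observable /x !muln1 mul1r normrM (ger0_norm M0).
have M2 : 0 <= M ^+ 2 by exact: sqr_ge0.
have dl0 : 0 <= D2 * (T / 2 ^+ l) by rewrite mulr_ge0// divr_ge0// exprn_ge0.
pose mu k := fine (\int[P']_w (o k w)%:E).
have mu2 k : (k < 2 ^ l)%N -> (- mu k) ^+ 2 <= M ^+ 2 * (D2 * (T / 2 ^+ l)).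
  move=> kl; rewrite sqrrN; apply: sqr_mean_le => //.
  apply: (Ex_leZ (g := fun w => x k w ^+ 2)) => //.
  - by nneg.
  - by nneg.
  - by mea.
  - by mea.
  - move=> w; rewrite -exprMn -[leLHS]normr_sqr// -[leRHS]normr_sqr//.
    by apply: lerXn2r; rewrite ?nnegrE.
  rewrite /x /next_node /this_node (minn_idPl kl) (minn_idPl (ltnW kl)).
  have := gridS 0 T l k; rewrite subr0 => <-; apply: Y_incr.
  - exact: grid_ge0.
  - exact: grid_le.
  - by have /andP[] := grid_itv kl.
have Pmu : Psi (2 ^ l) (fun k => - mu k) <= (5 / 7) ^+ l * (M ^+ 2 * (D2 * T)).
  apply: (le_trans (Psi_cst_le _ mu2)); first by rewrite mulr_ge0.
  rewrite (_ : (10 / 7) ^+ l = 2 ^+ l * (5 / 7) ^+ l); last by rewrite -exprMn; congr (_ ^+ l); field.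
  apply: eq_leW; field; rewrite expf_neq0//.
apply: (@le_trans _ _ (\E[P']_w (3 * (M ^+ 2 * Psi (2 ^ l) (fun k => x k w)) + 3 * ((5 / 7) ^+ l * (M ^+ 2 * (D2 * T)))))).
  apply: Ex_le.
  - by move=> w; exact: Psi_ge0.
  - by apply: measurable_Psi => k; exact: measurable_centered_incr.
  - by have mP := measurable_Psi (2 ^ l) mx; mea.
  - move=> w; apply: (le_trans (PsiD_le (2 ^ l) (fun k => o k w) (fun k => - mu k))).
    rewrite mulrDr lerD ?ler_pM2l// -PsiZ; apply: Psi_mono => k _; exact: ox.
have Px0 w : 0 <= Psi (2 ^ l) (fun k => x k w) by exact: Psi_ge0.
have c0 : 0 <= (5 / 7) ^+ l * (M ^+ 2 * (D2 * T)) by nneg.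
have mPx := measurable_Psi (2 ^ l) mx.
rewrite ExD//; try side.
rewrite ExZ//; try side.
rewrite ExZ//.
rewrite Ex_cst.
apply: (le_trans (lee_finD (lee_finZ _ (lee_finZ M2 (Ex_Psi_increments l i))) (lexx _))) => //.
by rewrite lee_fin /level_cst; apply: eq_leW; ring.
Qed.

Let iN0 : 0 <= N%:R^-1 :> R. Proof. by rewrite invr_ge0. Qed.
Let sqrN (c : R) (x : \bar R) : (x <= (N%:R * c)%:E)%E -> ((N%:R^-1 ^+ 2)%:E * (72%:E * x) <= (72 * c / N%:R)%:E)%E.
Proof.
move=> xc; apply: (le_trans (lee_finZ (sqr_ge0 _) (lee_finZ _ xc))); first by [].
by rewrite lee_fin; apply: eq_leW; field; rewrite gt_eqF// ltr0n.
Qed.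

Lemma Ex_Psi_level l :
  (\E[P']_w (Psi (2 ^ l) (level_incr T (mean_error^~ w) l)) <= (72 * ((5 / 7) ^+ l * level_cst) / N%:R)%:E)%E.
Proof.
pose S k w := \sum_(i < N) centered_incr l i k w.
have mS k : meas (S k) by apply: measurable_sum => i; exact: measurable_centered_incr.
have -> : \E[P']_w (Psi (2 ^ l) (level_incr T (mean_error^~ w) l)) =
    \E[P']_w (N%:R^-1 ^+ 2 * Psi (2 ^ l) (fun k => S k w)).
  apply: eq_integral => w _; rewrite -PsiZ; congr (_%:E); apply: Psi_ext => k kl.
  exact: level_incr_mean_error.
rewrite ExZ ?sqr_ge0//; last by exact: measurable_Psi.
  2: by move=> w; exact: Psi_ge0.
apply: (@le_trans _ _ ((N%:R^-1 ^+ 2)%:E * (72%:E * \sum_(i < N) \E[P']_w (Psi (2 ^ l) (fun k => centered_incr l i k w))))%E).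
  apply: lee_wpmul2l; first by rewrite lee_fin sqr_ge0.
  have al k : (next_node l k <= 2 ^ l)%N by rewrite geq_minr.
  have al' k : (this_node l k <= 2 ^ l)%N by rewrite geq_minr.
  have Y2' i t : 0 <= t <= T -> (\E[P']_w (Ys i t w ^+ 2) < +oo)%E.
    by move=> tT; apply: (le_lt_trans (Y2 i tT)); rewrite ltry.
  have mu0T : law P X0 setT = 1%E by rewrite /law /pushforward preimage_setT probability_setT.
  have := (type_two_copies cF' BM' mu0T F0' X0P L1 bL sgL T0 kappa0 aY cY iY eqY D20 Y_incr Y_sg Y2' M0 hM (2 ^ l) 1 al al').
  exact.
apply: sqrN; apply: (@le_trans _ _ (\sum_(i < N) ((5 / 7) ^+ l * level_cst)%:E)%E).
  by apply: lee_sum => i _; exact: centered_incr_bound.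
by rewrite sumEFin sumr_const card_ord -[X in (X%:E <= _)%E]mulr_natl.
Qed.

(** The case of one node and [theta = 0]. Centring removes [h 0], so the variance is bounded through
    the Lipschitz constant alone. *)
Lemma Ex_sqr_initial_error : (\E[P']_w (mean_error 0 w ^+ 2) <= (72 * (4 * (M ^+ 2 * S1)) / N%:R)%:E)%E.
Proof.
have mh := lip_measurable M0 hM.
pose nl (k : nat) := 0%N.
pose c i := centered_observable P' h nl nl 0 (fun j => Ys i (grid 0 T 0 j)) 1.
have m0 i : meas (Ys i 0) by apply: mY.
have T00 : 0 <= (0 : R) <= T by rewrite lexx.
have cE i w : c i 0%N w = h (Ys i 0 w) - fine (\int[P']_w (h (Ys i 0 w))%:E).
  rewrite /c /centered_observable /observable /nl mul0n grid0 mul0r subr0; congr (_ - fine _).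
  by apply: eq_integral => w' _; rewrite mul0r subr0.
have fE i : fine (\int[P']_w (h (Ys i 0 w))%:E) = h 0 + fine (\int[P']_w (h (Ys i 0 w) - h 0)%:E).
  have i1 := integrable_h i T00; have i2 := finite_measure_integrable_cst P' (h 0) measurableT.
  rewrite (integralB_EFin measurableT i1 i2) (fineB (integrable_fin_num measurableT i1) (integrable_fin_num measurableT i2)).
  have -> : (\int[P']_x (EFin \o cst (h 0)) x)%E = (h 0)%:E by exact: Ex_cst.
  by rewrite -[fine (h 0)%:E]/(h 0) addrC subrK.
have c2 i : (\E[P']_w (c i 0%N w ^+ 2) <= (4 * (M ^+ 2 * S1))%:E)%E.
  have -> : \E[P']_w (c i 0%N w ^+ 2) = \E[P']_w (((h (Ys i 0 w) - h 0) - fine (\int[P']_w (h (Ys i 0 w) - h 0)%:E)) ^+ 2).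
    by apply: eq_integral => w _; rewrite cE fE; congr ((_ ^+ 2)%:E); ring.
  apply: Ex_sqr_centered; first by mea.
  apply: (Ex_leZ (g := fun w => Ys i 0 w ^+ 2)) (Y2 i T00); rewrite ?sqr_ge0//.
  - by nneg.
  - by nneg.
  - by mea.
  - by mea.
  - move=> w; rewrite -[leLHS]normr_sqr// -[X in _ <= _ * X]normr_sqr// -exprMn.
    apply: lerXn2r; rewrite ?nnegrE ?mulr_ge0//.
    by have := hM (Ys i 0 w) 0; rewrite subr0.
have mc i : meas (c i 0%N).
  by rewrite (_ : c i 0%N = fun w => h (Ys i 0 w) - fine (\int[P']_w (h (Ys i 0 w))%:E)); [mea|apply/funext => w; rewrite cE].
pose S w := \sum_(i < N) c i 0%N w.
have mS : meas S by apply: measurable_sum => i; exact: mc.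
have -> : \E[P']_w (mean_error 0 w ^+ 2) = \E[P']_w (N%:R^-1 ^+ 2 * Psi 1 (fun k => \sum_(i < N) c i k w)).
  apply: eq_integral => w _; rewrite Psi1 -exprMn /mean_error; congr (((_ * _) ^+ 2)%:E).
  apply: eq_bigr => i _; rewrite cE /mean_path clamp_id//.
  by have := @copies_mean i 0 0 isT; rewrite grid0 => ->.
rewrite ExZ ?sqr_ge0//; last first.
- rewrite (_ : (fun w => _) = fun w => S w ^+ 2); [by mea|by apply/funext => w; rewrite Psi1].
- by move=> w; exact: Psi_ge0.
apply: (@le_trans _ _ ((N%:R^-1 ^+ 2)%:E * (72%:E * \sum_(i < N) \E[P']_w (Psi 1 (fun k => c i k w))))%E).
  apply: lee_wpmul2l; first by rewrite lee_fin sqr_ge0.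
  have al k : (nl k <= 2 ^ 0)%N by [].
  have Y2' i t : 0 <= t <= T -> (\E[P']_w (Ys i t w ^+ 2) < +oo)%E.
    by move=> tT; apply: (le_lt_trans (Y2 i tT)); rewrite ltry.
  have mu0T : law P X0 setT = 1%E by rewrite /law /pushforward preimage_setT probability_setT.
  have := (type_two_copies cF' BM' mu0T F0' X0P L1 bL sgL T0 kappa0 aY cY iY eqY D20 Y_incr Y_sg Y2' M0 hM 1%N 0 al al).
  exact.
apply: sqrN; apply: (@le_trans _ _ (\sum_(i < N) (4 * (M ^+ 2 * S1))%:E)%E).
  apply: lee_sum => i _; apply: le_trans (c2 i).
  by apply: eq_leW; apply: eq_integral => w _; rewrite Psi1.
by rewrite sumEFin sumr_const card_ord -[X in (X%:E <= _)%E]mulr_natl.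
Qed.

Lemma maximal_mean_error :
  (\int[P']_w esup (fun s w => mean_error s w ^+ 2)%R 0 T w <=
   ((2 * (72 * (4 * (M ^+ 2 * S1))) + 10 * (15 * (72 * level_cst))) / N%:R)%:E)%E.
Proof.
have pA := proc_mean_error; have [mA lA bA] := pA.
have pA2 := procX 2 pA; have [mA2 lA2 _] := pA2.
have N0' : 0 < N%:R :> R by rewrite ltr0n.
have lc0 : 0 <= level_cst.
  have Q0 : 0 <= Q by exact: le_trans Q1.
  by rewrite /level_cst; nneg.
pose Phi l w := Psi (2 ^ l) (level_incr T (mean_error^~ w) l).
have Phi0 l w : 0 <= Phi l w by exact: Psi_ge0.
have mPhi l : meas (Phi l).
  apply: measurable_Psi => k; rewrite /level_incr; apply: measurable_funB; apply: mA; exact: grid_ge0.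
pose W n w := 2 * mean_error 0 w ^+ 2 + 2 * 5 * \sum_(l < n.+1) (64 / 49) ^+ l * Phi l w.
have m0 : meas (mean_error 0) by exact: mA.
have t0 l w : 0 <= (64 / 49) ^+ l * Phi l w by nneg.
have W0 n w : 0 <= W n w by rewrite /W; nneg.
have mW n : meas (W n) by rewrite /W; mea.
pose c := (2 * (72 * (4 * (M ^+ 2 * S1))) + 10 * (15 * (72 * level_cst))) / N%:R.
apply: (@int_fatou _ _ _ P' _ (fun n w => (W n w)%:E) (fun=> c%:E)).
- exact: measurable_esup.
- by move=> w; apply: esup_ge0 => // s; rewrite sqr_ge0.
- by move=> n; apply/measurable_EFinP.
- by move=> n w; rewrite lee_fin.
- apply: aeW => w; apply: le_limn_einf => y; rewrite esup_dyadic// => /ereal_sup_gt[_ [n _ <-] yn].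
  have [m [mk mE]] := dyadic_grid 0 T n.
  apply: filterS mE => k kE; apply: (le_trans (ltW yn)); rewrite -kE lee_fin.
  exact: (@chain_bound_sqr _ T (mean_error^~ w) k (m k) (mk k)).
- move=> n; have -> : (\int[P']_w (W n w)%:E)%E = (2%:E * \E[P']_w (mean_error 0 w ^+ 2) +
      (2 * 5)%:E * \sum_(l < n.+1) \E[P']_w (((64 / 49) ^+ l * Phi l w)%R))%E.
    rewrite -(@Ex_sum _ _ _ P' n.+1 (fun l w => (64 / 49) ^+ l * Phi l w))//; last by move=> l; mea.
    rewrite -[LHS]/(Ex P' (W n)) /W ExD//; try side.
    by rewrite !ExZ//; [nneg|mea|nneg|mea].
  have hs : (\sum_(l < n.+1) \E[P']_w (((64 / 49) ^+ l * Phi l w)%R) <= (15 * (72 * level_cst / N%:R))%:E)%E.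
    (* The weight [64/49] of the chaining times the decay [5/7] is [320/343], just below [14/15],
       whose geometric series sums to 15. *)
    apply: (@le_trans _ _ (\sum_(l < n.+1) ((14 / 15) ^+ l * (72 * level_cst / N%:R))%:E)%E).
      apply: lee_sum => l _; have c0 : 0 <= (64 / 49) ^+ l :> R by nneg.
      rewrite (@ExZ _ _ _ P' _ _ c0 (Phi0 l) (mPhi l)).
      apply: (le_trans (lee_finZ c0 (Ex_Psi_level l))).
      rewrite lee_fin [leLHS](_ : _ = ((64 / 49) ^+ l * (5 / 7) ^+ l) * (72 * level_cst / N%:R)).
        2: by move: ((64 / 49) ^+ l) ((5 / 7) ^+ l) => u v; ring.
      apply: ler_wpM2r; first by nneg.
      by rewrite -exprMn; apply: lerXn2r; rewrite ?nnegrE; lra.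
    rewrite sumEFin lee_fin -mulr_suml; apply: ler_wpM2r; first by nneg.
    apply: (le_trans (geometric_le _ _ _)); [by lra|by lra|].
    by rewrite (_ : (1 - 14 / 15)^-1 = 15 :> R)//; field.
  apply: (le_trans (lee_finD (lee_finZ _ Ex_sqr_initial_error) (lee_finZ _ hs))) => //.
  by rewrite lee_fin /c; apply: eq_leW; field; rewrite gt_eqF.
- exact: cvg_cst.
Qed.

End law_of_large_numbers.

(** * Bookkeeping of the constants *)

Section orders_of_magnitude.
Context {R : realType}.
Variables (Q z : R).
Hypotheses (Q1 : 1 <= Q) (z2 : 2 <= z).

Let z0 : 0 <= z. Proof. exact: le_trans z2. Qed.
Let z1 : 1 <= z. Proof. by apply: le_trans z2; rewrite ler1n. Qed.
Let Q0 : 0 <= Q. Proof. exact: le_trans Q1. Qed.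

Lemma magnitude0 : Q <= Q * z ^+ 0. Proof. by rewrite expr0 mulr1. Qed.

Lemma magnitude1 : 1 <= Q * z ^+ 0. Proof. by rewrite expr0 mulr1. Qed.

Lemma magnitudeM n c x : 0 <= c <= z -> x <= Q * z ^+ n -> c * x <= Q * z ^+ n.+1.
Proof.
move=> /andP[c0 cz] xn; apply: (@le_trans _ _ (c * (Q * z ^+ n))); first by rewrite ler_wpM2l.
by rewrite exprS [leRHS]mulrCA ler_wpM2r// mulr_ge0// exprn_ge0.
Qed.

Lemma magnitudeD n n' x y : x <= Q * z ^+ n -> y <= Q * z ^+ n' -> x + y <= Q * z ^+ (maxn n n').+1.
Proof.
move=> xn yn; have H k : (k <= maxn n n')%N -> Q * z ^+ k <= Q * z ^+ maxn n n'.
  by move=> kn; apply: ler_wpM2l => //; exact: ler_weXn2l.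
apply: (@le_trans _ _ (2 * (Q * z ^+ maxn n n'))).
  by have := H _ (leq_maxl n n'); have := H _ (leq_maxr n n'); lra.
by rewrite exprS [leRHS]mulrCA ler_wpM2r// mulr_ge0// exprn_ge0.
Qed.

(** The division by [Q], provided by the weight, brings a square back to first order in [Q]. *)
Lemma magnitude_sqr n x : 0 <= x -> x <= Q * z ^+ n -> x ^+ 2 / Q <= Q * z ^+ (n * 2).
Proof.
move=> x0 xn; have Qp : 0 < Q by exact: lt_le_trans Q1.
rewrite ler_pdivrMr// exprM; apply: (@le_trans _ _ ((Q * z ^+ n) ^+ 2)).
  by apply: lerXn2r; rewrite ?nnegrE// (le_trans x0).
by rewrite exprMn; apply: eq_leW; ring.
Qed.

End orders_of_magnitude.

Section rate_constants.
Context {R : realType}.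

Definition gap_cst (L : R) := 2 * (4 * L ^+ 2) + 2 * 64 * L ^+ 2.

(** Dominates the factors of the estimates: the numerical ones up to 128, the powers of [L], and
    [bdg4]. In the same way [rate_cst] dominates the rates of all exponentials. *)
Definition scale_cst (L : R) := 128 + L ^+ 2 + L ^+ 4 + bdg4.
Definition rate_cst (L : R) := 1 + 6 * noise2_cst L + 54 * noise4_cst L + 8 * gap_cst L.
End rate_constants.

Lemma unreflectedE {R : realType} {d} {Om : measurableType d} (b : R -> R) (X0 : Om -> R) (X I : R -> Om -> R) t w :
  unreflected b X0 X I t w = X0 w + sde_noise b X I t w.
Proof. by rewrite /unreflected -addrA. Qed.

(** * Integration against empirical measures *)

Section empirical_integral.
Context {R : realType}.

(** [empirical] is a bare set function; this presents it as a scaled finite sum of Dirac measures,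
    to which the theory of integration applies. *)
Lemma empiricalE (n : nat) (u : 'I_n -> R) :
  empirical u = mscale (n%:R^-1)%:nng (msum (fun k => if insub k is Some i then \d_(u i) else mzero) n).
Proof.
apply/funext => A; rewrite /empirical /mscale/= /msum; congr (_ * _)%E.
by apply: eq_bigr => i _; rewrite valK.
Qed.

Lemma ge0_integral_empirical (n : nat) (u : 'I_n -> R) (f : R -> \bar R) :
  (forall x, (0 <= f x)%E) -> meas f ->
  (\int[empirical u]_z f z = (n%:R^-1)%:E * \sum_(i < n) f (u i))%E.
Proof.
move=> f0 mf; rewrite empiricalE ge0_integral_mscale//= ge0_integral_measure_sum//.
congr (_ * _)%E; apply: eq_bigr => i _; rewrite valK.
by rewrite integral_dirac// diracT mul1e.
Qed.

Lemma integral_empirical (n : nat) (u : 'I_n -> R) (f : R -> R) : meas f ->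
  (\int[empirical u]_z (f z)%:E = (n%:R^-1 * \sum_(i < n) f (u i))%:E)%E.
Proof.
move=> mf; have mf' : meas (EFin \o f) by exact/measurable_EFinP.
have H (g : R -> \bar R) := @ge0_integral_empirical n u g.
move: H; rewrite empiricalE => H; rewrite integralE !H//; [|exact: measurable_funeneg|exact: measurable_funepos].
rewrite (_ : (\sum_(i < n) _)%E = (\sum_(i < n) Num.max (f (u i)) 0)%:E); last first.
  by rewrite -sumEFin; apply: eq_bigr => i _; rewrite funeposE/= EFin_max.
rewrite (_ : (\sum_(i < n) _)%E = (\sum_(i < n) Num.max (- f (u i)) 0)%:E); last first.
  by rewrite -sumEFin; apply: eq_bigr => i _; rewrite funenegE/= EFin_max.
rewrite -!EFinM -EFinB -mulrBr -sumrB; congr (_ * _)%:E; apply: eq_bigr => i _.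
by case: (leP (f (u i)) 0) => ?; case: (leP (- f (u i)) 0) => ?; lra.
Qed.

End empirical_integral.

Lemma esup_fin_num {R : realType} {d} {T : measurableType d} (f : R -> T -> R) (t : R) (w : T) (c : R) : 0 <= t ->
  (forall s, 0 <= s <= t -> `|f s w| <= c) -> esup f 0 t w \is a fin_num.
Proof.
move=> t0 fc; rewrite fin_real//; apply/andP; split.
  apply: (@lt_le_trans _ _ (f 0 w)%:E); first by rewrite ltNyr.
  by apply: esup_ubound; rewrite lexx.
apply: (@le_lt_trans _ _ c%:E); last by rewrite ltry.
by apply: esup_le => s st; rewrite lee_fin (le_trans (ler_norm _)) ?fc.
Qed.

(** * Mean reflection and coupling *)

Section flat.
Context {R : realType} {d} {Om : measurableType d} (P : probability Om R).
Variables (F : R -> set (set Om)) (B : R -> Om -> R) (X0 : Om -> R).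
Hypothesis data : driving_data P F B X0.
Variables (b sg h : R -> R) (L m M : R).
Hypotheses (L1 : 1 <= L) (b0 : `|b 0| <= L) (bL : lip L b).
Hypotheses (sg0 : `|sg 0| <= L) (sgL : lip L sg).
Hypothesis hmM : increasing_bilipschitz h m M.
Variables (X I : R -> Om -> R) (K : cumulative R R).
Hypothesis flat : flat_solution P F b sg h B X0 X I K.

Local Notation V := (sde_noise b X I).
Local Notation U := (unreflected b X0 X I).
Local Notation G s := (G0 h (law P (U s))).

Let cF : complete_filtration P F. Proof. by case: data. Qed.
Let BM : brownian_motion P F B. Proof. by case: data. Qed.
Let F0 : measurable_wrt (F 0) X0. Proof. by case: data. Qed.
Let aX : adapted F X. Proof. by case: flat => -[]. Qed.
Let cX : continuous_paths X. Proof. by case: flat => -[]. Qed.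
Let iI : ito_integral P F B (fun t w => sg (X t w)) I. Proof. by case: flat. Qed.
Let cK : continuous K. Proof. by case: flat => _ []. Qed.
Let K0 t : t <= 0 -> K t = 0. Proof. by case: flat => _ [_ + _ _ _]; apply. Qed.
Let m0 : 0 < m. Proof. by case: hmM. Qed.
Let mM : m <= M. Proof. by case: hmM. Qed.
Let M0 : 0 <= M. Proof. exact: le_trans (ltW m0) mM. Qed.
Let hM x y : `|h x - h y| <= M * `|x - y|.
Proof. by case: hmM => _ _ _ /(_ x y) /andP[]. Qed.
Let hm x y : x <= y -> m * (y - x) <= h y - h x.
Proof.
move=> xy; case: hmM => _ _ hh /(_ y x) /andP[+ _].
by rewrite ger0_norm ?subr_ge0// ger0_norm// subr_ge0 hh.
Qed.
Let mX0 : meas X0 := filtration_measurable cF (lexx 0) F0.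
Let pX : proc X := proc_adapted cF aX cX.
Let mX t : 0 <= t -> meas (X t). Proof. by have [+ _ _] := pX; apply. Qed.
Let mV t : 0 <= t -> meas (V t).
Proof. by have [+ _ _] := proc_sde_noise cF L1 bL aX cX iI; apply. Qed.

Lemma cumulative_le s t : s <= t -> K s <= K t.
Proof. exact: cumulative_is_nondecreasing. Qed.
Lemma flat_ge0 t : 0 <= K t.
Proof.
have [t0|t0] := leP t 0; first by rewrite K0.
by rewrite -(K0 (lexx 0)); apply: cumulative_le; exact: ltW.
Qed.

Lemma flat_sde : {ae P, forall w, forall t, 0 <= t -> X t w = X0 w + V t w + K t}.
Proof.
case: flat => _ _ _ e _; apply: filterS e => w e t t0.
by rewrite (e t t0) unreflectedE.
Qed.

Section initial_moment.
Let Q := 1 + fine (\E[P]_w (X0 w ^+ 2)).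
Lemma square_integrable_lty : (\E[P]_w (X0 w ^+ 2) < +oo)%E.
Proof. by case: data => _ _ _; rewrite /square_integrable unlock. Qed.
Let Q1 : 1 <= Q. Proof. by rewrite lerDl fine_ge0// Ex_ge0// => w; exact: sqr_ge0. Qed.
Let X0Q : (\E[P]_w (X0 w ^+ 2) <= Q%:E)%E.
Proof.
rewrite /Q EFinD fineK; first by rewrite leeDr.
by rewrite ge0_fin_numE ?square_integrable_lty// Ex_ge0// => w; exact: sqr_ge0.
Qed.

(** A crude bound that depends on [K T]; it provides the finite starting point of
    [sde_moment2_self]. *)
Lemma flat_moment2_fin T : 0 <= T -> exists2 B2 : R, 0 <= B2 &
  forall t, 0 <= t <= T -> (\E[P]_w (1 + X t w ^+ 2) <= B2%:E)%E.
Proof.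
move=> T0; have := sde_moment2 cF BM L1 b0 bL sg0 sgL aX cX iI F0 flat_sde Q1 X0Q.
move=> /(_ T (K T ^+ 2)) hm2.
have lam0 : 0 <= 1 + 6 * noise2_cst L by rewrite /noise2_cst; have := le_trans ler01 L1 => ?; nneg.
have q0 : 0 <= 2 * (1 + 3 * Q + 3 * K T ^+ 2) by have := le_trans ler01 Q1 => ?; nneg.
exists (2 * (1 + 3 * Q + 3 * K T ^+ 2) * expR ((1 + 6 * noise2_cst L) * T)); first by rewrite mulr_ge0 ?expR_ge0.
move=> t tT; apply: (le_trans (hm2 _ t tT)).
  move=> s /andP[s0 sT]; apply: lerXn2r; rewrite ?nnegrE ?flat_ge0//.
  exact: cumulative_le.
by rewrite lee_fin ler_wpM2l// ler_expR ler_wpM2l//; case/andP: tT.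
Qed.

End initial_moment.

Let X2 t : 0 <= t -> (\E[P]_w (X t w ^+ 2) < +oo)%E.
Proof.
move=> t0; have [B2 _ hB] := flat_moment2_fin t0.
apply: le_lt_trans (ltry B2); apply: le_trans (hB t _); last by rewrite t0 lexx.
have h1 := mX t0; apply: Ex_le; try side.
by move=> w; rewrite lerDr.
Qed.

Let mU t : 0 <= t -> meas (U t).
Proof.
move=> t0; rewrite (_ : U t = fun w => X0 w + V t w).
  by have h1 := mV t0; mea.
by apply/funext => w; rewrite unreflectedE.
Qed.

Let U2 t : 0 <= t -> (\E[P]_w (U t w ^+ 2) < +oo)%E.
Proof.
move=> t0; have h1 := mX t0; have h2 := mU t0.
apply: (@le_lt_trans _ _ (\E[P]_w (2 * X t w ^+ 2 + 2 * K t ^+ 2))).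
  apply: Ex_le_ae; try side.
  apply: filterS flat_sde => w /(_ t t0) e.
  rewrite unreflectedE (_ : X0 w + V t w = X t w + - K t); last by rewrite e addrK.
  by have := sqrD_le (X t w) (- K t); rewrite sqrrN mulrDr.
rewrite ExD; try side.
rewrite Ex_cst ExZ//; try side.
by rewrite addeC; apply: lte_add_pinfty; [exact: ltry|apply: lte_mul_pinfty => //; exact: X2].
Qed.

Let ihX t : 0 <= t -> P.-integrable setT (EFin \o (h \o X t)).
Proof. by move=> t0; apply: (lip_integrable M0 hM); [exact: mX|exact: X2]. Qed.

Let mh := lip_measurable M0 hM.
Let mhU x t : 0 <= t -> meas (fun w => h (x + U t w)).
Proof. by move=> t0; apply: (measurableT_comp mh); have := mU t0 => ?; mea. Qed.
Lemma flat_integrable x t : 0 <= t -> P.-integrable setT (EFin \o (fun w => h (x + U t w))).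
Proof.
move=> t0; have h2 := mU t0; apply: (lip_integrable M0 hM (Y := fun w => x + U t w)); first by mea.
apply: (@le_lt_trans _ _ (\E[P]_w (2 * x ^+ 2 + 2 * U t w ^+ 2))).
  apply: Ex_le; try side.
  by move=> w; have := sqrD_le x (U t w); lra.
rewrite ExD; try side.
rewrite Ex_cst ExZ//; try side.
by apply: lte_add_pinfty; [exact: ltry|apply: lte_mul_pinfty => //; exact: U2].
Qed.

Lemma flat_lawE x t : 0 <= t -> (\int[law P (U t)]_z (h (x + z)%R)%:E = \int[P]_w (h (x + U t w)%R)%:E)%E.
Proof. by move=> t0; apply: (integral_law M0 hM); [exact: mU|exact: U2]. Qed.

Lemma flat_meanE t : 0 <= t -> (\int[P]_w (h (X t w))%:E = \int[P]_w (h (K t + U t w)%R)%:E)%E.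
Proof.
move=> t0; apply: ae_eq_integral => //.
- by apply/measurable_EFinP; apply: (measurableT_comp mh); exact: mX.
- by apply/measurable_EFinP; exact: mhU.
- by apply: filterS flat_sde => w /(_ t t0) e _; rewrite unreflectedE e addrC.
Qed.

Lemma flat_mean_ge0 t : 0 <= t -> (0 <= \int[P]_w (h (K t + U t w)%R)%:E)%E.
Proof.
move=> t0; rewrite -flat_meanE//; case: flat => _ _ _ _ [/(_ t t0)].
by rewrite unlock.
Qed.

Lemma flat_G_le t : 0 <= t -> G t <= K t.
Proof. by move=> t0; apply: G0_le; rewrite ?flat_ge0// flat_lawE// flat_mean_ge0. Qed.

(** Reflection in excess of the minimal shift shows in the mean: some admissible shift [x < y] has
    nonnegative mean, and raising it to [K t] adds at least [m (K t - y)]. *)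
Lemma flat_mean_gap t y : 0 <= t -> G t < y -> y <= K t ->
  ((m * (K t - y))%:E <= \int[P]_w (h (K t + U t w)%R)%:E)%E.
Proof.
move=> t0 Gy yK.
have [|x xy [x0 +]] := G0_lt (flat_ge0 t) _ Gy; first by rewrite flat_lawE// flat_mean_ge0.
rewrite flat_lawE// => hx.
apply: (@le_trans _ _ (\int[P]_w (h (x + U t w)%R)%:E + (m * (K t - y))%:E)%E).
  by rewrite leeDr.
rewrite -(Ex_cst P (m * (K t - y))) /Ex -integralD//; [|exact: flat_integrable|]; last first.
  by apply/integrableP; split => //; rewrite integral_cst//= probability_setT mule1 ltry.
apply: le_integral => //; [|exact: flat_integrable|].
  apply: integrableD => //; first exact: flat_integrable.
  by apply/integrableP; split => //; rewrite integral_cst//= probability_setT mule1 ltry.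
move=> w _; rewrite -EFinD lee_fin.
have xK : x + U t w <= K t + U t w by rewrite lerD2r (le_trans (ltW xy)).
have := hm xK; rewrite (_ : K t + U t w - (x + U t w) = (K t - y) + (y - x)); last by ring.
rewrite mulrDr; have : 0 <= m * (y - x) by rewrite mulr_ge0 ?subr_ge0// ltW.
lra.
Qed.

Let ubG t : 0 <= t -> ubound [set G s | s in `[0, t]] (K t).
Proof.
move=> t0 _ [s /= + <-]; rewrite in_itv/= => /andP[s0 st].
exact: le_trans (flat_G_le s0) (cumulative_le st).
Qed.
Let supG t : 0 <= t -> has_sup [set G s | s in `[0, t]].
Proof.
move=> t0; split; last by exists (K t); exact: ubG.
by exists (G 0); exists 0 => //=; rewrite in_itv/= lexx.
Qed.

(** If the supremum [S] were below [K t], continuity would give [r] with [K r] strictly between. On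
    []r, t]] the reflection then exceeds [G] by a fixed amount, so the mean is at least some [e > 0]
    there while [K] still increases, against the flatness condition. *)
Lemma flatE t : 0 <= t -> K t = sup [set G s | s in `[0, t]].
Proof.
move=> t0; apply/eqP; rewrite eq_le; apply/andP; split; last first.
  by apply: ge_sup; [case: (supG t0)|exact: ubG].
set S := sup _; rewrite leNgt; apply/negP => SK.
have GS s : 0 <= s <= t -> G s <= S.
  by move=> st; apply: ub_le_sup; [case: (supG t0)|exists s].
have S0 : 0 <= S by apply: le_trans (GS 0 _); [exact: G0_ge0|rewrite lexx].
pose c := (S + K t) / 2.
have [Sc cKt] : S < c /\ c < K t by rewrite /c; split; lra.
have cK01 : Num.min (K 0) (K t) <= c <= Num.max (K 0) (K t).
  by rewrite ge_min le_max (K0 (lexx 0)) (ltW cKt) orbT andbT (le_trans S0 (ltW Sc)).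
have [r] := IVT t0 (continuous_subspaceT cK) cK01; rewrite in_itv/= => /andP[r0 rt] Kr.
pose e := m * ((c - S) / 2).
have e0 : 0 < e by rewrite mulr_gt0// divr_gt0// subr_gt0.
have hge s : r < s -> s <= t -> (e%:E <= \int[P]_w (h (X s w))%:E)%E.
  move=> rs st; have s0 : 0 <= s by rewrite (le_trans r0)// ltW.
  have cKs : c <= K s by rewrite -Kr cumulative_le// ltW.
  have Gy : G s < (S + c) / 2 by apply: (le_lt_trans (GS s _)); [rewrite s0|lra].
  rewrite flat_meanE//; apply: le_trans (flat_mean_gap s0 Gy _); last by lra.
  by rewrite lee_fin /e ler_pM2l//; lra.
case: flat => _ _ _ _ [hpos /(_ t t0)].
have mE : measurable_fun (`[0, t] : set (measurableTypeR R)) (fun s => 'E_P[h \o X s]%E).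
  have ph : proc (fun s w => h (X s w)) by exact: proc_lip M0 hM pX.
  have pp : proc (fun s w => Num.max (h (X s w)) 0).
    by apply: (proc_lip ler01 (g := fun x => Num.max x 0)) => // x y; rewrite mul1r lip_max0.
  have pn : proc (fun s w => Num.max (- h (X s w)) 0).
    apply: (proc_lip ler01 (g := fun x => Num.max x 0)); last exact: procN ph.
    by move=> x y; rewrite mul1r lip_max0.
  have e1 s : 'E_P[h \o X s]%E = (\E[P]_w (Num.max (h (X s w)) 0) - \E[P]_w (Num.max (- h (X s w)) 0))%E.
    rewrite unlock integralE; congr (_ - _)%E; apply: eq_integral => w _.
      by rewrite unlock EFin_max.
    by rewrite unlock -EFinN EFin_max.
  apply: (eq_measurable_fun (fun s => \E[P]_w (Num.max (h (X s w)) 0) - \E[P]_w (Num.max (- h (X s w)) 0))%E).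
    by move=> s _; rewrite e1.
  by apply: emeasurable_funB; apply: measurable_Ex => // s w; rewrite le_max lexx orbT.
move=> /eqP; apply/negP; rewrite gt_eqF//.
apply: (@lt_le_trans _ _ (\int[lebesgue_stieltjes_measure K]_(s in `]r, t]) 'E_P[h \o X s])%E); last first.
  apply: ge0_subset_integral => //.
  - by move=> s /=; rewrite in_itv/= => /andP[s0 _]; exact: hpos.
  - by move=> s /=; rewrite !in_itv/= => /andP[rs ->]; rewrite (le_trans r0)// ltW.
apply: (@lt_le_trans _ _ (\int[lebesgue_stieltjes_measure K]_(s in `]r, t]) e%:E)%E).
  rewrite integral_cst// mule_gt0 ?lte_fin//=.
  rewrite /lebesgue_stieltjes_measure /measure_extension/=.
  rewrite measurable_mu_extE/= ?wlength_itv_bnd//; last exact: is_ocitv.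
  by rewrite lte_fin subr_gt0 Kr.
apply: ge0_le_integral => //.
- by move=> s _; rewrite lee_fin ltW.
- apply: measurable_funS mE => //.
  by move=> s /=; rewrite !in_itv/= => /andP[rs ->]; rewrite (le_trans r0)// ltW.
- by move=> s /=; rewrite in_itv/= => /andP[rs st]; rewrite unlock; exact: hge.
Qed.

(** Since the mean at time [s] is nonnegative, the extra shift [(M / m) e] pays for the movement of
    the noise since [s], so it bounds [G r] at all later [r <= t], and [K t] is the supremum of
    these. A strictly positive [e] allows Young's inequality; the limit is taken afterwards. *)
Let flat_increment_eps s t A e : 0 <= s -> s <= t -> 0 < e -> A <= e ^+ 2 ->
  (forall r, s <= r <= t -> (\E[P]_w ((V r w - V s w) ^+ 2) <= A%:E)%E) ->
  K t <= K s + M / m * e.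
Proof.
move=> s0 st e0 Ae hA; have t0 := le_trans s0 st.
pose q := M / m * e.
have q0 : 0 <= q by rewrite mulr_ge0 ?(ltW e0)// divr_ge0// ltW.
rewrite [leLHS]flatE//; apply: ge_sup; first by case: (supG t0).
move=> _ [r /= + <-]; rewrite in_itv/= => /andP[r0 rt].
have [rs|sr] := leP r s.
  by apply: (le_trans (flat_G_le r0)); rewrite (le_trans (cumulative_le rs))// lerDl.
have {}sr := ltW sr.
apply: G0_le; first by rewrite addr_ge0// flat_ge0.
rewrite flat_lawE//.
have h1 := mV r0; have h2 := mV s0.
pose D w := M * `|V r w - V s w|.
have mD : meas D by rewrite /D; mea.
have D0 w : 0 <= D w by rewrite mulr_ge0.
have ED : (Ex P D <= (m * q)%:E)%E.
  rewrite ExZ//; last by mea.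
  rewrite (_ : m * q = M * e); last by rewrite /q; field; rewrite gt_eqF.
  apply: lee_finZ => //; apply: Ex_normr_le => //; first by mea.
  by apply: (le_trans (hA r _)); rewrite ?sr// lee_fin.
have icst : P.-integrable setT (EFin \o (fun=> m * q)) by exact: finite_measure_integrable_cst.
have iY : P.-integrable setT (EFin \o (fun w => h (K s + U s w) + m * q)).
  apply: (@eq_integrable _ _ _ _ setT measurableT (fun w => (h (K s + U s w))%:E + (m * q)%:E)%E) => //.
  by apply: integrableD => //; exact: flat_integrable.
have YZ w : h (K s + U s w) + m * q <= h (K s + q + U r w) + D w.
  have hq : K s + U r w <= K s + q + U r w by rewrite lerD2r lerDl.
  have := hm hq; rewrite (_ : K s + q + U r w - (K s + U r w) = q); last by ring.
  have := hM (K s + U s w) (K s + U r w).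
  rewrite (_ : K s + U s w - (K s + U r w) = - (V r w - V s w)); last by rewrite !unreflectedE; ring.
  rewrite normrN -/(D w); have := ler_norm (h (K s + U s w) - h (K s + U r w)).
  by lra.
have := integral_shift_le iY (flat_integrable _ r0) mD D0 ED YZ.
rewrite (_ : (\int[P]_w (h (K s + U s w) + m * q)%:E)%E = (\int[P]_w (h (K s + U s w))%:E + (m * q)%:E)%E); last first.
  by rewrite -(Ex_cst P (m * q)) /Ex -integralD//; exact: flat_integrable.
by rewrite leeD2rE// => hle; exact: le_trans (flat_mean_ge0 s0) hle.
Qed.

Lemma flat_increment s t A : 0 <= s -> s <= t -> 0 <= A ->
  (forall r, s <= r <= t -> (\E[P]_w ((V r w - V s w) ^+ 2) <= A%:E)%E) ->
  (K t - K s) ^+ 2 <= (M / m) ^+ 2 * A.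
Proof.
move=> s0 st A0 hA.
have rho0 : 0 < M / m by rewrite divr_gt0// (lt_le_trans m0).
rewrite -(sqr_sqrtr A0) -exprMn; apply: lerXn2r.
- by rewrite nnegrE subr_ge0 cumulative_le.
- by rewrite nnegrE mulr_ge0 ?sqrtr_ge0// ltW.
apply/ler_addgt0Pr => e e0; rewrite lerBlDl.
have d0 : 0 < e / (M / m) by rewrite divr_gt0.
have sd0 : 0 < Num.sqrt A + e / (M / m) by rewrite ltr_wpDl ?sqrtr_ge0.
apply: (le_trans (flat_increment_eps s0 st sd0 _ hA)).
  by rewrite -{1}(sqr_sqrtr A0); apply: lerXn2r; rewrite ?nnegrE ?sqrtr_ge0// ?lerDl ltW.
by rewrite lerD2l mulrDr lerD2l mulrCA divff ?mulr1// gt_eqF.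
Qed.

Lemma flat_mean_fin s : 0 <= s -> ((fine (\int[P]_w (h (X s w))%:E))%:E = \int[P]_w (h (X s w))%:E)%E.
Proof.
move=> s0; rewrite (flat_meanE s0) fineK//.
by apply: integrable_fin_num => //; exact: (flat_integrable).
Qed.

(* Below [G s] the mean is negative, so the shift from [x] to [K s] accounts for all of it. *)
Lemma flat_mean_small s x : 0 <= s -> 0 <= x -> x <= K s -> x < G s ->
  fine (\int[P]_w (h (X s w))%:E) <= M * (K s - x).
Proof.
move=> s0 x0 xK xG; rewrite -lee_fin flat_mean_fin// (flat_meanE s0).
have iU y := flat_integrable y s0.
have Kx : 0 <= M * (K s - x) by rewrite mulr_ge0// subr_ge0.
have : (\int[P]_w (h (K s + U s w)%R)%:E <= \int[P]_w (h (x + U s w)%R)%:E + (M * (K s - x))%:E)%E.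
  apply: (integral_shift_le (iU (K s)) (iU x) (D := fun=> M * (K s - x))) => //.
    by rewrite Ex_cst.
  move=> w; have := hM (K s + U s w) (x + U s w).
  rewrite (_ : K s + U s w - (x + U s w) = K s - x); last by ring.
  by rewrite [X in _ * X]ger0_norm ?subr_ge0// => hh; have := ler_norm (h (K s + U s w) - h (x + U s w)); lra.
move/le_trans; apply.
have : (\int[P]_w (h (x + U s w)%R)%:E < 0)%E.
  rewrite ltNge; apply/negP => hx; move: xG; apply/negP; rewrite -leNgt.
  by apply: G0_le => //; rewrite (flat_lawE).
by move=> /ltW; rewrite -{2}[(M * _)%:E]add0e; exact: leeD2r.
Qed.

(** * Comparison of the empirical and the limiting reflection *)

Section empirical_measures.
Variables (N : nat) (u ub : 'I_N -> R -> R) (t dl rh : R).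
Hypotheses (N0 : (0 < N)%N) (t0 : 0 <= t) (dl0 : 0 <= dl) (rh0 : 0 <= rh).
Hypothesis u_dl : forall s, 0 <= s <= t -> N%:R^-1 * \sum_(i < N) `|u i s - ub i s| <= dl.
Hypothesis ub_rh : forall s, 0 <= s <= t ->
  `|N%:R^-1 * \sum_(i < N) (h (ub i s + K s) - fine (\int[P]_w (h (X s w))%:E))| <= rh.

Let e := (M * dl + rh) / m.
Let avg (f : 'I_N -> R) := N%:R^-1 * \sum_(i < N) f i.
Let Nr0 : 0 < N%:R :> R. Proof. by rewrite ltr0n. Qed.

Let avg_le f g : (forall i, f i <= g i) -> avg f <= avg g.
Proof. by move=> fg; rewrite ler_pM2l ?invr_gt0//; apply: ler_sum. Qed.
Let avgDc f c : avg (fun i => f i + c) = avg f + c.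
Proof. by rewrite /avg big_split/= mulrDr sumr_const card_ord -[c *+ N]mulr_natl mulKf ?gt_eqF. Qed.
Let avgD f g : avg (fun i => f i + g i) = avg f + avg g.
Proof. by rewrite /avg big_split/= mulrDr. Qed.
Let avgZ c f : avg (fun i => c * f i) = c * avg f.
Proof. by rewrite /avg -mulr_sumr mulrCA. Qed.

Let emp s x : (\int[empirical (fun k => u k s)]_z (h (x + z)%R)%:E = (avg (fun i => h (x + u i s)))%:E)%E.
Proof.
apply: (@integral_empirical _ _ _ (fun z => h (x + z))); apply: (measurableT_comp mh).
by apply: measurable_funD; [exact: measurable_cst|exact: measurable_id].
Qed.

Let g s := fine (\int[P]_w (h (X s w))%:E).

Let avg_near s : 0 <= s <= t -> `|avg (fun i => h (K s + u i s)) - g s| <= M * dl + rh.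
Proof.
move=> st; have := ub_rh st; rewrite -[X in `|X|]/(avg (fun i => h (ub i s + K s) - g s)).
have := u_dl st; rewrite -[X in X <= dl]/(avg (fun i => `|u i s - ub i s|)) => hd.
rewrite avgDc => hr.
have h1 : avg (fun i => h (K s + u i s)) <= avg (fun i => h (ub i s + K s)) + M * avg (fun i => `|u i s - ub i s|).
  rewrite -avgZ -avgD; apply: avg_le => i; have := hM (K s + u i s) (ub i s + K s).
  rewrite (_ : K s + u i s - (ub i s + K s) = u i s - ub i s); last by ring.
  by have := ler_norm (h (K s + u i s) - h (ub i s + K s)); lra.
have h2 : avg (fun i => h (ub i s + K s)) <= avg (fun i => h (K s + u i s)) + M * avg (fun i => `|u i s - ub i s|).
  rewrite -avgZ -avgD; apply: avg_le => i; have := hM (K s + u i s) (ub i s + K s).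
  rewrite (_ : K s + u i s - (ub i s + K s) = u i s - ub i s); last by ring.
  by have := ler_norm (- (h (K s + u i s) - h (ub i s + K s))); rewrite normrN; lra.
have : M * avg (fun i => `|u i s - ub i s|) <= M * dl by rewrite ler_wpM2l.
by move: hr; rewrite !ler_norml; lra.
Qed.

Let g_ge0 s : 0 <= s -> 0 <= g s.
Proof.
move=> s0; rewrite -lee_fin /g flat_mean_fin// (flat_meanE s0).
exact: (flat_mean_ge0 s0).
Qed.

Let e0 : 0 <= e. Proof. by rewrite divr_ge0 ?(ltW m0)// addr_ge0// mulr_ge0. Qed.

(** The empirical mean under the shift [K s] falls short of the true, nonnegative one by at most
    [M dl + rh]; the slope [m] recovers this with the additional shift [e]. *)
Let emp_ge0 s : 0 <= s <= t ->
  0 <= K s + e /\ (0 <= \int[empirical (fun k => u k s)]_z (h (K s + e + z)%R)%:E)%E.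
Proof.
move=> st; have s0 : 0 <= s by case/andP: st.
split; first by rewrite addr_ge0// flat_ge0.
rewrite emp lee_fin; apply: (@le_trans _ _ (avg (fun i => h (K s + u i s)) + m * e)).
  have := avg_near st; have := g_ge0 s0; rewrite /e mulrCA mulfV ?gt_eqF// mulr1 ler_norml; lra.
rewrite -avgDc; apply: avg_le => i.
have := @hm (K s + u i s) (K s + e + u i s); rewrite lerD2r lerDl => /(_ e0).
by rewrite (_ : K s + e + u i s - (K s + u i s) = e); [lra|ring].
Qed.

Let GN s := G0 h (empirical (fun k => u k s)).

Let GN_le s : 0 <= s <= t -> GN s <= K t + e.
Proof.
move=> st; have [a0 a1] := emp_ge0 st; apply: (le_trans (G0_le a0 a1)).
by rewrite lerD2r; apply: cumulative_le; case/andP: st.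
Qed.

(** When [G s] is within [eta] of [K t], the true mean is at most [M eta], so the empirical mean
    under the shift [K s] is small too; an admissible shift far below [K s] would make it larger by
    the slope [m]. *)
Let GN_ge s eta : 0 <= s <= t -> 0 < eta -> eta <= K t -> K t - eta < G s -> K t - eta - e - M / m * eta <= GN s.
Proof.
move=> st eta0 etaK KG; have s0 : 0 <= s by case/andP: st.
have KG' := flat_G_le s0.
have Kst : K s <= K t by apply: cumulative_le; case/andP: st.
have gs := @flat_mean_small s (K t - eta) s0 _ (ltW (lt_le_trans KG KG')) KG.
have {}gs : g s <= M * eta.
  apply: (le_trans (gs _)); first by rewrite subr_ge0.
  by apply: ler_wpM2l => //; lra.
apply: lb_le_inf; first by exists (K s + e); exact: emp_ge0.
move=> x [x0]; rewrite emp lee_fin => hx.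
have me : M / m * eta = M * eta / m by rewrite mulrAC.
case: (leP (K s) x) => Kx.
  have : 0 <= M / m * eta by rewrite mulr_ge0 ?divr_ge0 ?(ltW m0)// ltW.
  by have := e0; lra.
have : m * (K s - x) <= avg (fun i => h (K s + u i s)).
  apply: (@le_trans _ _ (avg (fun i => h (x + u i s)) + m * (K s - x))); first by rewrite lerDr.
  rewrite -avgDc; apply: avg_le => i; have := @hm (x + u i s) (K s + u i s).
  rewrite lerD2r => /(_ (ltW Kx)); rewrite (_ : K s + u i s - (x + u i s) = K s - x); [lra|ring].
have := avg_near st; rewrite ler_norml => /andP[_ h1] h2.
have : m * (K s - x) <= M * dl + rh + M * eta by lra.
rewrite mulrC -ler_pdivlMr// mulrDl -/e -me; lra.
Qed.

Lemma reflection_gap : `|sup [set GN s | s in `[0, t]] - K t| <= e.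
Proof.
have ne : [set GN s | s in `[0, t]] !=set0 by exists (GN 0), 0 => //=; rewrite in_itv/= lexx.
have ubN : ubound [set GN s | s in `[0, t]] (K t + e).
  by move=> _ [s /= + <-]; rewrite in_itv/= => st; exact: GN_le.
have hs : has_sup [set GN s | s in `[0, t]] by split => //; exists (K t + e).
rewrite ler_norml; apply/andP; split; last first.
  by rewrite lerBlDr addrC; apply: ge_sup.
have sup0 : 0 <= sup [set GN s | s in `[0, t]].
  apply: (le_trans (G0_ge0 h (empirical (fun k => u k 0)))); apply: sup_upper_bound => //.
  by exists 0 => //=; rewrite in_itv/= lexx.
rewrite lerBrDr addrC; apply/ler_addgt0Pr => eps eps0.
have [Kt0|Kt0] := leP (K t) 0; first by have := e0; lra.
(* The first bound keeps the trial shift [K t - eta] nonnegative, the second keeps the total loss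
   [eta (1 + M / m)] below [eps]. *)
pose eta := Num.min (K t) (eps / (1 + M / m)).
have Mm0 : 0 <= M / m by rewrite divr_ge0// ltW.
have Mm : 0 < 1 + M / m by rewrite ltr_pwDl.
have eta0 : 0 < eta by rewrite lt_min Kt0 divr_gt0.
have etaK : eta <= K t by rewrite ge_min lexx.
have etae : eta * (1 + M / m) <= eps by rewrite -ler_pdivlMr// ge_min lexx orbT.
have neG : [set G s | s in `[0, t]] !=set0 by exists (G 0), 0 => //=; rewrite in_itv/= lexx.
have hsG : has_sup [set G s | s in `[0, t]].
  split => //; exists (K t) => _ [s /= + <-]; rewrite in_itv/= => /andP[s0 st].
  exact: le_trans (flat_G_le s0) (cumulative_le st).
have KtG := flatE t0.
have [_ [s /= + <-]] := sup_adherent eta0 hsG.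
rewrite in_itv/= -KtG => st KG.
have := GN_ge st eta0 etaK KG.
have : GN s <= sup [set GN s | s in `[0, t]].
  by apply: sup_upper_bound => //; exists s => //=; rewrite in_itv.
by move: etae; rewrite mulrDr mulr1 mulrC; lra.
Qed.
End empirical_measures.
Section particles.
Context {d'} {Om' : measurableType d'} (P' : probability Om' R).
Variables (F' : R -> set (set Om')) (N : nat) (Bs : 'I_N -> R -> Om' -> R) (X0s : 'I_N -> Om' -> R).
Hypothesis pdata : particle_data P X0 P' F' Bs X0s.
Variables (Xs Is Ys Js : 'I_N -> R -> Om' -> R).
Hypothesis psys : particle_system P' F' b sg h Bs X0s Xs Is.
Hypothesis copies : coupled_copies P' F' b sg h (fun t => law P (U t)) Bs X0s Ys Js.
Variable T : R.
Hypotheses (T0 : 0 < T) (N0 : (0 < N)%N).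

Let T0' : 0 <= T := ltW T0.
Let L0 : 0 <= L. Proof. exact: le_trans L1. Qed.
Let cF' : complete_filtration P' F'. Proof. by case: pdata. Qed.
Let BM' : brownian_family P' F' Bs. Proof. by case: pdata. Qed.
Let BMi i := brownian_family_motion i BM'.
Let aY i : adapted F' (Ys i). Proof. by case: (copies i). Qed.
Let cY i : continuous_paths (Ys i). Proof. by case: (copies i). Qed.
Let iY i : ito_integral P' F' (Bs i) (fun t w => sg (Ys i t w)) (Js i). Proof. by case: (copies i). Qed.
Let pY i : proc (Ys i). Proof. exact: (proc_adapted cF' (aY i) (@cY i)). Qed.
Let gc0 : 0 <= gap_cst L. Proof. by rewrite /gap_cst; nneg. Qed.

(** * Coupling of the particles with their copies *)

Section coupling.
Variables (r : R) (err : R -> Om' -> R).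
Hypothesis perr : proc err.
Hypothesis errE : forall s w, 0 <= s <= T ->
  err s w = N%:R^-1 * \sum_(i < N) (h (Ys i s w) - fine (\int[P]_w' (h (X s w'))%:E)).
Hypothesis err_r : (\int[P']_w esup (fun s w => err s w ^+ 2)%R 0 T w <= r%:E)%E.

Let aXs i : adapted F' (Xs i). Proof. by case: (psys i). Qed.
Let cXs i : continuous_paths (Xs i). Proof. by case: (psys i). Qed.
Let iXs i : ito_integral P' F' (Bs i) (fun t w => sg (Xs i t w)) (Is i). Proof. by case: (psys i). Qed.
Let pXs i : proc (Xs i). Proof. exact: (proc_adapted cF' (aXs i) (@cXs i)). Qed.

Local Notation VX i := (sde_noise b (Xs i) (Is i)).
Local Notation VY i := (sde_noise b (Ys i) (Js i)).
Definition noise_gap i s w := VX i s w - VY i s w.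
Definition particle_gap i s w := Xs i s w - Ys i s w.
(** Summing over all particles and copies lets one cut-off bound all of them simultaneously, as
    their mean-field interaction requires. *)
Definition amplitude s w := \sum_(i < N) (`|Xs i s w| + `|Ys i s w|).
Local Notation a n := (amplitude_cut amplitude n%:R).

Let sum_insub {f : 'I_N -> R -> Om' -> R} : (forall i, proc (f i)) -> proc (fun s w => \sum_(i < N) f i s w).
Proof.
move=> pf; rewrite (_ : (fun s w => _) = fun s w => \sum_(i < N) (fun k s w => if insub k is Some i then f i s w else 0) i s w); last first.
  by apply/funext => s; apply/funext => w; apply: eq_bigr => i _; rewrite valK.
apply: (@proc_sum R d' Om' N (fun k s w => if insub k is Some i then f i s w else 0)) => k.
by case: insub => [i|]; [exact: pf|apply: proc_const; exact: measurable_cst].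
Qed.

Let pamp : proc amplitude.
Proof. by apply: sum_insub => i; apply: procD; apply: proc_abs. Qed.

Let aamp : adapted F' amplitude.
Proof.
move=> t t0; have sF := filtration_sigma cF' t0.
apply/(measurable_wrtP _ sF); apply: measurable_sum => i.
have /(measurable_wrtP _ sF) hX := aXs i t0; have /(measurable_wrtP _ sF) hY := aY i t0.
by apply: measurable_funD; apply: measurable_fun_normr.
Qed.

Let a01 n s w : a n s w = 0 \/ a n s w = 1 := amplitude_cut01 _ _ s w.
Let pa n : proc (a n). Proof. exact: proc_amplitude_cut. Qed.
Let Fa n : adapted F' (a n). Proof. exact: (@adapted_amplitude_cut _ _ _ P' F' amplitude n%:R cF' pamp aamp). Qed.
Let amono n s s' w : 0 <= s -> s <= s' -> a n s' w <= a n s w.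
Proof. exact: amplitude_cut_mono. Qed.
Let a_ge0 n s w : 0 <= a n s w. Proof. by case: (a01 n s w) => ->. Qed.

Let pW i : proc (noise_gap i).
Proof.
by apply: procB; [exact: (proc_sde_noise cF' L1 bL (aXs i) (@cXs i) (iXs i))|exact: (proc_sde_noise cF' L1 bL (aY i) (@cY i) (iY i))].
Qed.
Let pG i : proc (particle_gap i). Proof. exact: procB. Qed.

Definition gap_esup (f : 'I_N -> R -> Om' -> R) n t i w := esup (fun s w => a n s w * f i s w ^+ 2) 0 t w.

Let pgap (f : 'I_N -> R -> Om' -> R) n i : (forall i, proc (f i)) -> proc (fun s w => a n s w * f i s w ^+ 2).
Proof. by move=> pf; apply: procM => //; apply: procX. Qed.

Let noise0 : {ae P', forall w, forall i, VX i 0 w = 0 /\ VY i 0 w = 0}.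
Proof.
have H i : {ae P', forall w, VX i 0 w = 0 /\ VY i 0 w = 0}.
  have h1 := sde_noise0 cF' (@BMi i) b L1 sgL (aXs i) (@cXs i) (iXs i).
  have h2 := sde_noise0 cF' (@BMi i) b L1 sgL (aY i) (@cY i) (iY i).
  by apply: filterS2 h1 h2 => w.
exact: filter_forall.
Qed.

Let eqs : {ae P', forall w, forall i t, 0 <= t ->
  Xs i t w = X0s i w + VX i t w + sup [set G0 h (empirical (fun k => X0s k w + VX k s w)) | s in `[0, t]] /\
  Ys i t w = X0s i w + VY i t w + K t}.
Proof.
apply: filter_forall => i.
have [_ _ _ h1] := psys i; have [_ _ _ h2] := copies i.
apply: filterS2 h1 h2 => w h1 h2 t t0; split.
  rewrite (h1 t t0) unreflectedE; congr (_ + sup _).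
  apply: eq_imagel => s _; congr (G0 h (empirical _)); apply/funext => k.
  by rewrite unreflectedE.
by rewrite (h2 t t0) unreflectedE -(flatE t0).
Qed.

Let Nr0 : 0 < N%:R :> R. Proof. by rewrite ltr0n. Qed.
Let avg (f : 'I_N -> R) := N%:R^-1 * \sum_(i < N) f i.
Let avg_sqr_le f : avg f ^+ 2 <= avg (fun i => f i ^+ 2).
Proof.
rewrite -subr_ge0 (_ : _ - _ = N%:R^-1 * \sum_(i < N) (f i - avg f) ^+ 2).
  by rewrite mulr_ge0 ?invr_ge0// sumr_ge0// => i _; exact: sqr_ge0.
have -> : \sum_(i < N) (f i - avg f) ^+ 2 = \sum_(i < N) f i ^+ 2 + (- 2 * avg f * (\sum_(i < N) f i) + N%:R * avg f ^+ 2).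
  have -> : N%:R * avg f ^+ 2 = \sum_(i < N) avg f ^+ 2 by rewrite sumr_const card_ord mulr_natl.
  by rewrite mulr_sumr -!big_split/=; apply: eq_bigr => i _; ring.
rewrite [avg (fun i => _)]/avg (_ : \sum_(i < N) f i = N%:R * avg f); last by rewrite /avg mulVKf ?gt_eqF.
by move: (\sum_(i < N) _) (avg f) => u v; field; rewrite gt_eqF.
Qed.

Let rho := M / m.

(** [reflection_gap] is applied path by path, up to a time where the cut-off is 1. Its [dl] is the
    root of the average of the squared noise gaps, by Jensen's inequality, and its [rh] the root of
    the squared error of the empirical mean. *)
Let gap_pathwise : {ae P', forall w, forall n t i, 0 <= t <= T ->
  (gap_esup particle_gap n t i w <= 2%:E * gap_esup noise_gap n t i w +
    ((4 * rho ^+ 2 / N%:R)%:E * \sum_(k < N) gap_esup noise_gap n t k w +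
     (4 / m ^+ 2)%:E * esup (fun s w => err s w ^+ 2)%R 0 T w))%E}.
Proof.
apply: filterS eqs => w E n t i /andP[t0 tT].
have e_fin k : gap_esup noise_gap n t k w \is a fin_num.
  by have [_ _ /(_ w t)[c hc]] := pgap n k pW; exact: (esup_fin_num t0 hc).
have r_fin : esup (fun s w => err s w ^+ 2) 0 T w \is a fin_num.
  by have [_ _ /(_ w T)[c hc]] := procX 2 perr; exact: (esup_fin_num T0' hc).
pose e k := fine (gap_esup noise_gap n t k w).
pose q := fine (esup (fun s w => err s w ^+ 2) 0 T w).
have eE k : gap_esup noise_gap n t k w = (e k)%:E by rewrite fineK.
have qE : esup (fun s w => err s w ^+ 2) 0 T w = q%:E by rewrite fineK.
have e0 k : 0 <= e k.
  by rewrite -lee_fin -eE; apply: esup_ge0 => // s; rewrite mulr_ge0 ?sqr_ge0.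
have q0 : 0 <= q by rewrite -lee_fin -qE; apply: esup_ge0 => // s; rewrite sqr_ge0.
under eq_bigr do rewrite eE.
rewrite eE qE sumEFin -!EFinM -!EFinD; apply: esup_le => s /andP[s0 st]; rewrite lee_fin.
have M2 : 0 <= rho ^+ 2 by exact: sqr_ge0.
have m2 : 0 <= 4 / m ^+ 2 by rewrite divr_ge0// sqr_ge0.
have RHS0 : 0 <= 4 * rho ^+ 2 / N%:R * \sum_(k < N) e k + 4 / m ^+ 2 * q.
  apply: addr_ge0; apply: mulr_ge0 => //; last by apply: sumr_ge0.
  by rewrite divr_ge0 ?(ltW Nr0)// mulr_ge0.
case: (a01 n s w) => [->|as1]; first by rewrite mul0r addr_ge0// mulr_ge0.
rewrite as1 mul1r.
have ar s' : 0 <= s' <= s -> a n s' w = 1.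
  move=> /andP[s'0 s's]; case: (a01 n s' w) => // a0; have := amono n w s'0 s's.
  by rewrite a0 as1 ler10.
have We s' k : 0 <= s' <= s -> noise_gap k s' w ^+ 2 <= e k.
  move=> ss; have st' : 0 <= s' <= t by case/andP: ss => -> /le_trans; apply.
  have : ((a n s' w * noise_gap k s' w ^+ 2)%:E <= gap_esup noise_gap n t k w)%E by apply: esup_ubound.
  by rewrite eE lee_fin ar// mul1r.
pose dl := Num.sqrt (avg e); pose rh := Num.sqrt q.
have avg0 : 0 <= avg e by rewrite mulr_ge0 ?invr_ge0 ?(ltW Nr0)// sumr_ge0.
have dlP s' : 0 <= s' <= s -> avg (fun k => `|(X0s k w + VX k s' w) - (X0s k w + VY k s' w)|) <= dl.
  move=> ss; rewrite -(ler_pXn2r (n := 2)) ?nnegrE ?sqrtr_ge0//; last first.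
    by rewrite mulr_ge0 ?invr_ge0 ?(ltW Nr0)// sumr_ge0.
  rewrite sqr_sqrtr//; apply: (le_trans (avg_sqr_le _)); rewrite ler_pM2l ?invr_gt0//.
  apply: ler_sum => k _; rewrite normr_sqr//.
  rewrite (_ : X0s k w + _ - _ = noise_gap k s' w); [exact: We|rewrite /noise_gap; ring].
have rhP s' : 0 <= s' <= s ->
    `|avg (fun k => h ((X0s k w + VY k s' w) + K s') - fine (\int[P]_w' (h (X s' w'))%:E))| <= rh.
  move=> /andP[s'0 s's]; have s'T : 0 <= s' <= T by rewrite s'0 (le_trans s's)// (le_trans st).
  rewrite -(ler_pXn2r (n := 2)) ?nnegrE ?sqrtr_ge0// sqr_sqrtr// normr_sqr//.
  rewrite (_ : avg _ = err s' w); last first.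
    by rewrite errE//; congr (_ * _); apply: eq_bigr => k _; rewrite (E k s' s'0).2.
  rewrite -lee_fin -qE; exact: (@esup_ubound _ _ _ (fun s w => err s w ^+ 2) 0 T w s' s'T).
have := reflection_gap (u := fun k s' => X0s k w + VX k s' w)
  (ub := fun k s' => X0s k w + VY k s' w) N0 s0 (sqrtr_ge0 _) (sqrtr_ge0 _) dlP rhP.
set S := sup _ => hS.
have -> : particle_gap i s w = noise_gap i s w + (S - K s).
  by rewrite /particle_gap (E i s s0).1 (E i s s0).2 /noise_gap /S; ring.
apply: (le_trans (sqrD_le _ _)); rewrite mulrDr; apply: lerD.
  by rewrite ler_pM2l// We// s0 lexx.
apply: (@le_trans _ _ (2 * ((M * dl + rh) / m) ^+ 2)).
  rewrite ler_pM2l// -[leLHS]normr_sqr//; apply: lerXn2r; rewrite ?nnegrE//.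
  by rewrite divr_ge0 ?(ltW m0)// addr_ge0 ?mulr_ge0 ?sqrtr_ge0.
apply: (@le_trans _ _ (2 * (2 * ((M * dl / m) ^+ 2 + (rh / m) ^+ 2)))).
  by rewrite ler_pM2l// [(M * dl + rh) / m]mulrDl; exact: sqrD_le.
rewrite !exprMn !sqr_sqrtr// exprVn; apply: eq_leW.
rewrite /rho /avg; move: (\sum_(k < N) e k) => z; field; rewrite !gt_eqF//.
Qed.

Let mgap (f : 'I_N -> R -> Om' -> R) n t i : (forall i, proc (f i)) -> 0 <= t -> meas (gap_esup f n t i).
Proof. by move=> pf t0; apply: measurable_esup => //; exact: pgap. Qed.
Let gap0 f n t i w : 0 <= t -> (0 <= gap_esup f n t i w)%E.
Proof. by move=> t0; apply: esup_ge0 => // s; rewrite mulr_ge0 ?sqr_ge0. Qed.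

(** A bound [v] common to all particles turns the average over the particles into a single term,
    which makes exchangeability dispensable. *)
Lemma particle_gap_le n t v i : 0 <= t <= T ->
  (forall k, (\int[P']_w gap_esup noise_gap n t k w <= v%:E)%E) ->
  (\int[P']_w gap_esup particle_gap n t i w <= ((2 + 4 * rho ^+ 2) * v + 4 / m ^+ 2 * r)%:E)%E.
Proof.
move=> tT hv; have [t0 _] := andP tT.
have M2 : 0 <= 4 * rho ^+ 2 / N%:R by rewrite divr_ge0 ?(ltW Nr0)// mulr_ge0// sqr_ge0.
have m2 : 0 <= 4 / m ^+ 2 by rewrite divr_ge0// sqr_ge0.
have mN k := @mgap _ n t k pW t0.
have n0 k w := @gap0 noise_gap n t k w t0.
have merr : meas (esup (fun s w => err s w ^+ 2)%R 0 T) by apply: measurable_esup => //; apply: procX.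
have err0 w : (0 <= esup (fun s w => err s w ^+ 2)%R 0 T w)%E by apply: esup_ge0 => // s; rewrite sqr_ge0.
have s0 w : (0 <= \sum_(k < N) gap_esup noise_gap n t k w)%E by apply: sume_ge0.
have ms : meas (fun w => \sum_(k < N) gap_esup noise_gap n t k w)%E by apply: emeasurable_sum.
have i1 w : (0 <= 2%:E * gap_esup noise_gap n t i w)%E by rewrite mule_ge0.
have i2 w : (0 <= (4 * rho ^+ 2 / N%:R)%:E * \sum_(k < N) gap_esup noise_gap n t k w)%E by rewrite mule_ge0.
have i3 w : (0 <= (4 / m ^+ 2)%:E * esup (fun s w => err s w ^+ 2)%R 0 T w)%E by rewrite mule_ge0.
have j1 : meas (fun w => 2%:E * gap_esup noise_gap n t i w)%E by apply: measurable_funeM.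
have j2 : meas (fun w => (4 * rho ^+ 2 / N%:R)%:E * \sum_(k < N) gap_esup noise_gap n t k w)%E by apply: measurable_funeM.
have j3 : meas (fun w => (4 / m ^+ 2)%:E * esup (fun s w => err s w ^+ 2)%R 0 T w)%E by apply: measurable_funeM.
apply: (@le_trans _ _ (\int[P']_w (2%:E * gap_esup noise_gap n t i w +
    ((4 * rho ^+ 2 / N%:R)%:E * \sum_(k < N) gap_esup noise_gap n t k w +
     (4 / m ^+ 2)%:E * esup (fun s w => err s w ^+ 2)%R 0 T w)))%E).
  apply: ae_ge0_le_integral => //.
  - by move=> w _; exact: gap0.
  - exact: mgap.
  - by move=> w _; rewrite adde_ge0// adde_ge0.
  - by apply: emeasurable_funD => //; apply: emeasurable_funD.
  - by apply: filterS gap_pathwise => w H _; exact: H.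
rewrite ge0_integralD//; [|by move=> w _; rewrite adde_ge0|by apply: emeasurable_funD].
rewrite ge0_integralD// !ge0_integralZl_EFin// ge0_integral_sum//.
have hs : (\sum_(k < N) \int[P']_w gap_esup noise_gap n t k w <= (N%:R * v)%:E)%E.
  apply: (@le_trans _ _ (\sum_(k < N) v%:E)%E); first by apply: lee_sum => k _.
  by rewrite sumEFin sumr_const card_ord -[X in (X%:E <= _)%E]mulr_natl.
apply: (le_trans (lee_finD (lee_finZ _ (hv i)) (lee_finD (lee_finZ M2 hs) (lee_finZ m2 err_r)))) => //.
by rewrite lee_fin; apply: eq_leW; field; rewrite !gt_eqF.
Qed.

Lemma noise_gap_le n t c lam i : 0 <= t -> 1 <= lam -> 0 <= c ->
  (forall s, 0 <= s <= t -> (\E[P']_w (a n s w * particle_gap i s w ^+ 2) <= (c * expR (lam * s))%:E)%E) ->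
  (\int[P']_w gap_esup noise_gap n t i w <= (gap_cst L * (c / lam) * expR (lam * t))%:E)%E.
Proof.
move=> t0 lam1 c0 hc; have lam0 : 0 < lam by exact: lt_le_trans lam1.
have pbX := proc_lip L0 bL (pXs i); have pbY := proc_lip L0 bL (pY i).
have psX := proc_lip L0 sgL (pXs i); have psY := proc_lip L0 sgL (pY i).
have F1 : measurable_wrt (F' 0) (fun=> 1 : R).
  by apply/(measurable_wrtP _ (filtration_sigma cF' (lexx 0))); exact: measurable_cst.
have one1 (w : Om') : `|1 : R| <= 1 by rewrite normr1.
have := noise_maximal2 cF' (@BMi i) pbX pbY psX psY (iXs i) (iY i) (a01 n) (amono n) (pa n) (@Fa n) F1 one1 (lexx 0) t0.
set ni := noise_increment _ _ _ _ _ _ => hmax.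
have pni : proc ni.
  have pVX := proc_sde_noise cF' L1 bL (aXs i) (@cXs i) (iXs i).
  have pVY := proc_sde_noise cF' L1 bL (aY i) (@cY i) (iY i).
  have [mVX _ _] := pVX; have [mVY _ _] := pVY.
  apply: procM; first exact: proc_const.
  by apply: procB; apply: procB => //; apply: proc_const; [exact: mVX|exact: mVY].
apply: (@le_trans _ _ (\int[P']_w esup (fun s w => a n s w * ni s w ^+ 2)%R 0 t w)%E).
  apply: ae_ge0_le_integral => //.
  - by move=> w _; exact: gap0.
  - exact: mgap.
  - by move=> w _; apply: esup_ge0 => // s; rewrite mulr_ge0 ?sqr_ge0.
  - by apply: measurable_esup => //; apply: procM => //; exact: procX.
  - apply: filterS noise0 => w hw _; rewrite /gap_esup /esup; apply: eq_leW; congr ereal_sup.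
    apply: eq_imagel => s _; have [x0 y0] := hw i.
    by rewrite /ni /noise_increment mul1r -/(sde_noise b (Xs i) (Is i)) -/(sde_noise b (Ys i) (Js i)) x0 y0 !subr0.
apply: (le_trans hmax).
have L2 : 0 <= L ^+ 2 by exact: sqr_ge0.
have lip2 (f : R -> R) : lip L f -> forall s w,
    (a n s w * (1 * (f (Xs i s w) - f (Ys i s w)))) ^+ 2 <= L ^+ 2 * (a n s w * particle_gap i s w ^+ 2).
  move=> fL s w; case: (a01 n s w) => ->; first by rewrite !mul0r expr0n/= mulr0.
  rewrite !mul1r -exprMn -[leLHS]normr_sqr// -[leRHS]normr_sqr//.
  by apply: lerXn2r; rewrite ?nnegrE// normrM (ger0_norm L0).
have mG s : 0 <= s -> meas (fun w => a n s w * particle_gap i s w ^+ 2).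
  by case: (pgap n i pG) => + _ _; exact.
have g0 s w : 0 <= a n s w * particle_gap i s w ^+ 2 by rewrite mulr_ge0 ?sqr_ge0.
have pwi (f : R -> R) : proc (fun s w => f (Xs i s w)) -> proc (fun s w => f (Ys i s w)) ->
    proc (fun s w => a n s w * (1 * (f (Xs i s w) - f (Ys i s w)))).
  move=> p1 p2; apply: procM => //; apply: procM; last exact: procB.
  by apply: proc_const; exact: measurable_cst.
have Lc : 0 <= L ^+ 2 * c by rewrite mulr_ge0.
have hE (f : R -> R) : proc (fun s w => f (Xs i s w)) -> proc (fun s w => f (Ys i s w)) ->
    lip L f -> forall s, 0 <= s <= t ->
    (\E[P']_w ((a n s w * (1 * (f (Xs i s w) - f (Ys i s w)))) ^+ 2) <= (L ^+ 2 * c * expR (lam * s))%:E)%E.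
  move=> p1 p2 fL s st; rewrite -mulrA; apply: (Ex_leZ _ _ L2 _ _ (lip2 _ fL s)).
  - by move=> w; exact: sqr_ge0.
  - by [].
  - by have [m1 _ _] := procX 2 (pwi _ p1 p2); apply: m1; case/andP: st.
  - by apply: mG; case/andP: st.
  - exact: hc.
have d1 : (\E[P']_w (tint (weighted_drift (fun s w => b (Xs i s w)) (fun s w => b (Ys i s w)) (a n) (fun=> 1%R)) 0 t w ^+ 2) <=
    (L ^+ 2 * c * (4 / lam ^+ 2) * expR (lam * t))%:E)%E.
  apply: Ex_sqr_tint_expR => //.
    by apply: procM => //; apply: proc_abs; apply: procM; [apply: proc_const; exact: measurable_cst|exact: procB].
  move=> s st; apply: le_trans (hE _ pbX pbY bL s st).
  apply: eq_leW; apply: eq_integral => w _; congr (_%:E).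
  by rewrite /weighted_drift !exprMn normr_sqr// exprMn.
have d2 : (Ex P' (tint (weighted_integrand (fun s w => sg (Xs i s w)) (fun s w => sg (Ys i s w)) (a n) (fun=> 1%R)) 0 t) <=
    (L ^+ 2 * c * lam^-1 * expR (lam * t))%:E)%E.
  apply: Ex_tint_expRZ => //.
  - by apply: (procX 2); exact: (pwi _ psX psY).
  - by move=> s w; exact: sqr_ge0.
  - exact: hE.
apply: (le_trans (lee_finD (lee_finZ _ d1) (lee_finZ _ d2))) => //.
rewrite lee_fin /gap_cst !mulrA -mulrDl ler_wpM2r ?expR_ge0//.
rewrite -subr_ge0 (_ : _ - _ = 2 * 4 * L ^+ 2 * c / lam * (1 - lam^-1)); last by field; rewrite gt_eqF.
by rewrite mulr_ge0 ?subr_ge0 ?invf_le1// divr_ge0 ?(ltW lam0)// !mulr_ge0.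
Qed.

(** Chosen so that [(2 + 4 rho^2) gap_cst L / gap_rate <= 1/2], the contraction needed in the
    Gronwall step. *)
Definition gap_rate := 1 + 2 * ((2 + 4 * rho ^+ 2) * gap_cst L).

Let rho20 : 0 <= 2 + 4 * rho ^+ 2. Proof. by rewrite addr_ge0// mulr_ge0// sqr_ge0. Qed.
Lemma gap_rate_ge1 : 1 <= gap_rate.
Proof. by rewrite lerDl mulr_ge0// mulr_ge0. Qed.
Let rate0 : 0 < gap_rate. Proof. exact: lt_le_trans gap_rate_ge1. Qed.

Let half_rate c : 0 <= c -> (2 + 4 * rho ^+ 2) * (gap_cst L * (c / gap_rate)) <= c / 2.
Proof.
move=> c0; rewrite [leLHS](_ : _ = c * ((2 + 4 * rho ^+ 2) * gap_cst L / gap_rate)); last by ring.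
by rewrite ler_wpM2l// ler_pdivrMr// /gap_rate; lra.
Qed.

Let r0 : 0 <= r.
Proof.
rewrite -lee_fin; apply: le_trans err_r; apply: integral_ge0 => w _.
by apply: esup_ge0 => // s; rewrite sqr_ge0.
Qed.
Let c0 := 4 / m ^+ 2 * r.
Let c00 : 0 <= c0. Proof. by rewrite mulr_ge0// divr_ge0// sqr_ge0. Qed.

Let amp_le i n s w : 0 <= s -> a n s w * particle_gap i s w ^+ 2 <= n%:R ^+ 2.
Proof.
move=> s0; case: (a01 n s w) => as1; rewrite as1; first by rewrite mul0r sqr_ge0.
rewrite mul1r -[leLHS]normr_sqr//; apply: lerXn2r; rewrite ?nnegrE//.
have := amplitude_cut_le as1 (r := s); rewrite s0 lexx => /(_ isT).
apply: le_trans; rewrite [leRHS]ger0_norm; last by apply: sumr_ge0 => k _; rewrite addr_ge0.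
rewrite /amplitude (bigD1 i)//=; apply: (le_trans (ler_normB _ _)); rewrite lerDl.
by apply: sumr_ge0 => k _; rewrite addr_ge0.
Qed.

Let gap_moment n t : 0 <= t <= T -> forall i,
  (\E[P']_w (a n t w * particle_gap i t w ^+ 2) <= (2 * c0 * expR (gap_rate * t))%:E)%E.
Proof.
(* Gronwall's inequality is run on the worst particle; before it, the cut-off provides the finite
   bound [n^2]. *)
pose u t := ereal_sup [set \E[P']_w (a n t w * particle_gap i t w ^+ 2) | i in [set: 'I_N]].
have uP t' c : (forall i, (\E[P']_w (a n t' w * particle_gap i t' w ^+ 2) <= c)%E) -> (u t' <= c)%E.
  by move=> H; apply: ge_ereal_sup => _ [i _ <-].
have uU t' i : (\E[P']_w (a n t' w * particle_gap i t' w ^+ 2) <= u t')%E.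
  by apply: ereal_sup_ubound; exists i.
have mG i s : 0 <= s -> meas (fun w => a n s w * particle_gap i s w ^+ 2).
  by case: (pgap n i pG) => + _ _; exact.
have g0 i s w : 0 <= a n s w * particle_gap i s w ^+ 2 by rewrite mulr_ge0 ?sqr_ge0.
move=> tT i; apply: (le_trans (uU t i)); move: t tT.
apply: (gronwall_weighted (u := u) c00 (sqr_ge0 (n%:R : R)) (ltW rate0)).
  move=> t /andP[t0 _]; apply: uP => k; rewrite -(Ex_cst P' (n%:R ^+ 2)); apply: Ex_le => //.
  - exact: mG.
  - by move=> w; exact: amp_le.
move=> c cge0 H t tT; have [t0 _] := andP tT; apply: uP => k.
have hv k' : (\int[P']_w gap_esup noise_gap n t k' w <= (gap_cst L * (c / gap_rate) * expR (gap_rate * t))%:E)%E.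
  apply: noise_gap_le => //; first exact: gap_rate_ge1.
  move=> s /andP[s0 st]; apply: (le_trans (uU s k')); apply: H.
  by rewrite s0 (le_trans st)//; case/andP: tT.
apply: (@le_trans _ _ (\int[P']_w gap_esup particle_gap n t k w)%E).
  apply: ge0_le_integral => //.
  - by move=> w _; rewrite lee_fin.
  - by apply/measurable_EFinP; exact: mG.
  - exact: (@mgap _ n t k pG t0).
  - by move=> w _; apply: esup_ubound; rewrite t0 lexx.
apply: (le_trans (particle_gap_le k tT hv)); rewrite lee_fin -/c0 [leRHS]mulrDl [leLHS]addrC lerD//.
  by rewrite ler_peMr// -[leLHS](expR0) ler_expR mulr_ge0// ltW.
by rewrite mulrA ler_wpM2r ?expR_ge0//; exact: half_rate.
Qed.

(** The moment bound at fixed times is inserted once more into the maximal inequality to bring the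
    supremum inside the expectation; Fatou's lemma then removes the cut-off. *)
Lemma particle_gap_moment j :
  (\int[P']_w esup_sqr (fun s w => (Xs j s w - Ys j s w)%R) T w <=
   (2 * (4 / m ^+ 2 * r) * expR (gap_rate * T))%:E)%E.
Proof.
have TT : 0 <= T <= T by rewrite lexx T0'.
have e1 : 1 <= expR (gap_rate * T) by rewrite -[leLHS](expR0) ler_expR mulr_ge0// ltW.
have bound n : (\int[P']_w gap_esup particle_gap n T j w <= (2 * c0 * expR (gap_rate * T))%:E)%E.
  have hv k : (\int[P']_w gap_esup noise_gap n T k w <= (gap_cst L * (2 * c0 / gap_rate) * expR (gap_rate * T))%:E)%E.
    apply: noise_gap_le => //; [exact: gap_rate_ge1|by rewrite mulr_ge0|].
    by move=> s sT; exact: gap_moment.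
  apply: (le_trans (particle_gap_le j TT hv)); rewrite lee_fin -/c0.
  have h1 : (2 + 4 * rho ^+ 2) * (gap_cst L * (2 * c0 / gap_rate) * expR (gap_rate * T)) <= c0 * expR (gap_rate * T).
    rewrite mulrA ler_wpM2r ?expR_ge0//; apply: (le_trans (half_rate _)); first by rewrite mulr_ge0.
    by lra.
  have h2 : c0 <= c0 * expR (gap_rate * T) by rewrite ler_peMr.
  by rewrite -mulrA; lra.
rewrite (_ : (\int[P']_w _)%E = (\int[P']_w esup (fun s w => particle_gap j s w ^+ 2)%R 0 T w)%E); last first.
  apply: eq_integral => w _; rewrite /esup_sqr /esup; congr ereal_sup; apply: eq_imagel => s _.
  by rewrite normr_sqr.
apply: (@int_fatou _ _ _ P' _ (fun n w => gap_esup particle_gap n T j w) (fun=> (2 * c0 * expR (gap_rate * T))%:E)).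
- by apply: measurable_esup => //; exact: procX.
- by move=> w; apply: esup_ge0 => // s; rewrite sqr_ge0.
- by move=> n; exact: mgap.
- by move=> n w; exact: gap0.
- apply: aeW => w; apply: le_limn_einf => y yl.
  have [_ _ la] := pamp.
  apply: filterS (amplitude_cut_eventually T w la) => n an; apply: (le_trans (ltW yl)).
  apply: esup_le => s /andP[s0 sT].
  have as1 : a n s w = 1.
    by case: (a01 n s w) => // as0; have := amono n w s0 sT; rewrite as0 an ler10.
  rewrite -[particle_gap j s w ^+ 2]mul1r -{1}as1; apply: (@esup_ubound _ _ _ (fun s w => a n s w * particle_gap j s w ^+ 2)).
  by rewrite s0.
- exact: bound.
- exact: cvg_cst.
Qed.
End coupling.

(** * Explicit constants for the rate *)

Section rate.
Variables (M' Q : R).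
Hypotheses (M0' : 0 <= M') (hM' : lip M' h).
Hypotheses (Q1 : 1 <= Q) (X0Q : (\E[P]_w (X0 w ^+ 2) <= Q%:E)%E).
Let K00 : K 0 = 0 := K0 (lexx 0).

(* Dominates every constant of the estimates, which become monomials in it. *)
Definition magnitude := scale_cst L * expR (rate_cst L * ((1 + (M / m) ^+ 2) * (1 + T ^+ 2))).

Local Notation rho := (M / m).
Local Notation z := magnitude.
Let Q0 : 0 <= Q. Proof. exact: le_trans Q1. Qed.
Let n20 : 0 <= noise2_cst L. Proof. by rewrite /noise2_cst; nneg. Qed.
Let n40 : 0 <= noise4_cst L. Proof. by have := @bdg4_ge0 R; rewrite /noise4_cst; nneg. Qed.
Let rate1 : 1 <= rate_cst L. Proof. by have := n20; have := n40; have := gc0; rewrite /rate_cst; lra. Qed.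
Let L40 : 0 <= L ^+ 4. Proof. by nneg. Qed.
Let Theta := (1 + rho ^+ 2) * (1 + T ^+ 2).
Let sqrho : 0 <= rho ^+ 2. Proof. exact: sqr_ge0. Qed.
Let sqT : 0 <= T ^+ 2. Proof. exact: sqr_ge0. Qed.
Let T_le : T <= 1 + T ^+ 2. Proof. by have := sqr_ge0 (T - 1); nra. Qed.
Let Theta_rho : rho ^+ 2 <= Theta.
Proof. by rewrite /Theta mulrDr mulr1 (@le_trans _ _ (1 + rho ^+ 2)) ?lerDr// lerDl mulr_ge0// addr_ge0. Qed.
Let Theta_T : (1 + rho ^+ 2) * T <= Theta. Proof. by rewrite /Theta ler_wpM2l// addr_ge0. Qed.
Let Theta_T1 : T <= Theta. Proof. by apply: le_trans Theta_T; rewrite ler_peMl// lerDl. Qed.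
Let Theta0 : 0 <= Theta. Proof. exact: le_trans Theta_T1. Qed.
Let scale128 : 128 <= scale_cst L.
Proof. by have := @bdg4_ge0 R; have := sqr_ge0 L; have := L40; rewrite /scale_cst; lra. Qed.
Let exp1 : 1 <= expR (rate_cst L * Theta).
Proof. by rewrite -[leLHS](@expR0 R) ler_expR mulr_ge0// (le_trans _ rate1). Qed.

Let scale_z c : 0 <= c <= scale_cst L -> 0 <= c <= z.
Proof.
move=> /andP[c0 cs]; rewrite c0/=; apply: (le_trans cs); rewrite ler_peMr//.
exact: le_trans scale128.
Qed.
Let num_z (n : nat) : (n <= 128)%N -> 0 <= (n%:R : R) <= z.
Proof. by move=> n128; apply: scale_z; rewrite ler0n/=; apply: le_trans scale128; rewrite ler_nat. Qed.
Let exp_z c : c <= rate_cst L * Theta -> 0 <= expR c <= z.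
Proof.
move=> cr; rewrite expR_ge0/=; apply: (@le_trans _ _ (expR (rate_cst L * Theta))); first by rewrite ler_expR.
by rewrite ler_peMl ?expR_ge0// (le_trans _ scale128)// ler1n.
Qed.
Let Theta_z c : 0 <= c -> c <= Theta -> 0 <= c <= z.
Proof.
move=> c0 cT; rewrite c0/=; have /andP[_] := exp_z (lexx (rate_cst L * Theta)); apply: le_trans.
apply: (le_trans cT); apply: (@le_trans _ _ (rate_cst L * Theta)); first by rewrite ler_peMl.
by apply: le_trans (expR_ge1Dx _); rewrite lerDr.
Qed.
Let z2 : 2 <= z. Proof. by have /andP[] := @num_z 2 isT. Qed.
Let zT : 0 <= T <= z. Proof. exact: Theta_z. Qed.
Let zrho : 0 <= rho ^+ 2 <= z. Proof. exact: Theta_z. Qed.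
Let zL2 : 0 <= L ^+ 2 <= z.
Proof. by apply: scale_z; have := @bdg4_ge0 R; have := sqr_ge0 L; have := L40; rewrite /scale_cst; lra. Qed.
Let zL4 : 0 <= L ^+ 4 <= z.
Proof. by apply: scale_z; have := @bdg4_ge0 R; have := sqr_ge0 L; have := L40; rewrite /scale_cst; lra. Qed.
Let zbdg : 0 <= (bdg4 : R) <= z.
Proof. by apply: scale_z; have := @bdg4_ge0 R; have := sqr_ge0 L; have := L40; rewrite /scale_cst; lra. Qed.
Let zhalf : 0 <= (2^-1 : R) <= z. Proof. by have := z2; lra. Qed.
Let ze1 : 0 <= expR ((1 + 6 * (1 + rho ^+ 2) * noise2_cst L) * T) <= z.
Proof.
apply: exp_z; apply: (@le_trans _ _ ((1 + 6 * noise2_cst L) * Theta)).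
  rewrite mulrDl [leRHS]mulrDl !mul1r lerD// (_ : _ * T = 6 * noise2_cst L * ((1 + rho ^+ 2) * T)); last by ring.
  by rewrite ler_wpM2l// mulr_ge0.
by apply: ler_wpM2r => //; have := n40; have := gc0; rewrite /rate_cst; lra.
Qed.
Let ze2 : 0 <= expR ((1 + 6 * noise2_cst L) * T) <= z.
Proof.
apply: exp_z; apply: (@le_trans _ _ ((1 + 6 * noise2_cst L) * Theta)).
  by apply: ler_wpM2l => //; rewrite addr_ge0// mulr_ge0.
by apply: ler_wpM2r => //; have := n20; have := n40; have := gc0; rewrite /rate_cst; lra.
Qed.
Let ze4 : 0 <= expR ((1 + 54 * noise4_cst L) * T) <= z.
Proof.
apply: exp_z; apply: (@le_trans _ _ ((1 + 54 * noise4_cst L) * Theta)).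
  by apply: ler_wpM2l => //; rewrite addr_ge0// mulr_ge0.
by apply: ler_wpM2r => //; have := n20; have := n40; have := gc0; rewrite /rate_cst; lra.
Qed.
Let zgap : 0 <= expR (gap_rate * T) <= z.
Proof.
apply: exp_z; apply: (@le_trans _ _ ((1 + 8 * gap_cst L) * Theta)); last first.
  by apply: ler_wpM2r => //; have := n20; have := n40; have := gc0; rewrite /rate_cst; lra.
rewrite /gap_rate mulrDl [leRHS]mulrDl lerD ?mul1r//.
rewrite (_ : _ * T = 8 * gap_cst L * ((2^-1 + rho ^+ 2) * T)); last by field; rewrite gt_eqF.
apply: ler_wpM2l; first by rewrite mulr_ge0.
by apply: le_trans Theta_T; rewrite ler_wpM2r// lerD2r; lra.
Qed.

Let bM n c x := @magnitudeM R Q z Q1 z2 n c x.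
Let bD n n' x y := @magnitudeD R Q z Q1 z2 n n' x y.
Let bQ := @magnitude0 R Q z.
Let b1 := @magnitude1 R Q z Q1.

(** Two passes. For [X] the reflection is tied to its own noise: [S] bounds second moments, [v1]
    increments of the noise, and [k] then bounds [K^2]. With [K] now a known function, [S1] bounds
    second moments of [X] and of the copies alike; [v2], [D2] govern increments, and [S4], [v4],
    [D4] are their weighted fourth-moment analogues. *)
Let S := 2 * (1 + 3 * Q) * expR ((1 + 6 * (1 + rho ^+ 2) * noise2_cst L) * T).
Let v1 := incr2_cst L S T.
Let k := T * (rho ^+ 2 * v1).
Let S1 := 2 * (1 + 3 * Q + 3 * k) * expR ((1 + 6 * noise2_cst L) * T).
Let v2 := incr2_cst L S1 T.
Let D2 := 2 * v2 + 2 * (rho ^+ 2 * v2).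
Let S4 := 2 * (1 + 27 * (Q + k ^+ 2 / Q)) * expR ((1 + 54 * noise4_cst L) * T).
Let v4 := incr4_cst L S4 T.
Let D4 := 8 * v4 + 8 * ((rho ^+ 2 * v2) ^+ 2 / Q).
Let lev := 3 * (Q + T ^+ 2 * D4 / 2) + 3 * (D2 * T).

Let S_ge0 : 0 <= S. Proof. by rewrite /S; nneg. Qed.
Let v1_ge0 : 0 <= v1. Proof. by rewrite /v1 /incr2_cst; nneg. Qed.
Let k_ge0 : 0 <= k. Proof. by rewrite /k; nneg. Qed.
Let S1_ge0 : 0 <= S1. Proof. by rewrite /S1; nneg. Qed.
Let v2_ge0 : 0 <= v2. Proof. by rewrite /v2 /incr2_cst; nneg. Qed.
Let D2_ge0 : 0 <= D2. Proof. by rewrite /D2; nneg. Qed.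
Let S4_ge0 : 0 <= S4. Proof. by rewrite /S4; nneg. Qed.
Let v4_ge0 : 0 <= v4. Proof. by have := @bdg4_ge0 R; rewrite /v4 /incr4_cst; nneg. Qed.
Let D4_ge0 : 0 <= D4. Proof. by rewrite /D4; nneg. Qed.

(** In these bounds the exponent of [z] grows by one with each factor dominated by [z] and with each
    sum, as in [magnitudeM] and [magnitudeD]. *)
Let S_le : S <= Q * z ^+ 4.
Proof.
rewrite (_ : S = 2 * (expR ((1 + 6 * (1 + rho ^+ 2) * noise2_cst L) * T) * (1 + 3 * Q))); last by rewrite /S; ring.
exact: (bM (num_z (n := 2) isT) (bM ze1 (bD b1 (bM (num_z (n := 3) isT) bQ)))).
Qed.
Let incr2_le n s : s <= Q * z ^+ n -> incr2_cst L s T <= Q * z ^+ n.+4.+1.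
Proof.
move=> sn; rewrite (_ : incr2_cst L s T = 2 * (2 * (L ^+ 2 * (T * s))) + 2 * (64 * (2 * (L ^+ 2 * s)))); last by rewrite /incr2_cst; ring.
have := bD (bM (num_z (n := 2) isT) (bM (num_z (n := 2) isT) (bM zL2 (bM zT sn))))
  (bM (num_z (n := 2) isT) (bM (num_z (n := 64) isT) (bM (num_z (n := 2) isT) (bM zL2 sn)))).
by rewrite maxnn.
Qed.
Let k_le : k <= Q * z ^+ 11.
Proof. exact: (bM zT (bM zrho (incr2_le S_le))). Qed.
Let S1_le : S1 <= Q * z ^+ 15.
Proof.
rewrite (_ : S1 = 2 * (expR ((1 + 6 * noise2_cst L) * T) * (1 + 3 * Q + 3 * k))); last by rewrite /S1; ring.
exact: (bM (num_z (n := 2) isT) (bM ze2 (bD (bD b1 (bM (num_z (n := 3) isT) bQ)) (bM (num_z (n := 3) isT) k_le)))).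
Qed.
Let v2_le : v2 <= Q * z ^+ 20. Proof. exact: incr2_le. Qed.
Let D2_le : D2 <= Q * z ^+ 23.
Proof. exact: (bD (bM (num_z (n := 2) isT) v2_le) (bM (num_z (n := 2) isT) (bM zrho v2_le))). Qed.
Let S4_le : S4 <= Q * z ^+ 27.
Proof.
rewrite (_ : S4 = 2 * (expR ((1 + 54 * noise4_cst L) * T) * (1 + 27 * (Q + k ^+ 2 / Q)))); last by rewrite /S4; ring.
exact: (bM (num_z (n := 2) isT) (bM ze4 (bD b1 (bM (num_z (n := 27) isT) (bD bQ (magnitude_sqr Q1 k_ge0 k_le)))))).
Qed.
Let v4_le : v4 <= Q * z ^+ 33.
Proof.
rewrite (_ : v4 = 8 * (8 * (L ^+ 4 * (T * (T * S4)))) + bdg4 * (8 * (L ^+ 4 * S4))); last first.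
  by rewrite /v4 /incr4_cst; move: bdg4 => zz; ring.
exact: (bD (bM (num_z (n := 8) isT) (bM (num_z (n := 8) isT) (bM zL4 (bM zT (bM zT S4_le))))) (bM zbdg (bM (num_z (n := 8) isT) (bM zL4 S4_le)))).
Qed.
Let D4_le : D4 <= Q * z ^+ 44.
Proof.
have rv : 0 <= rho ^+ 2 * v2 by rewrite mulr_ge0.
exact: (bD (bM (num_z (n := 8) isT) v4_le) (bM (num_z (n := 8) isT) (magnitude_sqr Q1 rv (bM zrho v2_le)))).
Qed.
Let lev_le : lev <= Q * z ^+ 50.
Proof.
rewrite (_ : lev = 3 * (Q + 2^-1 * (T * (T * D4))) + 3 * (T * D2)); last by rewrite /lev; field.
exact: (bD (bM (num_z (n := 3) isT) (bD bQ (bM zhalf (bM zT (bM zT D4_le))))) (bM (num_z (n := 3) isT) (bM zT D2_le))).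
Qed.
(** The longest chain of factors, through [lev] and its exponent 50, yields the final exponent
    56. *)
Let error_le : 8 * (expR (gap_rate * T) * (2 * (72 * (4 * S1)) + 10 * (15 * (72 * lev)))) <= Q * z ^+ 56.
Proof.
exact: (bM (num_z (n := 8) isT) (bM zgap (bD (bM (num_z (n := 2) isT) (bM (num_z (n := 72) isT) (bM (num_z (n := 4) isT) S1_le)))
  (bM (num_z (n := 10) isT) (bM (num_z (n := 15) isT) (bM (num_z (n := 72) isT) lev_le)))))).
Qed.

Let eqX := flat_sde.
Let F0' i : measurable_wrt (F' 0) (X0s i). Proof. by case: pdata. Qed.
Let X0P (D : 'I_N -> set R) : (forall i, measurable (D i)) ->
  P' [set w | forall i, D i (X0s i w)] = (\prod_(i < N) law P X0 (D i))%E.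
Proof. by case: pdata => _ _ _; exact. Qed.
Let eqY i : {ae P', forall w, forall t, 0 <= t -> Ys i t w = X0s i w + sde_noise b (Ys i) (Js i) t w + K t}.
Proof.
have [_ _ _ h2] := copies i; apply: filterS h2 => w h2 t t0.
by rewrite (h2 t t0) unreflectedE -(flatE t0).
Qed.

Let X0Qs i : (\E[P']_w (X0s i w ^+ 2) <= Q%:E)%E.
Proof.
have mf : meas (fun x : R => (x ^+ 2)%:E).
  by apply/measurable_EFinP; exact: exprn_measurable.
have f0 (x : R) : (0 <= (x ^+ 2)%:E)%E by rewrite lee_fin sqr_ge0.
(* At step 0 the scheme is the initial value, so this is the equality in law of [X0s i] and [X0]. *)
have := euler_law cF BM F0 cF' (@BMi i) (@F0' i) (law_initial X0P i) K 0 L1 bL sgL T0 0 f0 mf.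
by rewrite /Ex /= => ->.
Qed.

Let noiseX0 : {ae P, forall w, V 0 w = 0}.
Proof. exact: (sde_noise0 cF BM b L1 sgL aX cX iI). Qed.

Let X_moment t : 0 <= t <= T -> (\E[P]_w (1 + X t w ^+ 2) <= S%:E)%E.
Proof.
move=> tT; have [B2 B20 hB] := flat_moment2_fin T0'.
have := sde_moment2_self cF BM L1 b0 bL sg0 sgL aX cX iI F0 eqX Q1 X0Q (T := T) (rho := rho) B20 hB.
move=> H; apply: (le_trans (H _ t tT)).
  move=> u v /andP[u0 uT] v0 hv; rewrite -[K u]subr0 -K00.
  apply: (flat_increment (lexx 0) u0 v0) => r ru.
  apply: le_trans (hv r ru); have /andP[r0' _] := ru; have h1 := mV r0'; have h2 := mV (lexx 0).
  apply: Ex_le_ae => //; try side.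
  by apply: filterS noiseX0 => w ->; rewrite subr0.
rewrite lee_fin /S ler_wpM2l//; first by nneg.
by rewrite ler_expR ler_wpM2l//; [nneg|case/andP: tT].
Qed.

Let K_incr S' s t : 0 <= S' -> (forall r, 0 <= r <= T -> (\E[P]_w (1 + X r w ^+ 2) <= S'%:E)%E) ->
  0 <= s -> s <= t -> t <= T -> (K t - K s) ^+ 2 <= rho ^+ 2 * incr2_cst L S' T * (t - s).
Proof.
move=> S'0 hS s0 st tT; rewrite -mulrA.
have i0 : 0 <= incr2_cst L S' T by rewrite /incr2_cst; nneg.
apply: (flat_increment s0 st); first by rewrite mulr_ge0// subr_ge0.
move=> r /andP[sr rt].
apply: (le_trans (noise_incr2 cF BM L1 b0 bL sg0 sgL aX cX iI S'0 hS s0 sr (le_trans rt tT))).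
by rewrite lee_fin ler_wpM2l// lerD2r.
Qed.

Let K_sqr t : 0 <= t <= T -> K t ^+ 2 <= k.
Proof.
move=> /andP[t0 tT]; rewrite -[K t]subr0 -K00; apply: (le_trans (K_incr S_ge0 X_moment (lexx 0) t0 tT)).
rewrite -/v1 subr0 /k [leRHS]mulrC ler_wpM2l// mulr_ge0//.
Qed.

Let S1_le_end (t : R) : 0 <= t <= T -> 2 * (1 + 3 * Q + 3 * k) * expR ((1 + 6 * noise2_cst L) * t) <= S1.
Proof.
move=> /andP[t0 tT]; rewrite /S1 ler_wpM2l//; first by nneg.
by rewrite ler_expR ler_wpM2l//; nneg.
Qed.

Let X_moment1 t : 0 <= t <= T -> (\E[P]_w (1 + X t w ^+ 2) <= S1%:E)%E.
Proof.
move=> tT; apply: (le_trans (sde_moment2 cF BM L1 b0 bL sg0 sgL aX cX iI F0 eqX Q1 X0Q K_sqr tT)).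
by rewrite lee_fin; exact: S1_le_end.
Qed.

Let Y_moment1 i t : 0 <= t <= T -> (\E[P']_w (1 + Ys i t w ^+ 2) <= S1%:E)%E.
Proof.
move=> tT; apply: (le_trans (sde_moment2 cF' (@BMi i) L1 b0 bL sg0 sgL (@aY i) (@cY i) (@iY i) (@F0' i) (eqY i) Q1 (X0Qs i) K_sqr tT)).
by rewrite lee_fin; exact: S1_le_end.
Qed.

Let sqr_moment {d0} {Om0 : measurableType d0} (P0 : probability Om0 R) (Z : Om0 -> R) (S' : R) : meas Z ->
  (\E[P0]_w (1 + Z w ^+ 2) <= S'%:E)%E -> (\E[P0]_w (Z w ^+ 2) <= S'%:E)%E.
Proof.
move=> mZ; apply: le_trans; apply: Ex_le; try side.
by move=> w; rewrite lerDr.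
Qed.

Let sg_moment {d0} {Om0 : measurableType d0} (P0 : probability Om0 R) (Z : R -> Om0 -> R) : proc Z ->
  (forall t, 0 <= t <= T -> (\E[P0]_w (1 + Z t w ^+ 2) <= S1%:E)%E) ->
  (Ex P0 (tint (fun s w => sg (Z s w) ^+ 2)%R 0 T) <= (2 * L ^+ 2 * S1 * T)%:E)%E.
Proof.
move=> pZ hZ; have psZ := proc_lip L0 sgL pZ.
rewrite -[X in _ * X]subr0; apply: Ex_tint_cst => //; first exact: (procX 2).
  by move=> s w; exact: sqr_ge0.
move=> s sT; have /andP[s0 _] := sT; have [m1 _ _] := pZ; have [m2 _ _] := psZ.
have m1s := m1 s s0; have m2s := m2 s s0.
apply: (Ex_leZ (g := fun w => 1 + Z s w ^+ 2)); [by nneg|by nneg|by nneg|by mea|by mea| |exact: hZ].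
by move=> w; exact: (lip_growth2 L0 sg0 sgL).
Qed.

Let X_incr s t : 0 <= s -> s <= t -> t <= T ->
  (\E[P]_w ((X t w - X s w) ^+ 2) <= (D2 * (t - s))%:E)%E.
Proof.
move=> s0 st tT; exact: (sde_incr2 cF BM L1 b0 bL sg0 sgL aX cX iI eqX S1_ge0 X_moment1 s0 st tT (lexx _)
  (K_incr S1_ge0 X_moment1 s0 st tT)).
Qed.

Let Y_incr i s t : 0 <= s -> s <= t -> t <= T ->
  (\E[P']_w ((Ys i t w - Ys i s w) ^+ 2) <= (D2 * (t - s))%:E)%E.
Proof.
move=> s0 st tT; exact: (sde_incr2 cF' (@BMi i) L1 b0 bL sg0 sgL (@aY i) (@cY i) (@iY i) (eqY i) S1_ge0 (Y_moment1 i) s0 st tT (lexx _)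
  (K_incr S1_ge0 X_moment1 s0 st tT)).
Qed.

Let K_pow4 t : 0 <= t <= T -> K t ^+ 4 <= k ^+ 2.
Proof.
move=> tT; rewrite (_ : K t ^+ 4 = (K t ^+ 2) ^+ 2); last by rewrite -exprM.
by apply: lerXn2r; rewrite ?nnegrE ?sqr_ge0//; exact: K_sqr.
Qed.

Let Y_incr4 i s t : 0 <= s -> s <= t -> t <= T ->
  (\E[P']_w ((Q + X0s i w ^+ 2)^-1 * (Ys i t w - Ys i s w) ^+ 4) <= (D4 * (t - s) ^+ 2)%:E)%E.
Proof.
move=> s0 st tT; exact: (sde_incr4 cF' (@BMi i) L1 b0 bL sg0 sgL (@aY i) (@cY i) (@iY i) (@F0' i) (eqY i) Q1 (X0Qs i)
  K_pow4 (sqr_ge0 k) s0 st tT (lexx _) (K_incr S1_ge0 X_moment1 s0 st tT)).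
Qed.

Let XS2 t : 0 <= t <= T -> (\E[P]_w (X t w ^+ 2) <= S1%:E)%E.
Proof. by move=> tT; apply: sqr_moment; [case: pX => + _ _; apply; case/andP: tT|exact: X_moment1]. Qed.
Let Y2 i t : 0 <= t <= T -> (\E[P']_w (Ys i t w ^+ 2) <= S1%:E)%E.
Proof. by move=> tT; apply: sqr_moment; [case: (pY i) => + _ _; apply; case/andP: tT|exact: Y_moment1]. Qed.

(** [M'] is any Lipschitz constant of [h], possibly other than [M], which stays hidden in
    [magnitude] through [M / m]. Thus (i) takes [M' = M] and (ii) the bound on the derivative.
    Linearity in [Q] is kept visible. *)
Lemma particle_rate j :
  (\int[P']_w esup_sqr (fun s w => (Xs j s w - Ys j s w)%R) T w <=
   (M' ^+ 2 / m ^+ 2 * (Q * magnitude ^+ 56) / N%:R)%:E)%E.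
Proof.
have perr := proc_mean_error cF cF' T0 aX aY cY D2_ge0 X_incr XS2 M0' hM'.
have err_r := maximal_mean_error cF BM F0 cF' BM' F0' X0P L1 bL sgL T0 K00 aX cX iI eqX aY cY iY eqY D2_ge0
  X_incr Y_incr (sg_moment pX X_moment1) (fun i => sg_moment (pY i) (Y_moment1 i)) XS2 Y2 M0' hM' N0 Q1 D4_ge0 X0Qs Y_incr4.
have errE s w : 0 <= s <= T -> mean_error P T X Ys h s w =
    N%:R^-1 * \sum_(i < N) (h (Ys i s w) - fine (\int[P]_w' (h (X s w'))%:E)).
  by move=> sT; rewrite /mean_error /mean_path clamp_id.
apply: (le_trans (particle_gap_moment perr errE err_r j)).
have Nr0 : 0 < N%:R :> R by rewrite ltr0n.
rewrite lee_fin [leLHS](_ : _ = M' ^+ 2 / m ^+ 2 *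
    (8 * (expR (gap_rate * T) * (2 * (72 * (4 * S1)) + 10 * (15 * (72 * lev))))) / N%:R); last first.
  by rewrite /level_cst /lev; move: (expR _) => ee; field; rewrite !gt_eqF.
rewrite ler_wpM2r ?invr_ge0 ?(ltW Nr0)// ler_wpM2l//.
by rewrite divr_ge0 ?sqr_ge0.
Qed.
End rate.
End particles.
End flat.

(** * Choice of the constants in the theorem *)

Lemma lipschitz_constant {R : realType} (f : R -> R) : lipschitz f ->
  exists c : R, forall c', c < c' -> lip c' f.
Proof. by case=> c [_ H]; exists c => c' cc' x y; exact: (H c' cc' (x, y)). Qed.

Lemma lipschitz_constants {R : realType} (f g : R -> R) : lipschitz f -> lipschitz g ->
  exists L : R, [/\ 1 <= L, `|f 0| <= L, (lip L f),
    `|g 0| <= L & lip L g].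
Proof.
move=> /lipschitz_constant[c cP] /lipschitz_constant[c' c'P].
exists (1 + `|c| + `|c'| + `|f 0| + `|g 0|).
have := ler_norm c; have := ler_norm c'; have := normr_ge0 c; have := normr_ge0 c'.
have := normr_ge0 (f 0); have := normr_ge0 (g 0) => h1 h2 h3 h4 h5 h6.
by split; [lra|lra|apply: cP; lra|lra|apply: c'P; lra].
Qed.

Lemma derive_bound_lipschitz {R : realType} (h : R -> R) (A : R) : (forall x, derivable h x 1) ->
  (forall x, `|derive1 h x| <= A) -> lip A h.
Proof.
move=> dh hA; have H x y : x < y -> `|h x - h y| <= A * `|x - y|.
  move=> xy; have [c _ hc] : exists2 c, c \in `]x, y[ & h y - h x = derive1 h c * (y - x).
    apply: MVT => // [z _|]; first by rewrite derive1E; exact: derivableP.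
    apply: continuous_subspaceT => z; apply: differentiable_continuous.
    exact/derivable1_diffP.
  by rewrite distrC hc normrM [`|x - y|]distrC ler_wpM2r.
move=> x y; case: (ltgtP x y) => [|yx|->]; first exact: H.
  by rewrite distrC [`|x - y|]distrC; exact: H.
by rewrite !subrr normr0 mulr0.
Qed.

Lemma magnitudeX {R : realType} (L m M T : R) n :
  magnitude L m M T ^+ n = scale_cst L ^+ n * expR (n%:R * rate_cst L * ((1 + M ^+ 2 / m ^+ 2) * (1 + T ^+ 2))).
Proof. by rewrite /magnitude exprMn -expRM_natl mulrA expr_div_n. Qed.

Section constants.
Context {R : realType}.
Variables (L m M T C a : R).
Hypotheses (L1 : 1 <= L) (a0 : 0 <= a).
Hypothesis aC : a * scale_cst L ^+ 56 + 56 * rate_cst L <= C.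

(** A sum of nonnegative terms dominates each of them: [C] bounds the prefactor by its first summand
    and the rate of the exponential by its second. *)
Lemma magnitude_le : a * magnitude L m M T ^+ 56 <= C * expR (C * (1 + M ^+ 2 / m ^+ 2) * (1 + T ^+ 2)).
Proof.
have s0 : 0 <= scale_cst L.
  by have := @bdg4_ge0 R; have : 0 <= L ^+ 4; [nneg|have := sqr_ge0 L; rewrite /scale_cst; lra].
have r0 : 0 <= rate_cst L.
  by have := @bdg4_ge0 R => b0; have L0 : 0 <= L := le_trans ler01 L1; rewrite /rate_cst /noise2_cst /noise4_cst /gap_cst; nneg.
have as0 : 0 <= a * scale_cst L ^+ 56 by rewrite mulr_ge0// exprn_ge0.
have r56 : 0 <= 56 * rate_cst L by rewrite mulr_ge0.
rewrite magnitudeX mulrA ler_pM ?expR_ge0//; first by apply: le_trans aC; rewrite lerDl.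
rewrite ler_expR -[leRHS]mulrA ler_wpM2r//.
  by rewrite mulr_ge0// addr_ge0// ?divr_ge0// sqr_ge0.
by apply: le_trans aC; rewrite lerDr.
Qed.
End constants.

Section initial_moments.
Context {R : realType} {d} {Om : measurableType d} (P : probability Om R).
Variable X0 : Om -> R.
Hypothesis mX0 : meas X0.

Lemma sqr_le_powR (x p : R) : 2 <= p -> x ^+ 2 <= 1 + `|x| `^ p.
Proof.
move=> p2; rewrite -normr_sqr//; case: (leP `|x| 1) => x1.
  apply: (@le_trans _ _ 1); last by rewrite lerDl powR_ge0.
  by rewrite expr_le1.
apply: (@le_trans _ _ (`|x| `^ p)); last by rewrite lerDr.
by rewrite -powR_mulrn// ler_powR// ltW.
Qed.

(** The moment of order [p] enters the estimate only through the second moment, bounded by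
    [1 + A]. *)
Lemma moment2_le (p A : R) : 2 <= p -> ('E_P[fun w => (`|X0 w| `^ p)%R] <= A%:E)%E ->
  0 <= A /\ (\E[P]_w (X0 w ^+ 2) <= (1 + A)%:E)%E.
Proof.
move=> p2; rewrite unlock => hA.
have mp : meas (fun w => `|X0 w| `^ p).
  by apply: (measurableT_comp (measurable_powR p)); mea.
have {}hA : (\E[P]_w (`|X0 w| `^ p) <= A%:E)%E by [].
have pp0 w : 0 <= `|X0 w| `^ p by exact: powR_ge0.
split; first by rewrite -lee_fin; apply: le_trans hA; exact: Ex_ge0.
apply: (@le_trans _ _ (\E[P]_w (1 + `|X0 w| `^ p))).
  by apply: Ex_le => [w|||w]; [exact: sqr_ge0|mea|mea|exact: sqr_le_powR].
rewrite ExD//.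
by rewrite Ex_cst; exact: lee_finD.
Qed.
End initial_moments.

Unset Implicit Arguments.

Theorem theorem3p2 (R : realType) (b sigma : R -> R)
  (lip_b : lipschitz b) (lip_sigma : lipschitz sigma) :
  (* (i): the constant depends on [b], [sigma], [p] and the moment bound [A] *)
  (forall p A : R, 4 < p ->
    exists C : R,
    forall (d : measure_display) (Om : measurableType d) (P : probability Om R)
      (F : R -> set (set Om)) (B : R -> Om -> R) (X0 : Om -> R)
      (h : R -> R) (m M : R) (X I : R -> Om -> R) (K : cumulative R R),
    driving_data P F B X0 ->
    ('E_P[fun w => (`|X0 w| `^ p)%R] <= A%:E)%E ->
    increasing_bilipschitz h m M ->
    (0 <= 'E_P[h \o X0])%E ->
    flat_solution P F b sigma h B X0 X I K ->
    forall (d' : measure_display) (Om' : measurableType d')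
      (P' : probability Om' R) (F' : R -> set (set Om')) (N : nat)
      (Bs : 'I_N -> R -> Om' -> R) (X0s : 'I_N -> Om' -> R)
      (Xs Is Ys Js : 'I_N -> R -> Om' -> R),
    particle_data P X0 P' F' Bs X0s ->
    particle_system P' F' b sigma h Bs X0s Xs Is ->
    coupled_copies P' F' b sigma h
      (fun t => law P (unreflected b X0 X I t)) Bs X0s Ys Js ->
    forall (T : R), 0 < T -> forall j : 'I_N,
    (\int[P']_w esup_sqr (fun s w => (Xs j s w - Ys j s w)%R) T w <=
     (C * expR (C * (1 + M ^+ 2 / m ^+ 2) * (1 + T ^+ 2)) *
      (M ^+ 2 / m ^+ 2) * (N%:R `^ (- 2^-1)))%:E)%E) /\
  (* (ii): the constant depends on [b], [sigma] and the bound [A] on h', h'' *)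
  (forall A : R,
    exists C : R,
    forall (d : measure_display) (Om : measurableType d) (P : probability Om R)
      (F : R -> set (set Om)) (B : R -> Om -> R) (X0 : Om -> R)
      (h : R -> R) (m M : R) (X I : R -> Om -> R) (K : cumulative R R),
    driving_data P F B X0 ->
    C2_with_derivatives_bounded_by A h ->
    increasing_bilipschitz h m M ->
    (0 <= 'E_P[h \o X0])%E ->
    flat_solution P F b sigma h B X0 X I K ->
    forall (d' : measure_display) (Om' : measurableType d')
      (P' : probability Om' R) (F' : R -> set (set Om')) (N : nat)
      (Bs : 'I_N -> R -> Om' -> R) (X0s : 'I_N -> Om' -> R)
      (Xs Is Ys Js : 'I_N -> R -> Om' -> R),
    particle_data P X0 P' F' Bs X0s ->
    particle_system P' F' b sigma h Bs X0s Xs Is ->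
    coupled_copies P' F' b sigma h
      (fun t => law P (unreflected b X0 X I t)) Bs X0s Ys Js ->
    forall (T : R), 0 < T -> forall j : 'I_N,
    (\int[P']_w esup_sqr (fun s w => (Xs j s w - Ys j s w)%R) T w <=
     (C * expR (C * (1 + M ^+ 2 / m ^+ 2) * (1 + T ^+ 2)) *
      ((1 + T ^+ 2) / m ^+ 2))%:E *
     (1 + \int[P]_w esup_sqr X T w) * (N%:R^-1)%:E)%E).

Proof.
have [L [L1 b0 bL sg0 sgL]] := lipschitz_constants lip_b lip_sigma.
split.
  (* The factor [2 + |A|] is the value of [Q], a bound on the second moment of [X0] that is at least
     1. *)
  move=> p A p4; exists ((2 + `|A|) * scale_cst L ^+ 56 + 56 * rate_cst L); set C := _ + _.
  move=> d Om P F B X0 h m M X I K data hp hmM hX0 flat d' Om' P' F' N Bs X0s Xs Is Ys Js pdata psys copies T T0 j.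
  have N0 : (0 < N)%N by exact: leq_ltn_trans (ltn_ord j).
  have [cF _ F0 _] := data; have mX0 := filtration_measurable cF (lexx 0) F0.
  have p2 : 2 <= p by rewrite (le_trans _ (ltW p4))// ler_nat.
  have [A0 X0A] := moment2_le mX0 p2 hp.
  have [m0 mM _ hM] := hmM; have M0 : 0 <= M := le_trans (ltW m0) mM.
  have hM' x y : `|h x - h y| <= M * `|x - y| by have /andP[] := hM x y.
  have Q1 : 1 <= 2 + `|A| by rewrite (@le_trans _ _ 2) ?ler1n// lerDl.
  have X0Q : (Ex P (fun w => X0 w ^+ 2)%R <= (2 + `|A|)%:E)%E.
    by apply: (le_trans X0A); rewrite lee_fin ger0_norm// lerD2r ler1n.
  apply: (le_trans (particle_rate data L1 b0 bL sg0 sgL hmM flat pdata psys copies T0 N0 M0 hM' Q1 X0Q j)).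
  have Q0 : 0 <= 2 + `|A| := le_trans ler01 Q1.
  have := magnitude_le m M T L1 Q0 (lexx C).
  have Nr0 : 0 < N%:R :> R by rewrite ltr0n.
  have u0 : 0 <= M ^+ 2 / m ^+ 2 by rewrite divr_ge0 ?sqr_ge0.
  move=> hC; rewrite lee_fin [leRHS](mulrC _ (N%:R `^ _)) [leLHS]mulrC ler_pM ?invr_ge0 ?(ltW Nr0)//.
  - by rewrite mulr_ge0// mulr_ge0// exprn_even_ge0.
  (* The rate [N^-1] obtained is better than the rate [N^(-1/2)] claimed, as [N >= 1]. *)
  - by rewrite -powR_inv1 ?(ltW Nr0)// ler_powR ?ler1n//; lra.
  - by rewrite mulrC ler_wpM2r.
(* The bound [A] on [h'] is the Lipschitz constant [M'], so [A^2] goes into [C] and only [1 / m^2]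
   remains outside. *)
move=> A; exists (A ^+ 2 * scale_cst L ^+ 56 + 56 * rate_cst L); set C := _ + _.
move=> d Om P F B X0 h m M X I K data [dh _ _ hA] hmM hX0 flat d' Om' P' F' N Bs X0s Xs Is Ys Js pdata psys copies T T0 j.
have N0 : (0 < N)%N by exact: leq_ltn_trans (ltn_ord j).
have [cF BM F0 X0fin] := data; have mX0 := filtration_measurable cF (lexx 0) F0.
have A0 : 0 <= A by have [+ _] := hA 0; apply: le_trans.
have hA' := derive_bound_lipschitz dh (fun x => proj1 (hA x)).
have X0fin' := square_integrable_lty data.
have e0 : (0 <= Ex P (fun w => X0 w ^+ 2)%R)%E by apply: Ex_ge0 => w; exact: sqr_ge0.
(* Unlike in (i), [Q] must not enter [C]: it is taken as small as possible, so as to be bounded by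
   the moment of the supremum of [X] in the statement. *)
pose q := 1 + fine (Ex P (fun w => X0 w ^+ 2)).
have qE : q%:E = (1 + Ex P (fun w => X0 w ^+ 2)%R)%E by rewrite EFinD fineK// ge0_fin_numE.
have Q1 : 1 <= q by rewrite lerDl fine_ge0.
have X0Q : (Ex P (fun w => X0 w ^+ 2)%R <= q%:E)%E by rewrite qE leeDr.
apply: (le_trans (particle_rate data L1 b0 bL sg0 sgL hmM flat pdata psys copies T0 N0 A0 hA' Q1 X0Q j)).
have hC := magnitude_le m M T L1 (sqr_ge0 A) (lexx C).
have Nr0 : 0 < N%:R :> R by rewrite ltr0n.
have [[aX cX] [_ KK] iX eX _] := flat.
have pX : proc X := proc_adapted cF aX cX.
have qle : (q%:E <= 1 + \int[P]_w esup_sqr X T w)%E.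
  rewrite qE leeD2l//.
  have -> : (\int[P]_w esup_sqr X T w = \int[P]_w esup (fun s w => X s w ^+ 2)%R 0 T w)%E.
    apply: eq_integral => w _; rewrite /esup_sqr /esup; congr ereal_sup; apply: eq_imagel => s _.
    by rewrite normr_sqr.
  apply: ae_ge0_le_integral => //.
  - by move=> w _; rewrite lee_fin sqr_ge0.
  - by apply/measurable_EFinP; mea.
  - by move=> w _; apply: esup_ge0 => [|s]; [exact: ltW|exact: sqr_ge0].
  - by apply: measurable_esup; [exact: lexx|exact: ltW|exact: procX].
  (* Noise and reflection both vanish at time 0, so [X 0 = X0] almost surely and the supremum
     dominates [X0^2]. *)
  - have V0 := sde_noise0 cF BM b L1 sgL aX cX iX.
    apply: filterS2 (flat_sde flat) V0 => w hw v0 _.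
    apply: (@le_trans _ _ (X 0 w ^+ 2)%:E); first by rewrite (hw 0 (lexx 0)) v0 KK// !addr0.
    by apply: (@esup_ubound _ _ _ (fun s w => X s w ^+ 2)); rewrite lexx ltW.
have z0 : 0 <= A ^+ 2 / m ^+ 2 * magnitude L m M T ^+ 56.
  by rewrite mulr_ge0 ?divr_ge0 ?sqr_ge0// exprn_even_ge0.
rewrite (_ : A ^+ 2 / m ^+ 2 * (q * magnitude L m M T ^+ 56) / N%:R =
  A ^+ 2 / m ^+ 2 * magnitude L m M T ^+ 56 * q * N%:R^-1); last by rewrite [q * _]mulrC mulrA.
rewrite !EFinM; apply: lee_wpmul2r; first by rewrite lee_fin invr_ge0 ltW.
apply: lee_pmul => //; first by rewrite lee_fin; apply: le_trans Q1.
rewrite -!EFinM lee_fin.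
apply: (@le_trans _ _ (A ^+ 2 * magnitude L m M T ^+ 56 * (1 / m ^+ 2))).
  by rewrite mul1r mulrAC.
apply: ler_pM => //; first by rewrite mulr_ge0 ?sqr_ge0// exprn_even_ge0.
  by rewrite divr_ge0 ?sqr_ge0.
by rewrite ler_wpM2r ?invr_ge0 ?sqr_ge0// lerDl sqr_ge0.
Qed.
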